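(* For every $a\in(0,1)$ there is a constant $c_a>0$ depending only on $a$, and for every $b\in(0,1)$ a constant $c_b>0$ depending only on $b$, such that the following holds. Let $n\geq 2$, let $\mu$ be an isotropic log-concave probability measure on $\mathbb{R}^n$, let $x_1,\ldots,x_N$ be independent random points distributed according to $\mu$, let $K_N=\mathrm{conv}\{\pm x_1,\ldots,\pm x_N\}$, and let $1\leq k\leq n$. (i) If $k\leq bn$, then with probability at least $1-N^{-1}$ one has $$\tilde D_k(K_N)\leq c_b\sqrt{\log N}\qquad\text{if } n^2\leq N\leq\exp(\sqrt{n}),$$ and $$\tilde D_k(K_N)\leq c_b\sqrt{\log N}\,(\log\log N)^2\qquad\text{if }\exp(\sqrt{n})\leq N\leq\exp(n).$$ (ii) If $k\geq an$ and $n^2\leq N\leq\exp\bigl((n\log n)^{2/5}\bigr)$, then with probability at least $1-\exp(-\sqrt{n})$ one has $$\tilde D_k(K_N)\geq c_a\frac{\sqrt{\log N}}{\log^3 n}.$$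
   Context: A log-concave probability measure on $\mathbb{R}^n$ is isotropic if its center of mass is the origin and its covariance matrix is the identity. For a convex body $C$ in $\mathbb{R}^n$, $R(C)=\max\{\|x\|_2:x\in C\}$ and, for $1\leq k\leq n$, $$\tilde D_k(C)=\int_{G_{n,k}}R(C\cap F)\,d\nu_{n,k}(F),$$ where $G_{n,k}$ is the Grassmannian of $k$-dimensional subspaces of $\mathbb{R}^n$ with its Haar probability measure $\nu_{n,k}$. *)

(* Defs.v *)
From HB Require Import structures.
From mathcomp Require Import all_boot all_order all_algebra.
From mathcomp Require Import all_classical all_reals all_analysis.

Set Implicit Arguments.
Unset Strict Implicit.
Unset Printing Implicit Defensive.

Import Order.TTheory GRing.Theory Num.Theory.
Import numFieldNormedType.Exports.

Local Open Scope classical_set_scope.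
Local Open Scope ring_scope.

(* R^n with its Borel sigma-algebra; vectors are row vectors. *)
Notation borel_rV R n := (g_sigma_algebraType (@open 'rV[R]_n)).

(* The library norm on matrices is the sup norm. *)
Definition enorm (R : realType) (n : nat) (x : 'rV[R]_n) : R :=
  Num.sqrt (\sum_(i < n) x ord0 i ^+ 2).

Definition log_concave (R : realType) (n : nat)
    (mu : probability (borel_rV R n) R) : Prop :=
  forall (A B : set 'rV[R]_n) (l : R),
    compact A -> compact B -> A !=set0 -> B !=set0 -> 0 < l < 1 ->
    (mu A `^ l * mu B `^ (1 - l) <=
      mu [set l *: x + (1 - l) *: y | x in A & y in B]%R)%E.

Definition coordinate (R : realType) (n : nat) (i : 'I_n) (x : borel_rV R n) : R :=
  (x : 'rV[R]_n) ord0 i.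

Definition isotropic (R : realType) (n : nat)
    (mu : probability (borel_rV R n) R) : Prop :=
  (forall i : 'I_n, ('E_mu[@coordinate R n i] = 0)%E) /\
  (forall i j : 'I_n,
    covariance mu (@coordinate R n i) (@coordinate R n j) = ((i == j)%:R)%:E).

Definition independent_rvs (R : realType) (d d' : measure_display)
    (T : measurableType d) (T' : measurableType d') (P : probability T R)
    (I : finType) (X : I -> {mfun T >-> T'}) : Prop :=
  forall (J : {set I}) (B : I -> set T'), (forall i, measurable (B i)) ->
    P (\bigcap_(i in [set i | i \in J]) (X i @^-1` B i)) =
    (\prod_(i in J) P (X i @^-1` B i))%E.

Definition has_law (R : realType) (d d' : measure_display)
    (T : measurableType d) (T' : measurableType d') (P : probability T R)
    (X : {mfun T >-> T'}) (mu : probability T' R) : Prop :=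
  forall B : set T', measurable B -> distribution P X B = mu B.

(* "A holds with probability at least p".  P is meaningful on measurable sets
   only, so A is required to contain a measurable event of probability >= p;
   for measurable A this is p <= P A. *)
Definition with_prob_ge (R : realType) (d : measure_display)
    (T : measurableType d) (P : probability T R) (p : R) (A : set T) : Prop :=
  exists E : set T, [/\ measurable E, E `<=` A & (p%:E <= P E)%E].

Definition conv_hull (R : realType) (n : nat) (A : set 'rV[R]_n) :
    set 'rV[R]_n :=
  smallest (@convex_set R 'rV[R]_n) A.

Definition sym_hull (R : realType) (n N : nat) (x : 'I_N -> 'rV[R]_n) :
    set 'rV[R]_n :=
  conv_hull (range x `|` range (fun i => - x i)).

Definition linsubspace (R : realType) (n : nat) : Type := {vspace 'rV[R]_n}.
HB.instance Definition _ (R : realType) (n : nat) :=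
  Choice.copy (linsubspace R n) {vspace 'rV[R]_n}.
HB.instance Definition _ (R : realType) (n : nat) :=
  isPointed.Build (linsubspace R n) (0%VS : {vspace 'rV[R]_n}).

Definition row_space (R : realType) (m n : nat) (A : 'M[R]_(m, n)) :
    linsubspace R n :=
  <<[seq row i A | i <- enum 'I_m]>>%VS.

(* Disjoint union of the usual topologies of the Grassmannians G_{n,m}, each
   being the quotient of the open set of full-rank m x n matrices by
   A |-> row space of A. *)
Definition subspace_open (R : realType) (n : nat) :
    set (set (linsubspace R n)) :=
  [set U | forall m : nat, open [set A : 'M[R]_(m, n) |
             row_free A /\ U (row_space A)]].

Notation borel_subspace R n := (g_sigma_algebraType (@subspace_open R n)).

Definition grassmannian (R : realType) (n k : nat) :
    set (borel_subspace R n) :=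
  [set F | \dim (F : {vspace 'rV[R]_n}) = k].

Definition subspace_image (R : realType) (n : nat) (g : 'M[R]_n)
    (F : borel_subspace R n) : borel_subspace R n :=
  (linfun (mulmxr g : 'rV[R]_n -> 'rV[R]_n) @: (F : {vspace 'rV[R]_n}))%VS.

(* For k <= n there is exactly one such nu: the probability measure carried by
   G_{n,k} and invariant under the transitive action of O(n). *)
Definition grassmannian_haar (R : realType) (n k : nat)
    (nu : probability (borel_subspace R n) R) : Prop :=
  nu (@grassmannian R n k) = 1%E /\
  (forall (g : 'M[R]_n) (B : set (borel_subspace R n)),
    g *m g^T = 1%:M -> measurable B ->
    nu (subspace_image g @^-1` B) = nu B).

(* Extended-real supremum; it is the maximum when C is compact and nonempty,
   as is the case for all the sets sym_hull x `&` F with N > 0. *)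
Definition circumradius (R : realType) (n : nat) (C : set 'rV[R]_n) : \bar R :=
  ereal_sup [set (enorm x)%:E | x in C].

Definition Dtilde (R : realType) (n k : nat)
    (nu : probability (borel_subspace R n) R) (C : set 'rV[R]_n) : \bar R :=
  (\int[nu]_(F in @grassmannian R n k)
     circumradius (C `&` [set x | x \in (F : {vspace 'rV[R]_n})]))%E.

(* Main.v *)
(** Upper bound.  For most x the ball of radius C sqrt n around x has mass at
    least exp(-C log N); let z be the mean of mu on such a ball.  By Markov, many
    multiples of z are sums of typical points of mu, and pushing masses through
    log-concavity gives disjoint-type packing bounds: the hull of these means is
    covered by exp(C n) balls of radius C sqrt(log N).  Maurey's lemma covers the
    hull of the residuals x_i - z_i.  A fixed vector y is within eps |y| of a
    random k-dimensional F with probability at most C^n eps^((1-b) n), so a union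
    bound over the centers makes K_N meet F in radius O(sqrt(log N)) outside an
    event small enough to absorb the trivial bound on R(K_N).

    Lower bound.  With the required probability K_N contains a fixed ball, which
    settles log N <= log^6 n and bounded n.  Otherwise put q = (log N)/78 and tilt
    mu, cut off at |x| <= 2 sqrt n, by exp <xi, x>.  For xi in half of a fine grid
    of the ball of radius sqrt q, sets of tilted mass 1/2 have mu-mass at least
    exp(-39 q)/4, hence z/4 lies below the support function of K_N, where z is the
    tilted mean, and the hull of all z is covered by exp(C n) balls of radius
    3 sqrt q.  If many xi had almost equal z, the tilted measure at one of them
    would have small variance along all the differences; by a small-ball
    estimate for high-dimensional marginals (random sign matrices and Talagrand's
    inequality) these differences are close to a subspace of dimension o(n/log n),
    which leaves room for C^n of the xi only.  So for every F of dimension at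
    least a n the pigeonhole principle yields z, z' with almost equal projections
    to the complement of F and |z - z'| >= c_a sqrt q; correcting z - z' by a
    point of the ball gives a point of F. *)

Require Import Defs.
From HB Require Import structures.
From mathcomp Require Import all_boot all_order all_algebra.
From mathcomp Require Import all_classical all_reals all_analysis.
From mathcomp Require Import measurable_realfun ring lra zify.

Set Implicit Arguments.
Unset Strict Implicit.
Unset Printing Implicit Defensive.

Import Order.TTheory GRing.Theory Num.Theory.
Import numFieldNormedType.Exports.

Local Open Scope classical_set_scope.
Local Open Scope ring_scope.

(** * Euclidean structure *)

(** The upper bound is balanced by sums of [m] points with [m log N] of order [n]: [m] points of
    cost [O(log N)] cost [O(n)] in all, [N ^ m] is [exp (O(n))], and averaging [m] vectors of length
    [O(sqrt n)] leaves an error [O(sqrt (n / m))], that is [O(sqrt (log N))]. In the lower bound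
    tilts and means are resolved at scale [1 / sqrt n], where tilts of length [sqrt q] number
    [X ^ n] with [X] of order [sqrt (q n)]. Up to factors [C ^ n], projections to the complement of
    [F] take [X ^ (n - d)] values and a cluster holds boundedly many tilts, so some fibre contains
    [X ^ d] distinct means, which forces diameter [c_a sqrt q]. The obstacle is to bound clusters:
    small variance along [k e] directions would put tilted mass 1/2 in a small ball of a marginal.
    As tilting inflates masses by [exp (O(q))] at most, a small-ball bound [exp (- k)] with [k] just
    above [39 q] suffices, and it needs [e] of order [k log n]. Summing over [O(log n)] octaves
    gives clusters of size [C ^ (k e log n)], and the range of [N] keeps [k e log n] below a small
    multiple of [n]. *)

Lemma continuous_sumr {R : realType} {T : topologicalType} (I : Type) (r : seq I)
    (F : I -> T -> R) :
  (forall i, continuous (F i)) -> continuous (fun x => \sum_(i <- r) F i x).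
Proof.
move=> h x; elim: r => [|i r ih].
  by under eq_fun do rewrite big_nil; exact: cvg_cst.
under eq_fun do rewrite big_cons.
by apply: (@continuousD _ _ _ (F i)); [exact: h|exact: ih].
Qed.

Section Euclidean.
Context {R : realType} {n : nat}.
Implicit Types (x y z u : 'rV[R]_n) (a : R).

Definition dot x y : R := \sum_(i < n) x ord0 i * y ord0 i.

Lemma dotC x y : dot x y = dot y x.
Proof. by apply: eq_bigr => i _; rewrite mulrC. Qed.
Lemma dotDl x y z : dot (x + y) z = dot x z + dot y z.
Proof. by rewrite -big_split; apply: eq_bigr => i _; rewrite mxE mulrDl. Qed.
Lemma dotDr x y z : dot z (x + y) = dot z x + dot z y.
Proof. by rewrite !(dotC z) dotDl. Qed.
Lemma dotZl a x z : dot (a *: x) z = a * dot x z.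
Proof. by rewrite /dot mulr_sumr; apply: eq_bigr => i _; rewrite mxE mulrA. Qed.
Lemma dotZr a x z : dot z (a *: x) = a * dot z x.
Proof. by rewrite !(dotC z) dotZl. Qed.
Lemma dotNl x z : dot (- x) z = - dot x z.
Proof. by rewrite -scaleN1r dotZl mulN1r. Qed.
Lemma dotNr x z : dot z (- x) = - dot z x.
Proof. by rewrite !(dotC z) dotNl. Qed.
Lemma dotBl x y z : dot (x - y) z = dot x z - dot y z.
Proof. by rewrite dotDl dotNl. Qed.
Lemma dotBr x y z : dot z (x - y) = dot z x - dot z y.
Proof. by rewrite dotDr dotNr. Qed.
Lemma dot0l z : dot 0 z = 0.
Proof. by rewrite -(scale0r 0) dotZl mul0r. Qed.
Lemma dot0r z : dot z 0 = 0.
Proof. by rewrite dotC dot0l. Qed.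
Lemma dot_suml (I : Type) (r : seq I) (P : pred I) (F : I -> 'rV[R]_n) z :
  dot (\sum_(i <- r | P i) F i) z = \sum_(i <- r | P i) dot (F i) z.
Proof. by elim/big_rec2: _ => [|i a b _ <-]; rewrite ?dot0l ?dotDl. Qed.
Lemma dot_sumr (I : Type) (r : seq I) (P : pred I) (F : I -> 'rV[R]_n) z :
  dot z (\sum_(i <- r | P i) F i) = \sum_(i <- r | P i) dot z (F i).
Proof. by rewrite dotC dot_suml; apply: eq_bigr => i _; rewrite dotC. Qed.

Lemma dot_ge0 x : 0 <= dot x x.
Proof. by apply: sumr_ge0 => i _; rewrite -expr2 sqr_ge0. Qed.
Lemma dot_eq0 x : (dot x x == 0) = (x == 0).
Proof.
apply/eqP/eqP => [/eqP|->]; last by rewrite dot0l.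
rewrite psumr_eq0 => [/allP h|i _]; last by rewrite -expr2 sqr_ge0.
apply/rowP => i; have := h i (mem_index_enum _); rewrite -expr2 sqrf_eq0 => /eqP.
by rewrite mxE.
Qed.

Lemma enormE x : enorm x = Num.sqrt (dot x x).
Proof. by rewrite /enorm; congr Num.sqrt; apply: eq_bigr => i _; rewrite expr2. Qed.
Lemma enorm_ge0 x : 0 <= enorm x. Proof. exact: sqrtr_ge0. Qed.
Lemma enorm2 x : enorm x ^+ 2 = dot x x.
Proof. by rewrite enormE sqr_sqrtr // dot_ge0. Qed.
Lemma enorm_eq0 x : (enorm x == 0) = (x == 0).
Proof. by rewrite -dot_eq0 -enorm2 sqrf_eq0. Qed.
Lemma enorm0 : enorm (0 : 'rV[R]_n) = 0.
Proof. by apply/eqP; rewrite enorm_eq0. Qed.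
Lemma enorm_gt0 x : (0 < enorm x) = (x != 0).
Proof. by rewrite lt_def enorm_eq0 enorm_ge0 andbT. Qed.
Lemma enormZ a x : enorm (a *: x) = `|a| * enorm x.
Proof.
rewrite !enormE dotZl dotZr mulrA -expr2 sqrtrM ?sqr_ge0 //.
by rewrite sqrtr_sqr.
Qed.
Lemma enormN x : enorm (- x) = enorm x.
Proof. by rewrite -scaleN1r enormZ normrN1 mul1r. Qed.
Lemma enormBC x y : enorm (x - y) = enorm (y - x).
Proof. by rewrite -enormN opprB. Qed.

Lemma dot_sqr_le x y : dot x y ^+ 2 <= dot x x * dot y y.
Proof.
have [/eqP|y0] := eqVneq (dot y y) 0.
  by rewrite dot_eq0 => /eqP ->; rewrite !dot0r expr0n mulr0.
have yp : 0 < dot y y by rewrite lt_def y0 dot_ge0.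
have := dot_ge0 (dot y y *: x - dot x y *: y).
rewrite !dotBl !dotBr !dotZl !dotZr (dotC y x).
have -> : dot y y * (dot y y * dot x x) - dot y y * (dot x y * dot x y) -
  (dot x y * (dot y y * dot x y) - dot x y * (dot x y * dot y y)) =
  dot y y * (dot x x * dot y y - dot x y ^+ 2) by ring.
by rewrite pmulr_rge0 // subr_ge0.
Qed.
Lemma ler_dot x y : `|dot x y| <= enorm x * enorm y.
Proof.
rewrite -[leRHS]ger0_norm ?mulr_ge0 ?enorm_ge0 // -ler_sqr ?nnegrE ?normr_ge0 //.
by rewrite !real_normK ?num_real // exprMn !enorm2 dot_sqr_le.
Qed.
Lemma dot_le x y : dot x y <= enorm x * enorm y.
Proof. exact: le_trans (ler_norm _) (ler_dot _ _). Qed.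
Lemma enormD x y : enorm (x + y) <= enorm x + enorm y.
Proof.
rewrite -ler_sqr ?nnegrE ?addr_ge0 ?enorm_ge0 // sqrrD !enorm2 dotDl !dotDr (dotC y x).
by have := dot_le x y; lra.
Qed.
Lemma enormB x y : enorm (x - y) <= enorm x + enorm y.
Proof. by rewrite -(enormN y) enormD. Qed.
Lemma enorm_dist x y z : enorm (x - z) <= enorm (x - y) + enorm (y - z).
Proof. by apply: le_trans (enormD _ _); rewrite addrA subrK. Qed.
Lemma enorm_sum (I : Type) (r : seq I) (P : pred I) (F : I -> 'rV[R]_n) :
  enorm (\sum_(i <- r | P i) F i) <= \sum_(i <- r | P i) enorm (F i).
Proof.
elim/big_rec2: _ => [|i a b _ h]; first by rewrite enorm0.
by apply: le_trans (enormD _ _) _; rewrite lerD2l.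
Qed.
Lemma ler_coord x i : `|x ord0 i| <= enorm x.
Proof.
rewrite -ler_sqr ?nnegrE ?enorm_ge0 // real_normK ?num_real // enorm2 /dot.
by rewrite (bigD1 i) //= expr2 lerDl; apply: sumr_ge0 => j _; rewrite -expr2 sqr_ge0.
Qed.

Lemma rV_norm_le x a : 0 <= a -> (forall i, `|x ord0 i| <= a) -> `|x| <= a.
Proof.
move=> a0 h; rewrite /Num.norm /= mx_normE.
rewrite -[a]/((NngNum a0)%:num) num_le; apply/bigmax_leP.
by split => [|-[i j] _]; rewrite -num_le /= ?[i]ord1.
Qed.

Lemma coordB_continuous u i : continuous (fun x : 'rV[R]_n => (x - u) ord0 i).
Proof.
have -> : (fun x : 'rV[R]_n => (x - u) ord0 i) = (fun x => x ord0 i - u ord0 i).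
  by apply/funext => y; rewrite !mxE.
move=> x; exact: (@continuousB _ _ _ (fun x : 'rV[R]_n => x ord0 i) (cst (u ord0 i)) x
  (@coord_continuous R 1 n ord0 i x) (@cst_continuous _ _ _ x)).
Qed.
Lemma dot_continuous u : continuous (fun x => dot x u).
Proof.
apply: continuous_sumr => i x.
exact: (@continuousM _ _ (fun x : 'rV[R]_n => x ord0 i) (cst (u ord0 i)) x
  (@coord_continuous R 1 n ord0 i x) (@cst_continuous _ _ _ x)).
Qed.
Lemma sqnorm_continuous u : continuous (fun x => dot (x - u) (x - u)).
Proof. by apply: continuous_sumr => i x; apply: continuousM; exact: coordB_continuous. Qed.
Lemma enorm_continuous u : continuous (fun x => enorm (x - u)).
Proof.
have -> : (fun x : 'rV[R]_n => enorm (x - u)) = (fun x => Num.sqrt (dot (x - u) (x - u))).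
  by apply/funext => y; rewrite enormE.
move=> x.
apply: (@continuous_comp _ _ _ (fun x => dot (x - u) (x - u)) Num.sqrt).
  exact: sqnorm_continuous.
exact: sqrt_continuous.
Qed.

Lemma closed_le (f : 'rV[R]_n -> R) a : continuous f -> closed [set x | f x <= a].
Proof.
move=> cf; apply: (@closed_comp _ _ f [set y | y <= a]); last exact: closed_le.
by move=> x _; exact: cf.
Qed.
Lemma compact_ball (K : set 'rV[R]_n) u a :
  closed K -> (forall x, K x -> enorm (x - u) <= a) -> compact K.
Proof.
move=> cK h; apply: bounded_closed_compact => //.
exists (`|a| + enorm u); split; first exact: num_real.
move=> M hM x Kx; apply: rV_norm_le => [|i].
  by apply: le_trans (ltW hM); rewrite addr_ge0 ?enorm_ge0.
apply: le_trans (ler_coord x i) _; apply: le_trans (ltW hM).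
have := enormD (x - u) u; rewrite subrK; have := h _ Kx; have := ler_norm a; lra.
Qed.

End Euclidean.

Section Measurability.
Context {R : realType} {n : nat}.
Notation V := (borel_rV R n).

Lemma closed_borel (K : set 'rV[R]_n) : closed K -> measurable (K : set V).
Proof.
move=> cK; rewrite -(setCK K); apply: measurableC; apply: sub_sigma_algebra.
by rewrite openC.
Qed.
Lemma compact_borel (K : set 'rV[R]_n) : compact K -> measurable (K : set V).
Proof. by move=> cK; apply: closed_borel; apply: compact_closed => //; exact: norm_hausdorff. Qed.
Lemma continuous_borel (f : 'rV[R]_n -> R) :
  continuous f -> measurable_fun setT (f : V -> R).
Proof.
move=> cf; apply: (measurability _ (RGenOpens.measurableE R)) => _ [_ [a [b ->]] <-].
rewrite setTI; apply: sub_sigma_algebra.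
by apply: open_comp => [x _|]; [exact: cf|exact: interval_open].
Qed.
Lemma coord_borel (i : 'I_n) : measurable_fun setT (@coordinate R n i).
Proof. by apply: continuous_borel; exact: coord_continuous. Qed.
End Measurability.

(** * Probabilities and bounded expectations *)

Section Prob.
Context {R : realType} {d : measure_display} {T : measurableType d}.
Variable P : probability T R.
Implicit Types (A B : set T) (f g : T -> R).

Definition pr A : R := fine (P A).

Lemma prE A : measurable A -> P A = (pr A)%:E.
Proof. by move=> mA; rewrite /pr fineK // fin_num_measure. Qed.
Lemma pr_ge0 A : 0 <= pr A. Proof. exact: fine_ge0. Qed.
Lemma prT : pr setT = 1. Proof. by rewrite /pr probability_setT. Qed.
Lemma pr0 : pr set0 = 0. Proof. by rewrite /pr measure0. Qed.
Lemma pr_mono A B : measurable A -> measurable B -> A `<=` B -> pr A <= pr B.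
Proof. by move=> mA mB AB; rewrite -lee_fin -!prE // le_measure // inE. Qed.
Lemma pr_le1 A : measurable A -> pr A <= 1.
Proof. by move=> mA; rewrite -prT; apply: pr_mono. Qed.
Lemma prU A B : measurable A -> measurable B -> A `&` B = set0 ->
  pr (A `|` B) = pr A + pr B.
Proof.
move=> mA mB AB; apply: EFin_inj; rewrite EFinD -!prE //; last exact: measurableU.
exact: measureU.
Qed.
Lemma prDI A B : measurable A -> measurable B -> pr A = pr (A `\` B) + pr (A `&` B).
Proof.
move=> mA mB; rewrite -prU; first by rewrite setUC setUIDK.
- exact: measurableD.
- exact: measurableI.
- by rewrite setDE setIACA setICl setI0.
Qed.
Lemma prC A : measurable A -> pr (~` A) = 1 - pr A.
Proof.
move=> mA; rewrite -prT (prDI measurableT mA) setTD setTI; lra.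
Qed.
Lemma prU_le A B : measurable A -> measurable B -> pr (A `|` B) <= pr A + pr B.
Proof.
move=> mA mB; rewrite -lee_fin EFinD -!prE //; last exact: measurableU.
exact: measureU2.
Qed.
Lemma prI_ge A B : measurable A -> measurable B -> pr A + pr B - 1 <= pr (A `&` B).
Proof.
move=> mA mB; have := prDI mA mB.
have : pr (A `\` B) <= pr (~` B).
  by apply: pr_mono; [exact: measurableD|exact: measurableC|move=> x []].
rewrite prC //; lra.
Qed.
Lemma measurable_bigsetU (I : eqType) (r : seq I) (F : I -> set T) :
  (forall i, i \in r -> measurable (F i)) -> measurable (\big[setU/set0]_(i <- r) F i).
Proof.
by move=> h; rewrite big_seq; apply: bigsetU_measurable.
Qed.
Lemma pr_bigU_le (I : eqType) (r : seq I) (F : I -> set T) :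
  (forall i, i \in r -> measurable (F i)) ->
  pr (\big[setU/set0]_(i <- r) F i) <= \sum_(i <- r) pr (F i).
Proof.
elim: r => [|i r ih] h; first by rewrite !big_nil pr0.
have hr j : j \in r -> measurable (F j) by move=> jr; apply: h; rewrite inE jr orbT.
rewrite !big_cons; apply: le_trans (prU_le _ _) _; [by apply: h; rewrite inE eqxx| |].
  exact: measurable_bigsetU.
by rewrite lerD2l ih.
Qed.

(** Bounded measurable functions: a class closed under the operations used below in which
    integrability is automatic, so that [Ex] is linear without side conditions. Unbounded integrands
    enter only through truncation or domination. *)
Definition bmf f := measurable_fun setT f /\ exists K : R, forall x, `|f x| <= K.
Definition Ex f : R := Rintegral P setT f.

Lemma bmfP f (K : R) : measurable_fun setT f -> (forall x, `|f x| <= K) -> bmf f.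
Proof. by move=> mf h; split => //; exists K. Qed.
Lemma bmf_cst (c : R) : bmf (fun=> c).
Proof. by apply: (@bmfP _ `|c|) => //; exact: measurable_cst. Qed.
Lemma bmfD f g : bmf f -> bmf g -> bmf (fun x => f x + g x).
Proof.
move=> [mf [K hK]] [mg [L hL]]; apply: (@bmfP _ (K + L)); first exact: measurable_funD.
by move=> x; apply: le_trans (ler_normD _ _) _; apply: lerD.
Qed.
Lemma bmfM f g : bmf f -> bmf g -> bmf (fun x => f x * g x).
Proof.
move=> [mf [K hK]] [mg [L hL]]; apply: (@bmfP _ (K * L)); first exact: measurable_funM.
by move=> x; rewrite normrM; apply: ler_pM.
Qed.
Lemma bmfN f : bmf f -> bmf (fun x => - f x).
Proof.
move=> [mf [K hK]]; apply: (@bmfP _ K) => [|x]; last by rewrite normrN.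
exact: measurableT_comp.
Qed.
Lemma bmfB f g : bmf f -> bmf g -> bmf (fun x => f x - g x).
Proof. by move=> hf hg; apply: bmfD => //; exact: bmfN. Qed.
Lemma bmfZ (c : R) f : bmf f -> bmf (fun x => c * f x).
Proof. by move=> hf; apply: bmfM => //; exact: bmf_cst. Qed.
Lemma bmf_indic A : measurable A -> bmf (\1_A : T -> R).
Proof.
move=> mA; apply: (@bmfP _ 1); first exact: measurable_indic.
by move=> x; rewrite indicE; case: (x \in A); rewrite ?normr1 ?normr0.
Qed.
Lemma bmf_sum (I : Type) (r : seq I) (F : I -> T -> R) :
  (forall i, bmf (F i)) -> bmf (fun x => \sum_(i <- r) F i x).
Proof.
move=> h; elim: r => [|i r ih].
  have -> : (fun x => \sum_(i <- [::]) F i x) = (fun=> 0) by apply/funext => x; rewrite big_nil.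
  exact: bmf_cst.
have -> : (fun x => \sum_(j <- i :: r) F j x) = (fun x => F i x + \sum_(j <- r) F j x).
  by apply/funext => x; rewrite big_cons.
exact: bmfD.
Qed.

Lemma bmf_int f : bmf f -> P.-integrable setT (EFin \o f).
Proof.
move=> [mf [K hK]]; apply: measurable_bounded_integrable => //.
  by apply: le_lt_trans (probability_le1 P measurableT) _; exact: ltry.
exists K; split; first exact: num_real.
by move=> x Kx y _; apply: le_trans (hK y) (ltW Kx).
Qed.
Lemma ExD f g : bmf f -> bmf g -> Ex (fun x => f x + g x) = Ex f + Ex g.
Proof. by move=> hf hg; rewrite /Ex RintegralD //; exact: bmf_int. Qed.
Lemma ExB f g : bmf f -> bmf g -> Ex (fun x => f x - g x) = Ex f - Ex g.
Proof. by move=> hf hg; rewrite /Ex RintegralB //; exact: bmf_int. Qed.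
Lemma ExZ (c : R) f : bmf f -> Ex (fun x => c * f x) = c * Ex f.
Proof. by move=> hf; rewrite /Ex RintegralZl //; exact: bmf_int. Qed.
Lemma Ex_cst (c : R) : Ex (fun=> c) = c.
Proof. by rewrite /Ex Rintegral_cst // -/(pr setT) prT mulr1. Qed.
Lemma Ex_le f g : bmf f -> bmf g -> (forall x, f x <= g x) -> Ex f <= Ex g.
Proof. by move=> hf hg h; apply: le_Rintegral => //; exact: bmf_int. Qed.
Lemma Ex_ge0 f : (forall x, 0 <= f x) -> 0 <= Ex f.
Proof. by move=> h; apply: Rintegral_ge0. Qed.
Lemma Ex_indic A : measurable A -> Ex \1_A = pr A.
Proof. by move=> mA; rewrite /Ex /Rintegral /pr integral_indic // setIT. Qed.
Lemma Ex_sum (I : Type) (r : seq I) (F : I -> T -> R) :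
  (forall i, bmf (F i)) -> Ex (fun x => \sum_(i <- r) F i x) = \sum_(i <- r) Ex (F i).
Proof.
move=> h; elim: r => [|i r ih].
  have -> : (fun x => \sum_(i <- [::]) F i x) = (fun=> 0) by apply/funext => x; rewrite big_nil.
  by rewrite Ex_cst big_nil.
have -> : (fun x => \sum_(j <- i :: r) F j x) = (fun x => F i x + \sum_(j <- r) F j x).
  by apply/funext => x; rewrite big_cons.
by rewrite ExD ?big_cons ?ih //; exact: bmf_sum.
Qed.
(** Integrates a pointwise bound on a weighted overlap count; the source of the packing bounds
    below. *)
Lemma sum_pr_le (I : Type) (r : seq I) (a : I -> R) (F : I -> set T) (K : R) :
  (forall i, measurable (F i)) ->
  (forall x, \sum_(i <- r) a i * \1_(F i) x <= K) ->
  \sum_(i <- r) a i * pr (F i) <= K.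
Proof.
move=> mF h; rewrite -[leRHS]Ex_cst.
have hb i : bmf (fun x => a i * \1_(F i) x) by apply: bmfZ; exact: bmf_indic.
have -> : \sum_(i <- r) a i * pr (F i) = Ex (fun x => \sum_(i <- r) a i * \1_(F i) x).
  rewrite Ex_sum //; apply: eq_bigr => i _.
  by rewrite ExZ ?Ex_indic //; exact: bmf_indic.
by apply: Ex_le => //; [exact: bmf_sum|exact: bmf_cst].
Qed.
Lemma markov_pr f A (t : R) : bmf f -> measurable A -> (forall x, 0 <= f x) ->
  (forall x, A x -> t <= f x) -> t * pr A <= Ex f.
Proof.
move=> hf mA f0 h; rewrite -Ex_indic // -ExZ; last exact: bmf_indic.
apply: Ex_le => //; first by apply: bmfZ; exact: bmf_indic.
move=> x; rewrite indicE; case: (boolP (x \in A)) => [/set_mem/h|_]; rewrite ?mulr1 ?mulr0 //.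
Qed.
Lemma measurable_le_set f (c : R) : measurable_fun setT f -> measurable [set x | f x <= c].
Proof.
move=> mf; rewrite -[X in measurable X]setTI.
have -> : [set x | f x <= c] = f @^-1` `]-oo, c].
  by apply/seteqP; split => x; rewrite /= in_itv.
by apply: mf => //; exact: measurable_itv.
Qed.
Lemma measurable_lt_set f (c : R) : measurable_fun setT f -> measurable [set x | f x < c].
Proof.
move=> mf; rewrite -[X in measurable X]setTI.
have -> : [set x | f x < c] = f @^-1` `]-oo, c[.
  by apply/seteqP; split => x; rewrite /= in_itv.
by apply: mf => //; exact: measurable_itv.
Qed.
Lemma measurable_ge_set f (c : R) : measurable_fun setT f -> measurable [set x | c <= f x].
Proof.
move=> mf; have -> : [set x | c <= f x] = ~` [set x | f x < c].
  by apply/seteqP; split => x /=; rewrite leNgt => /negP.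
by apply: measurableC; exact: measurable_lt_set.
Qed.
Lemma measurable_gt_set f (c : R) : measurable_fun setT f -> measurable [set x | c < f x].
Proof.
move=> mf; have -> : [set x | c < f x] = ~` [set x | f x <= c].
  by apply/seteqP; split => x /=; rewrite ltNge => /negP.
by apply: measurableC; exact: measurable_le_set.
Qed.
End Prob.
Arguments bmf {R d T} f.

(** * Isotropic log-concave measures *)

Section TruncatedIntegral.
Context {R : realType} {d : measure_display} {T : measurableType d}.
Variable P : probability T R.

Lemma bmf_trunc (f : T -> R) (k : R) : measurable_fun setT f -> (forall x, 0 <= f x) ->
  0 <= k -> bmf (fun x => Order.min (f x) k).
Proof.
move=> mf f0 k0; apply: (@bmfP _ _ _ _ k); first exact: measurable_minr.
by move=> x; rewrite ger0_norm ?le_min ?f0 // ge_min lexx orbT.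
Qed.

(** Monotone convergence along the truncations [min f k]; it lets second moments be bounded inside
    the class [bmf]. *)
Lemma int_le_trunc (f : T -> R) (c : R) : measurable_fun setT f -> (forall x, 0 <= f x) ->
  (forall k : nat, Ex P (fun x => Order.min (f x) k%:R) <= c) ->
  (\int[P]_x (f x)%:E <= c%:E)%E.
Proof.
move=> mf f0 h; pose g (k : nat) x := (Order.min (f x) k%:R)%:E.
have hb k : bmf (fun x => Order.min (f x) k%:R) by apply: bmf_trunc.
have -> : (\int[P]_x (f x)%:E = \int[P]_x limn (g ^~ x))%E.
  apply: eq_integral => x _; apply/esym/cvg_lim => //.
  apply: cvg_near_cst; near=> k; rewrite /g min_l //.
  near: k; exact: nbhs_infty_ger.
have mg k : measurable_fun setT (g k) by apply/measurable_EFinP; exact: (hb k).1.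
have g0 k x : setT x -> (0 <= g k x)%E by move=> _; rewrite lee_fin le_min f0 /=.
have ndg x : setT x -> {homo g ^~ x : k l / (k <= l)%N >-> (k <= l)%E}.
  by move=> _ k l kl; rewrite lee_fin le_min ge_min lexx /= ge_min ler_nat kl orbT.
have cv := @cvg_monotone_convergence _ _ _ P setT measurableT g mg g0 ndg.
rewrite -(cvg_lim _ cv) //; apply: lime_le; first by apply/cvg_ex; eexists; exact: cv.
near=> k; have := h k; rewrite /Ex /Rintegral -lee_fin fineK //.
exact: integrable_fin_num (bmf_int P (hb k)).
Unshelve. all: by end_near. Qed.

Lemma Ex_le_int (f g : T -> R) (c : R) : bmf f -> measurable_fun setT g -> (forall x, 0 <= g x) ->
  (forall x, f x <= g x) -> (\int[P]_x (g x)%:E <= c%:E)%E -> Ex P f <= c.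
Proof.
move=> hf mg g0 fg h; rewrite -lee_fin; apply: le_trans h.
have hi := integrable_fin_num measurableT (bmf_int P hf).
have [gi|gi] := boolP ((\int[P]_x (g x)%:E)%E \is a fin_num); last first.
  have -> : (\int[P]_x (g x)%:E = +oo)%E.
    have i0 : (0 <= \int[P]_x (g x)%:E)%E by apply: integral_ge0 => x _; rewrite lee_fin.
    by apply/eqP; move: gi; rewrite ge0_fin_numE // ltey negbK.
  by rewrite leey.
have ig : P.-integrable setT (EFin \o g).
  apply/integrableP; split; first exact/measurable_EFinP.
  under eq_integral do rewrite gee0_abs ?lee_fin //.
  by move: gi; rewrite ge0_fin_numE //; apply: integral_ge0 => x _; rewrite lee_fin.
rewrite /Ex /Rintegral fineK //; apply: le_integral => //; first exact: bmf_int.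
by move=> x _; rewrite lee_fin.
Qed.
End TruncatedIntegral.

Section LogConcave.
Context {R : realType} {n : nat} (mu : probability (borel_rV R n) R).
Notation V := (borel_rV R n).

Lemma lc_image_compact (A B : set 'rV[R]_n) (l : R) : compact A -> compact B ->
  compact [set l *: x + (1 - l) *: y | x in A & y in B].
Proof.
move=> cA cB.
have -> : [set l *: x + (1 - l) *: y | x in A & y in B] =
    (fun p : 'rV[R]_n * 'rV[R]_n => l *: p.1 + (1 - l) *: p.2) @` (A `*` B).
  apply/seteqP; split => [z [x Ax [y By <-]]|z [[x y] [/= Ax By] <-]].
    by exists (x, y).
  by exists x => //; exists y.
apply: continuous_compact; last exact: compact_setX.
apply: continuous_subspaceT => p.
apply: (@continuousD _ _ _ (fun p : 'rV[R]_n * 'rV[R]_n => l *: p.1) (fun p => (1 - l) *: p.2)).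
  by apply: continuousZl_tmp; exact: cvg_fst.
by apply: continuousZl_tmp; exact: cvg_snd.
Qed.

(** Log-concavity in terms of costs, that is minus logarithms of masses: the cost of a Minkowski
    average is at most the average of the costs. *)
Lemma lc_exp (A B C : set 'rV[R]_n) (l a b : R) : log_concave mu -> 0 < l < 1 ->
  compact A -> compact B -> measurable (C : set V) ->
  (forall x y, A x -> B y -> C (l *: x + (1 - l) *: y)) ->
  expR (- a) <= pr mu A -> expR (- b) <= pr mu B ->
  expR (- (l * a + (1 - l) * b)) <= pr mu C.
Proof.
move=> lc l01 cA cB mC h hA hB; have [l0 l1] := andP l01.
have mA := compact_borel cA; have mB := compact_borel cB.
have ne (D : set 'rV[R]_n) (e : R) : expR e <= pr mu D -> D !=set0.
  move=> hD; apply/set0P/eqP => D0; move: hD; rewrite D0 pr0 leNgt expR_gt0 //.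
have := lc A B l cA cB (ne _ _ hA) (ne _ _ hB) l01.
set S := [set _ | _ in _ & _ in _] => hS.
have mS : measurable (S : set V) by apply: compact_borel; exact: lc_image_compact.
have hSC : pr mu S <= pr mu C.
  by apply: pr_mono => // z [x Ax [y By <-]]; exact: h.
apply: le_trans hSC; move: hS; rewrite (prE mu mA) (prE mu mB) (prE mu mS) !poweR_EFin.
rewrite lee_fin; apply: le_trans.
rewrite opprD expRD -!mulrN -[l * _]mulrC -[(1 - l) * _]mulrC !expRM.
apply: ler_pM; rewrite ?powR_ge0 //; apply: ge0_ler_powR; rewrite ?nnegrE ?expR_ge0 ?pr_ge0 //; lra.
Qed.

End LogConcave.

Section Isotropic.
Context {R : realType} {n : nat} (mu : probability (borel_rV R n) R).
Notation V := (borel_rV R n).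
Hypothesis iso : isotropic mu.

(** With zero means the covariances are the integrals of products. The diagonal ones, being finite,
    make the squares integrable, and [|a b| <= a^2 + b^2] does the rest. *)
Lemma coordM_integrable (i j : 'I_n) :
  mu.-integrable setT (EFin \o (fun x : V => (x : 'rV[R]_n) ord0 i * (x : 'rV[R]_n) ord0 j)) /\
  (\int[mu]_x ((x : 'rV[R]_n) ord0 i * (x : 'rV[R]_n) ord0 j)%:E = ((i == j)%:R)%:E)%E.
Proof.
have [h0 h1] := iso.
have cov k l : (\int[mu]_x ((x : 'rV[R]_n) ord0 k * (x : 'rV[R]_n) ord0 l)%:E = ((k == l)%:R)%:E)%E.
  rewrite -h1 unlock /= !h0 unlock /=; apply: eq_integral => x _ /=.
  by rewrite /coordinate fctE /= !subr0.
have sq k : mu.-integrable setT (EFin \o (fun x : V => (x : 'rV[R]_n) ord0 k ^+ 2)).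
  apply/integrableP; split.
    by apply/measurable_EFinP; apply: measurable_funX; exact: coord_borel.
  under eq_integral do rewrite /= ger0_norm ?sqr_ge0 // expr2.
  by rewrite cov ltry.
split; last exact: cov.
have hs := integrableD measurableT (sq i) (sq j).
apply: (le_integrable measurableT _ _ hs) => /=.
  by apply/measurable_EFinP; apply: measurable_funM; exact: coord_borel.
move=> x _; rewrite lee_fin [leRHS]ger0_norm ?addr_ge0 ?sqr_ge0 //.
by rewrite ler_norml; apply/andP; split; nra.
Qed.

Lemma int_dot2 (u : 'rV[R]_n) : (\int[mu]_x (dot x u ^+ 2)%:E = (dot u u)%:E)%E.
Proof.
have -> : (\int[mu]_x (dot x u ^+ 2)%:E = \int[mu]_x \sum_(p <- index_enum ('I_n * 'I_n)%type)
   ((u ord0 p.1 * u ord0 p.2)%:E * ((x : 'rV[R]_n) ord0 p.1 * (x : 'rV[R]_n) ord0 p.2)%:E))%E.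
  apply: eq_integral => x _; rewrite -[RHS]/(\sum_p _)%E.
  rewrite (eq_bigr (fun p : 'I_n * 'I_n => ((u ord0 p.1 * u ord0 p.2) * ((x : 'rV[R]_n) ord0 p.1 * (x : 'rV[R]_n) ord0 p.2))%:E)) //.
  rewrite sumEFin; congr EFin.
  rewrite -(pair_bigA _ (fun i j => u ord0 i * u ord0 j * ((x : 'rV[R]_n) ord0 i * (x : 'rV[R]_n) ord0 j))) /=.
  rewrite expr2 /dot mulr_suml; apply: eq_bigr => i _.
  rewrite mulr_sumr; apply: eq_bigr => j _; ring.
rewrite integral_sum //; last by move=> p; apply: integrableZl => //; exact: (coordM_integrable p.1 p.2).1.
rewrite (eq_bigr (fun p : 'I_n * 'I_n => (u ord0 p.1 * u ord0 p.2 * (p.1 == p.2)%:R)%:E)); last first.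
  move=> p _; rewrite integralZl ?(coordM_integrable p.1 p.2).2 //.
  exact: (coordM_integrable p.1 p.2).1.
rewrite sumEFin; congr EFin.
rewrite -(pair_bigA _ (fun i j => u ord0 i * u ord0 j * (i == j)%:R)) /=.
apply: eq_bigr => i _; rewrite (bigD1 i) //= eqxx mulr1 big1 ?addr0 // => j.
by rewrite eq_sym => /negbTE ->; rewrite mulr0.
Qed.

Lemma int_norm2 : (\int[mu]_x (dot (x : 'rV[R]_n) x)%:E = n%:R%:E)%E.
Proof.
have -> : (\int[mu]_x (dot (x : 'rV[R]_n) x)%:E = \int[mu]_x \sum_(i <- index_enum 'I_n)
   ((x : 'rV[R]_n) ord0 i * (x : 'rV[R]_n) ord0 i)%:E)%E.
  by apply: eq_integral => x _; rewrite sumEFin.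
rewrite integral_sum //; last by move=> i; exact: (coordM_integrable i i).1.
rewrite (eq_bigr (fun=> 1%:E)) => [|i _]; last by rewrite (coordM_integrable i i).2 eqxx.
by rewrite sumEFin sumr_const card_ord.
Qed.

Lemma dot_borel (u : 'rV[R]_n) : measurable_fun setT (fun x : V => dot (x : 'rV[R]_n) u).
Proof. by apply: continuous_borel; exact: dot_continuous. Qed.
Lemma enormB_borel (u : 'rV[R]_n) : measurable_fun setT (fun x : V => enorm ((x : 'rV[R]_n) - u)).
Proof. by apply: continuous_borel; exact: enorm_continuous. Qed.
Lemma enorm_borel : measurable_fun setT (fun x : V => enorm (x : 'rV[R]_n)).
Proof.
have -> : (fun x : V => enorm (x : 'rV[R]_n)) = (fun x : V => enorm ((x : 'rV[R]_n) - 0)).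
  by apply/funext => x; rewrite subr0.
exact: enormB_borel.
Qed.

Lemma Ex_dot2_le (f : V -> R) (u : 'rV[R]_n) : bmf f ->
  (forall x : V, f x <= dot x u ^+ 2) -> Ex mu f <= dot u u.
Proof.
move=> hf h; apply: (@Ex_le_int _ _ _ mu f (fun x : V => dot (x : 'rV[R]_n) u ^+ 2)) => //.
- by apply: measurable_funX; exact: dot_borel.
- by move=> x; exact: sqr_ge0.
- by rewrite int_dot2.
Qed.
Lemma Ex_norm2_le (f : V -> R) : bmf f ->
  (forall x : V, f x <= dot (x : 'rV[R]_n) x) -> Ex mu f <= n%:R.
Proof.
move=> hf h; apply: (@Ex_le_int _ _ _ mu f (fun x : V => dot (x : 'rV[R]_n) x)) => //.
- have -> : (fun x : V => dot (x : 'rV[R]_n) x) = (fun x : V => enorm (x : 'rV[R]_n) ^+ 2).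
    by apply/funext => x; rewrite enorm2.
  by apply: measurable_funX; exact: enorm_borel.
- by move=> x; exact: dot_ge0.
- by rewrite int_norm2.
Qed.
Lemma dot2_trunc_le (u : 'rV[R]_n) (c : R) :
  (forall k : nat, Ex mu (fun x : V => Order.min (dot (x : 'rV[R]_n) u ^+ 2) k%:R) <= c) ->
  dot u u <= c.
Proof.
move=> h; rewrite -lee_fin -int_dot2; apply: int_le_trunc => //.
- by apply: measurable_funX; exact: dot_borel.
- by move=> x; exact: sqr_ge0.
Qed.
Lemma cheb_dot (u : 'rV[R]_n) (t : R) : 0 < t ->
  pr mu [set x : V | t < `|dot (x : 'rV[R]_n) u|] <= dot u u / t ^+ 2.
Proof.
move=> t0; rewrite ler_pdivlMr ?exprn_gt0 // mulrC.
have mA : measurable [set x : V | t < `|dot (x : 'rV[R]_n) u|].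
  apply: (measurable_gt_set (f := fun x : V => `|dot (x : 'rV[R]_n) u|)).
  by apply: measurableT_comp => //; exact: dot_borel.
rewrite -Ex_indic // -ExZ; last exact: bmf_indic.
apply: Ex_dot2_le; first by apply: bmfZ; exact: bmf_indic.
move=> x; rewrite indicE; case: (boolP (x \in _)) => [/set_mem/= hx|_]; rewrite ?mulr1 ?mulr0 ?sqr_ge0 //.
by rewrite -[leRHS]real_normK ?num_real // ler_sqr ?nnegrE // ltW.
Qed.
Lemma cheb_norm (t : R) : 0 < t ->
  pr mu [set x : V | t < enorm (x : 'rV[R]_n)] <= n%:R / t ^+ 2.
Proof.
move=> t0; rewrite ler_pdivlMr ?exprn_gt0 // mulrC.
have mA : measurable [set x : V | t < enorm (x : 'rV[R]_n)].
  by apply: (measurable_gt_set (f := fun x : V => enorm (x : 'rV[R]_n))); exact: enorm_borel.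
rewrite -Ex_indic // -ExZ; last exact: bmf_indic.
apply: Ex_norm2_le; first by apply: bmfZ; exact: bmf_indic.
move=> x; rewrite indicE; case: (boolP (x \in _)) => [/set_mem/= hx|_]; rewrite ?mulr1 ?mulr0 ?dot_ge0 //.
by rewrite -enorm2 ler_sqr ?nnegrE ?enorm_ge0 // ltW.
Qed.
End Isotropic.

Section Balls.
Context {R : realType} {n : nat}.
Notation V := (borel_rV R n).
Implicit Types (u x : 'rV[R]_n).

Lemma closed_ge (f : 'rV[R]_n -> R) a : continuous f -> closed [set x | a <= f x].
Proof.
move=> cf; have -> : [set x | a <= f x] = [set x | - f x <= - a].
  by apply/seteqP; split => x /=; rewrite lerN2.
by apply: closed_le => x; apply: continuousN; exact: cf.
Qed.
Lemma dotabs_continuous u t : continuous (fun x => `|dot x u - t|).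
Proof.
move=> x; apply: (@continuous_comp _ _ _ (fun x => dot x u - t) (fun y => `|y|)).
  by apply: continuousB; [exact: dot_continuous|exact: cst_continuous].
exact: norm_continuous.
Qed.
Lemma dot0abs_continuous u : continuous (fun x => `|dot x u|).
Proof.
by move=> x; have := @dotabs_continuous u 0 x; under eq_fun do rewrite subr0.
Qed.
Lemma enorm0_continuous : continuous (fun x => enorm x).
Proof.
by move=> x; have := @enorm_continuous R n 0 x; under eq_fun do rewrite subr0.
Qed.
Lemma closed_ball0 a : closed [set x : 'rV[R]_n | enorm x <= a].
Proof. by apply: closed_le; exact: enorm0_continuous. Qed.
Lemma compactI_ball0 (K : set 'rV[R]_n) a : closed K -> compact (K `&` [set x | enorm x <= a]).
Proof.
move=> cK; apply: (@compact_ball _ _ _ 0 a); first by apply: closedI => //; exact: closed_ball0.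
by move=> x [_ /=]; rewrite subr0.
Qed.
Lemma ball0_borel a : measurable ([set x : 'rV[R]_n | enorm x <= a] : set V).
Proof. by apply: closed_borel; exact: closed_ball0. Qed.

Variable mu : probability V R.
Hypothesis iso : isotropic mu.

Lemma pr_ballI (A : set V) (L : R) : measurable A -> 0 < L ->
  pr mu A <= pr mu (A `&` [set x : 'rV[R]_n | enorm x <= L]) + n%:R / L ^+ 2.
Proof.
move=> mA L0; have mB := ball0_borel L.
rewrite (prDI mu mA mB) addrC lerD2l.
apply: le_trans (cheb_norm iso L0); apply: pr_mono.
- exact: measurableD.
- by apply: (measurable_gt_set (f := fun x : V => enorm (x : 'rV[R]_n))); exact: enorm_borel.
- by move=> x [_ /= /negP]; rewrite -ltNge.
Qed.
Lemma pr_ball_lim (A : set V) (c L0 : R) : measurable A ->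
  (forall L, L0 <= L -> 0 < L -> pr mu (A `&` [set x : 'rV[R]_n | enorm x <= L]) <= c) -> pr mu A <= c.
Proof.
move=> mA h; apply/ler_addgt0Pr => e e0.
pose L := Order.max L0 (1 + n%:R / e).
have L1 : 1 <= L by rewrite le_max lerDl divr_ge0 ?orbT // ltW.
apply: le_trans (pr_ballI mA _) _; first exact: lt_le_trans L1.
apply: lerD; first by apply: h; rewrite ?le_max ?lexx // (lt_le_trans _ L1).
rewrite ler_pdivrMr ?exprn_gt0 ?(lt_le_trans _ L1) //.
have : 1 + n%:R / e <= L by rewrite le_max lexx orbT.
rewrite -(ler_pM2l e0) mulrDr mulrCA divff ?gt_eqF // !mulr1 expr2 => h1.
have : e * L <= e * (L * L) by rewrite ler_pM2l // ler_peMr // (le_trans _ L1).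
lra.
Qed.
Lemma pr_ball_ge (A : set V) (c e : R) : measurable A -> c <= pr mu A -> 0 < e ->
  exists2 L : R, 0 < L & c - e <= pr mu (A `&` [set x : 'rV[R]_n | enorm x <= L]).
Proof.
move=> mA hc e0; have [//|h] := pselect (exists2 L : R, 0 < L & c - e <= pr mu (A `&` [set x : 'rV[R]_n | enorm x <= L])).
have : pr mu A <= c - e.
  apply: (pr_ball_lim (L0 := 1)) => // L L1 L0; rewrite leNgt; apply/negP => hl.
  by apply: h; exists L => //; exact: ltW.
lra.
Qed.
End Balls.

Section LogConcaveClosed.
Context {R : realType} {n : nat} (mu : probability (borel_rV R n) R).
Notation V := (borel_rV R n).
Hypothesis (iso : isotropic mu) (lc : log_concave mu).

(** Closed sets are first cut to large balls, which raises each cost by at most [e]; then [e] tends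
    to 0. *)
Lemma lc_exp_cl (A B C : set 'rV[R]_n) (l a b : R) : 0 < l < 1 ->
  closed A -> closed B -> measurable (C : set V) ->
  (forall x y, A x -> B y -> C (l *: x + (1 - l) *: y)) ->
  expR (- a) <= pr mu A -> expR (- b) <= pr mu B ->
  expR (- (l * a + (1 - l) * b)) <= pr mu C.
Proof.
move=> l01 cA cB mC h hA hB; have [l0 l1] := andP l01.
have key e : 0 < e -> expR (- (l * a + (1 - l) * b)) * expR (- e) <= pr mu C.
  move=> e0.
  have sub (D : set 'rV[R]_n) c : closed D -> expR (- c) <= pr mu D ->
      exists L, expR (- (c + e)) <= pr mu (D `&` [set x | enorm x <= L]).
    move=> cD hD; have lt : 0 < expR (- c) - expR (- (c + e)) by rewrite subr_gt0 ltr_expR; lra.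
    have [L L0 hL] := pr_ball_ge iso (closed_borel cD) hD lt.
    by exists L; apply: le_trans hL; lra.
  have [L hL] := sub _ _ cA hA; have [M hM] := sub _ _ cB hB.
  rewrite -expRD; have -> : - (l * a + (1 - l) * b) + - e = - (l * (a + e) + (1 - l) * (b + e)) by ring.
  apply: (@lc_exp _ _ mu (A `&` [set x | enorm x <= L]) (B `&` [set x | enorm x <= M]) C) => //.
  - exact: compactI_ball0.
  - exact: compactI_ball0.
  - by move=> x y [Ax _] [By _]; exact: h.
apply/ler_addgt0Pr => e e0; have := key e e0; have h1 := @expR_ge1Dx R (- e).
set E := expR _ in key *; move=> h2.
have E0 : 0 <= E by exact: expR_ge0.
have a0 : 0 <= a.
  by rewrite -oppr_le0 -ler_expR expR0; apply: le_trans hA _; apply: pr_le1; exact: closed_borel.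
have b0 : 0 <= b.
  by rewrite -oppr_le0 -ler_expR expR0; apply: le_trans hB _; apply: pr_le1; exact: closed_borel.
have E1 : E <= 1.
  rewrite /E -[leRHS]expR0 ler_expR; have := mulr_ge0 (ltW l0) a0.
  have : 0 <= (1 - l) * b by apply: mulr_ge0 => //; lra.
  lra.
nra.
Qed.

Lemma lc_half_cl (A B C : set 'rV[R]_n) :
  closed A -> closed B -> measurable (C : set V) ->
  (forall x y, A x -> B y -> C (2^-1 *: (x + y))) ->
  pr mu A * pr mu B <= pr mu C ^+ 2.
Proof.
move=> cA cB mC h.
have [A0|A0] := eqVneq (pr mu A) 0; first by rewrite A0 mul0r sqr_ge0.
have [B0|B0] := eqVneq (pr mu B) 0; first by rewrite B0 mulr0 sqr_ge0.
have pA : 0 < pr mu A by rewrite lt_def A0 pr_ge0.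
have pB : 0 < pr mu B by rewrite lt_def B0 pr_ge0.
have h2 : (2^-1 : R) = 1 - 2^-1 by lra.
have h3 x y : A x -> B y -> C (2^-1 *: x + (1 - 2^-1) *: y).
  by move=> Ax By; rewrite -h2 -scalerDr; exact: h.
have hh : expR (- (2^-1 * - ln (pr mu A) + (1 - 2^-1) * - ln (pr mu B))) <= pr mu C.
  apply: (lc_exp_cl _ cA cB mC h3); first by lra.
  - by rewrite opprK lnK.
  - by rewrite opprK lnK.
have -> : pr mu A * pr mu B = expR (- (2^-1 * - ln (pr mu A) + (1 - 2^-1) * - ln (pr mu B))) ^+ 2.
  rewrite -expRM_natl -[X in X * _ = _]lnK // -[X in _ * X = _]lnK // -expRD.
  by congr expR; field.
by rewrite ler_sqr ?nnegrE ?expR_ge0 ?pr_ge0.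
Qed.
End LogConcaveClosed.

(** * Exponential tails of one-dimensional marginals *)

Section Tails.
Context {R : realType} {n : nat} (mu : probability (borel_rV R n) R).
Notation V := (borel_rV R n).
Hypothesis (iso : isotropic mu) (lc : log_concave mu).
Variable u : 'rV[R]_n.
Hypothesis u1 : dot u u = 1.

Lemma dge_closed (s : R) : closed [set x : 'rV[R]_n | s <= `|dot x u|].
Proof. by apply: closed_ge; exact: dot0abs_continuous. Qed.
Lemma dge_borel (s : R) : measurable ([set x : 'rV[R]_n | s <= `|dot x u|] : set V).
Proof. by apply: closed_borel; exact: dge_closed. Qed.
Lemma dle_closed (t s : R) : closed [set x : 'rV[R]_n | `|dot x u - t| <= s].
Proof. by apply: closed_le; exact: dotabs_continuous. Qed.

Lemma cheb_ge (s : R) : 1 < s -> pr mu [set x : V | s <= `|dot (x : 'rV[R]_n) u|] <= ((s - 1) ^+ 2)^-1.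
Proof.
move=> s1; have := @cheb_dot _ _ _ iso u (s - 1); rewrite u1 div1r subr_gt0 => /(_ s1).
apply: le_trans; apply: pr_mono.
- exact: dge_borel.
- apply: (measurable_gt_set (f := fun x : V => `|dot (x : 'rV[R]_n) u|)).
  by apply: measurableT_comp => //; exact: dot_borel.
- by move=> x /=; apply: lt_le_trans; lra.
Qed.

(** Borell's argument. A suitable convex combination of a point beyond [4 t] and a point within 4
    still lies beyond 4, an event of mass at most [1/9], while the mass within 4 is at least [8/9];
    log-concavity then bounds the mass beyond [4 t]. *)
Lemma tail_scaled (t : R) : 1 <= t ->
  pr mu [set x : V | 4 * t <= `|dot (x : 'rV[R]_n) u|] <= expR (- (t / 2)).
Proof.
move=> t1; set DL := [set _ | _].
have [->|D0] := eqVneq (pr mu DL) 0; first exact: expR_ge0.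
have Dp : 0 < pr mu DL by rewrite lt_def D0 pr_ge0.
have mA : measurable ([set x : 'rV[R]_n | `|dot x u - 0| <= 4] : set V).
  by apply: closed_borel; exact: dle_closed.
have hC : pr mu [set x : V | 4 <= `|dot (x : 'rV[R]_n) u|] <= 9^-1.
  have -> : (9 : R) = (4 - 1) ^+ 2 by ring.
  by apply: cheb_ge; lra.
have hA : 8 / 9 <= pr mu [set x : V | `|dot (x : 'rV[R]_n) u - 0| <= 4].
  have : pr mu (~` [set x : V | `|dot (x : 'rV[R]_n) u - 0| <= 4]) <= pr mu [set x : V | 4 <= `|dot (x : 'rV[R]_n) u|].
    apply: pr_mono; [exact: measurableC|exact: dge_borel|].
    by move=> x /= /negP; rewrite subr0 -ltNge => /ltW.
  rewrite prC //; lra.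
(* The weight for which [l * 4 t - (1 - l) * 4 = 4]. *)
pose l := 2 / (t + 1).
have l1 : l <= 1 by rewrite /l ler_pdivrMr; lra.
have lp : 0 < l by rewrite /l divr_gt0 //; lra.
have lt : l * (t + 1) = 2 by rewrite /l mulfVK // gt_eqF //; lra.
have [tE|tn] := eqVneq t 1.
  apply: le_trans (_ : (9^-1 : R) <= _).
    apply: le_trans (_ : pr mu [set x : V | 4 <= `|dot (x : 'rV[R]_n) u|] <= _); last by lra.
    by apply: pr_mono; [exact: dge_borel|exact: dge_borel|by move=> x; rewrite /DL /= tE mulr1].
  by have := expR_ge1Dx (- (t / 2)); lra.
have l01 : 0 < l < 1.
  have t1' : 1 < t by rewrite lt_def tn.
  by rewrite lp /l ltr_pdivrMr /=; lra.
clearbody l.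
have incl (x y : 'rV[R]_n) : DL x -> [set x : 'rV[R]_n | `|dot x u - 0| <= 4] y ->
    [set x : 'rV[R]_n | 4 <= `|dot x u|] (l *: x + (1 - l) *: y).
  rewrite /DL /= subr0 => hx hy; rewrite dotDl !dotZl.
  have := ler_normB (l * dot x u + (1 - l) * dot y u) ((1 - l) * dot y u).
  rewrite addrK !normrM (ger0_norm (ltW lp)) (@ger0_norm _ (1 - l)); last by lra.
  have : l * (4 * t) <= l * `|dot x u| by rewrite ler_pM2l.
  have : (1 - l) * `|dot y u| <= (1 - l) * 4 by apply: ler_wpM2l => //; lra.
  nra.
have hh : expR (- (l * - ln (pr mu DL) + (1 - l) * - ln (3 / 4))) <= pr mu [set x : 'rV[R]_n | 4 <= `|dot x u|].
  apply: (@lc_exp_cl _ _ mu iso lc DL [set x : 'rV[R]_n | `|dot x u - 0| <= 4]) => //.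
  - exact: dge_closed.
  - exact: dle_closed.
  - exact: dge_borel.
  - by rewrite opprK lnK ?posrE.
  - by rewrite opprK lnK ?posrE; lra.
have h9 : expR (- (l * - ln (pr mu DL) + (1 - l) * - ln (3 / 4))) <= 9^-1 by apply: le_trans hh _; lra.
have h3 : expR (-1) <= (2^-1 : R).
  by have := expRxMexpNx_1 (1 : R); have := @expR_ge1Dx R 1; have := expR_gt0 (-1 : R); nra.
have h4 : - ln (3/4 : R) <= 1/3.
  rewrite -lnV ?posrE; last by lra.
  have := @le_ln1Dx R (1/3) ltac:(lra); congr (ln _ <= _); lra.
have h5 : expR (-2) <= (4^-1 : R).
  have -> : (-2 : R) = 2%:R * (-1) by ring.
  rewrite expRM_natl; have := expR_gt0 (-1 : R); nra.
rewrite -[pr mu DL]lnK ?posrE // ler_expR.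
(* [exp (-1) >= 1/6] and [exp (-1/3) >= 2/3] have product at least [1/9]. The term with [ln (3/4)]
   takes back at most [1/3] of this exponent. *)
have h6 : - (l * - ln (pr mu DL) + (1 - l) * - ln (3 / 4)) <= -1 - 1/3.
  rewrite -ler_expR; apply: le_trans h9 _.
  rewrite expRD; have : (1 - 1/3 : R) <= expR (- (1/3) : R) by have := @expR_ge1Dx R (- (1/3)); lra.
  have : (6^-1 : R) <= expR (-1).
    have := expRxMexpNx_1 (1 : R); have := expR_gt0 (-1 : R).
    have : expR 1 <= (4 : R).
      have := expRxMexpNx_1 (2^-1 : R); have := expR_ge1Dx (- 2^-1 : R).
      have -> : expR (1:R) = expR (2^-1) ^+ 2 by rewrite -expRM_natl; congr expR; lra.
      have := expR_gt0 (2^-1 : R); nra.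
    nra.
  nra.
have h7 : l * ln (pr mu DL) <= - 1.
  have : (1 - l) * - ln (3 / 4) <= 1/3 * 1 by rewrite mulrC; apply: ler_pM => //; [rewrite oppr_ge0; apply: ln_le0; lra|lra|lra].
  nra.
have -> : - (t / 2) = - ((t+1)/2) + 1/2 by lra.
suff : ln (pr mu DL) <= - ((t + 1) / 2) by lra.
rewrite -(ler_pM2l lp); apply: le_trans h7 _; have := lt; nra.
Qed.

Lemma tail_dot (s : R) : pr mu [set x : V | s <= `|dot (x : 'rV[R]_n) u|] <= 2 * expR (- (s / 8)).
Proof.
have [s4|s4] := leP 4 s.
  have := @tail_scaled (s / 4) ltac:(lra).
  have -> : 4 * (s / 4) = s by lra.
  have -> : - (s / 4 / 2) = - (s / 8) by lra.
  have := expR_gt0 (- (s/8)); lra.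
have := pr_le1 mu (dge_borel s); have := expR_ge1Dx (- (s / 8)); lra.
Qed.
End Tails.

(** * Elementary inequalities *)

Section RealFacts.
Context {R : realType}.

Lemma expRN_poly4 (y : R) : 0 < y -> expR (- y) <= 24 / y ^+ 4.
Proof.
move=> y0; rewrite ler_pdivlMr ?exprn_gt0 //.
have := @expR_ge1Dxn R y 3 (ltW y0); have := expRxMexpNx_1 y; have := expR_gt0 (- y).
have -> : (4`!%:R : R) = 24 by [].
set a := expR (- y); set b := expR y => a0 ab h.
have : y ^+ 4 / 24 <= b by lra.
rewrite ler_pdivrMr ?ltr0n // => h2.
have : a * y ^+ 4 <= a * (b * 24) by rewrite ler_pM2l.
rewrite mulrA (mulrC a b) ab; lra.
Qed.

Lemma sum_inv_sqr (M : nat) : \sum_(1 <= i < M.+2) (i%:R ^- 2 : R) <= 2 - M.+1%:R^-1.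
Proof.
elim: M => [|M ih]; first by rewrite big_nat1 expr1n invr1; lra.
rewrite big_nat_recr //=.
apply: le_trans (lerD ih (lexx _)) _.
have m0 : (0 : R) < M.+1%:R by rewrite ltr0n.
rewrite -[in M.+2%:R]addn1 natrD; set m : R := M.+1%:R in m0 *.
rewrite -subr_ge0.
have -> : 2 - (m + 1)^-1 - (2 - m^-1 + (m + 1) ^- 2) = (m * (m + 1) ^+ 2)^-1.
  by field; rewrite !gt_eqF //; lra.
by rewrite invr_ge0 mulr_ge0 ?ltW // exprn_gt0 //; lra.
Qed.

Lemma ln_le_sqrt (x : R) : 0 < x -> ln x <= 2 * Num.sqrt x.
Proof.
move=> x0; have s0 : 0 < Num.sqrt x by rewrite sqrtr_gt0.
rewrite -[X in ln X]sqr_sqrtr ?ltW // expr2 lnM ?posrE //.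
have := ln_sublinear s0; lra.
Qed.

Lemma expR1_le4 : expR 1 <= (4 : R).
Proof.
have := expRxMexpNx_1 (2^-1 : R); have := @expR_ge1Dx R (- 2^-1).
have -> : expR (1:R) = expR (2^-1) ^+ 2 by rewrite -expRM_natl; congr expR; lra.
have := expR_gt0 (2^-1 : R); nra.
Qed.

Lemma sum_disj_le1 (I : eqType) (r : seq I) (Q : pred I) : uniq r ->
  {in r &, forall i j, Q i -> Q j -> i = j} -> \sum_(i <- r) ((Q i)%:R : R) <= 1.
Proof.
move=> ur h; have [/hasP[i ir Qi]|/hasPn hn] := boolP (has Q r).
  rewrite (bigD1_seq i) //= Qi big1_seq ?addr0 // => j /andP[ji jr].
  by have [Qj|] := boolP (Q j) => //; rewrite (h j i) ?eqxx // in ji.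
by rewrite big1_seq // => i /= ir; rewrite (negbTE (hn i ir)).
Qed.
End RealFacts.

(** * Small balls for one-dimensional marginals *)

Section SmallBall.
Context {R : realType}.

(** Tails are summed over multiples of [sb_S]; with mass below [sb_p] on [|<x,u>| >= 1/2] the second
    moment would be less than 1. Beyond [sb_R] lies mass at most [sb_p / 2], and [sb_c] is tuned to
    [l0 * - ln b <= 1] in [small_ball_sign]. *)
Definition sb_S : R := 2 ^+ 12.
Definition sb_p : R := (4 * sb_S ^+ 2)^-1.
Definition sb_R : R := 4 * sb_S + 1.
Definition sb_c : R := Num.sqrt (sb_p / (4 * sb_R)) / 2.
Definition sb_C : R := 48 / sb_c.

Lemma sb_S_ge1 : 1 <= sb_S.
Proof. by rewrite /sb_S exprn_ege1 // ler1n. Qed.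
Lemma sb_p_gt0 : 0 < sb_p.
Proof. by rewrite /sb_p invr_gt0 mulr_gt0 // exprn_gt0 // (lt_le_trans _ sb_S_ge1). Qed.
Lemma sb_p_le1 : sb_p <= 1.
Proof.
have S1 := sb_S_ge1; rewrite /sb_p invf_le1; first by nra.
by rewrite mulr_gt0 // exprn_gt0 //; lra.
Qed.
Lemma sb_R_gt0 : 0 < sb_R.
Proof. by have := sb_S_ge1; rewrite /sb_R; lra. Qed.
Lemma sb_c_gt0 : 0 < sb_c.
Proof. by rewrite /sb_c divr_gt0 // sqrtr_gt0 divr_gt0 ?sb_p_gt0 // mulr_gt0 // sb_R_gt0. Qed.
Lemma sb_C_gt0 : 0 < sb_C.
Proof. by rewrite /sb_C divr_gt0 // sb_c_gt0. Qed.

Context {n : nat} (mu : probability (borel_rV R n) R).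
Notation V := (borel_rV R n).
Hypothesis (iso : isotropic mu) (lc : log_concave mu).

Lemma indic_dge (u x : 'rV[R]_n) (s : R) :
  \1_[set x : V | s <= `|dot (x : 'rV[R]_n) u|] (x : V) = (s <= `|dot x u|)%R%:R :> R.
Proof.
rewrite indicE; congr (_%:R); congr nat_of_bool.
by apply/idP/idP => [/set_mem//|h]; exact/mem_set.
Qed.

(** Otherwise the squares below [1/2], the squares up to [sb_S] and the exponential tail would
    contribute at most [1/4] each to a second moment equal to 1. *)
Lemma half_mass (u : 'rV[R]_n) : dot u u = 1 -> sb_p <= pr mu [set x : V | 2^-1 <= `|dot (x : 'rV[R]_n) u|].
Proof.
move=> u1; rewrite leNgt; apply/negP => hp.
suff : dot u u <= 3/4 by rewrite u1; lra.
apply: (dot2_trunc_le iso) => k.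
pose D (s : R) := [set x : V | s <= `|dot (x : 'rV[R]_n) u|].
have mD (s : R) : measurable (D s) by exact: dge_borel.
pose S := sb_S.
have S1 : 1 <= S := sb_S_ge1.
have bD (s : R) : bmf (\1_(D s) : V -> R) by apply: bmf_indic.
pose g (x : V) : R := (4^-1 + S ^+ 2 * \1_(D 2^-1) x) +
   \sum_(i <- index_iota 1 k.+2) ((i%:R + 1) * S) ^+ 2 * \1_(D (i%:R * S)) x.
have bg1 : bmf (fun x : V => 4^-1 + S ^+ 2 * \1_(D 2^-1) x).
  by apply: bmfD; [exact: bmf_cst|exact: bmfZ].
have bgi (i : nat) : bmf (fun x : V => ((i%:R + 1) * S) ^+ 2 * \1_(D (i%:R * S)) x) by exact: bmfZ.
have bg2 := bmf_sum (index_iota 1 k.+2) bgi.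
have bg : bmf g by exact: bmfD.
(* Either [y < 1/2], or [y < S], or the last multiple [i S <= y] pays for [y ^ 2] with
   [((i + 1) S) ^ 2]. *)
have pw (y : R) (m : nat) : 0 <= y -> y < m.+1%:R * S ->
   y ^+ 2 <= 4^-1 + S ^+ 2 * (2^-1 <= y)%R%:R + \sum_(1 <= i < m.+1) ((i%:R + 1) * S) ^+ 2 * (i%:R * S <= y)%R%:R.
  move=> y0; elim: m => [|m ih] hy.
    rewrite big_geq // addr0; have [h|h] := leP 2^-1 y; last by rewrite mulr0; nra.
    rewrite mulr1; rewrite mul1r in hy; nra.
  rewrite big_nat_recr //= addrA; have [h|h] := ltP y (m.+1%:R * S).
    by apply: le_trans (ih h) _; rewrite lerDl mulr_ge0 ?sqr_ge0.
  rewrite -[leLHS]add0r mulr1; apply: lerD.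
    rewrite addr_ge0 ?addr_ge0 ?mulr_ge0 ?sqr_ge0 //.
    by apply: sumr_ge0 => i _; rewrite mulr_ge0 ?sqr_ge0.
  rewrite ler_sqr ?nnegrE ?mulr_ge0 ?addr_ge0 ?(le_trans _ S1) //.
  by rewrite -natr1 in hy; apply: ltW.
have le_g x : Order.min (dot (x : 'rV[R]_n) u ^+ 2) k%:R <= g x.
  rewrite /g indic_dge; under eq_bigr do rewrite indic_dge.
  have [h|h] := ltP `|dot (x : 'rV[R]_n) u| (k.+2%:R * S).
    rewrite ge_min; apply/orP; left; rewrite -[dot _ _ ^+ 2]real_normK ?num_real //.
    exact: pw.
  rewrite ge_min; apply/orP; right; rewrite big_nat_recr //=.
  have -> : k.+1%:R * S <= `|dot (x : 'rV[R]_n) u|.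
    by apply: le_trans h; rewrite ler_pM2r ?ler_nat //; lra.
  rewrite mulr1 -[leLHS]add0r -[leLHS]add0r; apply: lerD.
    by rewrite addr_ge0 ?mulr_ge0 ?sqr_ge0.
  apply: lerD; first by apply: sumr_ge0 => i _; rewrite mulr_ge0 ?sqr_ge0.
  have k0 : (0 : R) <= k%:R by rewrite ler0n.
  rewrite -natr1; have h5 : k%:R + 1 + 1 <= (k%:R + 1 + 1) * S by apply: ler_peMr => //; lra.
  set v := _ * S in h5 *; nra.
have bm : bmf (fun x : V => Order.min (dot (x : 'rV[R]_n) u ^+ 2) k%:R).
  apply: bmf_trunc => // [|x]; last exact: sqr_ge0.
  by apply: measurable_funX; exact: dot_borel.
apply: le_trans (Ex_le mu bm bg le_g) _.
rewrite ExD // ExD //; [|exact: bmf_cst|exact: bmfZ].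
rewrite Ex_cst ExZ // Ex_indic // Ex_sum //.
have h1 : S ^+ 2 * pr mu (D 2^-1) <= 4^-1.
  have S2 : 0 < S ^+ 2 by nra.
  have : S ^+ 2 * pr mu (D 2^-1) <= S ^+ 2 * sb_p by rewrite ler_pM2l // ltW.
  by rewrite /sb_p -/S invfM mulrCA divff ?mulr1 // gt_eqF.
have h2 : \sum_(i <- index_iota 1 k.+2) Ex mu (fun x : V => ((i%:R + 1) * S) ^+ 2 * \1_(D (i%:R * S)) x) <= 4^-1.
  apply: le_trans (_ : \sum_(1 <= i < k.+2) (8^-1 * (i%:R ^- 2)) <= _); last first.
    have hs := @sum_inv_sqr R k; have ht : 0 <= k.+1%:R^-1 :> R by rewrite invr_ge0 ler0n.
    rewrite -mulr_sumr; apply: le_trans (_ : 8^-1 * 2 <= _); last by lra.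
    by rewrite ler_pM2l ?invr_gt0 //; apply: le_trans hs _; rewrite gerBl.
  rewrite big_nat [leRHS]big_nat; apply: ler_sum => i /andP[i1 _].
  rewrite ExZ // Ex_indic //.
  have i1' : (1 : R) <= i%:R by rewrite ler1n.
  have i0 : (0 : R) < i%:R by lra.
  have ht : pr mu (D (i%:R * S)) <= 2 * expR (- (i%:R * S / 8)) by exact: tail_dot.
  have he := @expRN_poly4 R (i%:R * S / 8) ltac:(rewrite divr_gt0 // mulr_gt0 //; lra).
  have hp2 : pr mu (D (i%:R * S)) <= 48 * 8 ^+ 4 / (i%:R ^+ 4 * S ^+ 4).
    apply: le_trans ht _; apply: le_trans (_ : 2 * (24 / (i%:R * S / 8) ^+ 4) <= _); first by rewrite ler_pM2l.
    rewrite le_eqVlt; apply/orP; left; apply/eqP; field; rewrite !gt_eqF //; lra.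
  apply: le_trans (_ : (2 * i%:R * S) ^+ 2 * (48 * 8 ^+ 4 / (i%:R ^+ 4 * S ^+ 4)) <= _).
    apply: ler_pM; rewrite ?sqr_ge0 ?pr_ge0 //.
    rewrite ler_sqr ?nnegrE ?mulr_ge0 ?addr_ge0 //; try lra.
    by rewrite ler_pM2r; lra.
  have -> : (2 * i%:R * S) ^+ 2 * (48 * 8 ^+ 4 / (i%:R ^+ 4 * S ^+ 4)) = (192 * 8 ^+ 4 / S ^+ 2) * i%:R ^- 2.
    field; rewrite !gt_eqF //; lra.
  have S0 : 0 < S by lra.
  rewrite ler_pM2r ?invr_gt0 ?exprn_gt0 // ler_pdivrMr ?exprn_gt0 //.
  have -> : (192 * 8 ^+ 4 : R) = 2 ^+ 12 * 192 by ring.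
  have -> : S ^+ 2 = 2 ^+ 12 * (2 ^+ 12) by rewrite /S /sb_S expr2.
  have -> : 8^-1 * (2 ^+ 12 * (2 ^+ 12)) = 2 ^+ 12 * (2 ^+ 9 : R) by field.
  rewrite ler_pM2l ?exprn_gt0 //; lra.
have := lerD h1 h2; lra.
Qed.


(** By pigeonhole some slab of half-width [e] centred at [t >= 1/2] has mass at least [b], of order
    [e]. Log-concavity between it and the central slab of mass [a] gives mass at least [a / 4] to
    the slabs centred at [l t] for all [l <= l0], where [l0] is of order [sqrt e]. About
    [1 / sqrt e] of them are disjoint, so [a] is [O(sqrt e)]. *)
Lemma small_ball_sign (w : 'rV[R]_n) (e : R) : dot w w = 1 -> 0 < e -> e <= 2^-1 ->
  sb_p / 4 <= pr mu [set x : V | 2^-1 <= dot (x : 'rV[R]_n) w <= sb_R] ->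
  pr mu [set x : V | `|dot (x : 'rV[R]_n) w| <= e] <= sb_C * Num.sqrt e.
Proof.
move=> w1 e0 e2 hw; set a := pr mu _.
have p0 := sb_p_gt0; have R0 := sb_R_gt0; have S1 := sb_S_ge1; have c0 := sb_c_gt0.
have se0 : 0 < Num.sqrt e by rewrite sqrtr_gt0.
have mI t : measurable ([set x : 'rV[R]_n | `|dot x w - t| <= e] : set V).
  by apply: closed_borel; exact: dle_closed.
have cA : closed [set x : 'rV[R]_n | `|dot x w| <= e].
  by apply: closed_le; exact: dot0abs_continuous.
have mA := closed_borel cA.
have [az|an0] := eqVneq a 0; first by rewrite az mulr_ge0 // ltW // sb_C_gt0.
have a0 : 0 < a by rewrite lt_def an0 pr_ge0.
pose b := sb_p * e / (4 * sb_R).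
have b0 : 0 < b by rewrite /b divr_gt0 // mulr_gt0.
have [t t2 bt] : exists2 t, 2^-1 <= t & b <= pr mu [set x : V | `|dot (x : 'rV[R]_n) w - t| <= e].
  pose J := Num.truncn (sb_R / (2 * e)).
  pose tt (j : nat) : R := 2^-1 + (2 * e) * j%:R + e.
  have [[j jJ]|hn] := pselect (exists2 j : nat, (j < J.+1)%N & b <= pr mu [set x : V | `|dot (x : 'rV[R]_n) w - tt j| <= e]).
    by exists (tt j) => //; rewrite /tt -addrA lerDl addr_ge0 ?mulr_ge0 // ltW // mulr_gt0.
  exfalso; move: hw; apply/negP; rewrite -ltNge.
  apply: (@le_lt_trans _ _ (pr mu (\big[setU/set0]_(j <- iota 0 J.+1) [set x : V | `|dot (x : 'rV[R]_n) w - tt j| <= e]))).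
    apply: pr_mono.
    - have -> : [set x : V | 2^-1 <= dot (x : 'rV[R]_n) w <= sb_R] =
         [set x : V | 2^-1 <= dot (x : 'rV[R]_n) w] `&` [set x : V | dot (x : 'rV[R]_n) w <= sb_R].
        by apply/seteqP; split => x /=; [move/andP|move=> h; apply/andP].
      apply: measurableI; apply: closed_borel; [apply: closed_ge|apply: closed_le]; exact: dot_continuous.
    - by apply: measurable_bigsetU.
    - move=> x /= /andP[h1 h2]; pose y := (dot (x : 'rV[R]_n) w - 2^-1) / (2 * e).
      have y0 : 0 <= y by rewrite /y divr_ge0 ?subr_ge0 // ltW // mulr_gt0.
      have /andP[hj1 hj2] := truncn_itv y0.
      rewrite -bigcup_seq; exists (Num.truncn y).
        have : Num.truncn y \in iota 0 J.+1.
          rewrite mem_iota add0n ltnS; apply: le_truncn.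
          by rewrite /y ler_pM2r ?invr_gt0 ?mulr_gt0 //; lra.
        by [].
      have yE : (2 * e) * y = dot (x : 'rV[R]_n) w - 2^-1 by rewrite /y mulrCA divff ?mulr1 // gt_eqF // mulr_gt0.
      rewrite /= /tt ler_norml; rewrite -natr1 in hj2.
      by apply/andP; split; nra.
  apply: le_lt_trans (pr_bigU_le mu _) _; first by [].
  have hlt : \sum_(j <- iota 0 J.+1) pr mu [set x : V | `|dot (x : 'rV[R]_n) w - tt j| <= e] <= \sum_(j <- iota 0 J.+1) b.
    rewrite big_seq [leRHS]big_seq; apply: ler_sum => j; rewrite mem_iota add0n => /andP[_ jJ].
    by rewrite leNgt; apply/negP => hb; apply: hn; exists j => //; exact: ltW.
  apply: le_lt_trans hlt _.
  rewrite big_const_seq count_predT size_iota iter_addr addr0.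
  have hJ : J.+1%:R <= sb_R / (2 * e) + 1.
    rewrite -natr1 lerD2r.
    have /truncn_itv/andP[] // : 0 <= sb_R / (2 * e) by rewrite divr_ge0 ?ltW // mulr_gt0.
  rewrite -(mulr_natr b).
  apply: le_lt_trans (_ : b * (sb_R / (2 * e) + 1) < _); first by rewrite ler_pM2l.
  have -> : b * (sb_R / (2 * e) + 1) = sb_p / 8 + sb_p / 4 * (e / sb_R).
    by rewrite /b; field; rewrite !gt_eqF.
  have : e / sb_R <= 1/4 by rewrite ler_pdivrMr //; rewrite /sb_R; lra.
  have : 0 <= e / sb_R by rewrite divr_ge0 // ltW.
  nra.
have t0 : 0 < t by lra.
have b1 : b < 1.
  rewrite /b ltr_pdivrMr ?mulr_gt0 // mul1r /sb_R.
  have := sb_p_le1.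
  nra.
(* The bound [- ln b <= 2 / sqrt b] with [b] of order [e] leaves room for [l] of order [sqrt e],
   whence the square root in the conclusion. *)
pose l0 := sb_c * Num.sqrt e.
have l0p : 0 < l0 by rewrite mulr_gt0.
have lb : l0 * - ln b <= 1.
  rewrite -lnV ?posrE //.
  apply: le_trans (_ : l0 * (2 * Num.sqrt b^-1) <= _).
    by rewrite ler_pM2l // ln_le_sqrt // invr_gt0.
  rewrite /l0 /b.
  have -> : (sb_p * e / (4 * sb_R))^-1 = (sb_p / (4 * sb_R))^-1 * e^-1 by field; rewrite !gt_eqF.
  have hq : 0 < sb_p / (4 * sb_R) by rewrite divr_gt0 // mulr_gt0.
  have hqi : 0 <= (sb_p / (4 * sb_R))^-1 by rewrite invr_ge0; exact: ltW.
  rewrite sqrtrM // !sqrtrV; [|exact: ltW|exact: ltW].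
  have : sb_c = Num.sqrt (sb_p / (4 * sb_R)) / 2 by [].
  have : 0 < Num.sqrt (sb_p / (4 * sb_R)) by rewrite sqrtr_gt0.
  set q := Num.sqrt _ => q0 ->; set r := Num.sqrt e in se0 *.
  by rewrite le_eqVlt; apply/orP; left; apply/eqP; field; rewrite !gt_eqF.
have l01 : l0 < 1.
  rewrite /l0; have : sb_c <= 1/2.
    rewrite /sb_c; have : Num.sqrt (sb_p / (4 * sb_R)) <= 1.
      rewrite -[leRHS]sqrtr1 ler_sqrt ?ler01 // ler_pdivrMr ?mulr_gt0 //.
      have := sb_p_le1.
      rewrite /sb_R; lra.
    lra.
  have : Num.sqrt e <= 1 by rewrite -[leRHS]sqrtr1 ler_sqrt ?ler01 //; lra.
  nra.
have hC (l : R) : 0 < l -> l <= l0 -> a / 4 <= pr mu [set x : V | `|dot (x : 'rV[R]_n) w - l * t| <= e].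
  move=> lp ll; have h := @lc_exp_cl _ _ mu iso lc [set x : 'rV[R]_n | `|dot x w - t| <= e]
     [set x : 'rV[R]_n | `|dot x w| <= e] [set x : 'rV[R]_n | `|dot x w - l * t| <= e] l (- ln b) (- ln a).
  apply: le_trans (h _ _ _ _ _ _ _) => //.
  - rewrite opprD -mulrN opprK expRD; apply: le_trans (_ : expR (-1) * a <= _).
      rewrite mulrC ler_pM2r //; have := expRxMexpNx_1 (1 : R); have := expR1_le4 (R := R).
      have := expR_gt0 (-1 : R); nra.
    apply: ler_pM; rewrite ?expR_ge0 ?pr_ge0 //.
      rewrite ler_expR; have : - ln b >= 0 by rewrite oppr_ge0 ln_le0 // ltW.
      nra.
    rewrite -{1}[a]lnK ?posrE // ler_expR.
    have : ln a <= 0 by rewrite ln_le0 // pr_le1.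
    nra.
  - by rewrite lp; lra.
  - exact: dle_closed.
  - move=> x y /= hx hy; rewrite dotDl !dotZl.
    have -> : l * dot x w + (1 - l) * dot y w - l * t = l * (dot x w - t) + (1 - l) * dot y w by ring.
    apply: le_trans (ler_normD _ _) _; rewrite !normrM (ger0_norm (ltW lp)) (@ger0_norm _ (1 - l)); last by lra.
    have : l * `|dot x w - t| <= l * e by rewrite ler_pM2l.
    have : (1 - l) * `|dot y w| <= (1 - l) * e by rewrite ler_pM2l //; lra.
    lra.
  - by rewrite opprK lnK.
  - by rewrite opprK lnK.
(* Centres [3 e i] keep slabs of half-width [e] disjoint, and [i <= l0 / (6 e)] ensures
   [3 e i / t <= l0] since [t >= 1/2]. *)
pose I := Num.truncn (l0 / (6 * e)).
have hI : I%:R * (a / 4) <= 1.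
  have := @sum_pr_le _ _ _ mu nat (iota 1 I) (fun=> 1) (fun i => [set x : V | `|dot (x : 'rV[R]_n) w - 3 * e * i%:R| <= e]) 1.
  have mI2 i : measurable ([set x : V | `|dot (x : 'rV[R]_n) w - 3 * e * i%:R| <= e]) by exact: mI.
  move=> /(_ mI2) h.
  apply: le_trans (h _); last first.
    move=> x; under eq_bigr do rewrite mul1r indicE.
    apply: sum_disj_le1; first exact: iota_uniq.
    move=> i j _ _ /set_mem /= hi /set_mem /= hj.
    have h3 : `|3 * e * i%:R - 3 * e * j%:R| <= 2 * e.
      have -> : 3 * e * i%:R - 3 * e * j%:R = (dot (x : 'rV[R]_n) w - 3 * e * j%:R) - (dot (x : 'rV[R]_n) w - 3 * e * i%:R) by ring.
      apply: le_trans (ler_normB _ _) _; lra.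
    rewrite -mulrBr normrM gtr0_norm ?mulr_gt0 // in h3.
    have h4 : `|i%:R - j%:R| < (1 : R) by nra.
    move: h4; rewrite ltr_norml => /andP[h5 h6].
    by apply/eqP; rewrite eqn_leq; apply/andP; split; rewrite -ltnS -(ltr_nat R) -natr1; lra.
  under eq_bigr do rewrite mul1r.
  have -> : I%:R * (a / 4) = \sum_(i <- iota 1 I) (a / 4).
    by rewrite big_const_seq count_predT size_iota iter_addr addr0 mulr_natl.
  rewrite big_seq [leRHS]big_seq; apply: ler_sum => i; rewrite mem_iota add1n ltnS => /andP[i1 iI].
  have i0 : (0 : R) < i%:R by rewrite ltr0n.
  have -> : 3 * e * i%:R = (3 * e * i%:R / t) * t by rewrite mulfVK // gt_eqF.
  apply: hC; first by rewrite divr_gt0 // !mulr_gt0.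
  rewrite ler_pdivrMr //.
  have h7 : i%:R <= l0 / (6 * e).
    apply: le_trans (_ : I%:R <= _); first by rewrite ler_nat.
    have /truncn_itv/andP[] // : 0 <= l0 / (6 * e) by rewrite divr_ge0 ?ltW // mulr_gt0.
  have : i%:R * (6 * e) <= l0 by rewrite -ler_pdivlMr // mulr_gt0.
  nra.
have hI2 : l0 / (6 * e) < I%:R + 1.
  have /truncn_itv/andP[_] : 0 <= l0 / (6 * e) by rewrite divr_ge0 ?ltW // mulr_gt0.
  by rewrite natr1.
have hl : l0 / (6 * e) = sb_c / (6 * Num.sqrt e).
  rewrite /l0 -{2}[e]sqr_sqrtr ?ltW //; set r := Num.sqrt e in se0 *.
  by field; rewrite !gt_eqF.
have a1 : a <= 1 by exact: pr_le1.
rewrite /sb_C; set r := Num.sqrt e in se0 hl *.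
rewrite mulrAC ler_pdivlMr //.
have [h8|h8] := leP (sb_c / 12) r; first by nra.
have h9 : sb_c = (l0 / (6 * e)) * (6 * r) by rewrite hl mulfVK // gt_eqF // mulr_gt0.
set q := l0 / (6 * e) in hI2 h9.
have h10 : a * q <= 5.
  have : a * q <= a * (I%:R + 1) by rewrite ler_pM2l // ltW.
  by rewrite mulrDr mulr1 => h11; lra.
have h12 : a * sb_c = 6 * r * (a * q) by rewrite h9; ring.
rewrite h12; nra.
Qed.

(** Mass [sb_p] on [|<x,u>| >= 1/2], less at most [sb_p / 2] beyond [sb_R], leaves at least
    [sb_p / 4] on one side; replacing [u] by [- u] if necessary reduces to [small_ball_sign]. For
    [e > 1/2] the bound exceeds 1. *)
Lemma small_ball1 (u : 'rV[R]_n) (e : R) : dot u u = 1 -> 0 < e ->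
  pr mu [set x : V | `|dot (x : 'rV[R]_n) u| <= e] <= sb_C * Num.sqrt e.
Proof.
move=> u1 e0; have p0 := sb_p_gt0; have R0 := sb_R_gt0; have S1 := sb_S_ge1; have c0 := sb_c_gt0.
have mA (w : 'rV[R]_n) (s : R) : measurable ([set x : V | `|dot (x : 'rV[R]_n) w| <= s]).
  by apply: closed_borel; apply: closed_le; exact: dot0abs_continuous.
have [e2|e2] := leP e 2^-1; last first.
  apply: le_trans (pr_le1 mu (mA _ _)) _; rewrite /sb_C.
  have : 2^-1 <= Num.sqrt e.
    have -> : (2^-1 : R) = Num.sqrt (2^-1 ^+ 2) by rewrite sqrtr_sqr ger0_norm.
    by rewrite ler_sqrt; nra.
  have : 1 <= sb_c^-1.
    rewrite invf_ge1 // /sb_c.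
    have : Num.sqrt (sb_p / (4 * sb_R)) <= 1.
      rewrite -[leRHS]sqrtr1 ler_sqrt ?ler01 // ler_pdivrMr ?mulr_gt0 //.
      have := sb_p_le1.
      rewrite /sb_R; lra.
    lra.
  nra.
pose D (w : 'rV[R]_n) := [set x : V | 2^-1 <= dot (x : 'rV[R]_n) w <= sb_R].
have mD w : measurable (D w).
  have -> : D w = [set x : V | 2^-1 <= dot (x : 'rV[R]_n) w] `&` [set x : V | dot (x : 'rV[R]_n) w <= sb_R].
    by apply/seteqP; split => x /=; [move/andP|move=> h; apply/andP].
  apply: measurableI; apply: closed_borel; [apply: closed_ge|apply: closed_le]; exact: dot_continuous.
have h1 : sb_p <= pr mu (D u) + pr mu (D (- u)) + sb_p / 2.
  apply: le_trans (half_mass u1) _.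
  apply: le_trans (_ : pr mu ((D u `|` D (- u)) `|` [set x : V | sb_R <= `|dot (x : 'rV[R]_n) u|]) <= _).
    apply: pr_mono; [exact: dge_borel| |].
      by apply: measurableU; [exact: measurableU|exact: dge_borel].
    move=> x /= h; have [h2|h2] := leP sb_R `|dot (x : 'rV[R]_n) u|; [by right|left].
    rewrite /D /= dotNr; have [h3|h3] := leP 0 (dot (x : 'rV[R]_n) u).
      by left; move: h h2; rewrite ger0_norm // => h h2; rewrite h ltW.
    by right; move: h h2; rewrite ltr0_norm // => h h2; rewrite h ltW.
  apply: le_trans (prU_le _ _ _) _; [exact: measurableU|exact: dge_borel|].
  apply: lerD; first exact: prU_le.
  apply: le_trans (cheb_ge iso u1 _) _; first by rewrite /sb_R; lra.
  rewrite /sb_R addrK exprMn /sb_p invfM [leRHS]mulrC -invfM -invfM lef_pV2 ?posrE ?mulr_gt0 ?exprn_gt0 //; try lra.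
  nra.
have [h2|h2] := leP (sb_p / 4) (pr mu (D u)); first exact: small_ball_sign.
have -> : [set x : V | `|dot (x : 'rV[R]_n) u| <= e] = [set x : V | `|dot (x : 'rV[R]_n) (- u)| <= e].
  by apply/seteqP; split => x /=; rewrite dotNr normrN.
apply: small_ball_sign => //; first by rewrite dotNl dotNr opprK.
rewrite -/(D _); lra.
Qed.

Lemma small_ball (u : 'rV[R]_n) (e : R) : 0 < e ->
  u != 0 -> pr mu [set x : V | `|dot (x : 'rV[R]_n) u| <= e * enorm u] <= sb_C * Num.sqrt e.
Proof.
move=> e0 u0; have eu : 0 < enorm u by rewrite enorm_gt0.
pose v := (enorm u)^-1 *: u.
have v1 : dot v v = 1.
  by rewrite /v dotZl dotZr -enorm2; field; rewrite gt_eqF.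
have -> : [set x : V | `|dot (x : 'rV[R]_n) u| <= e * enorm u] = [set x : V | `|dot (x : 'rV[R]_n) v| <= e].
  apply/seteqP; split => x /=;
    by rewrite /v dotZr normrM gtr0_norm ?invr_gt0 // [_^-1 * _]mulrC ler_pdivrMr.
exact: small_ball1.
Qed.

End SmallBall.

(** * Lattice points, packings and coverings *)

Section LatticeCount.
Context {R : realType}.

(** Each term is at most a multiple of a telescoping difference: [phi] decreases over the integers
    right of [y] and [psi] increases over those left of it. The floor [-1] in [psi] gives the last
    integer left of [y] a full step. *)
Lemma expsum_le (a y : R) (m : nat) : 0 < a -> a <= 1 ->
  \sum_(j < m) expR (- (a * `|y - j%:R|)) <= 6 / a.
Proof.
move=> a0 a1.
pose phi (j : nat) := expR (- (a * Order.max (j%:R - y) 0)).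
pose psi (j : nat) := expR (- (a * Order.max (y - j%:R) (-1))).
have ea : 1 + a <= expR a by exact: expR_ge1Dx.
have ena : expR (- a) * (1 + a) <= 1.
  by rewrite -[leRHS](expRxMexpNx_1 a) [leRHS]mulrC ler_pM2l // expR_gt0.
have term j : expR (- (a * `|y - j%:R|)) <=
    (1 + a^-1) * (phi j - phi j.+1) + a^-1 * (psi j.+1 - psi j).
  have p1 : phi j.+1 <= phi j.
    rewrite /phi ler_expR lerN2 ler_pM2l // ge_max !le_max lexx orbT andbT.
    by rewrite -natr1; apply/orP; left; lra.
  have p2 : psi j <= psi j.+1.
    rewrite /psi ler_expR lerN2 ler_pM2l // ge_max le_max le_max lexx orbT andbT.
    by rewrite -natr1; apply/orP; left; lra.
  have ai : 0 < a^-1 by rewrite invr_gt0.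
  have [h|h] := leP y j%:R.
    apply: le_trans (_ : (1 + a^-1) * (phi j - phi j.+1) <= _); last first.
      by rewrite lerDl mulr_ge0 ?subr_ge0 // ltW.
    have -> : `|y - j%:R| = j%:R - y by rewrite distrC ger0_norm // subr_ge0.
    have -> : phi j = expR (- (a * (j%:R - y))) by rewrite /phi max_l // subr_ge0.
    have -> : phi j.+1 = expR (- (a * (j%:R - y))) * expR (- a).
      by rewrite /phi -expRD -natr1 max_l; [congr expR; ring|lra].
    set E := expR _; have E0 : 0 < E by exact: expR_gt0.
    have -> : (1 + a^-1) * (E - E * expR (- a)) = E * ((1 + a - expR (- a) * (1 + a)) / a) by field; rewrite gt_eqF.
    rewrite -[leLHS]mulr1; apply: ler_wpM2l; [exact: ltW|rewrite ler_pdivlMr //; lra].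
  apply: le_trans (_ : a^-1 * (psi j.+1 - psi j) <= _); last first.
    by rewrite lerDr mulr_ge0 ?subr_ge0 // addr_ge0 // ltW.
  have -> : `|y - j%:R| = y - j%:R by rewrite ger0_norm // subr_ge0 ltW.
  have -> : psi j = expR (- (a * (y - j%:R))) by rewrite /psi max_l //; lra.
  have -> : psi j.+1 = expR (- (a * (y - j%:R))) * expR a.
    by rewrite /psi -expRD -natr1 max_l; [congr expR; ring|lra].
  set E := expR _; have E0 : 0 < E by exact: expR_gt0.
  have -> : a^-1 * (E * expR a - E) = E * ((expR a - 1) / a) by field; rewrite gt_eqF.
  rewrite -[leLHS]mulr1; apply: ler_wpM2l; [exact: ltW|rewrite ler_pdivlMr //; lra].
apply: le_trans (ler_sum _ (fun (j : 'I_m) _ => term j)) _.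
rewrite big_split /= -!mulr_sumr.
have -> : \sum_(j < m) (phi j - phi j.+1) = phi 0%N - phi m.
  by elim: m => [|m ih]; rewrite ?big_ord0 ?subrr // big_ord_recr /= ih; ring.
have -> : \sum_(j < m) (psi j.+1 - psi j) = psi m - psi 0%N.
  by elim: m => [|m ih]; rewrite ?big_ord0 ?subrr // big_ord_recr /= ih; ring.
have h1 : phi 0%N <= 1.
  by rewrite /phi -[leRHS]expR0 ler_expR oppr_le0; apply: mulr_ge0; [exact: ltW|rewrite le_max lexx orbT].
have h2 : psi m <= 4.
  apply: le_trans (expR1_le4 (R := R)); rewrite /psi ler_expR -mulrN.
  have : -1 <= Order.max (y - m%:R) (-1) by rewrite le_max lexx orbT.
  by move: (Order.max _ _) => z hz; nra.
have h3 : 0 < phi m by exact: expR_gt0.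
have h4 : 0 < psi 0%N by exact: expR_gt0.
have ai : 1 <= a^-1 by rewrite invf_ge1.
nra.
Qed.

Lemma expsum_prod_le (d m : nat) (a : R) (y : 'I_d -> R) : 0 < a -> a <= 1 ->
  \sum_(z : {ffun 'I_d -> 'I_m}) expR (- (a * \sum_i `|y i - (z i)%:R|)) <= (6 / a) ^+ d.
Proof.
move=> a0 a1.
have -> : \sum_(z : {ffun 'I_d -> 'I_m}) expR (- (a * \sum_i `|y i - (z i)%:R|)) =
   \prod_(i < d) \sum_(j < m) expR (- (a * `|y i - j%:R|)).
  rewrite bigA_distr_bigA /=; apply: eq_bigr => z _.
  by rewrite mulr_sumr -sumrN expR_sum.
rewrite -[X in _ <= _ ^+ X](card_ord d) -prodr_const; apply: ler_prod => i _.
by rewrite expsum_le // andbT; apply: sumr_ge0 => j _; exact: expR_ge0.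
Qed.

(** Exponential weights at rate [1 / T]: their total is at most [(6 T) ^ d], and each point counted
    has weight at least [exp (- d) >= 4 ^ (- d)]. *)
Lemma lattice_count (d m : nat) (T : R) (y : 'I_d -> R) (A : {set {ffun 'I_d -> 'I_m}}) : 1 <= T ->
  (forall z, z \in A -> \sum_i `|y i - (z i)%:R| <= T * d%:R) -> (#|A|%:R : R) <= (24 * T) ^+ d.
Proof.
move=> T1 h; have T0 : 0 < T by lra.
have h1 := @expsum_prod_le d m T^-1 y ltac:(by rewrite invr_gt0) ltac:(by rewrite invf_le1).
rewrite invrK in h1.
have h2 : #|A|%:R * expR (- d%:R) <= (6 * T) ^+ d.
  apply: le_trans h1; rewrite (bigID (mem A)) /= -[leLHS]addr0; apply: lerD; last first.
    by apply: sumr_ge0 => z _; exact: expR_ge0.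
  rewrite mulr_natl -sumr_const; apply: ler_sum => z zA.
  by rewrite ler_expR lerN2 ler_pdivrMl // h.
have -> : (24 * T) ^+ d = (6 * T) ^+ d * 4 ^+ d by rewrite -exprMn; congr (_ ^+ d); ring.
have e4 : expR d%:R <= (4 : R) ^+ d.
  have -> : expR d%:R = expR 1 ^+ d :> R by have := expRM_natl d (1 : R); rewrite mulr1.
  by apply: lerXn2r; rewrite ?nnegrE ?expR_ge0 // expR1_le4.
have -> : #|A|%:R = (#|A|%:R * expR (- d%:R)) * expR d%:R :> R.
  by rewrite -mulrA [_ * expR d%:R]mulrC expRxMexpNx_1 mulr1.
by apply: ler_pM; rewrite ?mulr_ge0 ?expR_ge0.
Qed.

Lemma sum_abs_le (d : nat) (x : 'rV[R]_d) : \sum_i `|x ord0 i| <= Num.sqrt d%:R * enorm x.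
Proof.
pose s : 'rV[R]_d := \row_i Num.sg (x ord0 i).
have -> : \sum_i `|x ord0 i| = dot s x.
  by apply: eq_bigr => i _; rewrite mxE normrEsg.
apply: le_trans (dot_le s x) _; rewrite ler_wpM2r ?enorm_ge0 // enormE ler_sqrt //.
rewrite /dot -[X in _ <= X%:R](card_ord d) -sumr_const; apply: ler_sum => i _.
by rewrite mxE -expr2 sqr_sg; case: eqP.
Qed.

Lemma enorm_le_sup (d : nat) (x : 'rV[R]_d) (a : R) : 0 <= a -> (forall i, `|x ord0 i| <= a) ->
  enorm x <= Num.sqrt d%:R * a.
Proof.
move=> a0 h; rewrite -[X in _ <= _ * X]ger0_norm // -sqrtr_sqr -sqrtrM ?ler0n // enormE ler_sqrt; last by rewrite mulr_ge0 ?sqr_ge0.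
rewrite /dot -[X in _ <= X%:R * _](card_ord d) mulr_natl -sumr_const; apply: ler_sum => i _.
by rewrite -expr2 -[leLHS]real_normK ?num_real // ler_sqr ?nnegrE.
Qed.

(** Strict separation, so that a maximal such list is a net with closed balls of radius [s]. *)
Definition sep (n : nat) (s : R) (l : seq 'rV[R]_n) :=
  uniq l /\ {in l &, forall p q, p != q -> s < enorm (p - q)}.

(** Coordinates are rounded to a mesh [s / sqrt d]; two points in one cell are within [s], so the
    rounding is injective on a separated list. It turns counts of points into counts of lattice
    points. *)
Lemma cells (d : nat) (s r : R) (c : 'rV[R]_d) (l : seq 'rV[R]_d) : 0 < s ->
  sep s l -> (forall p, p \in l -> enorm (p - c) <= r) ->
  exists m (cell : 'rV[R]_d -> {ffun 'I_d -> 'I_m}), {in l &, injective cell} /\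
    forall p, p \in l -> forall i,
      `|((p - c) ord0 i + r) * (Num.sqrt d%:R / s) - (cell p i)%:R| <= 1.
Proof.
move=> s0 [ul hs] hl; pose q := Num.sqrt d%:R / s.
have q0 : 0 <= q by rewrite divr_ge0 ?sqrtr_ge0 // ltW.
pose m := (Num.truncn (2 * r * q)).+1.
pose cell (p : 'rV[R]_d) : {ffun 'I_d -> 'I_m} :=
  [ffun i => inord (Num.truncn ((p ord0 i - c ord0 i + r) * q))].
have hb p i : p \in l -> `|p ord0 i - c ord0 i| <= r.
  by move=> pl; apply: le_trans (hl _ pl); have := ler_coord (p - c) i; rewrite !mxE.
have cellE p i : p \in l -> (cell p i : nat) = Num.truncn ((p ord0 i - c ord0 i + r) * q).
  move=> pl; rewrite ffunE inordK // ltnS; apply: le_truncn.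
  by apply: ler_wpM2r => //; have := hb p i pl; rewrite ler_norml; lra.
have pos p i : p \in l -> 0 <= (p ord0 i - c ord0 i + r) * q.
  by move=> pl; apply: mulr_ge0 => //; have := hb p i pl; rewrite ler_norml; lra.
have inj : {in l &, injective cell}.
  move=> p p' pl p'l pE; apply/eqP; apply/negPn/negP => ne.
  have := hs _ _ pl p'l ne; apply/negP; rewrite -leNgt.
  (* In dimension 0 the mesh factor [q] vanishes, and all points coincide. *)
  case: d c l ul hs hl @q q0 @m @cell hb cellE pos p p' pl p'l pE ne => [|d] c l ul hs hl q q0 m cell hb cellE pos p p' pl p'l pE ne.
    by rewrite enormE /dot big_ord0 sqrtr0 ltW.
  have sd : 0 < Num.sqrt (d.+1%:R : R) by rewrite sqrtr_gt0 ltr0n.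
  have -> : s = Num.sqrt d.+1%:R * q^-1.
    by rewrite /q invfM invrK mulrA divff ?mul1r // gt_eqF.
  apply: enorm_le_sup => [|i]; first by rewrite invr_ge0.
  have qp : 0 < q by rewrite divr_gt0.
  rewrite -[leLHS]mulr1 -[in leLHS](divff (lt0r_neq0 qp)) mulrA ler_piMl ?invr_ge0 //.
  have e1 := cellE _ i pl; have e2 := cellE _ i p'l.
  rewrite -pE e1 in e2.
  have /truncn_itv/andP[a1 a2] := pos _ i pl; have /truncn_itv/andP[b1 b2] := pos _ i p'l.
  rewrite -e2 in b1 b2; rewrite -natr1 in a2 b2.
  rewrite !mxE -[X in _ * X]ger0_norm // -normrM ler_norml; apply/andP; split; lra.
exists m, cell; split => // p pl i; rewrite (cellE _ _ pl) !mxE.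
have /truncn_itv/andP[] := pos _ i pl; rewrite -natr1 -/q => a1 a2.
move: (Num.truncn _) a1 a2 => k a1 a2; rewrite ler_norml; lra.
Qed.

Lemma pack_size (d : nat) (s r : R) (c : 'rV[R]_d) (l : seq 'rV[R]_d) : 0 < s -> 0 <= r ->
  sep s l -> (forall p, p \in l -> enorm (p - c) <= r) ->
  ((size l)%:R : R) <= (24 * (r / s + 1)) ^+ d.
Proof.
move=> s0 r0 hsep hl; have [m [cell [inj hc]]] := cells s0 hsep hl; pose q := Num.sqrt d%:R / s.
have q0 : 0 <= q by rewrite divr_ge0 ?sqrtr_ge0 // ltW.
pose A := [set z in map cell l]%SET.
have -> : size l = #|A|.
  by rewrite cardsE -(size_map cell); apply/esym/card_uniqP; rewrite map_inj_in_uniq // hsep.1.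
apply: (@lattice_count d m (r / s + 1) (fun i => r * q)).
  by rewrite lerDr divr_ge0 // ltW.
move=> z; rewrite inE => /mapP[p pl ->].
apply: le_trans (_ : \sum_i (`|(p - c) ord0 i| * q + 1) <= _).
  apply: ler_sum => i _; have := hc _ pl i; rewrite -/q.
  have -> : r * q - (cell p i)%:R = (((p - c) ord0 i + r) * q - (cell p i)%:R) - (p - c) ord0 i * q by ring.
  by move=> h; apply: le_trans (ler_normB _ _) _; rewrite normrM (ger0_norm q0) [leLHS]addrC lerD2l.
rewrite big_split /= -mulr_suml sumr_const card_ord mulrDl mul1r lerD2r.
apply: le_trans (_ : Num.sqrt d%:R * r * q <= _).
  apply: ler_wpM2r => //; apply: le_trans (sum_abs_le _) _.
  by rewrite ler_wpM2l ?sqrtr_ge0 // hl.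
rewrite /q; have -> : Num.sqrt d%:R * r * (Num.sqrt d%:R / s) = r / s * (Num.sqrt d%:R ^+ 2) by ring.
by rewrite sqr_sqrtr.
Qed.

(** A maximal separated list in [A] is a net. The induction runs over the number [m] of points that
    can still be added before the size would exceed [M]. *)
Lemma sep_cover (n : nat) (s : R) (A : set 'rV[R]_n) (M : R) : 0 <= s ->
  (forall l, sep s l -> (forall p, p \in l -> A p) -> ((size l)%:R : R) <= M) ->
  exists l, [/\ sep s l, (forall p, p \in l -> A p), ((size l)%:R : R) <= M &
     forall x, A x -> exists2 p, p \in l & enorm (x - p) <= s].
Proof.
move=> s0 h.
suff key m l : sep s l -> (forall p, p \in l -> A p) -> M <= (size l + m)%:R ->
   exists l, [/\ sep s l, (forall p, p \in l -> A p), ((size l)%:R : R) <= M &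
     forall x, A x -> exists2 p, p \in l & enorm (x - p) <= s].
  apply: (key (Num.truncn `|M|).+1 [::]) => //.
  rewrite add0n; apply: le_trans (ler_norm M) _; apply: ltW.
  by have /truncn_itv/andP[] := normr_ge0 M.
elim: m l => [|m ih] l hl lA hM.
all: have [hc|] := pselect (forall x, A x -> exists2 p, p \in l & enorm (x - p) <= s);
  first by exists l; split => //; exact: h.
all: move=> /existsNP[x /not_implyP[Ax hx]].
all: have hx2 p : p \in l -> s < enorm (x - p) by move=> pl; rewrite ltNge; apply/negP => hp; apply: hx; exists p.
all: have hA p : p \in x :: l -> A p by rewrite inE => /orP[/eqP -> //|]; exact: lA.
all: have hsep : sep s (x :: l).
1, 3: have xl : x \notin l by apply/negP => /hx2; rewrite subrr enorm0 ltNge s0.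
1, 2: split => /=; [by rewrite xl hl.1|];
  move=> p q; rewrite !inE => /orP[/eqP ->|pl] /orP[/eqP ->|ql]; rewrite ?eqxx // => ne;
  [exact: hx2|rewrite enormBC; exact: hx2|exact: hl.2].
- by have := h _ hsep hA; move: hM; rewrite addn0 /= -natr1 => h1 h2; exfalso; lra.
- by apply: (ih (x :: l)) => //=; rewrite addSnnS.
Qed.
End LatticeCount.

(** * Most balls of radius C sqrt n are heavy *)

Section Fubini.
Context {R : realType} {d1 d2 : measure_display} {T1 : measurableType d1} {T2 : measurableType d2}.
Variables (P : probability T1 R) (Q : probability T2 R).

Lemma xsec_bmf (E : set (T1 * T2)) : measurable E -> bmf (fun x => pr Q (xsection E x)).
Proof.
move=> mE; apply: (@bmfP _ _ _ _ 1).
  by apply: measurableT_comp => //; exact: measurable_fun_xsection.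
by move=> x; rewrite ger0_norm ?pr_ge0 // pr_le1 //; exact: measurable_xsection.
Qed.
Lemma ysec_bmf (E : set (T1 * T2)) : measurable E -> bmf (fun y => pr P (ysection E y)).
Proof.
move=> mE; apply: (@bmfP _ _ _ _ 1).
  by apply: measurableT_comp => //; exact: measurable_fun_ysection.
by move=> x; rewrite ger0_norm ?pr_ge0 // pr_le1 //; exact: measurable_ysection.
Qed.
Lemma ExE d (T : measurableType d) (P' : probability T R) (f : T -> R) : bmf f ->
  (Ex P' f)%:E = (\int[P']_x (f x)%:E)%E.
Proof.
by move=> hf; rewrite /Ex /Rintegral fineK //; exact: integrable_fin_num (bmf_int P' hf).
Qed.
Lemma Ex_xsec (E : set (T1 * T2)) : measurable E ->
  Ex P (fun x => pr Q (xsection E x)) = pr (P \x Q)%E E.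
Proof.
move=> mE; apply: EFin_inj; rewrite ExE; last exact: xsec_bmf.
rewrite -prE //; transitivity (\int[P]_x Q (xsection E x))%E; last by [].
by apply: eq_integral => x _; rewrite -prE //; exact: measurable_xsection.
Qed.
Lemma Ex_ysec (E : set (T1 * T2)) : measurable E ->
  Ex Q (fun y => pr P (ysection E y)) = pr (P \x Q)%E E.
Proof.
move=> mE; apply: EFin_inj; rewrite ExE; last exact: ysec_bmf.
rewrite -prE //; transitivity ((P \x^ Q)%E E).
  rewrite [RHS]/product_measure2; apply: eq_integral => x _ /=.
  by rewrite -prE //; exact: measurable_ysection.
apply/esym; apply: (@product_measure_unique _ _ _ _ _ P Q (P \x^ Q)%E) => // ? ? ? ?.
exact: product_measure2E.
Qed.

(** By Fubini the mean over [x] of the section masses is at most [h m], so by Markov they cannot all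
    exceed [2 h m / a] on a set of mass [a]. *)
Lemma exists_section_le (E : set (T1 * T2)) (A : set T1) (D : set T2) (h a m : R) :
  measurable E -> measurable A -> measurable D -> (forall x y, E (x, y) -> D y) ->
  (forall y, D y -> pr P (ysection E y) <= h) -> 0 < h -> 0 < a -> a <= pr P A ->
  0 < m -> pr Q D <= m ->
  exists2 x, A x & pr Q (xsection E x) <= 2 * h / a * m.
Proof.
move=> mE mA mD ED hh h0 a0 aA m0 Dm; apply: contrapT => /forall2NP H.
have e1 : Ex P (fun x => pr Q (xsection E x)) <= h * m.
  rewrite Ex_xsec // -Ex_ysec //; apply: le_trans (_ : Ex Q (fun y => h * \1_D y) <= _); last first.
    by rewrite ExZ ?Ex_indic //; [rewrite ler_pM2l|exact: bmf_indic].
  apply: Ex_le => [||y]; [exact: ysec_bmf|by apply: bmfZ; exact: bmf_indic|].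
  rewrite indicE; have [yD|yD] := boolP (y \in D).
    by rewrite mulr1; apply: hh; exact: set_mem.
  rewrite mulr0; have -> : ysection E y = set0; last by rewrite pr0.
  rewrite -subset0 => x; rewrite /ysection /= inE => /ED /mem_set; by rewrite (negbTE yD).
have c0 : 0 < 2 * h / a * m by rewrite mulr_gt0 // divr_gt0 // mulr_gt0.
have e2 : 2 * h / a * m * pr P A <= h * m.
  apply: le_trans e1; apply: markov_pr => //; first exact: xsec_bmf.
  by move=> x; exact: pr_ge0.
  by move=> x Ax; case: (H x) => // /negP; rewrite -ltNge => /ltW.
have e3 : 2 * h / a * m * a <= 2 * h / a * m * pr P A by rewrite ler_pM2l.
have e4 : 2 * h / a * m * a = 2 * (h * m) by field; rewrite gt_eqF.
have := mulr_gt0 h0 m0; lra.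
Qed.
End Fubini.

Section Meas.
Context {R : realType} {n : nat} {d : measure_display} {T : measurableType d}.
Notation V := (borel_rV R n).
Lemma dot_meas (f g : T -> V) : measurable_fun setT f -> measurable_fun setT g ->
  measurable_fun setT (fun t => dot (f t : 'rV[R]_n) (g t)).
Proof.
move=> mf mg; apply: measurable_sum => i; apply: measurable_funM.
- exact: (measurableT_comp (coord_borel i) mf).
- exact: (measurableT_comp (coord_borel i) mg).
Qed.
Lemma enormB_meas (f g : T -> V) : measurable_fun setT f -> measurable_fun setT g ->
  measurable_fun setT (fun t => enorm ((f t : 'rV[R]_n) - g t)).
Proof.
move=> mf mg.
have -> : (fun t => enorm ((f t : 'rV[R]_n) - g t)) = (fun t => Num.sqrt
   (dot (f t : 'rV[R]_n) (f t) - 2 * dot (f t : 'rV[R]_n) (g t) + dot (g t : 'rV[R]_n) (g t))).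
  apply/funext => t; rewrite enormE; congr Num.sqrt.
  by rewrite dotBl !dotBr (dotC (g t) (f t)); ring.
apply: measurableT_comp; first by apply: continuous_measurable_fun; exact: sqrt_continuous.
apply: measurable_funD; last exact: dot_meas.
by apply: measurable_funB; [|apply: measurable_funM => //]; exact: dot_meas.
Qed.
End Meas.

Section Cells.
Context {R : realType} {n : nat} (mu : probability (borel_rV R n) R).
Notation V := (borel_rV R n).
Hypothesis (iso : isotropic mu) (lc : log_concave mu).

Lemma sumdot_continuous k (u : 'I_k -> 'rV[R]_n) (t : 'I_k -> R) :
  continuous (fun x : 'rV[R]_n => \sum_i `|dot x (u i) - t i|).
Proof. by apply: continuous_sumr => i; exact: dotabs_continuous. Qed.

(** If [B'] is the part of [B] in a cell, then [mu(B')^2 <= b mu(cell)], and midpoints of the cell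
    with the tame set of mass at least [tau] give [mu(cell) tau <= mu(E z)^2]. The sets [E z]
    overlap at most [(36 M) ^ k] times by [lattice_count], so the sum over the cells is bounded
    independently of their number. *)
Lemma cell_bound k (u : 'I_k -> 'rV[R]_n) (t0 : 'I_k -> R) (B : set V) (b tau M : R) : 0 <= b -> 0 < tau -> 1 <= M ->
  tau <= pr mu [set x : V | \sum_i `|dot (x : 'rV[R]_n) (u i) - t0 i| <= M * k%:R] ->
  measurable B ->
  (forall t : 'I_k -> R, pr mu (B `&` [set x : V | forall i, `|dot (x : 'rV[R]_n) (u i) - t i| <= 2^-1]) <= b) ->
  pr mu B <= Num.sqrt (b / tau) * (36 * M) ^+ k.
Proof.
move=> b0 tau0 M1 hA mB hb.
pose A0 := [set x : V | \sum_i `|dot (x : 'rV[R]_n) (u i) - t0 i| <= M * k%:R].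
have cA : closed (A0 : set 'rV[R]_n).
  by apply: closed_le; exact: sumdot_continuous.
apply: (@pr_ball_lim R n mu iso _ _ 1) => // L _ L0.
pose S := \sum_i enorm (u i); have S0 : 0 <= S by apply: sumr_ge0 => i _; exact: enorm_ge0.
pose r := L * S; have r0 : 0 <= r by rewrite mulr_ge0 // ltW.
pose m := (Num.truncn (2 * r)).+1.
pose t (z : {ffun 'I_k -> 'I_m}) i : R := (z i)%:R + 2^-1 - r.
pose cell (z : {ffun 'I_k -> 'I_m}) := [set x : V | forall i, `|dot (x : 'rV[R]_n) (u i) - t z i| <= 2^-1].
(* Holds all midpoints of [cell z] and of the tame set. In the coordinates [2 <x, u i>] it is an
   [l1]-neighbourhood of a translate of the lattice point [z], which permits the overlap count. *)
pose E (z : {ffun 'I_k -> 'I_m}) := [set x : V | \sum_i `|(2 * dot (x : 'rV[R]_n) (u i) + r - 2^-1 - t0 i) - (z i)%:R| <= (M + 2^-1) * k%:R].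
have ccell z : closed (cell z : set 'rV[R]_n).
  have -> : cell z = \bigcap_(i in setT) [set x : 'rV[R]_n | `|dot x (u i) - t z i| <= 2^-1].
    by apply/seteqP; split => x /= h i => [_|]; exact: h.
  by apply: closed_bigI => i _; exact: dle_closed.
have mE z : measurable (E z).
  apply: closed_borel.
  have -> : E z = [set x : 'rV[R]_n | \sum_i `|dot x (2 *: u i) - ((z i)%:R + 2^-1 - r + t0 i)| <= (M + 2^-1) * k%:R].
    apply/seteqP; split => x /=; apply: le_trans; rewrite le_eqVlt; apply/orP; left; apply/eqP;
      apply: eq_bigr => i _; rewrite dotZr; congr `|_|; ring.
  by apply: closed_le; exact: sumdot_continuous.
have mc z : measurable (B `&` cell z).
  by apply: measurableI => //; apply: closed_borel; exact: ccell.
have sub : B `&` [set x : 'rV[R]_n | enorm x <= L] `<=` \big[setU/set0]_(z <- index_enum {ffun 'I_k -> 'I_m}) (B `&` cell z).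
  move=> x [Bx /= xL]; rewrite -bigcup_seq.
  have yb i : `|dot x (u i)| <= r.
    apply: le_trans (ler_dot _ _) _; apply: ler_pM => //; try exact: enorm_ge0.
    by rewrite /S (bigD1 i) //= lerDl; apply: sumr_ge0 => j _; exact: enorm_ge0.
  exists [ffun i => inord (Num.truncn (dot x (u i) + r))]; first by rewrite /= mem_index_enum.
  split=> // i; rewrite /t ffunE inordK; last first.
    by rewrite ltnS; apply: le_truncn; have := yb i; rewrite ler_norml; lra.
  have : 0 <= dot x (u i) + r by have := yb i; rewrite ler_norml; lra.
  move=> /truncn_itv/andP[]; rewrite -natr1; move: (Num.truncn _) => w h1 h2.
  rewrite ler_norml; lra.
have mBL : measurable (B `&` [set x : V | enorm (x : 'rV[R]_n) <= L]).
  by apply: measurableI => //; exact: ball0_borel.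
apply: le_trans (pr_mono mu mBL _ sub) _.
  by apply: measurable_bigsetU => z _; exact: mc.
apply: le_trans (pr_bigU_le mu (fun z _ => mc z)) _.
have cb z : pr mu (B `&` cell z) <= Num.sqrt (b / tau) * pr mu (E z).
  have p0 := pr_ge0 mu (B `&` cell z); have e0 := pr_ge0 mu (E z).
  rewrite -(ger0_norm p0) -sqrtr_sqr -(ger0_norm e0) -sqrtr_sqr -sqrtrM; last by rewrite divr_ge0 // ltW.
  rewrite ler_wsqrtr // expr2.
  have h1 : pr mu (B `&` cell z) <= b by exact: hb.
  have h2 : pr mu (B `&` cell z) <= pr mu (cell z).
    by apply: pr_mono => [//||x []//]; apply: closed_borel; exact: ccell.
  have h3 : pr mu (cell z) * pr mu A0 <= pr mu (E z) ^+ 2.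
    apply: (lc_half_cl iso lc) => // x y cx Ay /=.
    apply: le_trans (_ : \sum_i (2^-1 + `|dot y (u i) - t0 i|) <= _).
      apply: ler_sum => i _; have := cx i; rewrite /t dotZl dotDl => hi.
      apply: le_trans (lerD hi (lexx _)); apply: le_trans (ler_normD _ _).
      by rewrite le_eqVlt; apply/orP; left; apply/eqP; congr `|_|; field.
    rewrite big_split /= sumr_const card_ord [(M + _) * _]mulrDl addrC; apply: lerD => //.
    by rewrite mulr_natr.
  have h4 : pr mu (cell z) * tau <= pr mu (cell z) * pr mu A0.
    by apply: ler_wpM2l => //; exact: pr_ge0.
  have h5 : pr mu (B `&` cell z) * pr mu (B `&` cell z) <= b * pr mu (cell z) by apply: ler_pM.
  apply: le_trans h5 _; rewrite -mulrA; apply: ler_wpM2l => //.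
  by rewrite ler_pdivlMl // mulrC; exact: le_trans h3.
apply: le_trans (ler_sum _ (fun z _ => cb z)) _.
rewrite -mulr_sumr; apply: ler_wpM2l; first exact: sqrtr_ge0.
have := @sum_pr_le _ _ _ mu _ (index_enum {ffun 'I_k -> 'I_m}) (fun=> 1) E ((36 * M) ^+ k) mE.
under eq_bigr do rewrite mul1r; apply => x.
have -> : \sum_(i <- index_enum {ffun 'I_k -> 'I_m}) 1 * \1_(E i) x =
    #|[set z : {ffun 'I_k -> 'I_m} | x \in E z]%SET|%:R :> R.
  rewrite -sum1_card natr_sum [RHS]big_mkcond /=; apply: eq_bigr => z _.
  by rewrite mul1r indicE inE; case: (x \in E z).
apply: le_trans (_ : (24 * (M + 2^-1)) ^+ k <= _); last first.
  by apply: lerXn2r; rewrite ?nnegrE; lra.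
apply: (@lattice_count R k m _ (fun i => 2 * dot (x : 'rV[R]_n) (u i) + r - 2^-1 - t0 i)); first by lra.
by move=> z; rewrite inE => /set_mem.
Qed.

(** [|t| <= (1 + t^2) / 2], and Markov for the sum of squares, whose mean is at most [k]. *)
Lemma sumdot_half k (u : 'I_k -> 'rV[R]_n) : (forall i, dot (u i) (u i) <= 1) ->
  2^-1 <= pr mu [set x : V | \sum_i `|dot (x : 'rV[R]_n) (u i)| <= 2 * k%:R].
Proof.
case: k u => [|k] u hu.
  have -> : [set x : V | \sum_i `|dot (x : 'rV[R]_n) (u i)| <= 2 * 0%:R] = setT.
    by apply/seteqP; split => x //= _; rewrite big_ord0 mulr0.
  by rewrite prT; lra.
pose S (x : V) := \sum_i `|dot (x : 'rV[R]_n) (u i)|.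
pose A := [set x : V | 2 * k.+1%:R < S x].
have mS : measurable_fun setT S.
  by apply: measurable_sum => i; apply: measurableT_comp => //; exact: dot_borel.
have mA : measurable A by apply: (measurable_gt_set (f := S)).
have -> : [set x : V | \sum_i `|dot (x : 'rV[R]_n) (u i)| <= 2 * k.+1%:R] = ~` A.
  by apply/seteqP; split => x /=; rewrite leNgt => /negP.
rewrite prC //.
have k0 : 0 < k.+1%:R :> R by rewrite ltr0n.
suff : 3 * k.+1%:R * pr mu A <= k.+1%:R.
  rewrite -[X in _ <= X]mul1r -[3 * _]mulrC -mulrA [X in _ <= X]mulrC ler_pM2l //; lra.
rewrite -Ex_indic // -ExZ; last exact: bmf_indic.
apply: (@Ex_le_int _ _ _ mu _ (fun x : V => \sum_i dot (x : 'rV[R]_n) (u i) ^+ 2)).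
- by apply: bmfZ; exact: bmf_indic.
- by apply: measurable_sum => i; apply: measurable_funX; exact: dot_borel.
- by move=> x; apply: sumr_ge0 => i _; exact: sqr_ge0.
- move=> x; rewrite indicE; have [/set_mem hx|_] := boolP (x \in A); last first.
    by rewrite mulr0; apply: sumr_ge0 => i _; exact: sqr_ge0.
  have : S x <= \sum_i (2^-1 + 2^-1 * dot (x : 'rV[R]_n) (u i) ^+ 2).
    apply: ler_sum => i _; rewrite -[dot _ _ ^+ 2]real_normK ?num_real //.
    by have := sqr_ge0 (`|dot (x : 'rV[R]_n) (u i)| - 1); rewrite sqrrB; lra.
  rewrite big_split /= sumr_const card_ord -mulr_natr -mulr_sumr mulr1.
  by move: hx; rewrite /A /=; lra.
under eq_integral do rewrite -sumEFin.
rewrite ge0_integral_sum //; last 2 first.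
- by move=> i; apply/measurable_EFinP; apply: measurable_funX; exact: dot_borel.
- by move=> i x _; rewrite lee_fin sqr_ge0.
under eq_bigr do rewrite int_dot2 //.
rewrite sumEFin lee_fin; apply: le_trans (ler_sum _ (fun i _ => hu i)) _.
by rewrite sumr_const card_ord.
Qed.
End Cells.

Section Cover.
Context {R : realType}.

(** [72 = 36 * 2] is the overlap base of [cell_bound] for [M = 2]. [cv_th ^ k] stays below
    [b ^ 2 / 4] for the [b] of [cover_bound], and [cv_s] makes the small-ball gain of one row equal
    to [cv_th]. *)
Definition cv_th : R := (4 * (expR 1 * 72) ^+ 2) ^- 2 / 4.
Definition cv_s : R := 2 * (8 * sb_C / (3 * cv_th)) ^+ 2.
Lemma cv_th_gt0 : 0 < cv_th.
Proof. by rewrite /cv_th divr_gt0 // invr_gt0 exprn_gt0 // mulr_gt0 // exprn_gt0 // mulr_gt0 // expR_gt0. Qed.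
Lemma cv_th_lt1 : cv_th < 1.
Proof.
have e1 : 1 <= expR 1 :> R by rewrite -[leLHS]expR0 ler_expR.
have h : 1 <= 4 * (expR 1 * 72) ^+ 2 :> R by nra.
rewrite /cv_th; have : (4 * (expR 1 * 72) ^+ 2 : R) ^- 2 <= 1.
  by rewrite invf_le1 ?exprn_gt0 // ?exprn_ege1 //; lra.
lra.
Qed.
Lemma cv_s_gt0 : 0 < cv_s.
Proof.
have t0 := cv_th_gt0; have c0 := @sb_C_gt0 R.
by rewrite mulr_gt0 // exprn_gt0 // divr_gt0 // mulr_gt0.
Qed.

Context {n : nat} (mu : probability (borel_rV R n) R).
Notation V := (borel_rV R n).
Hypothesis (iso : isotropic mu) (lc : log_concave mu) (n0 : (0 < n)%N).
Let sn := Num.sqrt (n%:R : R).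
Let sn0 : 0 < sn. Proof. by rewrite sqrtr_gt0 ltr0n. Qed.

Definition nball (x : 'rV[R]_n) (r : R) : set V := [set y : V | enorm ((y : 'rV[R]_n) - x) <= r].
Lemma nball_closed x r : closed (nball x r : set 'rV[R]_n).
Proof. by apply: closed_le; exact: enorm_continuous. Qed.
Lemma nball_borel x r : measurable (nball x r).
Proof. by apply: closed_borel; exact: nball_closed. Qed.

Lemma pr_nball_meas r : measurable_fun setT (fun x : V => pr mu (nball x r)).
Proof.
pose E := [set p : V * V | enorm ((p.2 : 'rV[R]_n) - p.1) <= r].
have mE : measurable E.
  by apply: (measurable_le_set (f := fun p : V * V => enorm ((p.2 : 'rV[R]_n) - p.1))); exact: enormB_meas.
have -> : (fun x : V => pr mu (nball x r)) = (fun x => pr mu (xsection E x)); last exact: (xsec_bmf _ mE).1.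
by apply/funext => x; congr pr; apply/seteqP; split => y; rewrite /xsection /= inE.
Qed.

Definition row_set k (g : 'I_k -> 'rV[R]_n) := [set p : V * V | cv_s * sn <= enorm ((p.1 : 'rV[R]_n) - p.2) /\
     forall i, `|dot (g i) ((p.1 : 'rV[R]_n) - p.2)| <= 2 * sn].
Lemma row_set_meas j (g : 'I_j -> 'rV[R]_n) : measurable (row_set g).
Proof.
have mdot (v : 'rV[R]_n) : measurable_fun setT (fun p : V * V => dot v ((p.1 : 'rV[R]_n) - p.2)).
  have -> : (fun p : V * V => dot v ((p.1 : 'rV[R]_n) - p.2)) =
     (fun p : V * V => dot (p.1 : 'rV[R]_n) v - dot (p.2 : 'rV[R]_n) v).
    by apply/funext => p; rewrite dotBr dotC (dotC v).
  by apply: measurable_funB; [exact: (measurableT_comp (dot_borel v) measurable_fst)|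
    exact: (measurableT_comp (dot_borel v) measurable_snd)].
have -> : row_set g = [set p : V * V | cv_s * sn <= enorm ((p.1 : 'rV[R]_n) - p.2)] `&`
   \bigcap_(i in setT) [set p : V * V | `|dot (g i) ((p.1 : 'rV[R]_n) - p.2)| <= 2 * sn].
  by apply/seteqP; split => p /= [h1 h2]; split => // i *; exact: h2.
apply: measurableI.
  by apply: (measurable_ge_set (f := fun p : V * V => enorm ((p.1 : 'rV[R]_n) - p.2))); exact: enormB_meas.
apply: fin_bigcap_measurable => // i _.
apply: (measurable_le_set (f := fun p : V * V => `|dot (g i) ((p.1 : 'rV[R]_n) - p.2)|)).
by apply: measurableT_comp => //; exact: mdot.
Qed.

(** Rows are chosen one at a time. For a pair at distance at least [cv_s * sn] and [g] distributed
    as [mu], the event [|<g, x - y>| <= 2 sn] is a small ball; averaging over [g] in a ball of mass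
    at least [3/4] finds one row that multiplies the bound on the mass of surviving pairs by
    [cv_th]. *)
Lemma cover_rows k : exists2 g : 'I_k -> 'rV[R]_n, forall i, enorm (g i) <= 2 * sn &
  pr (mu \x mu)%E (row_set g) <= cv_th ^+ k.
Proof.
have th0 := cv_th_gt0; have s0 := cv_s_gt0.
elim: k => [|k [g hg hm]].
  exists (fun=> 0) => [i|]; first by rewrite enorm0 mulr_ge0 // ltW.
  by rewrite expr0; apply: pr_le1; exact: row_set_meas.
pose E := [set q : V * (V * V) | row_set g q.2 /\ `|dot (q.1 : 'rV[R]_n) ((q.2.1 : 'rV[R]_n) - q.2.2)| <= 2 * sn].
have mE : measurable E.
  have -> : E = (snd @^-1` (row_set g)) `&` [set q : V * (V * V) | `|dot (q.1 : 'rV[R]_n) ((q.2.1 : 'rV[R]_n) - q.2.2)| <= 2 * sn] by [].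
  apply: measurableI; first by rewrite -[X in measurable X]setTI; apply: measurable_snd => //; exact: row_set_meas.
  apply: (measurable_le_set (f := fun q : V * (V * V) => `|dot (q.1 : 'rV[R]_n) ((q.2.1 : 'rV[R]_n) - q.2.2)|)).
  apply: measurableT_comp => //.
  have -> : (fun q : V * (V * V) => dot (q.1 : 'rV[R]_n) ((q.2.1 : 'rV[R]_n) - q.2.2)) =
     (fun q : V * (V * V) => dot (q.1 : 'rV[R]_n) (q.2.1 : 'rV[R]_n) - dot (q.1 : 'rV[R]_n) (q.2.2 : 'rV[R]_n)).
    by apply/funext => q; rewrite dotBr.
  apply: measurable_funB; apply: dot_meas => //.
    exact: (measurableT_comp measurable_fst measurable_snd).
  exact: (measurableT_comp measurable_snd measurable_snd).
pose h := sb_C * Num.sqrt (2 / cv_s).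
have h0 : 0 < h by rewrite mulr_gt0 ?sb_C_gt0 // sqrtr_gt0 divr_gt0.
have hE : 2 * h / (3 / 4) = cv_th.
  rewrite /h.
  have -> : 2 / cv_s = (3 * cv_th / (8 * sb_C)) ^+ 2 :> R.
    by rewrite /cv_s; field; rewrite !gt_eqF ?sb_C_gt0.
  have c0 := @sb_C_gt0 R.
  rewrite sqrtr_sqr gtr0_norm; last by apply: divr_gt0; apply: mulr_gt0.
  by field; rewrite gt_eqF // sb_C_gt0.
have [|||||||x Ax hx] := @exists_section_le R _ _ _ _ mu (mu \x mu)%E E [set x : V | enorm (x : 'rV[R]_n) <= 2 * sn] (row_set g) h (3 / 4) (cv_th ^+ k) mE (ball0_borel _) (row_set_meas _).
- by move=> x y [].
- move=> y [hy _]; set w : 'rV[R]_n := y.1 - y.2.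
  have w0 : w != 0 by rewrite -enorm_gt0; apply: lt_le_trans hy; rewrite mulr_gt0.
  apply: le_trans (small_ball iso lc (e := 2 / cv_s) _ w0); last by rewrite divr_gt0.
  apply: pr_mono.
  + exact: measurable_ysection.
  + by apply: (measurable_le_set (f := fun x : V => `|dot (x : 'rV[R]_n) w|)); apply: measurableT_comp => //; exact: dot_borel.
  + move=> x; rewrite /ysection /= inE => -[_ /= /le_trans]; apply.
    rewrite -mulrA ler_pM2l // ler_pdivlMl //.
- exact: h0.
- by [].
- have -> : [set x : V | enorm (x : 'rV[R]_n) <= 2 * sn] = ~` [set x : V | 2 * sn < enorm (x : 'rV[R]_n)].
    by apply/seteqP; split => x /=; rewrite leNgt => /negP.
  rewrite prC; last by apply: (measurable_gt_set (f := fun x : V => enorm (x : 'rV[R]_n))); exact: enorm_borel.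
  have := @cheb_norm _ _ _ iso (2 * sn) ltac:(by rewrite mulr_gt0).
  have -> : n%:R / (2 * sn) ^+ 2 = 4^-1 :> R; last by lra.
  by rewrite exprMn sqr_sqrtr //; field; rewrite gt_eqF // ltr0n.
- by rewrite exprn_gt0.
- exact: hm.
rewrite hE in hx.
exists (fun i : 'I_k.+1 => oapp g x (unlift ord_max i)) => [i|].
  by case: (unlift ord_max i) => [j|] /=; [exact: hg|exact: Ax].
rewrite exprS; apply: le_trans hx; apply: pr_mono.
- exact: row_set_meas.
- exact: measurable_xsection.
- move=> p [p1 p2]; rewrite /xsection /= inE; split => /=.
    by split => // i; have := p2 (lift ord_max i); rewrite liftK.
  by have := p2 ord_max; rewrite unlift_none.
Qed.

(** Two light points in one cell of the [k] marginals are either far apart, hence a pair in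
    [row_set], or close, and then the second lies in the light ball about the first. Either event
    has mass at most [cv_th ^ k], so light points have mass at most [b] in each cell and
    [cell_bound] applies. *)
Lemma cover_bound k : (0 < k)%N ->
  pr mu [set x : V | pr mu (nball x (cv_s * sn)) < cv_th ^+ k] <= expR (- k%:R).
Proof.
move=> k0; set B := [set x : V | _].
have mB : measurable B by apply: measurable_lt_set; exact: pr_nball_meas.
have [g hg hm] := cover_rows k.
pose u i := (2 * sn)^-1 *: g i.
have s2 : 0 < 2 * sn by rewrite mulr_gt0.
have hu i : dot (u i) (u i) <= 1.
  have i2 : 0 < (2 * sn)^-1 by rewrite invr_gt0.
  rewrite -enorm2 /u enormZ gtr0_norm //; apply: exprn_ile1.
    by apply: mulr_ge0; [exact: ltW|exact: enorm_ge0].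
  by rewrite mulrC ler_pdivrMr // mul1r.
(* Chosen so that [sqrt (2 b) 72 ^ k] equals [sqrt 2] times [2 ^ (- k) exp (- k)], which is at most
   [exp (- k)] for [k > 0]. *)
pose b : R := (4 * (expR 1 * 72) ^+ 2) ^- 1 ^+ k.
have b0 : 0 < b by rewrite exprn_gt0 // invr_gt0 mulr_gt0 // exprn_gt0 // mulr_gt0 // expR_gt0.
apply: le_trans (cell_bound iso lc (u := u) (t0 := fun=> 0) (tau := 2^-1) (ltW b0) _ (M := 2) _ _ mB _) _; [by lra|by lra| | |].
  have -> : [set x : V | \sum_i `|dot (x : 'rV[R]_n) (u i) - 0| <= 2 * k%:R] = [set x : V | \sum_i `|dot (x : 'rV[R]_n) (u i)| <= 2 * k%:R].
    by apply/funext => x /=; congr (is_true (_ <= _)); apply: eq_bigr => i _; rewrite subr0.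
  exact: sumdot_half.
  move=> t; set B' := _ `&` _.
  have mB' : measurable B'.
    apply: measurableI => //; apply: closed_borel.
    have -> : [set x : V | forall i, `|dot (x : 'rV[R]_n) (u i) - t i| <= 2^-1] =
       \bigcap_(i in setT) [set x : 'rV[R]_n | `|dot x (u i) - t i| <= 2^-1].
      by apply/seteqP; split => x /= h i => [_|]; exact: h.
    by apply: closed_bigI => i _; exact: dle_closed.
  pose D := row_set g.
  pose C := [set p : V * V | B' p.1 /\ enorm ((p.2 : 'rV[R]_n) - p.1) <= cv_s * sn].
  have mC : measurable C.
    apply: (@measurableI _ _ (fst @^-1` B')).
      by rewrite -[X in measurable X]setTI; exact: measurable_fst.
    by apply: (measurable_le_set (f := fun p : V * V => enorm ((p.2 : 'rV[R]_n) - p.1))); exact: enormB_meas.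
  have mD : measurable D by exact: row_set_meas.
  have hC : pr (mu \x mu)%E C <= cv_th ^+ k.
    rewrite -Ex_xsec // -[leRHS](Ex_cst mu); apply: Ex_le; [exact: xsec_bmf|exact: bmf_cst|].
    move=> x; have [xB|xB] := pselect (B' x).
      apply: le_trans (_ : pr mu (nball x (cv_s * sn)) <= _); last exact: ltW xB.1.
      apply: pr_mono; [exact: measurable_xsection|exact: nball_borel|].
      by move=> y; rewrite /xsection /= inE => -[].
    have -> : xsection C x = set0; last by rewrite pr0 exprn_ge0 // ltW // cv_th_gt0.
    by rewrite -subset0 => y; rewrite /xsection /= inE => -[].
  have hBB : pr mu B' * pr mu B' <= cv_th ^+ k + cv_th ^+ k.
    have -> : pr mu B' * pr mu B' = pr (mu \x mu)%E (B' `*` B').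
      apply: EFin_inj; rewrite EFinM -!prE //; last exact: measurableX.
      exact/esym/product_measure1E.
    apply: le_trans (_ : pr (mu \x mu)%E (D `|` C) <= _).
      apply: pr_mono; [exact: measurableX|exact: measurableU|].
      move=> [x y] [/= xB yB]; have [h|h] := leP (enorm ((y : 'rV[R]_n) - x)) (cv_s * sn).
        by right.
      left; split => [|i] /=; first by rewrite enormBC ltW.
      have := xB.2 i; have := yB.2 i; rewrite /u !dotZr (dotC x) (dotC y) => h1 h2.
      have h3 : `|(2 * sn)^-1 * dot (g i) (x - y)| <= 1.
        rewrite dotBr mulrBr; move: h1 h2; rewrite !ler_norml; lra.
      by move: h3; rewrite normrM ger0_norm ?invr_ge0 ?(ltW s2) // ler_pdivrMl // mulr1.
    by apply: le_trans (prU_le _ _ _) _ => //; apply: lerD.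
  have hth : cv_th ^+ k <= b ^+ 2 / 4.
    rewrite /cv_th /b exprMn -exprVn -!exprM mulnC ler_pM2l; last first.
      by rewrite exprn_gt0 // invr_gt0 mulr_gt0 // exprn_gt0 // mulr_gt0 // expR_gt0.
    by case: k k0 {g hg hm u hu b b0 t B B' mB mB' D C mC mD hC hBB} => // k _; rewrite exprS ler_piMr // exprn_ile1 //; lra.
  have := pr_ge0 mu B'; move: (pr mu B') hBB => p hp p0.
  rewrite leNgt; apply/negP => bp.
  have : b * b < p * p by apply: ltr_pM => //; exact: ltW.
  have := mulr_gt0 b0 b0; move: hth hp; rewrite expr2; lra.
have -> : 36 * 2 = 72 :> R by ring.
rewrite invrK [b * 2]mulrC.
have e0 := expR_gt0 (1 : R).
have -> : expR (- k%:R) = (expR 1)^-1 ^+ k :> R.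
  by rewrite expRN exprVn; have := expRM_natl k (1 : R); rewrite mulr1 => ->.
rewrite -[X in Num.sqrt _ * X]ger0_norm ?exprn_ge0 //.
have q0 : 0 <= (expR 1)^-1 ^+ k :> R by rewrite exprn_ge0 // invr_ge0 ltW.
rewrite -[leRHS]ger0_norm // -!sqrtr_sqr -sqrtrM; last by rewrite mulr_ge0 // ltW.
rewrite ler_wsqrtr // /b -!exprM ![(k * 2)%N]mulnC !exprM -mulrA -exprMn.
have -> : (4 * (expR 1 * 72) ^+ 2)^-1 * 72 ^+ 2 = (expR 1)^-1 ^+ 2 / 4 :> R.
  by field; rewrite gt_eqF.
rewrite exprMn mulrCA -[leRHS]mulr1; apply: ler_wpM2l; first by rewrite exprn_ge0 // sqr_ge0.
by case: k k0 {g hg hm u hu b b0 B mB q0} => // k _; rewrite exprS mulrA; have : (4^-1 : R) ^+ k <= 1; [rewrite exprn_ile1 //; lra|have : 0 <= (4^-1 : R) ^+ k; [rewrite exprn_ge0 //|lra]].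
Qed.
End Cover.

(** * Sums of typical points *)

(** Stated for any set closed under two-point combinations because it serves both [Wset] and the
    convex sets that define the hull. *)
Lemma conv_mean {R : realType} {n : nat} (K : set 'rV[R]_n) (I : Type) (r : seq I) (c : I -> R) (w : I -> 'rV[R]_n) (t : R) :
  (forall x y l, 0 < l < 1 -> K x -> K y -> K (l *: x + (1 - l) *: y)) ->
  (forall i, 0 <= c i) -> 0 < t -> \sum_(i <- r) c i = t ->
  (forall i, K (w i)) -> K (t^-1 *: \sum_(i <- r) c i *: w i).
Proof.
move=> hK c0 + + hw; elim: r t => [|i r ih] t t0; first by rewrite big_nil => h; move: t0; rewrite -h ltxx.
rewrite !big_cons => ht; set S := \sum_(j <- r) c j in ht.
have S0 : 0 <= S by apply: sumr_ge0 => k _.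
have [Sz|Sn] := eqVneq S 0.
  have -> : \sum_(j <- r) c j *: w j = 0.
    have : \sum_(j <- r) c j = 0 by [].
    elim: (r) => [|k r' ih'] Sz'; first by rewrite big_nil.
    move: Sz'; rewrite !big_cons => Sz'.
    have r0 : 0 <= \sum_(j <- r') c j by apply: sumr_ge0 => l _.
    have := c0 k => ck; have -> : c k = 0 by lra.
    by rewrite scale0r add0r ih' //; lra.
  rewrite addr0 scalerA; move: ht; rewrite Sz addr0 => ->.
  by rewrite mulVf ?scale1r // gt_eqF.
have Sp : 0 < S by rewrite lt_def Sn.
have [cz|cn] := eqVneq (c i) 0.
  by move: ht; rewrite cz add0r scale0r add0r => ht; apply: ih.
have cp : 0 < c i by rewrite lt_def cn c0.
have -> : t^-1 *: (c i *: w i + \sum_(j <- r) c j *: w j) =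
   (c i / t) *: w i + (1 - c i / t) *: (S^-1 *: \sum_(j <- r) c j *: w j).
  rewrite scalerDr !scalerA [t^-1 * _]mulrC; congr (_ + _ *: _).
  by rewrite -ht; field; rewrite -ht in t0; rewrite !gt_eqF.
apply: hK; [|exact: hw|exact: ih].
by rewrite divr_gt0 //= ltr_pdivrMr // mul1r -ht ltrDl.
Qed.

Section SumTrick.
Context {R : realType} {n : nat} (mu : probability (borel_rV R n) R).
Notation V := (borel_rV R n).
Hypothesis lc : log_concave mu.
Variable rho : R.
Hypothesis rho0 : 0 < rho.

(* [w] is within [rho b] of sums of [j] points ranging over compact sets, the costs (minus log-masses)
   of these sets and [b] adding up to at most [a]. *)
Fixpoint Wset (j : nat) (a : R) (w : 'rV[R]_n) : Prop :=
  if j is j'.+1 then exists b c (C : set 'rV[R]_n),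
    [/\ b + c <= a, compact C, expR (- c) <= pr mu C & forall x, C x -> Wset j' b (w - x)]
  else enorm w <= rho * a.

(** Induction on [j]: replace [exp (- c i)] by the mass of [C i] and integrate. For a fixed [x] the
    vectors [w i - x] with [x] in [C i] have one summand less. The hypothesis is uniform in [y]
    because every summand translates all the vectors. *)
Lemma Wpack j (I : choiceType) (r : seq I) (Q : pred I) (a : I -> R) (w : I -> 'rV[R]_n) (K : R) :
  (forall i, Q i -> Wset j (a i) (w i)) ->
  (forall y, \sum_(i <- r | Q i) expR (- (enorm (w i - y) / rho)) <= K) ->
  \sum_(i <- r | Q i) expR (- a i) <= K.
Proof.
elim: j Q a w => [|j ih] Q a w hw hK.
  apply: le_trans (hK 0); apply: ler_sum => i Qi.
  by rewrite subr0 ler_expR lerN2 ler_pdivrMr // mulrC; exact: hw.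
have hch i : exists p : R * R * set 'rV[R]_n, Q i ->
    [/\ p.1.1 + p.1.2 <= a i, compact p.2, expR (- p.1.2) <= pr mu p.2 & forall x, p.2 x -> Wset j p.1.1 (w i - x)].
  have [Qi|] := boolP (Q i); last by exists (0, 0, set0).
  by have [b [c [C [? ? ? ?]]]] := hw i Qi; exists (b, c, C).
have /choice[f hf] := hch.
pose F i : set V := if Q i then (f i).2 else set0.
have mF i : measurable (F i).
  by rewrite /F; case: ifP => // Qi; have [_ cC _ _] := hf i Qi; exact: compact_borel.
have := @sum_pr_le _ _ _ mu _ r (fun i => expR (- (f i).1.1)) F K mF.
move=> h; apply: le_trans (h _).
  rewrite big_mkcond; apply: ler_sum => i _.
  rewrite /F; case: ifP => Qi; last by rewrite pr0 mulr0.
  have [hab _ hp _] := hf i Qi.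
  apply: le_trans (_ : expR (- (f i).1.1) * expR (- (f i).1.2) <= _); last first.
    by rewrite ler_pM2l ?expR_gt0.
  by rewrite -expRD ler_expR; lra.
move=> x.
have -> : \sum_(i <- r) expR (- (f i).1.1) * \1_(F i) x =
    \sum_(i <- r | Q i && (x \in F i)) expR (- (f i).1.1).
  rewrite [RHS]big_mkcond; apply: eq_bigr => i _; rewrite indicE /F.
  case: (Q i) => /=; last by rewrite in_set0 mulr0.
  by case: (x \in _); rewrite ?mulr1 ?mulr0.
apply: (ih (fun i => Q i && (x \in F i)) (fun i => (f i).1.1) (fun i => w i - x)).
  move=> i /andP[Qi]; rewrite /F Qi => /set_mem xF.
  by have [_ _ _] := hf i Qi; apply.
move=> y; apply: le_trans (hK (x + y)).
rewrite [leRHS](bigID (fun i => x \in F i)) /= -[leLHS]addr0; apply: lerD.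
  by apply: ler_sum => i _; rewrite opprD addrA.
by apply: sumr_ge0 => i _; exact: expR_ge0.
Qed.

Lemma Wmono j (a a' : R) (w : 'rV[R]_n) : a <= a' -> Wset j a w -> Wset j a' w.
Proof.
case: j => [|j] /= aa'; first by move=> /le_trans; apply; rewrite ler_pM2l.
by move=> [b [c [C [h ? ? ?]]]]; exists b, c, C; split => //; exact: le_trans aa'.
Qed.

(** Cheapness survives convex combinations because the compact sets can be averaged by
    log-concavity; this is why [Wset] records sets with costs and not points. *)
Lemma Wconv2 j (l a1 a2 : R) (w1 w2 : 'rV[R]_n) : 0 < l < 1 ->
  Wset j a1 w1 -> Wset j a2 w2 -> Wset j (l * a1 + (1 - l) * a2) (l *: w1 + (1 - l) *: w2).
Proof.
move=> l01; have [l0 l1] := andP l01.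
elim: j a1 a2 w1 w2 => [|j ih] a1 a2 w1 w2 /=.
  move=> h1 h2; apply: le_trans (enormD _ _) _; rewrite !enormZ !gtr0_norm ?subr_gt0 //.
  rewrite mulrDr; apply: lerD; rewrite mulrCA ler_pM2l ?subr_gt0 //.
move=> [b1 [c1 [C1 [s1 k1 p1 h1]]]] [b2 [c2 [C2 [s2 k2 p2 h2]]]].
exists (l * b1 + (1 - l) * b2), (l * c1 + (1 - l) * c2),
  [set l *: x + (1 - l) *: y | x in C1 & y in C2]; split.
- apply: le_trans (_ : l * (b1 + c1) + (1 - l) * (b2 + c2) <= _); first by lra.
  by apply: lerD; rewrite ler_pM2l // subr_gt0.
- exact: lc_image_compact.
- apply: (lc_exp lc l01 k1 k2) => //.
    by apply: compact_borel; exact: lc_image_compact.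
  by move=> x y Cx Cy; exists x => //; exists y.
- move=> _ [x Cx [y Cy <-]].
  have -> : l *: w1 + (1 - l) *: w2 - (l *: x + (1 - l) *: y) = l *: (w1 - x) + (1 - l) *: (w2 - y).
    by rewrite !scalerBr opprD addrACA.
  by apply: ih; [exact: h1|exact: h2].
Qed.

Lemma Wconv j (I : Type) (r : seq I) (c : I -> R) (a : R) (w : I -> 'rV[R]_n) (t : R) :
  (forall i, 0 <= c i) -> 0 < t -> \sum_(i <- r) c i = t ->
  (forall i, Wset j a (w i)) -> Wset j a (t^-1 *: \sum_(i <- r) c i *: w i).
Proof.
apply: conv_mean => x y l l01 hx hy.
have -> : a = l * a + (1 - l) * a by ring.
exact: Wconv2.
Qed.

End SumTrick.

(** * Multiples of a weighted mean as sums of typical points *)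

Section Member.
Context {R : realType} {n : nat} (mu : probability (borel_rV R n) R).
Notation V := (borel_rV R n).
Variables (phi : V -> R) (x0 : 'rV[R]_n) (r : R).
Hypotheses (phi0 : forall x, 0 <= phi x) (phib : bmf phi) (phi1 : Ex mu phi = 1)
  (phis : forall x, phi x != 0 -> enorm ((x : 'rV[R]_n) - x0) <= r) (r0 : 0 < r).

Lemma wt_bmf (g : V -> R) (K : R) : measurable_fun setT g ->
  (forall x : V, enorm ((x : 'rV[R]_n) - x0) <= r -> `|g x| <= K) -> bmf (fun x => g x * phi x).
Proof.
move=> mg hg; have [mp [L hL]] := phib.
apply: (@bmfP _ _ _ _ (K * L)); first exact: measurable_funM.
move=> x; have [->|/phis/hg hx] := eqVneq (phi x) 0; last by rewrite normrM; apply: ler_pM.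
rewrite mulr0 normr0 mulr_ge0 //; last by apply: le_trans (hL x).
apply: le_trans (hg x0 _) => //; by rewrite subrr enorm0 ltW.
Qed.

(** Barycentre, and below it the second moment about [p], of the probability with density [phi] with
    respect to [mu]. *)
Definition wmean : 'rV[R]_n := \row_i Ex mu (fun x : V => (x : 'rV[R]_n) ord0 i * phi x).
Definition wvar (p : 'rV[R]_n) : R := Ex mu (fun x : V => enorm ((x : 'rV[R]_n) - p) ^+ 2 * phi x).

Lemma wt_enorm_le (x : 'rV[R]_n) : enorm (x - x0) <= r -> enorm x <= enorm x0 + r.
Proof. by move=> h; have := enormD (x - x0) x0; rewrite subrK; lra. Qed.

Lemma wt_dot_bmf (u : 'rV[R]_n) : bmf (fun x : V => dot (x : 'rV[R]_n) u * phi x).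
Proof.
apply: (@wt_bmf _ ((enorm x0 + r) * enorm u)); first exact: dot_borel.
move=> x hx; apply: le_trans (ler_dot _ _) _; rewrite ler_wpM2r ?enorm_ge0 //; exact: wt_enorm_le.
Qed.
Lemma wt_sq_bmf (p : 'rV[R]_n) : bmf (fun x : V => enorm ((x : 'rV[R]_n) - p) ^+ 2 * phi x).
Proof.
apply: (@wt_bmf _ ((enorm (x0 - p) + r) ^+ 2)).
  by apply: measurable_funX; exact: enormB_borel.
move=> x hx; rewrite ger0_norm ?sqr_ge0 // ler_sqr ?nnegrE ?enorm_ge0 ?addr_ge0 ?enorm_ge0 ?(ltW r0) //.
have := enorm_dist (x : 'rV[R]_n) x0 p; lra.
Qed.

Lemma wmean_dot (u : 'rV[R]_n) : Ex mu (fun x : V => dot (x : 'rV[R]_n) u * phi x) = dot wmean u.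
Proof.
have -> : (fun x : V => dot (x : 'rV[R]_n) u * phi x) =
   (fun x : V => \sum_i u ord0 i * ((x : 'rV[R]_n) ord0 i * phi x)).
  by apply/funext => x; rewrite /dot mulr_suml; apply: eq_bigr => i _; ring.
have hb i : bmf (fun x : V => (x : 'rV[R]_n) ord0 i * phi x).
  apply: (@wt_bmf _ (enorm x0 + r)); first exact: coord_borel.
  by move=> x hx; apply: le_trans (ler_coord _ _) _; exact: wt_enorm_le.
rewrite Ex_sum => [|i]; last exact: bmfZ.
by apply: eq_bigr => i _; rewrite ExZ // mxE mulrC.
Qed.

Lemma wvarE (p : 'rV[R]_n) : wvar p = wvar 0 - 2 * dot wmean p + dot p p.
Proof.
rewrite /wvar.
have -> : (fun x : V => enorm ((x : 'rV[R]_n) - p) ^+ 2 * phi x) =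
   (fun x : V => (enorm ((x : 'rV[R]_n) - 0) ^+ 2 * phi x + (- 2) * (dot (x : 'rV[R]_n) p * phi x)) + dot p p * phi x).
  by apply/funext => x; rewrite !enorm2 subr0 !dotBl !dotBr (dotC p x); ring.
have h1 := wt_sq_bmf 0; have h2 := wt_dot_bmf p.
rewrite !ExD //; do ?[exact: bmfZ|by apply: bmfD => //; exact: bmfZ].
by rewrite !ExZ // phi1 wmean_dot; ring.
Qed.

Lemma wvar_x0 : wvar x0 <= r ^+ 2.
Proof.
rewrite -[leRHS]mulr1 -phi1 -ExZ //; apply: Ex_le; [exact: wt_sq_bmf|exact: bmfZ|].
move=> x; have [->|h] := eqVneq (phi x) 0; first by rewrite !mulr0.
by apply: ler_wpM2r => //; rewrite ler_sqr ?nnegrE ?enorm_ge0 ?(ltW r0) //; exact: phis.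
Qed.

Lemma wvar_shift (v : 'rV[R]_n) : wvar (v + wmean) <= dot v v + r ^+ 2.
Proof.
have h1 := wvarE (v + wmean); have h2 := wvarE x0; have h3 := wvar_x0.
have h4 := dot_ge0 (x0 - wmean).
move: h1 h2 h3 h4; rewrite !dotDr !dotDl !dotNr !dotNl (dotC wmean v) (dotC x0 wmean).
move: (wvar x0) (wvar _) (wvar 0) (dot wmean wmean) (dot wmean x0) (dot x0 x0) (dot v v) (dot v wmean).
by move=> a b c p q s t u; lra.
Qed.

Lemma wmean_dist : enorm (wmean - x0) <= r.
Proof.
have h1 := wvarE wmean; have h2 := wvarE x0; have h3 := wvar_x0.
have h4 : 0 <= wvar wmean by apply: Ex_ge0 => x; rewrite mulr_ge0 ?sqr_ge0.
rewrite -ler_sqr ?nnegrE ?enorm_ge0 ?(ltW r0) // enorm2.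
move: h1 h2 h3 h4; rewrite !dotBr !dotBl (dotC x0 wmean).
move: (wvar x0) (wvar wmean) (wvar 0) (dot wmean wmean) (dot wmean x0) (dot x0 x0).
by move=> a b c p q s; lra.
Qed.

Variable c : R.
Hypothesis phic : forall (C : set V) (t : R), measurable C -> 0 <= t ->
  t <= Ex mu (fun x => \1_C x * phi x) -> expR (- c) * t ^+ 2 <= pr mu C.

(** A point drawn with density [phi] has mean square distance at most [|v|^2 + r^2] from
    [v + wmean]. By Markov, on a set of [phi]-mass at least [1 / (2 m + 2)] the squared remainder
    grows by at most [2 r ^ 2] when the point is subtracted. After [j] steps the remainder is of
    order [sqrt j * r] and not [j r], and each step costs [c + 2 ln (2 m + 2)] by [phic]. *)
Lemma Wmember (m j : nat) (v : 'rV[R]_n) (rho : R) : 0 < rho -> (j <= m)%N ->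
  dot v v <= 2 * (m - j)%:R * r ^+ 2 ->
  Wset mu rho j (j%:R * (c + 2 * ln (2 * m%:R + 2)) + Num.sqrt (dot v v + 2 * j%:R * r ^+ 2) / rho)
    (j%:R *: wmean + v).
Proof.
move=> rho0; have m0 : 0 < 2 * m%:R + 2 :> R by rewrite ltr_wpDl // mulr_ge0.
have rp : 0 < r ^+ 2 by rewrite exprn_gt0.
elim: j v => [|j ih] v jm hv /=.
  rewrite mul0r add0r scale0r add0r mulr0 mul0r addr0 -enormE mulrC divfK //.
  by rewrite gt_eqF.
set a := _ + _ / rho.
pose L := c + 2 * ln (2 * m%:R + 2).
pose C := [set x : 'rV[R]_n | enorm (x - (v + wmean)) ^+ 2 <= dot v v + 2 * r ^+ 2] `&` [set x | enorm (x - x0) <= r].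
have cC : compact C.
  apply: (@compact_ball _ _ _ x0 r) => [|x [_ //]].
  apply: closedI; last exact: nball_closed.
  have -> : [set x : 'rV[R]_n | enorm (x - (v + wmean)) ^+ 2 <= dot v v + 2 * r ^+ 2] =
     [set x : 'rV[R]_n | dot (x - (v + wmean)) (x - (v + wmean)) <= dot v v + 2 * r ^+ 2].
    by apply/seteqP; split => x /=; rewrite enorm2.
  by apply: closed_le; exact: sqnorm_continuous.
exists (j%:R * L + Num.sqrt (dot v v + 2 * r ^+ 2 + 2 * j%:R * r ^+ 2) / rho), L, C; split => //.
- rewrite /a -/L -[j.+1%:R]natr1; have -> : dot v v + 2 * (j%:R + 1) * r ^+ 2 = dot v v + 2 * r ^+ 2 + 2 * j%:R * r ^+ 2 by ring.
  by rewrite le_eqVlt; apply/orP; left; apply/eqP; ring.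
- have mC : measurable (C : set V) by exact: compact_borel.
  have -> : expR (- L) = expR (- c) * (2 * m%:R + 2)^-1 ^+ 2.
    rewrite /L opprD [LHS]expRD; congr (_ * _); have -> : 2 * ln (2 * m%:R + 2) = ln (2 * m%:R + 2) + ln (2 * m%:R + 2) :> R by ring.
    by rewrite opprD expRD expRN lnK ?posrE // expr2.
  apply: (phic mC); first by apply: ltW; rewrite invr_gt0.
  pose t := dot v v + 2 * r ^+ 2.
  have t0 : 0 < t by rewrite ltr_wpDl ?dot_ge0 // mulr_gt0.
  have h1 := wvar_shift v.
  have h2 : t * (1 - Ex mu (fun x => \1_(C : set V) x * phi x)) <= wvar (v + wmean).
    have hb : bmf (fun x : V => \1_(C : set V) x * phi x) by apply: bmfM => //; exact: bmf_indic.
    rewrite -phi1 -ExB // -ExZ; last exact: bmfB.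
    apply: Ex_le; [by apply: bmfZ; exact: bmfB|exact: wt_sq_bmf|] => x.
    rewrite indicE; have [xC|xC] := boolP (x \in C).
      by rewrite mul1r subrr mulr0 mulr_ge0 // sqr_ge0.
    rewrite mul0r subr0; have [->|/phis hx] := eqVneq (phi x) 0; first by rewrite !mulr0.
    apply: ler_wpM2r => //; rewrite leNgt; apply/negP => hlt; move/negP: xC; apply; apply/mem_set.
    by split => //=; exact: ltW.
  have h3 : t <= (2 * m%:R + 2) * r ^+ 2.
    rewrite /t [(2 * m%:R + 2) * _]mulrDl lerD2r; apply: le_trans hv _; rewrite ler_pM2r // ler_pM2l // ler_nat; exact: leq_subr.
  rewrite -[leLHS]mulr1 -(ler_pM2l m0) mulrA mulrV ?unitfE ?gt_eqF // mul1r.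
  set E := Ex _ _ in h2 *.
  have h4 : r ^+ 2 <= t * E by rewrite /t in h2 *; lra.
  have E0 : 0 <= E by apply: Ex_ge0 => x; rewrite mulr_ge0 // indicE.
  rewrite -(ler_pM2r rp) mul1r; apply: le_trans h4 _; rewrite mulrAC ler_wpM2r //.
- move=> x [hx _].
  have -> : j.+1%:R *: wmean + v - x = j%:R *: wmean + (v + wmean - x).
    by rewrite -natr1 scalerDl scale1r -!addrA; congr (_ + _); rewrite !addrA; congr (_ - _); rewrite addrC.
  have h : dot (v + wmean - x) (v + wmean - x) <= dot v v + 2 * r ^+ 2 by rewrite -enorm2 enormBC.
  have hm : dot (v + wmean - x) (v + wmean - x) <= 2 * (m - j)%:R * r ^+ 2.
    apply: le_trans h _; apply: le_trans (lerD hv (lexx _)) _.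
    rewrite -mulrDl ler_pM2r // -{2}[2]mulr1 -mulrDr ler_pM2l // natr1 ler_nat.
    by rewrite -subSn // subSS.
  apply: Wmono (ih _ (ltnW jm) hm) => //.
  by rewrite lerD2l ler_pM2r ?invr_gt0 // ler_wsqrtr // lerD2r.
Qed.
End Member.

(** * Coverings of convex hulls *)

Section Coverings.
Context {R : realType} {n : nat}.
Implicit Types A B : set 'rV[R]_n.

Definition covers A (M s : R) := exists l : seq 'rV[R]_n, (size l)%:R <= M /\
  forall x, A x -> exists2 p, p \in l & enorm (x - p) <= s.

Lemma covers_le A (M M' s s' : R) : M <= M' -> s <= s' -> covers A M s -> covers A M' s'.
Proof.
move=> hM hs [l [h1 h2]]; exists l; split; first exact: le_trans hM.
by move=> x /h2[p pl h]; exists p => //; exact: le_trans hs.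
Qed.
Lemma covers_sub A B (M s : R) : B `<=` A -> covers A M s -> covers B M s.
Proof. by move=> BA [l [h1 h2]]; exists l; split => // x /BA /h2. Qed.
Lemma covers_opp A (M s : R) : covers A M s -> covers [set - x | x in A] M s.
Proof.
move=> [l [h1 h2]]; exists (map -%R l); split; first by rewrite size_map.
move=> _ [x /h2[p pl h] <-]; exists (- p); first exact: map_f.
by rewrite -opprD enormN.
Qed.
Lemma covers_add A B C (M M' s s' : R) : covers A M s -> covers B M' s' ->
  (forall x, C x -> exists a b, [/\ A a, B b & x = a + b]) -> covers C (M * M') (s + s').
Proof.
move=> [l [h1 h2]] [l' [h1' h2']] h; exists [seq p + q | p <- l, q <- l']; split.
  by rewrite size_allpairs natrM ler_pM.
move=> _ /h[a [b [/h2[p pl hp] /h2'[q ql hq] ->]]].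
exists (p + q); first by apply/allpairsP; exists (p, q).
by rewrite opprD addrACA; apply: le_trans (enormD _ _) _; exact: lerD.
Qed.

Definition hull (I : finType) (z : I -> 'rV[R]_n) : set 'rV[R]_n :=
  [set y | exists c : I -> R, [/\ forall i, 0 <= c i, \sum_i c i = 1 & y = \sum_i c i *: z i]].

(** Greedy instead of random: the [c]-average of [<S, v i - y>] is 0, so some [i] increases [|S|^2]
    by at most [4 r ^ 2]. *)
Lemma maurey (I : finType) (v : I -> 'rV[R]_n) (r : R) (c : I -> R) (m : nat) :
  (forall i, enorm (v i) <= r) -> (forall i, 0 <= c i) -> \sum_i c i = 1 -> (0 < m)%N ->
  exists f : {ffun 'I_m -> I},
    enorm (\sum_i c i *: v i - m%:R^-1 *: \sum_j v (f j)) <= 2 * r / Num.sqrt m%:R.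
Proof.
move=> hv c0 c1 m0; set y := \sum_i c i *: v i; have yE : \sum_i c i *: v i = y by [].
have i0 : I by case: (pickP [pred i : I | true]) => // h; move: c1; rewrite big_pred0 ?h // => /esym/eqP; rewrite oner_eq0.
have r0 : 0 <= r by apply: le_trans (hv i0); exact: enorm_ge0.
have hy : enorm y <= r.
  apply: le_trans (enorm_sum _ _ _) _; rewrite -[leRHS]mul1r -c1 mulr_suml; apply: ler_sum => i _.
  by rewrite enormZ ger0_norm // ler_wpM2l.
clearbody y.
have step (S : 'rV[R]_n) : exists i, dot S (v i - y) <= 0.
  apply: contrapT => /forallNP h.
  have hp i : 0 < dot S (v i - y) by rewrite ltNge; apply/negP; exact: h.
  have : \sum_i c i * dot S (v i - y) = 0.
    have -> : \sum_i c i * dot S (v i - y) = dot S (\sum_i c i *: v i) - (\sum_i c i) * dot S y.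
      by rewrite dot_sumr mulr_suml -sumrB; apply: eq_bigr => i _; rewrite dotBr dotZr mulrBr.
    by rewrite c1 mul1r yE subrr.
  move=> /eqP; rewrite psumr_eq0 => [/allP hz|i _]; last by rewrite mulr_ge0 // ltW.
  suff : (1 : R) == 0 by rewrite oner_eq0.
  rewrite -c1 big1 // => i _; apply/eqP.
  by have := hz i (mem_index_enum _); rewrite mulf_eq0 (gt_eqF (hp i)) orbF.
have key k : exists s : seq I, size s = k /\ dot (\sum_(i <- s) (v i - y)) (\sum_(i <- s) (v i - y)) <= 4 * r ^+ 2 * k%:R.
  elim: k => [|k [s [sk hs]]]; first by exists [::]; rewrite !big_nil dot0l mulr0.
  have [i hi] := step (\sum_(i <- s) (v i - y)).
  exists (i :: s); split; first by rewrite /= sk.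
  rewrite !big_cons; move: hs hi; move: (\sum_(_ <- _) _) => S hs hi.
  have h : dot (v i - y) (v i - y) <= 4 * r ^+ 2.
    rewrite -enorm2; have -> : 4 * r ^+ 2 = (2 * r) ^+ 2 by rewrite exprMn; congr (_ * _); rewrite -natrX.
    rewrite ler_sqr ?nnegrE ?enorm_ge0 ?mulr_ge0 //; have := enormB (v i) y; have := hv i; lra.
  move: h hs hi; move: (v i - y) => t h hs hi.
  rewrite dotDl !dotDr (dotC t S) -(natr1 k); lra.
have [s [sk hs]] := key m.
exists [ffun j : 'I_m => nth i0 s j].
have -> : \sum_(j < m) v ([ffun j : 'I_m => nth i0 s j] j) = \sum_(i <- s) v i.
  by rewrite (big_nth i0) sk big_mkord; apply: eq_bigr => j _; rewrite ffunE.
have mp : 0 < m%:R :> R by rewrite ltr0n.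
have mn : m%:R != 0 :> R by rewrite gt_eqF.
have -> : y - m%:R^-1 *: \sum_(i <- s) v i = (- m%:R^-1) *: \sum_(i <- s) (v i - y).
  rewrite sumrB big_const_seq count_predT sk iter_addr_0 scalerBr scaleNr scaleNr opprK addrC.
  by rewrite -(scaler_nat m y) scalerA mulVf // scale1r.
rewrite enormZ normrN gtr0_norm ?invr_gt0 // ler_pdivrMl //.
have -> : m%:R * (2 * r / Num.sqrt m%:R) = Num.sqrt (4 * r ^+ 2 * m%:R) :> R.
  have -> : 4 * r ^+ 2 = (2 * r) ^+ 2 by rewrite exprMn; congr (_ * _); rewrite -natrX.
  rewrite sqrtrM ?sqr_ge0 // sqrtr_sqr ger0_norm ?mulr_ge0 //.
  have sp : 0 < Num.sqrt (m%:R : R) by rewrite sqrtr_gt0.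
  rewrite -[X in X * _](sqr_sqrtr (ltW mp)); field; by rewrite gt_eqF.
by rewrite enormE ler_wsqrtr.
Qed.

Lemma maurey_cover (I : finType) (v : I -> 'rV[R]_n) (r : R) (m : nat) : (0 < m)%N ->
  (forall i, enorm (v i) <= r) -> covers (hull v) (#|I|%:R ^+ m) (2 * r / Num.sqrt m%:R).
Proof.
move=> m0 hv; exists [seq m%:R^-1 *: \sum_j v (f j) | f : {ffun 'I_m -> I}]; split.
  by rewrite size_map -cardE card_ffun card_ord natrX.
move=> y [c [c0 c1 ->]]; have [f hf] := maurey hv c0 c1 m0.
by exists (m%:R^-1 *: \sum_j v (f j)) => //; apply: map_f; rewrite mem_enum.
Qed.

Lemma hull_split (I : finType) (x z : I -> 'rV[R]_n) (M M' s s' : R) :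
  covers (hull z) M s -> covers (hull (fun i => x i - z i)) M' s' -> covers (hull x) (M * M') (s + s').
Proof.
move=> h1 h2; apply: (covers_add h1 h2) => y [c [c0 c1 ->]].
exists (\sum_i c i *: z i), (\sum_i c i *: (x i - z i)); split; [by exists c|by exists c|].
by rewrite -big_split /=; apply: eq_bigr => i _; rewrite -scalerDr addrC subrK.
Qed.

(** Rounding by [cells] dominates the sum by a product of one-dimensional lattice sums, uniformly in
    [y], as [Wpack] requires. *)
Lemma sepsum (s : R) (l : seq 'rV[R]_n) (y : 'rV[R]_n) : 0 < s -> sep s l ->
  \sum_(p <- l) expR (- (n%:R * enorm (p - y) / s)) <= 24 ^+ n.
Proof.
move=> s0 hl; pose r := \sum_(p <- l) enorm p.
have hr p : p \in l -> enorm (p - 0) <= r.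
  by move=> pl; rewrite subr0 /r (big_rem p pl) /= lerDl; apply: sumr_ge0 => q _; exact: enorm_ge0.
have [m [cell [inj hc]]] := cells s0 hl hr.
pose q := Num.sqrt n%:R / s; have q0 : 0 <= q by rewrite divr_ge0 ?sqrtr_ge0 // ltW.
pose y' i := (y ord0 i + r) * q.
have h p : p \in l -> expR (- (n%:R * enorm (p - y) / s)) <= expR 1 ^+ n * expR (- (1 * \sum_i `|y' i - (cell p i)%:R|)).
  move=> pl; have -> : expR 1 ^+ n = expR n%:R :> R by have := expRM_natl n (1 : R); rewrite mulr1.
  rewrite -expRD ler_expR mul1r.
  have : \sum_i `|y' i - (cell p i)%:R| <= \sum_i (`|(p - y) ord0 i| * q + 1).
    apply: ler_sum => i _; have := hc _ pl i; rewrite !mxE oppr0 addr0 => h1.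
    have -> : y' i - (cell p i)%:R = (- ((p ord0 i - y ord0 i) * q)) + ((p ord0 i + r) * q - (cell p i)%:R) by rewrite /y'; ring.
    by apply: le_trans (ler_normD _ _) _; rewrite normrN normrM (ger0_norm q0) lerD2l.
  rewrite big_split /= -mulr_suml sumr_const card_ord.
  have h2 := sum_abs_le (p - y).
  have : (\sum_i `|(p - y) ord0 i|) * q <= Num.sqrt n%:R * enorm (p - y) * q by rewrite ler_wpM2r.
  have -> : Num.sqrt n%:R * enorm (p - y) * q = n%:R * enorm (p - y) / s.
    by rewrite /q -[in RHS](sqr_sqrtr (ler0n R n)); ring.
  lra.
rewrite big_seq; apply: le_trans (ler_sum _ h) _; rewrite -mulr_sumr -big_seq.
have -> : 24 ^+ n = 4 ^+ n * 6 ^+ n :> R by rewrite -exprMn; congr (_ ^+ _); ring.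
apply: ler_pM; [exact/exprn_ge0/expR_ge0|by apply: sumr_ge0 => p _; exact: expR_ge0| |].
  by apply: lerXn2r; rewrite ?nnegrE ?expR_ge0 // expR1_le4.
have := @expsum_prod_le R n m 1 y' ltr01 (lexx _); rewrite divr1; apply: le_trans.
rewrite -(big_map cell xpredT (fun z : {ffun 'I_n -> 'I_m} => expR (- (1 * \sum_i `|y' i - (z i)%:R|)))).
rewrite big_uniq /=; last by rewrite map_inj_in_uniq // hl.1.
rewrite big_mkcond /=; apply: ler_sum => z _; case: ifP => // _; exact: expR_ge0.
Qed.
End Coverings.

Section HullCover.
Context {R : realType} {n : nat} (mu : probability (borel_rV R n) R).
Notation V := (borel_rV R n).
Hypotheses (lc : log_concave mu) (n0 : (0 < n)%N).
Let n0R : 0 < n%:R :> R. Proof. by rewrite ltr0n. Qed.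

(** [m] times any point of the hull is as cheap as the [m z i], so [Wpack] bounds a separated list
    in the hull by [24 ^ n * expR a]. The radius [m s / n] turns the exponent of [Wpack] into that
    of [sepsum]. *)
Lemma Whull_cover (I : finType) (z : I -> 'rV[R]_n) (m : nat) (s a : R) : (0 < m)%N -> 0 < s ->
  (forall i, Wset mu (m%:R * s / n%:R) m a (m%:R *: z i)) -> covers (hull z) (24 ^+ n * expR a) s.
Proof.
move=> m0 s0 hz.
have mp : 0 < m%:R :> R by rewrite ltr0n.
have rp : 0 < m%:R * s / n%:R by rewrite divr_gt0 // mulr_gt0.
have [||l [_ _ h1 h2]] := @sep_cover R n s (hull z) (24 ^+ n * expR a); last by exists l.
  exact: ltW.
move=> l hl lz.
have hW p : p \in l -> Wset mu (m%:R * s / n%:R) m a (m%:R *: p).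
  move=> /lz[c [c0 c1 ->]].
  have := Wconv lc c0 ltr01 c1 hz; rewrite invr1 scale1r scaler_sumr.
  under eq_bigr do rewrite scalerA mulrC -scalerA.
  by rewrite -scaler_sumr.
have hp := Wpack (mu := mu) rp (j := m) (r := l) (Q := fun p => p \in l) (a := fun=> a) (w := fun p => m%:R *: p) (K := 24 ^+ n) hW.
have : \sum_(p <- l | p \in l) expR (- a) <= 24 ^+ n.
  apply: hp => y; rewrite -big_seq; apply: le_trans (@sepsum R n s l (m%:R^-1 *: y) s0 hl).
  apply: ler_sum => p _; rewrite ler_expR lerN2.
  have -> : m%:R *: p - y = m%:R *: (p - m%:R^-1 *: y) by rewrite scalerBr scalerA mulfV ?scale1r // gt_eqF.
  rewrite enormZ gtr0_norm // le_eqVlt; apply/orP; left; apply/eqP; field.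
  by rewrite !gt_eqF.
rewrite -big_seq big_const_seq count_predT iter_addr_0 expRN.
have -> : (expR a)^-1 *+ size l = (size l)%:R / expR a by rewrite mulr_natl.
by rewrite ler_pdivrMr ?expR_gt0.
Qed.

(** Here [phi] is the normalised indicator of a ball of mass at least [exp (- c)]. Its mean is
    within [r] of the centre, so the residuals have length at most [r] and Maurey's lemma covers
    their hull. *)
Lemma ball_mean_cover (I : finType) (x : I -> 'rV[R]_n) (r c s : R) (m : nat) : (0 < m)%N -> 0 < s -> 0 < r ->
  (forall i, expR (- c) <= pr mu (nball (x i) r)) ->
  covers (hull x) (24 ^+ n * expR (m%:R * (c + 2 * ln (2 * m%:R + 2)) + Num.sqrt (2 * m%:R * r ^+ 2) / (m%:R * s / n%:R)) * #|I|%:R ^+ m)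
    (s + 2 * r / Num.sqrt m%:R).
Proof.
move=> m0 s0 r0 hx.
have rp : 0 < m%:R * s / n%:R by rewrite divr_gt0 // mulr_gt0 // ltr0n.
pose phi i : V -> R := fun y => (pr mu (nball (x i) r))^-1 * \1_(nball (x i) r) y.
have p0 i : 0 < pr mu (nball (x i) r) by apply: lt_le_trans (hx i); exact: expR_gt0.
have phi0 i y : 0 <= phi i y by rewrite mulr_ge0 ?invr_ge0 ?(ltW (p0 i)) // indicE.
have phib i : bmf (phi i) by apply: bmfZ; apply: bmf_indic; exact: nball_borel.
have phi1 i : Ex mu (phi i) = 1.
  rewrite ExZ; last by apply: bmf_indic; exact: nball_borel.
  by rewrite Ex_indic ?mulVf ?gt_eqF //; exact: nball_borel.
have phis i y : phi i y != 0 -> enorm ((y : 'rV[R]_n) - x i) <= r.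
  rewrite /phi indicE; case: (boolP (y \in _)) => [/set_mem//|_]; by rewrite mulr0 eqxx.
have phic i (C : set V) (t : R) : measurable C -> 0 <= t ->
  t <= Ex mu (fun y => \1_C y * phi i y) -> expR (- c) * t ^+ 2 <= pr mu C.
  move=> mC t0 ht.
  have mCB : measurable (C `&` nball (x i) r) by apply: measurableI => //; exact: nball_borel.
  have e : Ex mu (fun y => \1_C y * phi i y) = (pr mu (nball (x i) r))^-1 * pr mu (C `&` nball (x i) r).
    rewrite -(Ex_indic mu mCB) -ExZ; last exact: bmf_indic.
    congr Ex; apply/funext => y; rewrite /phi indicI /=; ring.
  have t1 : t <= 1.
    apply: le_trans ht _; rewrite e ler_pdivrMl // mulr1; apply: pr_mono => //; by [apply: nball_borel|move=> y []].
  apply: le_trans (_ : pr mu (nball (x i) r) * t <= _).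
    apply: ler_pM; rewrite ?expR_ge0 ?sqr_ge0 // expr2; exact: ler_piMl.
  move: ht; rewrite e ler_pdivlMl // => /le_trans; apply; apply: pr_mono => //; by move=> y [].
pose z i := wmean mu (phi i).
have hd i : enorm (x i - z i) <= r.
  rewrite enormBC; exact: (wmean_dist (phi0 i) (phib i) (phi1 i) (phis i) r0).
apply: (@hull_split _ _ _ _ z).
  apply: (Whull_cover m0 s0) => i.
  have := Wmember (phi0 i) (phib i) (phi1 i) (phis i) r0 (phic i) rp (leqnn m) (v := 0).
  by rewrite dot0l subnn mulr0 mul0r addr0 add0r; apply.
exact: maurey_cover.
Qed.
End HullCover.

(** * Haar measure on the Grassmannian *)

Section Orthonormal.
Context {R : realType} {n : nat}.

Definition onseq (l : seq 'rV[R]_n) :=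
  (forall x, x \in l -> dot x x = 1) /\ pairwise (fun x y => dot x y == 0) l.

Lemma onseq_proj (l : seq 'rV[R]_n) (c : 'rV[R]_n -> R) e : onseq l -> e \in l ->
  dot (\sum_(x <- l) c x *: x) e = c e.
Proof.
move=> [l1 l2]; elim: l l1 l2 => [//|x l ih] l1 /= /andP[/allP hx l2].
rewrite inE big_cons dotDl dotZl => /orP[/eqP ->|el].
  rewrite l1 ?inE ?eqxx // mulr1 dot_suml big_seq big1 ?addr0 // => y yl.
  by rewrite dotZl dotC (eqP (hx _ yl)) mulr0.
rewrite (eqP (hx _ el)) mulr0 add0r; apply: ih => // y yl; apply: l1; by rewrite inE yl orbT.
Qed.

Lemma gram_schmidt (X : seq 'rV[R]_n) : exists2 l, onseq l & span l = span X.
Proof.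
elim: X => [|x X [l ol hl]]; first by exists [::].
pose v := x - \sum_(e <- l) dot x e *: e.
have vl : \sum_(e <- l) dot x e *: e \in span l.
  by rewrite big_seq; apply: rpred_sum => e el; apply: rpredZ; exact: memv_span.
have ve e : e \in l -> dot v e = 0.
  by move=> el; rewrite dotBl (onseq_proj (fun e => dot x e) ol el) subrr.
have [v0|v0] := eqVneq v 0.
  exists l => //; rewrite span_cons -hl; apply/esym/addv_idPr.
  rewrite -memvE; have -> : x = \sum_(e <- l) dot x e *: e by apply/eqP; rewrite -subr_eq0 -/v v0.
  exact: vl.
have ev : 0 < enorm v by rewrite enorm_gt0.
exists ((enorm v)^-1 *: v :: l).
  split=> [y|] /=.
    rewrite inE => /orP[/eqP ->|]; last by move/ol.1.
    by rewrite dotZl dotZr -enorm2; field; rewrite gt_eqF.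
  rewrite ol.2 andbT; apply/allP => e el; by rewrite dotZl ve // mulr0.
rewrite !span_cons -hl; apply/eqP; rewrite eqEsubv; apply/andP; split.
  rewrite subv_add; apply/andP; split; last exact: addvSr.
  rewrite -memvE; apply: rpredZ; rewrite /v; apply: rpredB.
    by apply: subvP (addvSl _ _) _ _; exact: memv_line.
  by apply: subvP (addvSr _ _) _ vl.
rewrite subv_add; apply/andP; split; last exact: addvSr.
rewrite -memvE; have -> : x = v + \sum_(e <- l) dot x e *: e by rewrite /v subrK.
apply: rpredD; last by apply: subvP (addvSr _ _) _ vl.
rewrite -[X in X \in _](scale1r v) -(divff (lt0r_neq0 ev)) -scalerA.
by apply: rpredZ; apply: subvP (addvSl _ _) _ _; exact: memv_line.
Qed.

Lemma onseq_free (l : seq 'rV[R]_n) : onseq l -> free l.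
Proof.
move=> [l1 l2]; elim: l l1 l2 => [|x l ih] l1 l2; first exact: nil_free.
have ol : onseq (x :: l) by [].
move: l2 => /= /andP[/allP hx l2]; rewrite free_cons ih ?andbT //; last first.
  by move=> y yl; apply: l1; rewrite inE yl orbT.
apply/negP => xl.
have : dot x x = 0.
  rewrite {2}(coord_span (X := in_tuple l) xl) dot_sumr big1 // => i _.
  by rewrite dotZr; have /eqP -> := hx _ (mem_nth 0 (ltn_ord i)); rewrite mulr0.
by rewrite l1 ?inE ?eqxx // => /eqP; rewrite oner_eq0.
Qed.

(** Subspaces are handled through matrices with orthonormal rows: [U^T *m U] is the projection, and
    [U^T] gives isometric coordinates on [F]. *)
Lemma onb (F : {vspace 'rV[R]_n}) : exists U : 'M[R]_(\dim F, n), U *m U^T = 1%:M /\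
  forall v, v \in F <-> v *m U^T *m U = v.
Proof.
have [l ol hl] := gram_schmidt (vbasis F).
have sF : span (vbasis F) = F by have /andP[/eqP] := vbasisP F.
rewrite sF in hl.
have sl : size l = \dim F by rewrite -hl; apply/esym/eqP; rewrite -/(free l); exact: onseq_free.
pose U : 'M[R]_(\dim F, n) := \matrix_(i, j) l`_i ord0 j.
have lu i : (i < size l)%N -> l`_i \in l by exact: mem_nth.
have UU : U *m U^T = 1%:M.
  apply/matrixP => i j; rewrite !mxE.
  have -> : \sum_k U i k * U^T k j = dot l`_i l`_j by apply: eq_bigr => k _; rewrite !mxE.
  have := ol; move=> [l1 /(pairwiseP 0) l2].
  have hi : (i < size l)%N by rewrite sl. have hj : (j < size l)%N by rewrite sl.
  case: (ltngtP i j) => [ij|ji|ij].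
  - by rewrite (eqP (l2 _ _ _ _ ij)) ?inE //; case: eqVneq => // e; rewrite e ltnn in ij.
  - by rewrite dotC (eqP (l2 _ _ _ _ ji)) ?inE //; case: eqVneq => // e; rewrite e ltnn in ji.
  - by rewrite ij l1 ?lu // (_ : i = j) ?eqxx //; exact: val_inj.
have rowU i : row i U = l`_i by apply/rowP => j; rewrite !mxE.
exists U; split => // v; split => [vF|<-].
  have : v \in span l by rewrite hl.
  move/(coord_span (X := in_tuple l)) => ->.
  rewrite !mulmx_suml; apply: eq_bigr => i _; rewrite -!scalemxAl; congr (_ *: _).
  have hi : (i < \dim F)%N by rewrite -sl.
  have -> : (in_tuple l)`_i = row (Ordinal hi) U by rewrite rowU.
  by rewrite -!row_mul UU mul1mx.
have sub y : y \in span l -> y \in F by rewrite hl.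
rewrite mulmx_sum_row; apply: rpred_sum => i _; apply: rpredZ; apply: sub; apply: memv_span.
by rewrite rowU lu // sl.
Qed.

Lemma dot_mx (x y : 'rV[R]_n) : dot x y = (x *m y^T) ord0 ord0.
Proof. by rewrite mxE; apply: eq_bigr => i _; rewrite mxE. Qed.
End Orthonormal.

Lemma dot_mulmx {R : realType} {n d : nat} (U : 'M[R]_(d, n)) (c : 'rV[R]_d) (x : 'rV[R]_n) :
  dot (c *m U) x = dot c (x *m U^T).
Proof. by rewrite !dot_mx trmx_mul trmxK mulmxA. Qed.

Lemma dot_iso {R : realType} {n d : nat} (U : 'M[R]_(d, n)) (a b : 'rV[R]_d) :
  U *m U^T = 1%:M -> dot (a *m U) (b *m U) = dot a b.
Proof. by move=> UU; rewrite dot_mulmx -mulmxA UU mulmx1. Qed.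

Lemma enorm_iso {R : realType} {n d : nat} (U : 'M[R]_(d, n)) (a : 'rV[R]_d) :
  U *m U^T = 1%:M -> enorm (a *m U) = enorm a.
Proof. by move=> UU; rewrite !enormE dot_iso. Qed.

Lemma enorm_proj {R : realType} {n d : nat} (U : 'M[R]_(d, n)) (x : 'rV[R]_n) :
  U *m U^T = 1%:M -> enorm (x *m U^T) <= enorm x.
Proof.
move=> UU; have h : dot (x *m U^T) (x *m U^T) = dot (x *m U^T *m U) x by rewrite [RHS]dot_mulmx.
have := dot_le (x *m U^T *m U) x; rewrite -h -enorm2 (enorm_iso _ UU) expr2.
have [->|h0] := eqVneq (enorm (x *m U^T)) 0; first by rewrite enorm_ge0.
by rewrite ler_pM2l // lt_def h0 enorm_ge0.
Qed.

Section Haar.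
Context {R : realType} {n k : nat} (nu : probability (borel_subspace R n) R).
Hypothesis hnu : grassmannian_haar k nu.
Notation G := (borel_subspace R n).

Lemma row_space_in m (A : 'M[R]_(m, n)) (v : 'rV[R]_n) :
  (v \in (row_space A : {vspace 'rV[R]_n})) <-> exists c : 'rV[R]_m, v = c *m A.
Proof.
split=> [|[c ->]]; last first.
  rewrite mulmx_sum_row; apply: rpred_sum => i _; apply: rpredZ; apply: memv_span.
  by apply: map_f; rewrite mem_enum.
move=> /(coord_span (X := in_tuple [seq row i A | i <- enum 'I_m])) /=.
set t := in_tuple _ => hv.
have st : size [seq row i A | i <- enum 'I_m] = m by rewrite size_map size_enum_ord.
exists (\row_(i < m) coord t (cast_ord (esym st) i) v).
rewrite {1}hv mulmx_sum_row (reindex (cast_ord (esym st))) /=; last first.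
  by exists (cast_ord st) => i _; rewrite ?cast_ordK ?cast_ordKV.
apply: eq_bigr => i _; rewrite !mxE; congr (_ *: _).
by rewrite (nth_map i) ?size_enum_ord // nth_ord_enum.
Qed.

Lemma row_space_dim m (A : 'M[R]_(m, n)) : row_free A -> \dim (row_space A : {vspace 'rV[R]_n}) = m.
Proof.
move=> fA; have [U [UU hU]] := onb (row_space A : {vspace 'rV[R]_n}).
set d := \dim _ in U UU hU *.
have h1 : (A <= U)%MS.
  apply/row_subP => i; apply/submxP; exists (row i A *m U^T); apply/esym/hU/row_space_in.
  by exists (delta_mx 0 i); rewrite -rowE.
have h2 : (U <= A)%MS.
  apply/row_subP => i; apply/submxP; apply/row_space_in/hU.
  by rewrite rowE -!mulmxA (mulmxA U) UU mul1mx.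
have rU : \rank U = d.
  apply/eqP; rewrite -/(row_free U); apply/row_freeP; by exists U^T.
have := mxrankS h1; have := mxrankS h2; rewrite rU (eqP fA) => a b.
by apply/eqP; rewrite eqn_leq a b.
Qed.

(** Full row rank is the union over [B] of the open conditions [det (A B) != 0]. *)
Lemma open_row_free m : open [set A : 'M[R]_(m, n) | row_free A].
Proof.
have -> : [set A : 'M[R]_(m, n) | row_free A] = \bigcup_(B in [set: 'M[R]_(n, m)])
    [set A : 'M[R]_(m, n) | \det (A *m B) != 0].
  apply/seteqP; split => [A /row_freeP[B AB]|A [B _ /=]].
    by exists B => //=; rewrite AB det1 oner_eq0.
  rewrite -unitfE -/(_ \in unitmx) => hu; apply/row_freeP.
  by exists (B *m invmx (A *m B)); rewrite mulmxA mulmxV.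
apply: bigcup_open => B _.
have c1 i j : continuous (fun A : 'M[R]_(m, n) => (A *m B) i j).
  have -> : (fun A : 'M[R]_(m, n) => (A *m B) i j) = (fun A => \sum_l A i l * B l j).
    by apply/funext => A; rewrite mxE.
  apply: continuous_sumr => l A.
  exact: (@continuousM _ _ (fun A : 'M[R]_(m, n) => A i l) (cst (B l j)) A
    (@coord_continuous R m n i l A) (@cst_continuous _ _ _ A)).
have hp (sg : 'I_m -> 'I_m) : continuous (fun A : 'M[R]_(m, n) => \prod_i (A *m B) i (sg i)).
  move=> A; elim: (index_enum _) => [|i l ih].
    by under eq_fun do rewrite big_nil; exact: cst_continuous.
  under eq_fun do rewrite big_cons.
  exact: (continuousM (@c1 _ _ A) ih).
have c2 : continuous (fun A : 'M[R]_(m, n) => \det (A *m B)).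
  apply: continuous_sumr => s A.
  exact: (continuousM (@cst_continuous _ _ _ A) (@hp _ A)).
apply: (@open_comp _ _ (fun A : 'M[R]_(m, n) => \det (A *m B)) [set x | x != 0]) => [A _|]; first exact: c2.
have -> : [set x : R | x != 0] = [set x | x < 0] `|` [set x | 0 < x].
  by apply/seteqP; split => x /=; rewrite neq_lt => /orP.
by apply: openU; [exact: open_lt|exact: open_gt].
Qed.

Lemma grassmannian_meas : measurable (grassmannian k : set G).
Proof.
apply: sub_sigma_algebra => m.
have [->|mk] := eqVneq m k.
  have -> : [set A : 'M[R]_(k, n) | row_free A /\ grassmannian k (row_space A)] = [set A | row_free A].
    by apply/seteqP; split => [A []//|A /= fA]; split => //; exact: row_space_dim.
  exact: open_row_free.
have -> : [set A : 'M[R]_(m, n) | row_free A /\ grassmannian k (row_space A)] = set0; last exact: open0.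
rewrite -subset0 => A [fA]; rewrite /grassmannian /= row_space_dim // => /eqP; by rewrite (negbTE mk).
Qed.

(** The strict inequality makes this set open in the charts by full-rank matrices, hence
    measurable. *)
Definition near_space (e : R) (y : 'rV[R]_n) : set G :=
  [set F | exists2 v, v \in (F : {vspace 'rV[R]_n}) & enorm (y - v) < e * enorm y].

Lemma near_space_meas e y : measurable (near_space e y).
Proof.
apply: sub_sigma_algebra => m.
have -> : [set A : 'M[R]_(m, n) | row_free A /\ near_space e y (row_space A)] =
  [set A | row_free A] `&` \bigcup_(c in [set: 'rV[R]_m]) [set A : 'M[R]_(m, n) | enorm (y - c *m A) < e * enorm y].
  apply/seteqP; split => A [fA].
    by move=> [v /row_space_in[c ->] hc]; split => //; exists c.
  by move=> [c _ hc]; split => //; exists (c *m A) => //; apply/row_space_in; exists c.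
apply: openI; first exact: open_row_free.
apply: bigcup_open => c _.
pose f (A : 'M[R]_(m, n)) := \sum_j (y ord0 j - \sum_i c ord0 i * A i j) ^+ 2.
have -> : [set A : 'M[R]_(m, n) | enorm (y - c *m A) < e * enorm y] = (fun A => Num.sqrt (f A)) @^-1` [set x | x < e * enorm y].
  by apply/seteqP; split => A /=; congr (is_true (_ < _)); rewrite /enorm; congr Num.sqrt; apply: eq_bigr => j _; rewrite !mxE.
apply: open_comp => [A _|]; last exact: open_lt.
apply: (@continuous_comp _ _ _ f Num.sqrt); last exact: sqrt_continuous.
apply: continuous_sumr => j B.
have h : {for B, continuous (fun A : 'M[R]_(m, n) => y ord0 j - \sum_i c ord0 i * A i j)}.
  apply: (@continuousB _ _ _ (cst (y ord0 j)) (fun A : 'M[R]_(m, n) => \sum_i c ord0 i * A i j) B); first exact: cst_continuous.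
  apply: continuous_sumr => i B'.
  exact: (@continuousM _ _ (cst (c ord0 i)) (fun A : 'M[R]_(m, n) => A i j) B' (@cst_continuous _ _ _ B') (@coord_continuous R m n i j B')).
by under eq_fun do rewrite expr2; exact: (continuousM h h).
Qed.

Lemma near_space_orth (e : R) (y : 'rV[R]_n) (g : 'M[R]_n) : g *m g^T = 1%:M ->
  pr nu (near_space e (y *m g)) = pr nu (near_space e y).
Proof.
move=> gg; rewrite /pr -(hnu.2 g _ gg (near_space_meas e (y *m g))); congr (fine (nu _)).
apply/seteqP; split => F.
  move=> [_ /memv_imgP[v vF ->]]; rewrite lfunE /= -mulmxBl !enorm_iso // => h.
  by exists v.
move=> [v vF h]; exists (v *m g); last by rewrite -mulmxBl !enorm_iso.
by apply/memv_imgP; exists v => //; rewrite lfunE.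
Qed.

Lemma near_spaceZ (e a : R) (y : 'rV[R]_n) : a != 0 -> near_space e (a *: y) = near_space e y.
Proof.
move=> a0; have ap : 0 < `|a| by rewrite normr_gt0.
apply/seteqP; split => F [v vF h].
  exists (a^-1 *: v); first exact: rpredZ.
  have -> : y - a^-1 *: v = a^-1 *: (a *: y - v) by rewrite scalerBr scalerA mulVf // scale1r.
  rewrite enormZ normfV ltr_pdivrMl //; move: h; by rewrite enormZ mulrCA.
exists (a *: v); first exact: rpredZ.
by rewrite -scalerBr !enormZ mulrCA ltr_pM2l.
Qed.

(** The reflection exchanging [y] and [z]; it makes the orthogonal group transitive on spheres. *)
Lemma householder (y z : 'rV[R]_n) : enorm y = enorm z ->
  exists2 g : 'M[R]_n, g *m g^T = 1%:M & y *m g = z.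
Proof.
move=> yz; have yz2 : dot y y = dot z z by rewrite -!enorm2 yz.
have [->|ne] := eqVneq y z; first by exists 1%:M; rewrite ?trmx1 mulmx1.
pose u := y - z; have u0 : dot u u != 0 by rewrite dot_eq0 subr_eq0.
have uu : u *m u^T = (dot u u)%:M by apply/matrixP => i j; rewrite !ord1 -dot_mx !mxE mulr1n.
pose t := 2 / dot u u.
pose g : 'M[R]_n := 1%:M - t *: (u^T *m u).
have gT : g^T = g by rewrite /g linearB linearZ /= trmx1 trmx_mul trmxK.
exists g.
  rewrite gT /g; set Q := u^T *m u.
  have QQ : Q *m Q = dot u u *: Q.
    by rewrite /Q mulmxA -(mulmxA u^T) uu mul_mx_scalar scalemxAl.
  have -> : (1%:M - t *: Q) *m (1%:M - t *: Q) = 1%:M - t *: Q - t *: Q + (t * t) *: (Q *m Q).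
    rewrite mulmxBr mulmx1 mulmxBl mul1mx -scalemxAl -scalemxAr scalerA.
    by rewrite opprB addrCA addrC.
  rewrite QQ scalerA; have -> : t * t * dot u u = 2 * t by rewrite /t; field.
  by apply/matrixP => i j; rewrite !mxE; ring.
have yu : y *m u^T = (dot y u)%:M by apply/matrixP => i j; rewrite !ord1 -dot_mx !mxE mulr1n.
rewrite /g mulmxBr mulmx1 -scalemxAr mulmxA yu mul_scalar_mx scalerA.
have -> : t * dot y u = 1.
  rewrite /t; have -> : dot y u = dot u u / 2; last by field.
  by rewrite /u !dotBr !dotBl yz2 (dotC z y); field.
by rewrite scale1r /u opprB addrC subrK.
Qed.

Lemma near_space_const (e : R) (y z : 'rV[R]_n) : y != 0 -> z != 0 ->
  pr nu (near_space e y) = pr nu (near_space e z).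
Proof.
move=> y0 z0; pose a := enorm z / enorm y.
have ey : 0 < enorm y by rewrite enorm_gt0. have ez : 0 < enorm z by rewrite enorm_gt0.
have a0 : 0 < a by rewrite divr_gt0.
rewrite -(near_spaceZ e y (lt0r_neq0 a0)).
have [|g gg <-] := @householder (a *: y) z; last by rewrite near_space_orth.
by rewrite enormZ gtr0_norm // divfK // gt_eqF.
Qed.

(** A net of the ball of radius [2 rr] in [F] at scale [s = e * rr] has at most [(72 / e) ^ k]
    points, and each lattice point near [F] is within [2 s] of one of them; a ball of radius [2 s]
    holds at most [(48 e L) ^ n] lattice points. *)
Lemma near_count (F : {vspace 'rV[R]_n}) (e : R) (L : nat) : \dim F = k -> 0 < e -> e <= 1 -> 1 <= 2 * e * L%:R ->
  (#|[set z : {ffun 'I_n -> 'I_L} | `[< near_space e (\row_i (z i).+1%:R) F >]]%SET|%:R : R)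
    <= (72 / e) ^+ k * (48 * e * L%:R) ^+ n.
Proof.
move=> dF e0 e1 eL; have [U [UU hU]] := onb F; rewrite dF in U UU hU.
have L0 : 0 < L%:R :> R.
  by rewrite lt_def ler0n andbT; apply/eqP => h; move: eL; rewrite h mulr0; lra.
pose y (z : {ffun 'I_n -> 'I_L}) : 'rV[R]_n := \row_i (z i).+1%:R.
have yL z : enorm (y z) <= Num.sqrt n%:R * L%:R.
  by apply: enorm_le_sup => // i; rewrite mxE ger0_norm // ler_nat.
have [n0|n0] := posnP n.
  set S := [set z | _]%SET.
  suff -> : #|S| = 0%N.
    by rewrite mulr_ge0 // exprn_ge0 ?divr_ge0 ?mulr_ge0 // ltW.
  apply/eqP; rewrite cards_eq0; apply/eqP/setP => z; rewrite !inE; apply/asboolP => -[v _].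
  have h : enorm (y z) <= 0 by apply: le_trans (yL z) _; rewrite n0 sqrtr0 mul0r.
  have := enorm_ge0 (y z - v).
  have : e * enorm (y z) <= 0 by rewrite mulr_ge0_le0 // ltW.
  by rewrite -/(y z) => h1 h2 h3; have := le_lt_trans h2 (lt_le_trans h3 h1); rewrite ltxx.
pose rr : R := Num.sqrt n%:R * L%:R.
have sn : 0 < Num.sqrt (n%:R : R) by rewrite sqrtr_gt0 ltr0n.
have r0 : 0 < rr by rewrite mulr_gt0.
pose s := e * rr; have s0 : 0 < s by rewrite mulr_gt0.
have [||l [_ _ hl1 hl2]] := @sep_cover R k s [set c | enorm (c - 0) <= 2 * rr] ((72 / e) ^+ k).
  exact: ltW.
  move=> l hl lb; apply: le_trans (pack_size s0 _ hl lb) _; first by rewrite mulr_ge0 // ltW.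
  have -> : 2 * rr / s = 2 / e by rewrite /s; field; rewrite !gt_eqF.
  have ei : 1 <= e^-1 by rewrite invf_ge1.
  by apply: lerXn2r; rewrite ?nnegrE; lra.
pose S := [set z : {ffun 'I_n -> 'I_L} | `[< near_space e (y z) F >]]%SET.
pose T (p : 'rV[R]_k) := [set z : {ffun 'I_n -> 'I_L} | enorm (y z - p *m U) <= 2 * s]%SET.
have hS z : z \in S -> exists2 p, p \in l & z \in T p.
  rewrite inE => /asboolP[v vF hv].
  have hv2 : enorm (y z - v) <= s.
    by apply: le_trans (ltW hv) _; rewrite /s; apply: ler_wpM2l; [exact: ltW|exact: yL].
  have [|p pl hp] := hl2 (v *m U^T).
    rewrite /= subr0; apply: le_trans (enorm_proj _ UU) _.
    have := enormBC v (y z); have := enormD (v - y z) (y z); rewrite subrK.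
    have := yL z; rewrite -/rr; have : s <= rr by rewrite /s ler_piMl // ltW.
    by lra.
  exists p => //; rewrite inE; apply: le_trans (enorm_dist _ v _) _.
  have : enorm (v - p *m U) <= s by rewrite -{1}((hU v).1 vF) -mulmxBl enorm_iso.
  by lra.
have hT p : (#|T p|%:R : R) <= (48 * e * L%:R) ^+ n.
  have -> : 48 * e * L%:R = 24 * (2 * e * L%:R) by ring.
  apply: (@lattice_count R n L _ (fun i => (p *m U) ord0 i - 1)) => // z; rewrite inE => hz.
  have h1 := sum_abs_le (p *m U - y z); rewrite enormBC in h1.
  apply: le_trans (_ : \sum_i `|(p *m U - y z) ord0 i| <= _).
    by apply: ler_sum => i _; rewrite le_eqVlt; apply/orP; left; apply/eqP; rewrite !mxE -natr1; congr `|_|; ring.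
  apply: le_trans h1 _; apply: le_trans (_ : Num.sqrt n%:R * (2 * s) <= _); first by rewrite ler_pM2l.
  rewrite /s /rr le_eqVlt; apply/orP; left; apply/eqP; have := sqr_sqrtr (ler0n R n).
  by move: (Num.sqrt _) => q <-; ring.
apply: le_trans (_ : \sum_(p <- l) #|T p|%:R <= _); last first.
  apply: le_trans (ler_sum _ (fun p _ => hT p)) _.
  rewrite big_const_seq count_predT iter_addr_0.
  have h48 : 0 <= (48 * e * L%:R) ^+ n by rewrite exprn_ge0 // !mulr_ge0 // ltW.
  apply: le_trans (_ : (size l)%:R * (48 * e * L%:R) ^+ n <= _); last by rewrite ler_wpM2r.
  by rewrite [leRHS]mulr_natl.
rewrite -/S -sum1_card natr_sum.
under [leRHS]eq_bigr do rewrite -sum1_card natr_sum.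
rewrite [leRHS](exchange_big_dep xpredT) //= [leLHS]big_mkcond; apply: ler_sum => z _.
case: ifP => [/hS[p pl pT]|_]; last by apply: sumr_ge0.
by rewrite (big_rem p pl) /= pT lerDl; apply: sumr_ge0.
Qed.

(** Invariance gives all nonzero vectors the same probability, so it can be averaged over the
    lattice points of a cube, where [near_count] bounds the number of hits for each fixed [F]. The
    factor [L ^ n] cancels; [L >= 1 / e] is what the count asks for. Coordinates start at 1 to
    exclude the zero vector. *)
Lemma haar_bound (e : R) (y : 'rV[R]_n) : 0 < e -> e <= 1 -> y != 0 ->
  pr nu (near_space e y) <= (72 / e) ^+ k * (48 * e) ^+ n.
Proof.
move=> e0 e1 y0.
pose L := (Num.truncn e^-1).+1.
have eL : 1 <= e * L%:R.
  have /truncn_itv/andP[_] : 0 <= e^-1 by rewrite invr_ge0 ltW.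
  by rewrite -/L => h; rewrite -[leLHS](mulfV (lt0r_neq0 e0)) ler_pM2l // ltW.
have L0 : 0 < L%:R :> R by rewrite ltr0n.
pose yz (z : {ffun 'I_n -> 'I_L}) : 'rV[R]_n := \row_i (z i).+1%:R.
have n0 : (0 < n)%N.
  case: n y y0 => // y; by rewrite (_ : y = 0) ?eqxx //; apply/rowP => -[].
have yz0 z : yz z != 0.
  apply/eqP => /rowP /(_ (Ordinal n0)); rewrite !mxE => /eqP; by rewrite pnatr_eq0.
have mN e' y' := near_space_meas e' y'.
have mNG z : measurable (near_space e (yz z) `&` grassmannian k).
  by apply: measurableI => //; exact: grassmannian_meas.
have h := @sum_pr_le _ _ _ nu _ (index_enum {ffun 'I_n -> 'I_L}) (fun=> 1) (fun z => near_space e (yz z) `&` grassmannian k)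
   ((72 / e) ^+ k * (48 * e * L%:R) ^+ n) mNG.
have hG : pr nu (~` grassmannian k) = 0.
  by rewrite prC /pr ?hnu.1 ?subrr //; exact: grassmannian_meas.
have hz z : 1 * pr nu (near_space e (yz z) `&` grassmannian k) = pr nu (near_space e y).
  rewrite mul1r (near_space_const e y0 (yz0 z)) [RHS](prDI nu (mN e (yz z)) grassmannian_meas).
  have -> : pr nu (near_space e (yz z) `\` grassmannian k) = 0; last by rewrite add0r.
  apply/eqP; rewrite eq_le pr_ge0 andbT -hG; apply: pr_mono => [||F []//].
    by apply: measurableD => //; exact: grassmannian_meas.
  by apply: measurableC; exact: grassmannian_meas.
rewrite (eq_bigr _ (fun z _ => hz z)) in h.
rewrite sumr_const cardT -cardE card_ffun !card_ord in h.
have hK : (72 / e) ^+ k * (48 * e * L%:R) ^+ n = (72 / e) ^+ k * (48 * e) ^+ n * L%:R ^+ n by rewrite [(48 * e * L%:R) ^+ n]exprMn mulrA.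
rewrite hK in h.
have Ln : 0 < L%:R ^+ n :> R by rewrite exprn_gt0.
have hp : pr nu (near_space e y) *+ L ^ n = pr nu (near_space e y) * L%:R ^+ n by rewrite -natrX mulr_natr.
rewrite hp in h.
rewrite -(ler_pM2r Ln); apply: h => F.
have [dF|dF] := pselect (\dim (F : {vspace 'rV[R]_n}) = k); last first.
  rewrite big1 => [|z _]; first by rewrite !mulr_ge0 ?exprn_ge0 ?divr_ge0 ?(ltW e0) // mulr_ge0 // ltW.
  rewrite indicE mul1r; case: (boolP (F \in _)) => // /set_mem[_]; by rewrite /grassmannian /=.
have := near_count (e := e) (L := L) dF e0 e1.
rewrite hK => hn; apply: le_trans (hn _); last by rewrite -mulrA; lra.
rewrite -sum1_card natr_sum [leRHS]big_mkcond /=; apply: ler_sum => z _.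
rewrite mul1r indicE inE; case: (boolP (F \in _)) => [/set_mem[h1 _]|_] /=.
  by rewrite (_ : `[< near_space e (\row_i (z i).+1%:R) F >] = true) //; apply/asboolP.
by case: ifP.
Qed.
End Haar.

(** * The upper bound *)

(** Valid for arbitrary functions, since the integral of a nonnegative function is a supremum over
    the simple functions below it. It is applied to the radius of a section as a function of the
    subspace. *)
Lemma ge0_le_integral_any {R : realType} {d : measure_display} {T : measurableType d}
  (mu : {measure set T -> \bar R}) (D : set T) (f g : T -> \bar R) :
  (forall x, D x -> 0 <= f x)%E -> (forall x, D x -> f x <= g x)%E ->
  (\int[mu]_(x in D) f x <= \int[mu]_(x in D) g x)%E.
Proof.
move=> f0 fg; rewrite !ge0_integralE => [|x Dx|//]; last exact: le_trans (f0 _ Dx) (fg _ Dx).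
apply: le_ereal_sup => _ [h hf <-]; exists h => // x.
apply: le_trans (hf x) _; rewrite /patch; case: ifP => // /set_mem; exact: fg.
Qed.

Section Sample.
Context {R : realType} {d d' : measure_display} {T : measurableType d} {T' : measurableType d'}.
Variables (P : probability T R) (mu : probability T' R) (N : nat) (x : 'I_N -> {mfun T >-> T'}).
Hypothesis hx : forall i, has_law P (x i) mu.

Lemma law_pr i (A : set T') : measurable A -> pr P (x i @^-1` A) = pr mu A.
Proof. by move=> mA; rewrite /pr -(hx i mA). Qed.

Lemma preim_meas i (A : set T') : measurable A -> measurable (x i @^-1` A).
Proof. by move=> mA; rewrite -[X in measurable X]setTI; exact: measurable_funPT. Qed.

Lemma sample_all (A : set T') (e : R) : measurable A -> pr mu (~` A) <= e ->
  measurable [set w | forall i, A (x i w)] /\ 1 - N%:R * e <= pr P [set w | forall i, A (x i w)].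
Proof.
move=> mA he.
have -> : [set w | forall i, A (x i w)] = ~` \big[setU/set0]_(i <- index_enum 'I_N) (x i @^-1` (~` A)).
  apply/seteqP; split => [w hw|w hw i].
    by rewrite /= -bigcup_seq => -[i _]; apply; exact: hw.
  by apply: contrapT => h; apply: hw; rewrite -bigcup_seq; exists i => //=; rewrite mem_index_enum.
have mi i : measurable (x i @^-1` (~` A)) by apply: preim_meas; exact: measurableC.
have mU : measurable (\big[setU/set0]_(i <- index_enum 'I_N) (x i @^-1` (~` A))).
  by apply: measurable_bigsetU => i _.
split; first exact: measurableC.
rewrite prC // lerD2l lerN2; apply: le_trans (pr_bigU_le P (fun i _ => mi i)) _.
apply: le_trans (_ : \sum_(i < N) e <= _); last by rewrite sumr_const card_ord mulr_natl.
by apply: ler_sum => i _; rewrite law_pr //; exact: measurableC.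
Qed.
End Sample.

Section SymHull.
Context {R : realType} {n N : nat} (x : 'I_N -> 'rV[R]_n).

Definition crosshull : set 'rV[R]_n :=
  [set y | exists2 c : 'I_N -> R, \sum_i `|c i| <= 1 & y = \sum_i c i *: x i].

Lemma sym_hull_sub : sym_hull x `<=` crosshull.
Proof.
apply: smallest_sub.
  move=> y z l /set_mem[c hc ->] /set_mem[c' hc' ->]; apply/mem_set.
  have l0 : 0 <= l%:num by []. have l1 : l%:num <= 1 by [].
  exists (fun i => l%:num * c i + (1 - l%:num) * c' i); last first.
    rewrite /conv /= !scaler_sumr -big_split /=; apply: eq_bigr => i _.
    by rewrite [RHS]scalerDl !scalerA.
  apply: le_trans (_ : \sum_i (l%:num * `|c i| + (1 - l%:num) * `|c' i|) <= _).
    apply: ler_sum => i _; apply: le_trans (ler_normD _ _) _.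
    by rewrite !normrM (ger0_norm l0) [`|1 - _|]ger0_norm // subr_ge0.
  rewrite big_split /= -!mulr_sumr.
  move: hc hc' l0 l1; move: (\sum_i _) (\sum_i _) (l%:num) => p q t; nra.
have h (e : R) i : `|e| <= 1 -> crosshull (e *: x i).
  move=> e1; exists (fun j => (j == i)%:R * e).
    rewrite (bigD1 i) //= eqxx mul1r big1 ?addr0 // => j /negbTE ->; by rewrite mul0r normr0.
  rewrite (bigD1 i) //= eqxx mul1r big1 ?addr0 // => j /negbTE ->; by rewrite mul0r scale0r.
move=> _ [[i _ <-]|[i _ <-]].
  by have := h 1 i; rewrite scale1r normr1; apply.
by have := h (-1) i; rewrite scaleN1r normrN normr1; apply.
Qed.

Lemma crosshull_norm (t : R) y : (forall i, enorm (x i) <= t) -> 0 <= t -> crosshull y -> enorm y <= t.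
Proof.
move=> ht t0 [c hc ->]; apply: le_trans (enorm_sum _ _ _) _.
apply: le_trans (_ : \sum_i `|c i| * t <= _).
  by apply: ler_sum => i _; rewrite enormZ ler_wpM2l.
by rewrite -mulr_suml ler_piMl.
Qed.

Lemma sym_hull0 (i : 'I_N) : sym_hull x 0.
Proof.
move=> A [cA hA]; have h1 : A (x i) by apply: hA; left; exists i.
have h2 : A (- x i) by apply: hA; right; exists i.
have := cA (x i) (- x i) (@Itv01 R 2^-1 ltac:(by rewrite invr_ge0) ltac:(by lra)) (mem_set h1) (mem_set h2).
rewrite /conv /= scalerN -scalerBl.
have -> : 2^-1 - unstable.onem 2^-1 = 0 :> R by rewrite /unstable.onem; lra.
by rewrite scale0r => /set_mem.
Qed.

Let xo (i : option 'I_N) : 'rV[R]_n := oapp x 0 i.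

(** Positive and negative parts of the coefficients; the origin added in [xo] takes up the missing
    weight. *)
Lemma crosshull_diff y : crosshull y -> exists a b, [/\ hull xo a, [set - z | z in hull xo] b & y = a + b].
Proof.
move=> [c hc ->].
have key (e : 'I_N -> R) : (forall i, 0 <= e i) -> \sum_i e i <= 1 -> hull xo (\sum_i e i *: x i).
  move=> e0 e1; exists (fun i => oapp e (1 - \sum_i e i) i); split.
  - by case=> [i|] //=; rewrite subr_ge0.
  - rewrite (bigD1 None) //= (reindex_omap Some id) /=; last by case.
    by under [X in _ + X]eq_bigl do rewrite eqxx; rewrite subrK.
  - rewrite (bigD1 None) //= scaler0 add0r (reindex_omap Some id) /=; last by case.
    by apply: eq_bigl => i; rewrite eqxx.
exists (\sum_i Order.max (c i) 0 *: x i), (- \sum_i Order.max (- c i) 0 *: x i); split.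
- apply: key => [i|]; first by rewrite le_max lexx orbT.
  apply: le_trans hc; apply: ler_sum => i _; by rewrite ge_max ler_norm normr_ge0.
- exists (\sum_i Order.max (- c i) 0 *: x i) => //; apply: key => [i|]; first by rewrite le_max lexx orbT.
  apply: le_trans hc; apply: ler_sum => i _; by rewrite ge_max normr_ge0 -normrN ler_norm.
- rewrite -sumrB; apply: eq_bigr => i _; rewrite -scalerBl; congr (_ *: _).
  have [h|h] := leP 0 (c i).
    by rewrite max_r ?subr0 // oppr_le0.
  by rewrite max_l ?sub0r ?opprK // oppr_ge0 ltW.
Qed.

Lemma crosshull_cover (M s : R) : covers (hull xo) M s -> covers crosshull (M * M) (s + s).
Proof. by move=> h; apply: (covers_add h (covers_opp h)) => y; exact: crosshull_diff. Qed.
End SymHull.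

Section UpperDtilde.
Context {R : realType} {n k : nat} (nu : probability (borel_subspace R n) R).
Hypothesis hnu : grassmannian_haar k nu.
Notation G := (borel_subspace R n).

(** If [F] avoids the neighbourhoods of all nonzero centres, a point of [K] in [F] with centre [p]
    gives [e |p| <= r], hence norm at most [r + r / e]. On the remaining [F] the trivial bound [t]
    is used. *)
Lemma Dtilde_le (K : set 'rV[R]_n) (l : seq 'rV[R]_n) (r e t : R) :
  K 0 -> 0 < e -> e <= 1 -> 0 <= r -> 0 <= t ->
  (forall x, K x -> exists2 p, p \in l & enorm (x - p) <= r) ->
  (forall x, K x -> enorm x <= t) ->
  (Dtilde k nu K <= (2 * r / e + t * ((size l)%:R * ((72 / e) ^+ k * (48 * e) ^+ n)))%:E)%E.
Proof.
move=> K0 e0 e1 r0 t0 hl ht.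
(* The centre 0 is set aside: the Haar bound concerns nonzero vectors, and a point within [r] of 0
   is short anyway. *)
pose l' := [seq p <- l | p != 0].
pose bad : set G := \big[setU/set0]_(p <- l') near_space e p.
have mbad : measurable bad by apply: measurable_bigsetU => p _; exact: near_space_meas.
have hbad : pr nu bad <= (size l)%:R * ((72 / e) ^+ k * (48 * e) ^+ n).
  apply: le_trans (pr_bigU_le nu (fun p _ => near_space_meas e p)) _.
  apply: le_trans (_ : \sum_(p <- l') ((72 / e) ^+ k * (48 * e) ^+ n) <= _).
    rewrite !big_seq; apply: ler_sum => p; rewrite mem_filter => /andP[p0 _]; exact: haar_bound.
  rewrite big_const_seq count_predT iter_addr_0 -[leLHS]mulr_natl ler_wpM2r //.
    by rewrite mulr_ge0 // exprn_ge0 ?divr_ge0 ?mulr_ge0 // ltW.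
  by rewrite ler_nat size_filter count_size.
pose g (F : G) : R := 2 * r / e + t * \1_bad F.
have re0 : 0 <= 2 * r / e by rewrite divr_ge0 ?mulr_ge0 // ltW.
have g0 F : 0 <= g F by rewrite addr_ge0 // mulr_ge0 // indicE.
have hg : bmf g by apply: bmfD; [exact: bmf_cst|apply: bmfZ; exact: bmf_indic].
have mG := @grassmannian_meas R n k.
apply: le_trans (_ : (\int[nu]_(F in @grassmannian R n k) (g F)%:E <= _)%E); last first.
  apply: le_trans (_ : (\int[nu]_F (g F)%:E <= _)%E).
    apply: ge0_subset_integral => //; first by apply/measurable_EFinP; exact: hg.1.
    by move=> F _; rewrite lee_fin.
  rewrite -ExE // lee_fin ExD; [|exact: bmf_cst|by apply: bmfZ; exact: bmf_indic].
  rewrite Ex_cst ExZ; last exact: bmf_indic.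
  by rewrite Ex_indic // lerD2l ler_wpM2l.
apply: ge0_le_integral_any => F _.
  by apply: ereal_sup_ubound; exists 0; [split => //=; exact: mem0v|rewrite enorm0].
apply: ub_ereal_sup => _ [x [Kx /= xF] <-]; rewrite lee_fin /g indicE.
have [/set_mem|hF] := boolP (F \in bad).
  by move=> _; rewrite mulr1; apply: le_trans (ht _ Kx) _; rewrite lerDr.
rewrite mulr0 addr0; have [p pl hp] := hl x Kx.
have rle : r <= r / e by rewrite ler_pdivlMr // ler_piMr.
have hxp := enormD (x - p) p; rewrite subrK in hxp.
have [p0|p0] := eqVneq p 0.
  move: hxp; rewrite p0 enorm0 addr0 => hxp; rewrite p0 in hp.
  by rewrite -mulrA; lra.
have : e * enorm p <= r.
  apply: le_trans hp; rewrite leNgt; apply/negP => h; move/negP: hF; apply; apply/mem_set.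
  rewrite /bad -bigcup_seq; exists p; first by rewrite /= mem_filter p0.
  by exists x => //; rewrite enormBC.
rewrite mulrC -ler_pdivlMr // => h.
by rewrite -mulrA; lra.
Qed.
End UpperDtilde.

(** * Covering the random hull and the resulting bound *)

Section UpperBound.
Context {R : realType}.

(** [ub_L] is the cost per unit exponent of the balls in [cover_bound], [ub_S] their radius factor,
    enlarged so that the ball about the added origin is heavy too; [ub_A] and [ub_D] are the
    exponent and the radius factor for one hull in [sample_cover]. *)
Definition ub_L : R := - ln (cv_th : R).
Definition ub_S : R := cv_s + 2.
Definition ub_A : R := 4 * ub_L + 2 * ub_S + 19.
Definition ub_D : R := 1 + 4 * ub_S.
Lemma ub_L_gt0 : 0 < ub_L.
Proof. by rewrite /ub_L oppr_gt0 ln_lt0 // cv_th_gt0 cv_th_lt1. Qed.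
Lemma ub_S_gt0 : 0 < ub_S.
Proof. by rewrite /ub_S addr_gt0 // cv_s_gt0. Qed.
Lemma cv_th_le4 : cv_th <= 4^-1 :> R.
Proof.
have e1 : 1 <= expR 1 :> R by rewrite -[leLHS]expR0 ler_expR.
have h : 1 <= 4 * (expR 1 * 72) ^+ 2 :> R by nra.
rewrite /cv_th; have : (4 * (expR 1 * 72) ^+ 2 : R) ^- 2 <= 1.
  by rewrite invf_le1 ?exprn_gt0 // ?exprn_ege1 //; lra.
lra.
Qed.
Lemma cv_thX (k : nat) : cv_th ^+ k = expR (- (k%:R * ub_L)) :> R.
Proof.
have -> : - (k%:R * ub_L) = k%:R * ln cv_th by rewrite /ub_L; ring.
by rewrite expRM_natl lnK // posrE cv_th_gt0.
Qed.
Lemma cube_ge (v : R) : 2 <= v -> 2 * v + 2 <= v ^+ 3.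
Proof.
move=> v2; have h : 4 <= v * v by nra.
have v0 : 0 <= v by lra.
have := ler_wpM2l v0 h; rewrite !exprS expr0 mulr1; lra.
Qed.
Lemma expR_ge2n (n : nat) : 2 ^+ n <= expR n%:R :> R.
Proof.
have -> : expR n%:R = expR 1 ^+ n :> R by have := expRM_natl n (1 : R); rewrite mulr1.
by apply: lerXn2r; rewrite ?nnegrE ?expR_ge0 //; have := expR_ge1Dx (1 : R); lra.
Qed.

Context {n : nat} (mu : probability (borel_rV R n) R).
Notation V := (borel_rV R n).
Hypotheses (iso : isotropic mu) (lc : log_concave mu) (n2 : (2 <= n)%N).
Let n0 : (0 < n)%N. Proof. exact: ltnW. Qed.
Let nR : 2 <= n%:R :> R. Proof. by rewrite (ler_nat _ 2). Qed.
Let sn := Num.sqrt (n%:R : R).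
Let sn0 : 0 < sn. Proof. by rewrite sqrtr_gt0 ltr0n. Qed.

Lemma sample_cover (N K : nat) (q : R) (x : 'I_N -> 'rV[R]_n) : q = ln N%:R -> 1 <= q -> q <= n%:R ->
  ln n%:R <= 2 * q -> K%:R <= 4 * q -> (0 < K)%N ->
  (forall i, cv_th ^+ K <= pr mu (nball (x i) (cv_s * sn))) ->
  covers (crosshull x) (expR (2 * ub_A * n%:R)) (2 * ub_D * Num.sqrt q).
Proof.
move=> qE q1 qn lnq Kq K0 hx.
have q0 : 0 < q by lra.
have N0 : 0 < N%:R :> R by rewrite ltNge; apply/negP => h; move: q1; rewrite qE ln0 //; lra.
have NE : N%:R = expR q :> R by rewrite qE lnK // posrE.
(* [m q <= n <= 2 m q] balances the cost [m q] of a sum against [n] and makes the Maurey radius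
   [sqrt (n / m)] of order [sqrt q]. *)
pose m := Num.truncn (n%:R / q).
have nq1 : 1 <= n%:R / q by rewrite ler_pdivlMr // mul1r.
have m0 : (0 < m)%N by rewrite /m truncn_gt0.
have /truncn_itv/andP[ma mb] : 0 <= n%:R / q by lra.
rewrite -/m -natr1 in ma mb; move: ma mb; rewrite ler_pdivlMr // ltr_pdivrMr // => ma mb.
have m1 : 1 <= m%:R :> R by rewrite (ler_nat _ 1).
have mc : n%:R <= 2 * m%:R * q by nra.
pose xo (i : option 'I_N) : 'rV[R]_n := oapp x 0 i.
have L0 := ub_L_gt0; have S0 := ub_S_gt0; have s0 := @cv_s_gt0 R.
have sq0 : 0 < Num.sqrt q by rewrite sqrtr_gt0.
have r0 : 0 < ub_S * sn by rewrite mulr_gt0.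
have hxo i : expR (- (K%:R * ub_L)) <= pr mu (nball (xo i) (ub_S * sn)).
  rewrite -cv_thX; case: i => [i|] /=.
    apply: le_trans (hx i) _; apply: pr_mono; try exact: nball_borel.
    by move=> y; rewrite /nball /= => /le_trans; apply; rewrite ler_pM2r // /ub_S lerDl.
  apply: le_trans (_ : 4^-1 <= _).
    apply: le_trans cv_th_le4; case: (K) K0 => // K' _; rewrite exprS ler_piMr ?(ltW cv_th_gt0) //.
    by rewrite exprn_ile1 // ltW ?cv_th_gt0 ?cv_th_lt1.
  have -> : nball 0 (ub_S * sn) = ~` [set y : V | ub_S * sn < enorm (y : 'rV[R]_n)].
    by apply/seteqP; split => y; rewrite /nball /= subr0 leNgt => /negP.
  rewrite prC; last by apply: (measurable_gt_set (f := fun y : V => enorm (y : 'rV[R]_n))); exact: enorm_borel.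
  have := cheb_norm iso r0.
  have : n%:R / (ub_S * sn) ^+ 2 <= 4^-1 :> R.
    rewrite exprMn sqr_sqrtr // ler_pdivrMr ?mulr_gt0 ?exprn_gt0 ?ltr0n // mulrA ler_peMl //.
    by rewrite /ub_S expr2; nra.
  lra.
have := ball_mean_cover lc n0 m0 sq0 r0 hxo => h.
have -> : 2 * ub_D * Num.sqrt q = ub_D * Num.sqrt q + ub_D * Num.sqrt q by ring.
have -> : expR (2 * ub_A * n%:R) = expR (ub_A * n%:R) * expR (ub_A * n%:R) by rewrite -expRD; congr expR; ring.
apply: crosshull_cover; apply: covers_le h; last first.
  have -> : ub_D * Num.sqrt q = Num.sqrt q + 4 * ub_S * Num.sqrt q by rewrite /ub_D; ring.
  rewrite lerD2l.
  have sm : 0 < Num.sqrt (m%:R : R) by rewrite sqrtr_gt0; lra.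
  rewrite ler_pdivrMr //.
  have : sn <= 2 * Num.sqrt q * Num.sqrt m%:R.
    have -> : 2 = Num.sqrt (2 ^+ 2) :> R by rewrite sqrtr_sqr ger0_norm.
    rewrite -!sqrtrM ?sqr_ge0 ?mulr_ge0 ?sqr_ge0 ?(ltW q0) // ler_wsqrtr //.
    by rewrite expr2; nra.
  by move=> h; have := ler_wpM2l (ltW S0) h; lra.
have -> : ub_A * n%:R = 5 * n%:R + ((4 * ub_L * n%:R + 12 * n%:R + 2 * ub_S * n%:R) + 2 * n%:R).
  by rewrite /ub_A; ring.
rewrite [leRHS]expRD [X in _ <= _ * X]expRD.
have e24 : (24 : R) ^+ n <= expR (5 * n%:R).
  apply: le_trans (_ : (2 ^+ 5) ^+ n <= _).
    by apply: lerXn2r; rewrite ?nnegrE ?exprn_ge0 // -natrX ler_nat.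
  by rewrite -exprM; have := expR_ge2n (5 * n); rewrite natrM.
rewrite -[leLHS]mulrA; apply: ler_pM => //; rewrite ?exprn_ge0 ?mulr_ge0 ?expR_ge0 ?exprn_ge0 //.
apply: ler_pM; rewrite ?expR_ge0 ?exprn_ge0 //; last first.
  rewrite card_option card_ord.
  apply: le_trans (_ : (N%:R ^+ 2) ^+ m <= _).
    apply: lerXn2r; rewrite ?nnegrE ?sqr_ge0 // -natr1 NE expr2.
    by have := expR_ge1Dx q; nra.
  rewrite NE -expRM_natl -expRM_natl ler_expR; nra.
rewrite ler_expR; apply: lerD.
  rewrite mulrDr; apply: lerD.
    have h1 : m%:R * K%:R <= 4 * n%:R :> R by have := ler0n R K; nra.
    by rewrite mulrA [4 * _ * _]mulrAC ler_pM2r.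
  have hl : ln (2 * m%:R + 2) <= 6 * q.
    apply: le_trans (_ : 3 * ln n%:R <= _); last by lra.
    have -> : 3 * ln n%:R = ln (n%:R ^+ 3) :> R by rewrite lnXn ?ltr0n // mulr_natl.
    have n3 : 0 < n%:R ^+ 3 :> R by rewrite exprn_gt0 // ltr0n.
    have m2 : 0 < 2 * m%:R + 2 :> R by lra.
    rewrite ler_ln ?posrE //.
    have mn : m%:R <= n%:R :> R by nra.
    by apply: le_trans (cube_ge nR); lra.
  have m00 : 0 <= 2 * m%:R :> R by rewrite mulr_ge0.
  have := ler_wpM2l m00 hl; have : m%:R * q <= n%:R by [].
  by lra.
have rp : 0 < m%:R * Num.sqrt q / n%:R by rewrite divr_gt0 ?mulr_gt0 ?ltr0n.
rewrite ler_pdivrMr //.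
have -> : 2 * ub_S * n%:R * (m%:R * Num.sqrt q / n%:R) = 2 * ub_S * m%:R * Num.sqrt q by field; rewrite gt_eqF ?ltr0n.
rewrite -[leRHS]ger0_norm; last by rewrite !mulr_ge0 ?(ltW S0) ?(ltW sq0).
rewrite -sqrtr_sqr ler_wsqrtr // !exprMn !sqr_sqrtr ?ler0n ?(ltW q0) //.
have Sp : 0 < ub_S ^+ 2 by rewrite exprn_gt0.
have : m%:R * n%:R <= 2 * m%:R ^+ 2 * q :> R by rewrite expr2; nra.
move=> h'; have := ler_wpM2l (ltW Sp) h'; lra.
Qed.

Context {k : nat} (nu : probability (borel_subspace R n) R).
Hypotheses (hnu : grassmannian_haar k nu) (kn : (k <= n)%N).

Lemma upper_core (b : R) (N : nat) (q : R) (d : measure_display) (T : measurableType d)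
  (P : probability T R) (x : 'I_N -> {mfun T >-> V}) :
  0 < b < 1 -> k%:R <= b * n%:R -> q = ln N%:R -> 1 <= q -> q <= n%:R -> ln n%:R <= 2 * q ->
  (forall i, has_law P (x i) mu) ->
  with_prob_ge P (1 - N%:R^-1)
    [set w | (Dtilde k nu (sym_hull (fun i => x i w)) <=
      ((4 * ub_D * expR ((2 * ub_A + 15) / (1 - b)) + 2) * Num.sqrt q)%:E)%E].
Proof.
move=> /andP[b0 b1] kb qE q1 qn lnq hx.
have q0 : 0 < q by lra.
have N0 : 0 < N%:R :> R by rewrite ltNge; apply/negP => h; move: q1; rewrite qE ln0 //; lra.
have NE : N%:R = expR q :> R by rewrite qE lnK // posrE.
(* [K > 2 q + 1] makes light points rarer than [N ^ -2 / 2], enough for a union bound over the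
   sample. *)
pose K := (Num.truncn (2 * q + 1)).+1.
have /truncn_itv/andP[Ka Kb] : 0 <= 2 * q + 1 by lra.
have K1 : 2 * q + 1 < K%:R by [].
have K2 : K%:R <= 4 * q by rewrite /K -natr1; lra.
(* Chebyshev at this radius costs [N ^ -2 / 4]; this is the trivial bound on the norms in the
   hull. *)
pose t : R := 2 * N%:R * sn.
have t0 : 0 < t by rewrite !mulr_gt0.
pose A := [set y : V | cv_th ^+ K <= pr mu (nball y (cv_s * sn))] `&` [set y : V | enorm (y : 'rV[R]_n) <= t].
have mA : measurable A.
  apply: measurableI; last exact: ball0_borel.
  by apply: measurable_ge_set; exact: pr_nball_meas.
have hA : pr mu (~` A) <= N%:R^-1 ^+ 2.
  have -> : ~` A = [set y : V | pr mu (nball y (cv_s * sn)) < cv_th ^+ K] `|` [set y : V | t < enorm (y : 'rV[R]_n)].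
    rewrite /A setCI; congr (_ `|` _); apply/seteqP; split => y /=; rewrite ltNge; by [move/negP|move/negP].
  apply: le_trans (prU_le _ _ _) _.
  - by apply: measurable_lt_set; exact: pr_nball_meas.
  - by apply: (measurable_gt_set (f := fun y : V => enorm (y : 'rV[R]_n))); exact: enorm_borel.
  apply: le_trans (lerD (cover_bound iso lc n0 (ltn0Sn _)) (cheb_norm iso t0)) _.
  have -> : n%:R / t ^+ 2 = N%:R^-1 ^+ 2 / 4.
    rewrite /t !exprMn sqr_sqrtr //; have nn : 0 < n%:R :> R by rewrite ltr0n.
    by field; rewrite !gt_eqF.
  have : expR (- K%:R) <= N%:R^-1 ^+ 2 / 2 :> R.
    apply: le_trans (_ : expR (- (2 * q)) * expR (- 1) <= _).
      by rewrite -expRD ler_expR; lra.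
    have -> : N%:R^-1 ^+ 2 = expR (- (2 * q)) by rewrite NE -expRN -expRM_natl; congr expR; ring.
    rewrite ler_pM2l ?expR_gt0 // expRN lef_pV2 ?posrE ?expR_gt0 //.
    by have := expR_ge1Dx (1 : R); lra.
  have := sqr_ge0 (N%:R^-1 : R); lra.
have [mE pE] := sample_all hx mA hA.
exists [set w | forall i, A (x i w)]; split => //; last first.
  rewrite prE // lee_fin; apply: le_trans pE; rewrite lerD2l lerN2 expr2 mulrA mulfV ?mul1r // gt_eqF //.
move=> w hw /=.
have [l [sl hl]] := sample_cover qE q1 qn lnq K2 (ltn0Sn _) (fun i => (hw i).1).
have Nn : (0 < N)%N by move: N0; rewrite ltr0n.
(* [e ^ (n - k)] has to beat the [exp (2 ub_A n)] centres, the factor [72 * 48 <= 2 ^ 12] per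
   dimension, and the trivial bound [t], for which [exp (- 3 n)] is kept. *)
set e := expR (- ((2 * ub_A + 15) / (1 - b))).
have L0 := ub_L_gt0; have S0 := ub_S_gt0.
have D0 : 0 < ub_D by rewrite /ub_D; lra.
have A0 : 0 < ub_A by rewrite /ub_A; lra.
have e1 : e <= 1.
  by rewrite -[leRHS]expR0 ler_expR oppr_le0 divr_ge0 ?subr_ge0 ?(ltW b1) //; lra.
have sq1 : 1 <= Num.sqrt q by rewrite -sqrtr1 ler_wsqrtr.
have r0 : 0 <= 2 * ub_D * Num.sqrt q by rewrite !mulr_ge0 ?(ltW D0) //; lra.
have hc : forall y, sym_hull (fun i => x i w) y -> exists2 p, p \in l & enorm (y - p) <= 2 * ub_D * Num.sqrt q.
  by move=> y /sym_hull_sub /hl.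
have ht : forall y, sym_hull (fun i => x i w) y -> enorm y <= t.
  move=> y /sym_hull_sub; apply: crosshull_norm; last exact: ltW.
  by move=> i; exact: (hw i).2.
have h := Dtilde_le hnu (@sym_hull0 R n N (fun i => x i w) (Ordinal Nn)) (expR_gt0 _) e1 r0 (ltW t0) hc ht.
apply: le_trans h _; rewrite lee_fin -/e.
have -> : 2 * (2 * ub_D * Num.sqrt q) / e = 4 * ub_D * expR ((2 * ub_A + 15) / (1 - b)) * Num.sqrt q.
  by rewrite /e expRN invrK; ring.
rewrite [leRHS]mulrDl lerD2l; apply: le_trans (_ : 2 <= _); last by rewrite ler_peMr.
have h1 : (72 / e) ^+ k * (48 * e) ^+ n <= expR (- ((2 * ub_A + 3) * n%:R)).
  have e0 : 0 < e by exact: expR_gt0.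
  have -> : (48 * e) ^+ n = (48 * e) ^+ k * (48 * e) ^+ (n - k) by rewrite -exprD subnKC.
  rewrite mulrA -exprMn; have -> : 72 / e * (48 * e) = 72 * 48 by field; rewrite gt_eqF.
  rewrite [(48 * e) ^+ _]exprMn mulrA.
  apply: le_trans (_ : (2 ^+ 12) ^+ n * e ^+ (n - k) <= _).
    apply: ler_wpM2r; first by rewrite exprn_ge0 // ltW.
    have -> : (2 ^+ 12) ^+ n = (2 ^+ 12) ^+ k * (2 ^+ 12) ^+ (n - k) :> R by rewrite -exprD subnKC.
    by apply: ler_pM; rewrite ?exprn_ge0 //; apply: lerXn2r; rewrite ?nnegrE -?natrX -?natrM ?ler_nat.
  have -> : - ((2 * ub_A + 3) * n%:R) = 12 * n%:R + - ((2 * ub_A + 15) * n%:R) by ring.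
  rewrite expRD; apply: ler_pM; rewrite ?exprn_ge0 ?(ltW e0) //.
    by rewrite -exprM; have := expR_ge2n (12 * n); rewrite natrM.
  rewrite -expRM_natl ler_expR mulrN lerN2 mulrA ler_pdivlMr ?subr_gt0 // natrB //.
  nra.
apply: le_trans (_ : t * (expR (2 * ub_A * n%:R) * expR (- ((2 * ub_A + 3) * n%:R))) <= _).
  by rewrite ler_pM2l //; apply: ler_pM => //; rewrite mulr_ge0 // exprn_ge0 ?divr_ge0 ?mulr_ge0 ?(ltW (expR_gt0 _)).
rewrite -expRD; have -> : 2 * ub_A * n%:R + - ((2 * ub_A + 3) * n%:R) = - (n%:R + (n%:R + n%:R)) by ring.
rewrite !opprD !expRD /t NE.
have -> : 2 * expR q * sn * (expR (- n%:R) * (expR (- n%:R) * expR (- n%:R))) = 2 * (expR q * expR (- n%:R)) * (sn * expR (- n%:R)) * expR (- n%:R) by ring.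
have h2 : expR q * expR (- n%:R) <= 1 by rewrite -expRD -[leRHS]expR0 ler_expR; lra.
have h3 : sn * expR (- n%:R) <= 1.
  rewrite expRN ler_pdivrMr ?expR_gt0 // mul1r; have := expR_ge1Dx (n%:R : R).
  have : sn <= n%:R; last by lra.
  rewrite -[leRHS]ger0_norm // -sqrtr_sqr ler_wsqrtr // expr2; nra.
have h4 : expR (- n%:R) <= 1 :> R by rewrite -[leRHS]expR0 ler_expR; lra.
have g2 : 0 <= expR q * expR (- n%:R) by rewrite mulr_ge0 ?expR_ge0.
have g3 : 0 <= sn * expR (- n%:R) by rewrite mulr_ge0 ?expR_ge0 ?(ltW sn0).
have g4 := expR_ge0 (- n%:R : R).
have h5 : (expR q * expR (- n%:R)) * (sn * expR (- n%:R)) * expR (- n%:R) <= 1 * 1 * 1.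
  by apply: ler_pM => //; [exact: mulr_ge0|apply: ler_pM].
lra.
Qed.
End UpperBound.

Section PartOne.
Context {R : realType}.

Lemma part_one (b : R) : 0 < b < 1 -> exists2 cb : R, 0 < cb &
    forall (n k N : nat) (mu : probability (borel_rV R n) R)
      (nu : probability (borel_subspace R n) R)
      (d : measure_display) (T : measurableType d) (P : probability T R)
      (x : 'I_N -> {mfun T >-> borel_rV R n}),
    (2 <= n)%N -> (1 <= k <= n)%N ->
    isotropic mu -> log_concave mu ->
    independent_rvs P x -> (forall i, has_law P (x i) mu) ->
    grassmannian_haar k nu ->
    k%:R <= b * n%:R ->
    ((n ^ 2 <= N)%N -> N%:R <= expR (Num.sqrt n%:R : R) ->
      with_prob_ge P (1 - N%:R^-1)
        [set w | (Dtilde k nu (sym_hull (fun i => x i w)) <=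
                  (cb * Num.sqrt (ln N%:R))%:E)%E]) /\
    (expR (Num.sqrt n%:R : R) <= N%:R -> N%:R <= expR (n%:R : R) ->
      with_prob_ge P (1 - N%:R^-1)
        [set w | (Dtilde k nu (sym_hull (fun i => x i w)) <=
                  (cb * Num.sqrt (ln N%:R) * ln (ln N%:R) ^+ 2)%:E)%E]).
Proof.
move=> b01; pose c0 : R := 4 * ub_D * expR ((2 * ub_A + 15) / (1 - b)) + 2.
have S0 := @ub_S_gt0 R.
have c00 : 0 < c0.
  by rewrite /c0 addr_gt0 // !mulr_gt0 ?expR_gt0 // /ub_D; lra.
(* In the second range [ln N >= sqrt n >= 5/4], so [f] bounds [(ln ln N) ^ 2] from below and its
   inverse enters the constant. *)
pose f : R := (ln (5 / 4)) ^+ 2; have f0 : 0 < f by rewrite exprn_gt0 // ln_gt0 //; lra.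
exists (c0 * (1 + f^-1)); first by rewrite mulr_gt0 // addr_gt0 // invr_gt0.
move=> n k N mu nu d T P x n2 /andP[k1 kn] iso lc _ hx hnu kb.
have nR : 2 <= n%:R :> R by rewrite (ler_nat _ 2).
have sn54 : 5 / 4 <= Num.sqrt (n%:R : R).
  rewrite -[leLHS]ger0_norm; last by lra.
  by rewrite -sqrtr_sqr ler_wsqrtr // expr2; lra.
have snn : Num.sqrt (n%:R : R) <= n%:R.
  rewrite -[leRHS]ger0_norm // -sqrtr_sqr ler_wsqrtr // expr2; nra.
have lnn : ln (n%:R : R) <= 2 * Num.sqrt n%:R.
  have -> : ln (n%:R : R) = 2 * ln (Num.sqrt n%:R).
    by rewrite mulrC mulr_natr -lnXn ?sqr_sqrtr // sqrtr_gt0; lra.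
  rewrite ler_pM2l //; apply: le_trans (_ : ln (1 + Num.sqrt n%:R) <= _).
    by rewrite ler_ln ?posrE; lra.
  by apply: le_ln1Dx; lra.
split=> h1 h2.
  have Nn : n%:R ^+ 2 <= N%:R :> R by rewrite -natrX ler_nat.
  have N0 : 0 < N%:R :> R by nra.
  have q2 : 2 * ln n%:R <= ln N%:R :> R.
    by rewrite mulrC mulr_natr -lnXn ?ltr0n ?(ltnW n2) // ler_ln ?posrE ?exprn_gt0 //; lra.
  have ln2 : 2^-1 <= ln (n%:R : R).
    apply: le_trans (_ : ln 2 <= _); last by rewrite ler_ln ?posrE //; lra.
    rewrite -(ler_expR) lnK ?posrE //.
    have h : expR 2^-1 * expR 2^-1 <= 4 :> R.
      rewrite -expRD; have -> : 2^-1 + 2^-1 = 1 :> R by lra.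
      exact: expR1_le4.
    by have := expR_gt0 (2^-1 : R); nra.
  have qn : ln (N%:R : R) <= n%:R.
    apply: le_trans snn; by rewrite -ler_expR lnK ?posrE.
  have := upper_core iso lc n2 hnu kn (N := N) b01 kb erefl _ qn _ hx.
  move=> /(_ ltac:(lra) ltac:(lra)) [E [mE sE pE]]; exists E; split => // w /sE /= h.
  apply: le_trans h _; rewrite lee_fin -/c0 ler_wpM2r ?sqrtr_ge0 // ler_peMr ?(ltW c00) //.
  by rewrite lerDl invr_ge0 ltW.
have N0 : 0 < N%:R :> R by apply: lt_le_trans h1; exact: expR_gt0.
have q1 : Num.sqrt n%:R <= ln N%:R :> R by rewrite -ler_expR lnK ?posrE.
have qn : ln (N%:R : R) <= n%:R by rewrite -ler_expR lnK ?posrE.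
have := upper_core iso lc n2 hnu kn (N := N) b01 kb erefl _ qn _ hx.
move=> /(_ ltac:(lra) ltac:(lra)) [E [mE sE pE]]; exists E; split => // w /sE /= h.
apply: le_trans h _; rewrite lee_fin -/c0 -!mulrA ler_pM2l //.
rewrite [leRHS]mulrCA ler_peMr ?sqrtr_ge0 //.
have ff : f <= ln (ln (N%:R : R)) ^+ 2.
  rewrite /f ler_sqr ?nnegrE ?ln_ge0 //; try lra.
  by rewrite ler_ln ?posrE; lra.
apply: le_trans (_ : (1 + f^-1) * f <= _); last by rewrite ler_pM2l // addr_gt0 // invr_gt0.
rewrite mulrDl mul1r mulVf ?gt_eqF //; lra.
Qed.
End PartOne.

(** * Quadratic forms and separation *)

Section Spectral.
Context {R : realType} {n : nat} (Q : 'M[R]_n).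
Hypotheses (Qs : Q^T = Q) (Qp : forall v : 'rV[R]_n, 0 <= dot (v *m Q) v).
Notation B v w := (dot (v *m Q) w).

Lemma formC v w : B v w = B w v.
Proof. by rewrite dotC -{1}Qs -dot_mulmx. Qed.

Lemma form_add h p : B h p = 0 -> B (h + p) (h + p) = B h h + B p p.
Proof. by move=> hp; rewrite mulmxDl dotDl !dotDr (formC p h) hp; ring. Qed.

Lemma form_continuous : continuous (fun v : 'rV[R]_n => B v v).
Proof.
apply: continuous_sumr => i x.
apply: (@continuousM _ _ (fun v : 'rV[R]_n => (v *m Q) ord0 i) (fun v : 'rV[R]_n => v ord0 i)); last exact: coord_continuous.
have -> : (fun v : 'rV[R]_n => (v *m Q) ord0 i) = (fun v => \sum_j v ord0 j * Q j i).
  by apply/funext => v; rewrite mxE.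
apply: continuous_sumr => j v.
exact: (@continuousM _ _ (fun v : 'rV[R]_n => v ord0 j) (cst (Q j i)) v
  (@coord_continuous R 1 n ord0 j v) (@cst_continuous _ _ _ v)).
Qed.

(** The first-order condition at a minimum. *)
Lemma quad_lin0 (a c : R) : (forall t, 0 <= 2 * t * a + t ^+ 2 * c) -> a = 0.
Proof.
move=> h; have c0 : 0 <= c by have := h 1; have := h (-1); rewrite sqrrN expr1n; lra.
have := h (- (a / (c + 1))); rewrite sqrrN => h1.
have cp : 0 < c + 1 by lra.
have e : 2 * - (a / (c + 1)) * a + (a / (c + 1)) ^+ 2 * c = - (a ^+ 2 * ((c + 2) / (c + 1) ^+ 2)).
  by field; rewrite gt_eqF.
rewrite e oppr_ge0 in h1.
have q0 : 0 < (c + 2) / (c + 1) ^+ 2 by rewrite divr_gt0 ?exprn_gt0 //; lra.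
rewrite pmulr_lle0 // in h1.
by apply/eqP; rewrite -sqrf_eq0 eq_le h1 sqr_ge0.
Qed.

(** As long as the form is below [kap] somewhere orthogonal to the rows of [U], a unit minimiser of
    the form there is appended; vanishing first variation keeps the orthogonal complement of the
    rows invariant. [m] bounds the number of rows that can still be added. *)
Lemma spectral_aux (kap : R) m d (U : 'M[R]_(d, n)) : (n < d + m)%N ->
  U *m U^T = 1%:M -> (forall i, B (row i U) (row i U) <= kap) ->
  (forall h : 'rV[R]_n, h *m U^T = 0 -> h *m Q *m U^T = 0) ->
  exists d' (U' : 'M[R]_(d', n)), [/\ U' *m U'^T = 1%:M, forall i, B (row i U') (row i U') <= kap,
    forall h : 'rV[R]_n, h *m U'^T = 0 -> h *m Q *m U'^T = 0 &
    forall h : 'rV[R]_n, h *m U'^T = 0 -> kap * dot h h <= B h h].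
Proof.
elim: m d U => [|m ih] d U nd UU hU hQ.
  have : row_free U by apply/row_freeP; exists U^T.
  by rewrite /row_free => /eqP rU; have := rank_leq_col U; rewrite rU leqNgt -(addn0 d) nd.
have [hfin|] := pselect (forall h : 'rV[R]_n, h *m U^T = 0 -> kap * dot h h <= B h h).
  by exists d, U.
move=> /existsNP[h0 /not_implyP[h0U /negP]]; rewrite -ltNge => h0k.
have h00 : h0 != 0 by apply/eqP => h; move: h0k; rewrite h dot0l mulr0 mul0mx dot0l ltxx.
pose S := [set v : 'rV[R]_n | v *m U^T = 0 /\ dot v v = 1].
have cdot : continuous (fun v : 'rV[R]_n => dot v v).
  by have := @sqnorm_continuous R n 0; under eq_fun do rewrite subr0.
have cS : compact S.
  apply: (@compact_ball _ _ _ 0 1); last first.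
    by move=> v [_ v1]; rewrite subr0 enormE v1 sqrtr1.
  have -> : S = [set v | dot v v <= 1] `&` [set v | 1 <= dot v v] `&`
      \bigcap_(i in setT) ([set v : 'rV[R]_n | dot v (row i U) <= 0] `&` [set v : 'rV[R]_n | 0 <= dot v (row i U)]).
    have hz v i : (v *m U^T) ord0 i = dot v (row i U).
      by rewrite mxE; apply: eq_bigr => j _; rewrite !mxE.
    apply/seteqP; split => v.
      move=> [vU v1]; split; first by split => /=; rewrite v1.
      by move=> i _ /=; rewrite -hz vU mxE lexx.
    move=> [[/= v1 v2] vU]; split; last by apply/eqP; rewrite eq_le v1 v2.
    apply/rowP => i; rewrite hz mxE; have [a b] := vU i I; by apply/eqP; rewrite eq_le a b.
  apply: closedI; first by apply: closedI; [exact: closed_le|exact: closed_ge].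
  apply: closed_bigI => i _; apply: closedI; [apply: closed_le|apply: closed_ge]; exact: dot_continuous.
have eh0 : 0 < enorm h0 by rewrite enorm_gt0.
have Sh : S ((enorm h0)^-1 *: h0).
  split; first by rewrite -scalemxAl h0U scaler0.
  by rewrite dotZl dotZr -enorm2; field; rewrite gt_eqF.
have [u /set_mem[uU u1] hmin] := @compact_EVT_min _ R (fun v : 'rV[R]_n => B v v) S (ex_intro _ _ Sh) cS
   (continuous_subspaceT form_continuous).
have hmin' v : v *m U^T = 0 -> B u u * dot v v <= B v v.
  move=> vU; have [->|v0] := eqVneq v 0; first by rewrite dot0l mulr0 mul0mx dot0l.
  have ev : 0 < enorm v by rewrite enorm_gt0.
  have Sv : S ((enorm v)^-1 *: v).
    split; first by rewrite -scalemxAl vU scaler0.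
    by rewrite dotZl dotZr -enorm2; field; rewrite gt_eqF.
  have := hmin _ (mem_set Sv); rewrite -scalemxAl dotZl dotZr mulrA -invfM -expr2 enorm2.
  by rewrite ler_pdivlMl ?dot_eq0 // 1?mulrC // lt_def dot_ge0 dot_eq0 v0.
have lk : B u u <= kap.
  have := hmin' _ h0U => h; have p0 : 0 < dot h0 h0 by rewrite lt_def dot_ge0 dot_eq0 h00.
  by rewrite -(ler_pM2r p0); apply: le_trans h (ltW h0k).
have hst w : w *m U^T = 0 -> dot u w = 0 -> B u w = 0.
  move=> wU uw; apply: (@quad_lin0 _ (B w w - B u u * dot w w)) => t.
  have := hmin' (u + t *: w); rewrite mulmxDl uU -scalemxAl wU scaler0 addr0 => /(_ erefl).
  rewrite !mulmxDl -!scalemxAl !dotDl !dotDr !dotZl !dotZr (dotC w u) uw u1 (formC w u); lra.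
pose U' : 'M[R]_(1 + d, n) := col_mx u U.
have uu : u *m u^T = 1%:M by apply/matrixP => i j; rewrite !ord1 -dot_mx u1 mxE eqxx.
apply: (ih (1 + d)%N U').
- by rewrite add1n addSnnS.
- rewrite /U' tr_col_mx mul_col_mx !mul_mx_row uu UU uU.
  have -> : U *m u^T = 0 by apply: trmx_inj; rewrite trmx_mul trmxK uU trmx0.
  by rewrite [RHS]scalar_mx_block.
- move=> i; case: (splitP i) => [j ij|j ij].
    have -> : row i U' = u; last by [].
    have -> : i = lshift d j by exact: val_inj.
    by rewrite rowKu; apply/rowP => l; rewrite mxE ord1.
  have -> : i = rshift 1 j by exact: val_inj.
  by rewrite rowKd.
- move=> h; rewrite /U' tr_col_mx !mul_mx_row => /eqP; rewrite row_mx_eq0 => /andP[/eqP hu /eqP hU'].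
  rewrite hQ //; have uh : dot u h = 0 by rewrite dotC dot_mx hu mxE.
  have -> : h *m Q *m u^T = 0; last by rewrite row_mx0.
  by apply/matrixP => i j; rewrite !ord1 -dot_mx formC hst // mxE.
Qed.

Lemma spectral (kap : R) : exists d (U : 'M[R]_(d, n)), [/\ U *m U^T = 1%:M,
  forall i, B (row i U) (row i U) <= kap &
  forall v : 'rV[R]_n, kap * dot (v - v *m U^T *m U) (v - v *m U^T *m U) <= B v v].
Proof.
have [||||d [U [UU hU hQ hB]]] := @spectral_aux kap n.+1 0 (0 : 'M[R]_(0, n)).
- by rewrite add0n.
- by apply/matrixP => -[].
- by case.
- by move=> h _; apply/matrixP => i [].
exists d, U; split => // v.
set p := v *m U^T *m U; set h := v - p.
have hU0 : h *m U^T = 0 by rewrite mulmxBl -!mulmxA UU mulmx1 subrr.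
have hp : B h p = 0 by rewrite dotC dot_mulmx hQ // dot0r.
have -> : B v v = B (h + p) (h + p) by rewrite subrK.
by rewrite (form_add hp); have := Qp p; have := hB h hU0; lra.
Qed.
End Spectral.

Section Separation.
Context {R : realType} {k : nat}.

(** If [p] stayed farther than [e] from [H], take [h1] almost nearest to [p] and a point [v] of [H]
    at least as far as [p] in direction [p - h1]. Moving from [h1] towards [v] by the fraction [l]
    lowers the squared distance by more than the defect allowed by the choice of [h1]. *)
Lemma conv_approx (H : set 'rV[R]_k) (L : R) (p : 'rV[R]_k) : H !=set0 ->
  (forall x, H x -> enorm x <= L) ->
  (forall x y l, H x -> H y -> 0 < l < 1 -> H (l *: x + (1 - l) *: y)) ->
  (forall u, exists2 v, H v & dot u p <= dot u v) ->
  forall e, 0 < e -> exists2 h, H h & enorm (p - h) <= e.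
Proof.
move=> [h0 Hh0] hL hc hs e e0; apply: contrapT => /forall2NP hn.
have hn' h : H h -> e < enorm (p - h) by move=> Hh; rewrite ltNge; apply/negP; case: (hn h).
have L0 : 0 <= L by apply: le_trans (hL _ Hh0); exact: enorm_ge0.
have e2 : 0 < e ^+ 2 by rewrite exprn_gt0.
(* Small enough for the second-order term [4 l L ^ 2] to be at most half of [e ^ 2]. *)
pose l := e ^+ 2 / (2 * (e ^+ 2 + 8 * L ^+ 2)).
have d0 : 0 < e ^+ 2 + 8 * L ^+ 2 by rewrite ltr_pwDl // mulr_ge0 // sqr_ge0.
have l0 : 0 < l by rewrite divr_gt0 // mulr_gt0.
have l1 : l < 1.
  by rewrite ltr_pdivrMr ?mulr_gt0 // mul1r; have := sqr_ge0 L; lra.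
have l2 : 4 * l * L ^+ 2 <= e ^+ 2 / 2.
  have -> : 4 * l * L ^+ 2 = e ^+ 2 / 2 * (4 * L ^+ 2 / (e ^+ 2 + 8 * L ^+ 2)) by rewrite /l; field; rewrite gt_eqF.
  by apply: ler_piMr; [exact/ltW/divr_gt0|rewrite ler_pdivrMr // mul1r; lra].
pose E := [set enorm (p - h) ^+ 2 | h in H].
have hE : has_inf E.
  split; first by exists (enorm (p - h0) ^+ 2), h0.
  by exists 0 => _ [h _ <-]; exact: sqr_ge0.
have le0 : 0 < l * e ^+ 2 / 2 by rewrite divr_gt0 // mulr_gt0.
have [_ [h1 Hh1 <-] h1i] := inf_adherent le0 hE.
have [v Hv hv] := hs (p - h1).
have Hm := hc v h1 l Hv Hh1; rewrite l0 l1 in Hm.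
have : inf E <= enorm (p - (l *: v + (1 - l) *: h1)) ^+ 2.
  by apply: ge_inf; [exact: hE.2|exists (l *: v + (1 - l) *: h1) => //; exact: Hm].
have -> : p - (l *: v + (1 - l) *: h1) = (p - h1) - l *: (v - h1).
  by rewrite scalerBl scale1r scalerBr; apply/rowP => i; rewrite !mxE; ring.
have hg := hn' h1 Hh1.
have hw : enorm (v - h1) <= 2 * L by apply: le_trans (enormB _ _) _; have := hL _ Hv; have := hL _ Hh1; lra.
have hw2 : dot (v - h1) (v - h1) <= 4 * L ^+ 2.
  rewrite -enorm2; have -> : 4 * L ^+ 2 = (2 * L) ^+ 2 by rewrite exprMn; congr (_ * _); rewrite -natrX.
  by rewrite ler_sqr ?nnegrE ?enorm_ge0 // mulr_ge0.
have hg2 : e ^+ 2 < dot (p - h1) (p - h1) by rewrite -enorm2 ltr_sqr ?nnegrE ?enorm_ge0 // ltW.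
have hgw : dot (p - h1) (p - h1) <= dot (p - h1) (v - h1) by rewrite !dotBr; move: hv; lra.
move: h1i; rewrite !enorm2.
move: (p - h1) (v - h1) hw2 hg2 hgw => g w hw2 hg2 hgw h1i.
rewrite !dotBl !dotBr !dotZl !dotZr (dotC w g) => h2.
have h3 : 2 * l * dot g w <= l * e ^+ 2 / 2 + l ^+ 2 * dot w w.
  by rewrite expr2; lra.
have h4 : l ^+ 2 * dot w w <= l ^+ 2 * (4 * L ^+ 2) by rewrite ler_pM2l // exprn_gt0.
have h5 : l ^+ 2 * (4 * L ^+ 2) <= l * (e ^+ 2 / 2).
  by rewrite expr2 -mulrA ler_pM2l // mulrCA mulrA.
have h6 : l * e ^+ 2 < l * dot g w by rewrite ltr_pM2l // (lt_le_trans hg2).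
lra.
Qed.
End Separation.

Section CauchySchwarz.
Context {R : realType} {d : measure_display} {T : measurableType d} (P : probability T R).

Lemma Ex_CS (f g : T -> R) : bmf f -> bmf g ->
  Ex P (fun x => f x * g x) ^+ 2 <= Ex P (fun x => f x ^+ 2) * Ex P (fun x => g x ^+ 2).
Proof.
move=> hf hg.
have hff : bmf (fun x => f x ^+ 2) by have := bmfM hf hf; under eq_fun do rewrite -expr2.
have hgg : bmf (fun x => g x ^+ 2) by have := bmfM hg hg; under eq_fun do rewrite -expr2.
have hfg := bmfM hf hg.
set a := Ex P (fun x => f x * g x); set p := Ex P (fun x => f x ^+ 2); set q := Ex P (fun x => g x ^+ 2).
have key (s t : R) : 0 <= s ^+ 2 * p - 2 * s * t * a + t ^+ 2 * q.
  have : 0 <= Ex P (fun x => (s * f x - t * g x) ^+ 2) by apply: Ex_ge0 => x; exact: sqr_ge0.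
  have -> : (fun x => (s * f x - t * g x) ^+ 2) =
     (fun x => (s ^+ 2 * f x ^+ 2 - (2 * s * t) * (f x * g x)) + t ^+ 2 * g x ^+ 2).
    by apply/funext => x; ring.
  rewrite ExD; [|by apply: bmfB; exact: bmfZ|exact: bmfZ].
  by rewrite ExB; [rewrite !ExZ|exact: bmfZ|exact: bmfZ].
have p0 : 0 <= p by apply: Ex_ge0 => x; exact: sqr_ge0.
have [pz|pp] := eqVneq p 0.
  have h : a = 0.
    apply/eqP; rewrite -oppr_eq0; apply/eqP; apply: (@quad_lin0 R (- a) q) => t.
    by have := key 1 t; rewrite pz; lra.
  by rewrite h expr0n pz mul0r.
have := key a p; have -> : a ^+ 2 * p - 2 * a * p * a + p ^+ 2 * q = p * (p * q - a ^+ 2) by ring.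
by rewrite pmulr_rge0 ?subr_ge0 // lt_def pp.
Qed.
End CauchySchwarz.

(** * Random signs and Talagrand's inequality *)

Section Signs.
Context {R : realType}.
Implicit Types (f g : seq R -> R).

(* [Es m f] is the expectation of f over a uniform random sign sequence of length m. *)
Fixpoint Es (m : nat) f : R :=
  if m is m'.+1 then (Es m' (fun s => f (1 :: s)) + Es m' (fun s => f (-1 :: s))) / 2 else f [::].

Definition issign (m : nat) (s : seq R) := (size s == m) && all (fun a => (a == 1) || (a == -1)) s.

Lemma Es_cst m (c : R) : Es m (fun=> c) = c.
Proof. by elim: m => //= m ->; lra. Qed.
Lemma EsD m f g : Es m (fun s => f s + g s) = Es m f + Es m g.
Proof. by elim: m f g => //= m ih f g; rewrite !ih; lra. Qed.
Lemma EsZ m (c : R) f : Es m (fun s => c * f s) = c * Es m f.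
Proof. by elim: m f => //= m ih f; rewrite !ih; lra. Qed.
Lemma Es_sum m (I : Type) (r : seq I) (F : I -> seq R -> R) :
  Es m (fun s => \sum_(i <- r) F i s) = \sum_(i <- r) Es m (F i).
Proof.
elim: r => [|i r ih].
  have -> : (fun s => \sum_(i <- [::]) F i s) = (fun=> 0) by apply/funext => s; rewrite big_nil.
  by rewrite Es_cst big_nil.
have -> : (fun s => \sum_(j <- i :: r) F j s) = (fun s => F i s + \sum_(j <- r) F j s).
  by apply/funext => s; rewrite big_cons.
by rewrite EsD ih big_cons.
Qed.
Lemma Es_le m f g : (forall s, issign m s -> f s <= g s) -> Es m f <= Es m g.
Proof.
elim: m f g => [|m ih] f g h /=; first exact: h.
have h1 : Es m (fun s => f (1 :: s)) <= Es m (fun s => g (1 :: s)).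
  by apply: ih => s /andP[s1 s2]; apply: h; rewrite /issign /= eqSS s1 eqxx.
have h2 : Es m (fun s => f (-1 :: s)) <= Es m (fun s => g (-1 :: s)).
  by apply: ih => s /andP[s1 s2]; apply: h; rewrite /issign /= eqSS s1 eqxx orbT.
lra.
Qed.
Lemma Es_eq m f g : (forall s, issign m s -> f s = g s) -> Es m f = Es m g.
Proof. by move=> h; apply/eqP; rewrite eq_le; apply/andP; split; apply: Es_le => s /h ->. Qed.
Lemma Es_ge0 m f : (forall s, issign m s -> 0 <= f s) -> 0 <= Es m f.
Proof. by move=> h; rewrite -[leLHS](Es_cst m); apply: Es_le. Qed.
Lemma Es_cat m1 m2 f : Es (m1 + m2) f = Es m1 (fun s1 => Es m2 (fun s2 => f (s1 ++ s2))).
Proof. by elim: m1 f => //= m1 ih f; rewrite !ih. Qed.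
Lemma Es_exists m f (c : R) : c <= Es m f -> exists2 s, issign m s & c <= f s.
Proof.
elim: m f => [|m ih] f /= h; first by exists [::].
have [h1|h1] := leP c (Es m (fun s => f (1 :: s))).
  by have [s /andP[s1 s2] hs] := ih _ h1; exists (1 :: s) => //; rewrite /issign /= eqSS s1 eqxx.
have [|s /andP[s1 s2] hs] := ih (fun s => f (-1 :: s)); first by lra.
by exists (-1 :: s) => //; rewrite /issign /= eqSS s1 eqxx orbT.
Qed.
Lemma Es_markov m f (A : seq R -> bool) (t : R) : (forall s, issign m s -> 0 <= f s) ->
  (forall s, issign m s -> A s -> t <= f s) -> t * Es m (fun s => (A s)%:R) <= Es m f.
Proof.
move=> f0 hA; rewrite -EsZ; apply: Es_le => s ss.
by case: (boolP (A s)) => As; rewrite ?mulr1 ?mulr0; [exact: hA|exact: f0].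
Qed.
Lemma Es_compl m (A : seq R -> bool) : Es m (fun s => (~~ A s)%:R) = 1 - Es m (fun s => (A s)%:R).
Proof.
have : 1 = Es m (fun s => (A s)%:R + (~~ A s)%:R).
  by rewrite -[LHS](Es_cst m); apply: Es_eq => s _; case: (A s); rewrite ?addr0 ?add0r.
rewrite EsD; lra.
Qed.
(** Convexity of the exponential after normalising both means to 1. *)
Lemma Es_holder m f g (l : R) : 0 <= l -> l <= 1 ->
  Es m (fun s => expR (l * f s + (1 - l) * g s)) <=
  expR (l * ln (Es m (fun s => expR (f s))) + (1 - l) * ln (Es m (fun s => expR (g s)))).
Proof.
move=> l0 l1.
have pos h : 0 < Es m (fun s => expR (h s)).
  elim: m h => [|m ih] h /=; first exact: expR_gt0.
  by have := ih (fun s => h (1 :: s)); have := ih (fun s => h (-1 :: s)); lra.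
set F := Es m (fun s => expR (f s)); set G := Es m (fun s => expR (g s)).
have F0 : 0 < F by exact: pos. have G0 : 0 < G by exact: pos.
rewrite -[leRHS]mulr1 -ler_pdivrMl ?expR_gt0 // -expRN -EsZ.
apply: le_trans (_ : Es m (fun s => l / F * expR (f s) + (1 - l) / G * expR (g s)) <= _); last first.
  rewrite EsD !EsZ -/F -/G; have -> : l / F * F + (1 - l) / G * G = 1; last by [].
  by field; rewrite !gt_eqF.
apply: Es_le => s _; rewrite -expRD.
have -> : - (l * ln F + (1 - l) * ln G) + (l * f s + (1 - l) * g s) =
   l * (f s - ln F) + (1 - l) * (g s - ln G) by ring.
apply: le_trans (_ : l * expR (f s - ln F) + (1 - l) * expR (g s - ln G) <= _).
  have := convex_expR (Itv01 l0 l1) (f s - ln F) (g s - ln G).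
  by rewrite !convRE.
by rewrite !expRD !expRN !lnK ?posrE //; apply: lerD; rewrite le_eqVlt; apply/orP; left; apply/eqP; ring.
Qed.

Definition dsq (m : nat) (s : seq R) (p : nat -> R) : R := \sum_(l < m) (s`_l - p l) ^+ 2.
Definition scons (a : R) (y : nat -> R) (i : nat) := if i is j.+1 then y j else a.

Lemma dsq_cons m a s p : dsq m.+1 (a :: s) p = (a - p 0%N) ^+ 2 + dsq m s (fun i => p i.+1).
Proof. by rewrite /dsq big_ord_recl. Qed.

(** The numerical core of Talagrand's induction: [r] is the ratio of the masses of two sections, [l]
    the weight given to the smaller one. [1/16 = 4/64] because opposite signs differ by 2. *)
Lemma two_point (r : R) : 0 < r -> r <= 1 ->
  exists2 l, 0 <= l <= 1 & expR (- (l * ln r) + (1 - l) ^+ 2 / 16) <= 2 - r.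
Proof.
move=> r0 r1; have [rh|rh] := leP (3 / 4) r; last first.
  exists 0; first by rewrite lexx ler01.
  have -> : - (0 * ln r) + (1 - 0) ^+ 2 / 16 = 1 / 16 by ring.
  apply: le_trans (_ : 5 / 4 <= _); last by lra.
  have h := @expR_ge1Dx R (- (1 / 16)).
  have h2 := expRxMexpNx_1 (1 / 16 : R); have h3 := expR_gt0 (1 / 16 : R).
  nra.
pose d := 1 - r; have rE : r = 1 - d by rewrite /d; ring.
have d0 : 0 <= d by rewrite /d; lra.
have dh : d <= 4^-1 by rewrite /d; lra.
(* To second order in [d] the exponent is then [d - (5/3 - 9/16) d ^ 2], which is below
   [ln (1 + d)]. *)
clearbody d; exists (1 - 3 * d); first by lra.
have d2 := sqr_ge0 d; have d3 : 0 <= d ^+ 3 by rewrite exprn_ge0.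
have d3' : d ^+ 3 <= d ^+ 2 * 4^-1 by rewrite exprSr ler_wpM2l.
have h1 : - ln r <= d + 4 / 3 * d ^+ 2.
  rewrite -(ler_expR) expRN lnK ?posrE //.
  rewrite -[leLHS]mul1r ler_pdivrMr //.
  have := expR_ge1Dx (d + 4 / 3 * d ^+ 2); rewrite rE => h.
  apply: le_trans (_ : (1 + (d + 4 / 3 * d ^+ 2)) * (1 - d) <= _); last by rewrite ler_wpM2r //; lra.
  have -> : (1 + (d + 4 / 3 * d ^+ 2)) * (1 - d) = 1 + d ^+ 2 / 3 - 4 / 3 * d ^+ 3 by field.
  lra.
have h2 : (1 - 3 * d) * - ln r <= (1 - 3 * d) * (d + 4 / 3 * d ^+ 2) by rewrite ler_wpM2l //; lra.
pose y := d - 11 / 10 * d ^+ 2.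
have h3 : - ((1 - 3 * d) * ln r) + (1 - (1 - 3 * d)) ^+ 2 / 16 <= y.
  have e1 : (1 - 3 * d) * (d + 4 / 3 * d ^+ 2) = d - 5 / 3 * d ^+ 2 - 4 * d ^+ 3 by field.
  have e2 : (1 - (1 - 3 * d)) ^+ 2 / 16 = 9 / 16 * d ^+ 2 by field.
  rewrite e2 /y; move: h2; rewrite e1; lra.
apply: le_trans (_ : expR y <= _); first by rewrite ler_expR.
have -> : 2 - r = 1 + d by rewrite rE; ring.
have h4 := expR_ge1Dx (- y); have h5 := expRxMexpNx_1 y; have h6 := expR_gt0 y.
have h7 : 1 <= (1 + d) * (1 - y).
  have -> : (1 + d) * (1 - y) = 1 + d ^+ 2 / 10 + 11 / 10 * d ^+ 3 by rewrite /y; field.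
  lra.
have h8 : (1 + d) * (1 - y) <= (1 + d) * expR (- y) by rewrite ler_wpM2l //; lra.
have h9 : expR y <= expR y * ((1 + d) * expR (- y)) by rewrite ler_peMr ?(ltW h6) // (le_trans h7).
by rewrite mulrCA h5 mulr1 in h9.
Qed.

Definition conv_pred (A : (nat -> R) -> Prop) :=
  forall x y l, A x -> A y -> 0 <= l <= 1 -> A (fun i => l * x i + (1 - l) * y i).
Definition sgP m (A : (nat -> R) -> Prop) : R := Es m (fun s => `[< A (nth 0 s) >]%:R).

Lemma dsq_conv m s x y l : 0 <= l <= 1 ->
  dsq m s (fun i => l * x i + (1 - l) * y i) <= l * dsq m s x + (1 - l) * dsq m s y.
Proof.
move=> /andP[l0 l1]; rewrite /dsq !mulr_sumr -big_split /=; apply: ler_sum => i _.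
rewrite -subr_ge0.
have -> : l * (s`_i - x i) ^+ 2 + (1 - l) * (s`_i - y i) ^+ 2 - (s`_i - (l * x i + (1 - l) * y i)) ^+ 2 =
   l * (1 - l) * (x i - y i) ^+ 2 by ring.
by apply: mulr_ge0; [apply: mulr_ge0; lra|exact: sqr_ge0].
Qed.

Lemma Es_exp_gt0 m (h : seq R -> R) : 0 < Es m (fun s => expR (h s)).
Proof.
elim: m h => [|m ih] h /=; first exact: expR_gt0.
by have := ih (fun s => h (1 :: s)); have := ih (fun s => h (-1 :: s)); lra.
Qed.

(** Talagrand's inequality with an explicit choice [p s] of a point of the convex set in place of
    the distance as an infimum. *)
Definition tal_ok m A := forall P, P = sgP m A -> 0 < P ->
  exists2 p : seq R -> nat -> R, forall s, A (p s) & Es m (fun s => expR (dsq m s (p s) / 64)) * P <= 1.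

(** [a] is the sign whose section has the larger mass. For sign [a] the point comes from that
    section; for [b] it mixes the two sections with the weight from [two_point], the mismatch in the
    first coordinate costing [4 (1 - l) ^ 2]. With [r] the mass ratio, the product is at most
    [(3 - r)(1 + r) / 4 <= 1]. *)
Lemma tal_step m (A : (nat -> R) -> Prop) (a b : R) : (a - b) ^+ 2 = 4 -> conv_pred A ->
  tal_ok m (fun y => A (scons a y)) -> tal_ok m (fun y => A (scons b y)) ->
  sgP m (fun y => A (scons b y)) <= sgP m (fun y => A (scons a y)) -> 0 < sgP m (fun y => A (scons a y)) ->
  exists p1 p2 : seq R -> nat -> R, [/\ forall s, A (p1 s), forall s, A (p2 s) &
    (Es m (fun s => expR (dsq m.+1 (a :: s) (p1 s) / 64)) + Es m (fun s => expR (dsq m.+1 (b :: s) (p2 s) / 64))) / 2 *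
    ((sgP m (fun y => A (scons a y)) + sgP m (fun y => A (scons b y))) / 2) <= 1].
Proof.
move=> ab cA ha hb; set Pa := sgP m (fun y => A (scons a y)); set Pb := sgP m (fun y => A (scons b y)) => ba Pa0.
have [pa hpa ea] := ha _ erefl Pa0.
set Ea := Es m (fun s => expR (dsq m s (pa s) / 64)) in ea.
have e1 : Es m (fun s => expR (dsq m.+1 (a :: s) (scons a (pa s)) / 64)) = Ea.
  by apply: Es_eq => s _; rewrite dsq_cons /= subrr expr0n add0r.
have Ea0 : 0 < Ea by exact: Es_exp_gt0.
have eaP : Ea <= Pa^-1 by rewrite -[leRHS]mul1r ler_pdivlMr.
have Pb0 : 0 <= Pb by apply: Es_ge0.
have [Pbz|Pbn] := eqVneq Pb 0.
  exists (fun s => scons a (pa s)), (fun s => scons a (pa s)); split => //.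
  rewrite e1 Pbz addr0.
  have -> : Es m (fun s => expR (dsq m.+1 (b :: s) (scons a (pa s)) / 64)) = expR (1 / 16) * Ea.
    rewrite -EsZ; apply: Es_eq => s _; rewrite -expRD dsq_cons /=; congr expR.
    have -> : (b - a) ^+ 2 = 4 by rewrite -ab; ring.
    by field.
  have h := @expR_ge1Dx R (- (1 / 16)).
  have h2 := expRxMexpNx_1 (1 / 16 : R); have h3 := expR_gt0 (1 / 16 : R).
  have h4 : expR (1 / 16) <= 2 :> R by nra.
  have -> : (Ea + expR (1 / 16) * Ea) / 2 * (Pa / 2) = (1 + expR (1 / 16)) / 4 * (Ea * Pa) by field.
  have eap0 : 0 <= Ea * Pa by rewrite mulr_ge0 // ltW.
  have h5 : 0 <= (1 + expR (1 / 16)) / 4 :> R by lra.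
  by apply: le_trans (ler_wpM2l h5 ea) _; lra.
have Pbp : 0 < Pb by rewrite lt_def Pbn.
have [pb hpb eb] := hb _ erefl Pbp.
set Eb := Es m (fun s => expR (dsq m s (pb s) / 64)) in eb.
have Eb0 : 0 < Eb by exact: Es_exp_gt0.
have ebP : Eb <= Pb^-1 by rewrite -[leRHS]mul1r ler_pdivlMr.
pose r := Pb / Pa; have r0 : 0 < r by rewrite divr_gt0.
have r1 : r <= 1 by rewrite ler_pdivrMr // mul1r.
have [l l01 hl] := two_point r0 r1; have /andP[l0 l1] := l01.
exists (fun s => scons a (pa s)), (fun s i => l * scons b (pb s) i + (1 - l) * scons a (pa s) i); split => //.
  by move=> s; exact: cA.
rewrite e1; set E2 := Es m _.
have hE2 : E2 <= Pa^-1 * (2 - r).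
  apply: le_trans (_ : expR ((1 - l) ^+ 2 / 16) * Es m (fun s => expR (l * (dsq m s (pb s) / 64) + (1 - l) * (dsq m s (pa s) / 64))) <= _).
    rewrite -EsZ; apply: Es_le => s _; rewrite -expRD ler_expR dsq_cons /=.
    have -> : (b - (l * b + (1 - l) * a)) ^+ 2 = (1 - l) ^+ 2 * 4 by rewrite -ab; ring.
    by have := dsq_conv m s (pb s) (pa s) l01; lra.
  apply: le_trans (_ : expR ((1 - l) ^+ 2 / 16) * expR (l * ln Eb + (1 - l) * ln Ea) <= _).
    by rewrite ler_pM2l ?expR_gt0 //; exact: Es_holder.
  have lb : ln Eb <= - ln Pb by rewrite -lnV ?posrE // ler_ln ?posrE ?invr_gt0.
  have la : ln Ea <= - ln Pa by rewrite -lnV ?posrE // ler_ln ?posrE ?invr_gt0.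
  have lr : ln r = ln Pb - ln Pa by rewrite /r ln_div ?posrE.
  apply: le_trans (_ : expR (- ln Pa) * expR (- (l * ln r) + (1 - l) ^+ 2 / 16) <= _).
    rewrite -!expRD ler_expR lr.
    have := ler_wpM2l l0 lb; have h : 0 <= 1 - l by lra.
    by have := ler_wpM2l h la; lra.
  by rewrite expRN lnK ?posrE // ler_pM2l ?invr_gt0.
have rE : Pb = r * Pa by rewrite /r divfK // gt_eqF.
apply: le_trans (_ : (Pa^-1 + Pa^-1 * (2 - r)) / 2 * ((Pa + Pb) / 2) <= _).
  by apply: ler_wpM2r; [lra|rewrite ler_pM2r // lerD].
rewrite rE; have -> : (Pa^-1 + Pa^-1 * (2 - r)) / 2 * ((Pa + r * Pa) / 2) = (3 - r) * (1 + r) / 4 by field; rewrite gt_eqF.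
by have := sqr_ge0 (1 - r); rewrite expr2; lra.
Qed.

Lemma talagrand m (A : (nat -> R) -> Prop) : conv_pred A -> tal_ok m A.
Proof.
elim: m A => [|m ih] A cA P ->.
  rewrite /sgP /=; case: (asboolP (A _)) => [hA _|_]; last by rewrite ltxx.
  exists (fun=> nth 0 [::]) => //=; rewrite /dsq big_ord0 mul0r expR0 mulr1 //.
have cs a : conv_pred (fun y => A (scons a y)).
  move=> x y l Ax Ay l01; have := cA _ _ _ Ax Ay l01.
  have -> // : (fun i => l * scons a x i + (1 - l) * scons a y i) = scons a (fun i => l * x i + (1 - l) * y i).
  by apply/funext => -[|i] //=; ring.
have PE : sgP m.+1 A = (sgP m (fun y => A (scons 1 y)) + sgP m (fun y => A (scons (-1) y))) / 2.
  have h a s : nth 0 (a :: s) = scons a (nth 0 s) :> (nat -> R) by apply/funext => -[].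
  by rewrite /sgP /=; congr ((_ + _) / _); apply: Es_eq => s _; rewrite h.
have P10 : 0 <= sgP m (fun y => A (scons 1 y)) by exact: Es_ge0.
have P20 : 0 <= sgP m (fun y => A (scons (-1) y)) by exact: Es_ge0.
have n1 : (-1 == 1 :> R) = false by apply/eqP; lra.
rewrite PE => P0.
have [h|h] := leP (sgP m (fun y => A (scons (-1) y))) (sgP m (fun y => A (scons 1 y))).
  have [||p1 [p2 [h1 h2 h3]]] := @tal_step m A 1 (-1) _ cA (ih _ (cs _)) (ih _ (cs _)) h; [by ring|by lra|].
  exists (fun s => if head 0 s == 1 then p1 (behead s) else p2 (behead s)) => [s|]; first by case: ifP.
  by rewrite /= eqxx n1.
have [|||p1 [p2 [h1 h2 h3]]] := @tal_step m A (-1) 1 _ cA (ih _ (cs _)) (ih _ (cs _)); [by ring|exact: ltW|by lra|].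
exists (fun s => if head 0 s == 1 then p2 (behead s) else p1 (behead s)) => [s|]; first by case: ifP.
by rewrite /= eqxx n1 addrC [X in _ * (X / _)]addrC.
Qed.

(* Concentration of a convex Lipschitz function, in the form of a supremum of linear forms [c z]. *)
Lemma sup_lin_conc m (Z : Type) (c : Z -> nat -> R) (L t u : R) : 0 < L -> 0 <= t ->
  (forall z, \sum_(l < m) c z l ^+ 2 <= L ^+ 2) ->
  Es m (fun s => `[< forall z, \sum_(l < m) c z l * s`_l <= u >]%:R) *
  Es m (fun s => `[< exists z, u + t <= \sum_(l < m) c z l * s`_l >]%:R) <= expR (- (t ^+ 2 / (64 * L ^+ 2))).
Proof.
move=> L0 t0 hc; pose A (y : nat -> R) := forall z, \sum_(l < m) c z l * y l <= u.
have cA : conv_pred A.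
  move=> x y l Ax Ay /andP[l0 l1] z.
  have -> : \sum_(i < m) c z i * (l * x i + (1 - l) * y i) = l * (\sum_(i < m) c z i * x i) + (1 - l) * (\sum_(i < m) c z i * y i).
    by rewrite !mulr_sumr -big_split /=; apply: eq_bigr => i _; ring.
  by have := ler_wpM2l l0 (Ax z); have h : 0 <= 1 - l by [lra]; have := ler_wpM2l h (Ay z); lra.
set PA := Es m _; set PB := Es m _.
have PA0 : 0 <= PA by exact: Es_ge0.
have [PAz|PAn] := eqVneq PA 0; first by rewrite PAz mul0r expR_ge0.
have PAp : 0 < PA by rewrite lt_def PAn.
have [p hp hE] := talagrand cA (P := PA) erefl PAp.
have h : expR (t ^+ 2 / (64 * L ^+ 2)) * PB <= Es m (fun s => expR (dsq m s (p s) / 64)).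
  apply: Es_markov => [s _|s _]; first exact: expR_ge0.
  move=> /asboolP[z hz]; rewrite ler_expR.
  have := hp s z => hz2.
  set D := dsq m s (p s).
  have cs : (\sum_(l < m) c z l * (s`_l - p s l)) ^+ 2 <= L ^+ 2 * D.
    pose a : 'rV[R]_m := \row_l c z l; pose b : 'rV[R]_m := \row_l (s`_l - p s l).
    have -> : \sum_(l < m) c z l * (s`_l - p s l) = dot a b by apply: eq_bigr => l _; rewrite !mxE.
    have -> : D = dot b b by apply: eq_bigr => l _; rewrite !mxE expr2.
    apply: le_trans (dot_sqr_le a b) _; apply: ler_wpM2r; first exact: dot_ge0.
    by apply: le_trans (hc z); rewrite le_eqVlt; apply/orP; left; apply/eqP; apply: eq_bigr => l _; rewrite !mxE expr2.
  have tD : t <= \sum_(l < m) c z l * (s`_l - p s l).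
    have -> : \sum_(l < m) c z l * (s`_l - p s l) = \sum_(l < m) c z l * s`_l - \sum_(l < m) c z l * p s l.
      by rewrite -sumrB; apply: eq_bigr => l _; ring.
    lra.
  have tD2 : t ^+ 2 <= L ^+ 2 * D by apply: le_trans cs; rewrite ler_sqr ?nnegrE // (le_trans t0).
  rewrite ler_pdivrMr ?mulr_gt0 ?exprn_gt0 //.
  by have -> : D / 64 * (64 * L ^+ 2) = L ^+ 2 * D by field.
have h2 := ler_wpM2r (ltW PAp) h.
have h3 : expR (t ^+ 2 / (64 * L ^+ 2)) * PB * PA <= 1 by exact: le_trans hE.
rewrite expRN -[leRHS]mul1r ler_pdivlMr ?expR_gt0 //; lra.
Qed.
End Signs.

(** * Linear forms in random signs *)

Section SignSums.
Context {R : realType}.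

Definition lin (m : nat) (a : nat -> R) (s : seq R) : R := \sum_(l < m) a l * s`_l.
Definition sq (m : nat) (a : nat -> R) : R := \sum_(l < m) a l ^+ 2.

Lemma lin_cons m a c s : lin m.+1 a (c :: s) = a 0%N * c + lin m (fun l => a l.+1) s.
Proof. by rewrite /lin big_ord_recl. Qed.
Lemma sq_cons m a : sq m.+1 a = a 0%N ^+ 2 + sq m (fun l => a l.+1).
Proof. by rewrite /sq big_ord_recl. Qed.
Lemma sq_ge0 m a : 0 <= sq m a.
Proof. by apply: sumr_ge0 => l _; exact: sqr_ge0. Qed.

Lemma Es_lin m a : Es m (lin m a) = 0.
Proof.
elim: m a => [|m ih] a /=; first by rewrite /lin big_ord0.
under [X in Es m X + _]eq_fun do rewrite lin_cons.
under [X in _ + Es m X]eq_fun do rewrite lin_cons.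
rewrite !EsD !Es_cst ih; ring.
Qed.
Lemma Es_lin2 m a : Es m (fun s => lin m a s ^+ 2) = sq m a.
Proof.
elim: m a => [|m ih] a; first by rewrite /= /lin /sq !big_ord0 expr0n.
rewrite sq_cons -ih /=.
have h c : Es m (fun s => lin m.+1 a (c :: s) ^+ 2) = (a 0%N * c) ^+ 2 + Es m (fun s => lin m (fun l => a l.+1) s ^+ 2).
  have -> : (fun s => lin m.+1 a (c :: s) ^+ 2) = (fun s => ((a 0%N * c) ^+ 2 + (2 * (a 0%N * c)) * lin m (fun l => a l.+1) s) + lin m (fun l => a l.+1) s ^+ 2).
    by apply/funext => s; rewrite lin_cons; ring.
  by rewrite EsD EsD Es_cst EsZ Es_lin; ring.
by rewrite !h; field.
Qed.
Lemma Es_lin3 m a : Es m (fun s => lin m a s ^+ 3) = 0.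
Proof.
elim: m a => [|m ih] a; first by rewrite /= /lin !big_ord0 expr0n.
have h c : Es m (fun s => lin m.+1 a (c :: s) ^+ 3) = (a 0%N * c) ^+ 3 + 3 * (a 0%N * c) * sq m (fun l => a l.+1).
  have -> : (fun s => lin m.+1 a (c :: s) ^+ 3) = (fun s => (((a 0%N * c) ^+ 3 + (3 * (a 0%N * c) ^+ 2) * lin m (fun l => a l.+1) s) + (3 * (a 0%N * c)) * lin m (fun l => a l.+1) s ^+ 2) + lin m (fun l => a l.+1) s ^+ 3).
    by apply/funext => s; rewrite lin_cons; ring.
  by rewrite EsD EsD EsD Es_cst !EsZ Es_lin ih Es_lin2; ring.
by rewrite /= !h; field.
Qed.
Lemma Es_lin4 m a : Es m (fun s => lin m a s ^+ 4) <= 3 * sq m a ^+ 2.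
Proof.
elim: m a => [|m ih] a; first by rewrite /= /lin /sq !big_ord0 !expr0n /= mulr0.
have h c : Es m (fun s => lin m.+1 a (c :: s) ^+ 4) = (a 0%N * c) ^+ 4 + 6 * (a 0%N * c) ^+ 2 * sq m (fun l => a l.+1) + Es m (fun s => lin m (fun l => a l.+1) s ^+ 4).
  have -> : (fun s => lin m.+1 a (c :: s) ^+ 4) = (fun s => ((((a 0%N * c) ^+ 4 + (4 * (a 0%N * c) ^+ 3) * lin m (fun l => a l.+1) s) + (6 * (a 0%N * c) ^+ 2) * lin m (fun l => a l.+1) s ^+ 2) + (4 * (a 0%N * c)) * lin m (fun l => a l.+1) s ^+ 3) + lin m (fun l => a l.+1) s ^+ 4).
    by apply/funext => s; rewrite lin_cons; ring.
  by rewrite EsD EsD EsD EsD Es_cst !EsZ Es_lin Es_lin3 Es_lin2; ring.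
rewrite /= !h sq_cons; have := ih (fun l => a l.+1); set E := Es _ _ => hE.
have -> : ((a 0%N * 1) ^+ 4 + 6 * (a 0%N * 1) ^+ 2 * sq m (fun l => a l.+1) + E + ((a 0%N * -1) ^+ 4 + 6 * (a 0%N * -1) ^+ 2 * sq m (fun l => a l.+1) + E)) / 2 =
  (a 0%N) ^+ 4 + 6 * (a 0%N) ^+ 2 * sq m (fun l => a l.+1) + E by field.
have -> : 3 * (a 0%N ^+ 2 + sq m (fun l => a l.+1)) ^+ 2 = 3 * a 0%N ^+ 4 + 6 * a 0%N ^+ 2 * sq m (fun l => a l.+1) + 3 * sq m (fun l => a l.+1) ^+ 2 by ring.
have : 0 <= a 0%N ^+ 4 by rewrite exprn_even_ge0.
lra.
Qed.

(* The quartic (t - 1/2)(4 - t)(t + 2)^2 is at most 441 on [1/2, 4] and nonpositive elsewhere, while its mean is at least 1. *)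
Definition sgp : R := (2 ^+ 9)^-1.
Lemma sgp_gt0 : 0 < sgp.
Proof. by rewrite /sgp invr_gt0 exprn_gt0. Qed.
Lemma lin_ge m a : sgp <= Es m (fun s => (Num.sqrt (sq m a) / 2 <= lin m a s)%R%:R).
Proof.
have [z|nz] := eqVneq (sq m a) 0.
  have hl s : lin m a s = 0.
    rewrite /lin big1 // => l _; move/eqP: z; rewrite /sq psumr_eq0 => [/allP/(_ l (mem_index_enum _))|i _]; last exact: sqr_ge0.
    by rewrite sqrf_eq0 => /eqP ->; rewrite mul0r.
  apply: le_trans (_ : 1 <= _); first by rewrite /sgp invf_le1 ?exprn_gt0 // exprn_ege1 //; lra.
  by rewrite -[leLHS](Es_cst m); apply: Es_le => s _; rewrite z sqrtr0 mul0r hl lexx.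
have v0 : 0 < sq m a by rewrite lt_def nz sq_ge0.
set r := Num.sqrt (sq m a); have r0 : 0 < r by rewrite sqrtr_gt0.
have r2 : r ^+ 2 = sq m a by rewrite sqr_sqrtr // ltW.
(* Odd moments vanish, so the mean of this quartic is at least [(- 3 + 12 - 8) r ^ 4]. *)
pose q s := (lin m a s - r / 2) * (4 * r - lin m a s) * (lin m a s + 2 * r) ^+ 2.
have r4 : 0 < r ^+ 4 by rewrite exprn_gt0.
have hq : r ^+ 4 <= Es m q.
  have -> : q = (fun s => ((((- 1) * lin m a s ^+ 4 + (r / 2) * lin m a s ^+ 3) + (12 * r ^+ 2) * lin m a s ^+ 2) + (10 * r ^+ 3) * lin m a s) + (- 8 * r ^+ 4)).
    by apply/funext => s; rewrite /q; field.
  rewrite EsD EsD EsD EsD Es_cst !EsZ Es_lin Es_lin3 Es_lin2.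
  have := Es_lin4 m a; rewrite -r2.
  have -> : (r ^+ 2) ^+ 2 = r ^+ 4 by rewrite -exprM.
  have -> : 12 * r ^+ 2 * r ^+ 2 = 12 * r ^+ 4 by ring.
  lra.
have hle : Es m q <= Es m (fun s => (2 ^+ 9 * r ^+ 4) * (r / 2 <= lin m a s)%R%:R).
  apply: Es_le => s _; rewrite /q; move: (lin m a s) => t.
  have s2 : 0 <= (t + 2 * r) ^+ 2 by exact: sqr_ge0.
  case: (leP (r / 2) t) => h.
    have [h4|h4] := leP t (4 * r); last first.
      apply: le_trans (_ : 0 <= _); last by rewrite mulr1 mulr_ge0 // ltW.
      by rewrite -mulrA mulr_ge0_le0 ?subr_ge0 // mulr_le0_ge0 // subr_le0 ltW.
    apply: le_trans (_ : (7 / 2 * r) * (7 / 2 * r) * (6 * r) ^+ 2 <= _).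
      apply: ler_pM => //; [by apply: mulr_ge0; lra|by apply: ler_pM; lra|].
      by rewrite ler_sqr ?nnegrE; lra.
    have -> : (7 / 2 * r) * (7 / 2 * r) * (6 * r) ^+ 2 = 441 * r ^+ 4 by field.
    by rewrite mulr1 ler_pM2r // !exprS expr0; lra.
  rewrite mulr0 -mulrA mulr_le0_ge0 ?subr_le0 ?(ltW h) // mulr_ge0 // subr_ge0; lra.
rewrite EsZ in hle.
have := le_trans hq hle; set E := Es _ _ => h.
rewrite /sgp -[leLHS]mulr1 ler_pdivrMl ?exprn_gt0 //.
by rewrite -(ler_pM2r r4) mul1r mulrAC.
Qed.

Lemma lin_cat m1 m2 a s1 s2 : size s1 = m1 -> lin (m1 + m2) a (s1 ++ s2) = lin m1 a s1 + lin m2 (fun l => a (m1 + l)%N) s2.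
Proof.
move=> h1; rewrite /lin big_split_ord /=; congr (_ + _); apply: eq_bigr => l _.
  by rewrite nth_cat h1 ltn_ord.
by rewrite nth_cat h1 ltnNge leq_addr /= addKn.
Qed.

(** Each of [k] independent blocks reaches half its own standard deviation with probability at least
    [sgp]. When all do, the form reaches half the sum of the block norms, which for balanced blocks
    is of order [sqrt k] standard deviations of the whole. *)
Lemma lin_blocks (k l : nat) (a : nat -> R) :
  sgp ^+ k <= Es (k * l) (fun s => (\sum_(b < k) Num.sqrt (sq l (fun i => a (b * l + i)%N)) / 2 <= lin (k * l) a s)%R%:R).
Proof.
elim: k a => [|k ih] a; first by rewrite mul0n /= /lin !big_ord0 lexx.
rewrite mulSn Es_cat exprS.
pose a' i := a (l + i)%N.
have hi (s1 : seq R) : issign l s1 -> (Num.sqrt (sq l a) / 2 <= lin l a s1)%R ->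
  sgp ^+ k <= Es (k * l) (fun s2 => (\sum_(b < k.+1) Num.sqrt (sq l (fun i => a (b * l + i)%N)) / 2 <= lin (l + k * l) a (s1 ++ s2))%R%:R).
  move=> /andP[/eqP s1l _] h1; apply: le_trans (ih a') _; apply: Es_le => s2 _.
  rewrite ler_nat; case: (leP _ (lin (k * l) a' s2)) => // h2.
  rewrite lin_cat // big_ord_recl mul0n.
  have -> : \sum_(i < k) Num.sqrt (sq l (fun i0 => a (lift ord0 i * l + i0)%N)) / 2 = \sum_(b < k) Num.sqrt (sq l (fun i => a' (b * l + i)%N)) / 2.
    apply: eq_bigr => b _; congr (Num.sqrt _ / 2); apply: eq_bigr => i _; congr (a _ ^+ 2).
    by rewrite lift0 mulSn addnA.
  by rewrite lerD.
apply: le_trans (_ : sgp ^+ k * Es l (fun s1 => (Num.sqrt (sq l a) / 2 <= lin l a s1)%R%:R) <= _).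
  by rewrite mulrC ler_wpM2l ?exprn_ge0 ?(ltW sgp_gt0) //; exact: lin_ge.
apply: Es_markov => s ss; first by apply: Es_ge0.
exact: hi.
Qed.
End SignSums.

Section SignExpectation.
Context {R : realType} {d : measure_display} {T : measurableType d} (P : probability T R).

Lemma Es_bmf m (f : seq R -> T -> R) : (forall s, bmf (f s)) -> bmf (fun x => Es m (fun s => f s x)).
Proof.
elim: m f => [|m ih] f hf /=; first exact: hf.
have h := bmfD (ih (fun s => f (1 :: s)) (fun s => hf _)) (ih (fun s => f (-1 :: s)) (fun s => hf _)).
by have := bmfZ 2^-1 h; under eq_fun do rewrite mulrC.
Qed.
Lemma Es_Ex m (f : seq R -> T -> R) : (forall s, bmf (f s)) ->
  Es m (fun s => Ex P (f s)) = Ex P (fun x => Es m (fun s => f s x)).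
Proof.
elim: m f => [//|m ih] f hf /=.
have h1 := @Es_bmf m (fun s => f (1 :: s)) (fun s => hf _).
have h2 := @Es_bmf m (fun s => f (-1 :: s)) (fun s => hf _).
rewrite (ih (fun s => f (1 :: s))) // (ih (fun s => f (-1 :: s))) // -ExD // mulrC -ExZ; last exact: bmfD.
by congr Ex; apply/funext => x; rewrite mulrC.
Qed.
Lemma Es_pr m (A : seq R -> set T) : (forall s, measurable (A s)) ->
  Es m (fun s => pr P (A s)) = Ex P (fun x => Es m (fun s => \1_(A s) x)).
Proof.
move=> mA; rewrite -Es_Ex; last by move=> s; exact: bmf_indic.
by congr Es; apply/funext => s; rewrite Ex_indic.
Qed.
End SignExpectation.

Lemma sum_mul {R : realType} (a b : nat) (F : nat -> R) :
  \sum_(l < a * b) F l = \sum_(i < a) \sum_(j < b) F (i * b + j)%N.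
Proof.
elim: a F => [|a ih] F; first by rewrite mul0n !big_ord0.
rewrite mulSn big_split_ord /= [RHS]big_ord_recl; congr (_ + _).
rewrite (ih (fun l => F (b + l)%N)); apply: eq_bigr => i _; apply: eq_bigr => j _.
by rewrite lift0 mulSn addnA.
Qed.

(** * Norms of block marginals and conditional means *)

Section BlockNorm.
Context {R : realType} {n : nat} (mu : probability (borel_rV R n) R).
Notation V := (borel_rV R n).
Hypotheses (iso : isotropic mu) (lc : log_concave mu).

(** Makes [sb_C * sqrt bn_eta] equal to [1/8]. *)
Definition bn_eta : R := (8 * sb_C) ^- 2.
Lemma bn_eta_gt0 : 0 < bn_eta.
Proof. by rewrite /bn_eta invr_gt0 exprn_gt0 // mulr_gt0 // sb_C_gt0. Qed.

Lemma sign_sqr m (s : seq R) i : issign m s -> (i < m)%N -> s`_i ^+ 2 = 1.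
Proof.
move=> /andP[/eqP sm /allP h] im; have /h/orP[] : s`_i \in s by apply: mem_nth; rewrite sm.
  by move/eqP ->; rewrite expr1n.
by move/eqP ->; rewrite sqrrN expr1n.
Qed.

Lemma sumsq_borel e (r : 'I_e -> 'rV[R]_n) : measurable_fun setT (fun x : V => \sum_i dot (x : 'rV[R]_n) (r i) ^+ 2).
Proof. by apply: measurable_sum => i; apply: measurable_funX; exact: dot_borel. Qed.

(** The test vector [g] combines the [r i] with random signs and has norm [sqrt e]. By [small_ball]
    the slab [B s] has mass at most [1/8] for every sign sequence, whereas a point of [A] lies in it
    for at least half of them, by Markov over the signs. Fubini compares the two. *)
Lemma block_norm (e : nat) (r : 'I_e -> 'rV[R]_n) : (0 < e)%N -> (forall i j, dot (r i) (r j) = (i == j)%:R) ->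
  pr mu [set x : V | \sum_i dot (x : 'rV[R]_n) (r i) ^+ 2 <= (bn_eta / 2) ^+ 2 * e%:R] <= 4^-1.
Proof.
move=> e0 hr; set A := [set x : V | _].
have et0 := bn_eta_gt0; have er : 0 < e%:R :> R by rewrite ltr0n.
have mA : measurable A by apply: measurable_le_set; exact: sumsq_borel.
pose g (s : seq R) : 'rV[R]_n := \sum_(i < e) s`_i *: r i.
pose B s := [set x : V | `|dot (x : 'rV[R]_n) (g s)| <= bn_eta * enorm (g s)].
have mB s : measurable (B s).
  apply: (measurable_le_set (f := fun x : V => `|dot (x : 'rV[R]_n) (g s)|)).
  by apply: measurableT_comp => //; exact: dot_borel.
have gg s : issign e s -> enorm (g s) ^+ 2 = e%:R.
  move=> ss; rewrite enorm2 /g dot_suml -[X in _ = X%:R](card_ord e) -sumr_const; apply: eq_bigr => i _.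
  rewrite dotZl dot_sumr (bigD1 i) //= big1 => [|j ji]; last by rewrite dotZr hr eq_sym (negbTE ji) mulr0.
  by rewrite dotZr hr eqxx addr0 mulr1 -expr2 (sign_sqr ss).
have h1 : Es e (fun s => pr mu (B s)) <= 8^-1.
  rewrite -[leRHS](Es_cst e); apply: Es_le => s ss.
  have g0 : g s != 0 by rewrite -enorm_gt0 lt_def enorm_ge0 -sqrf_eq0 gg // gt_eqF.
  apply: le_trans (small_ball iso lc et0 g0) _.
  have c0 := @sb_C_gt0 R.
  have -> : Num.sqrt bn_eta = (8 * sb_C)^-1 :> R.
    by rewrite /bn_eta sqrtrV ?sqr_ge0 // sqrtr_sqr gtr0_norm // mulr_gt0.
  have -> : sb_C * (8 * sb_C)^-1 = 8^-1 :> R by field; rewrite gt_eqF.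
  exact: lexx.
have h2 : pr mu A / 2 <= Es e (fun s => pr mu (B s)).
  rewrite (Es_pr mu _ mB) mulrC -Ex_indic // -ExZ; last exact: bmf_indic.
  apply: Ex_le => [||x].
  - by apply: bmfZ; exact: bmf_indic.
  - by apply: Es_bmf => s; exact: bmf_indic.
  rewrite indicE; case: (boolP (x \in A)) => [/set_mem hx|_]; last first.
    by rewrite mulr0; apply: Es_ge0 => s _; rewrite indicE.
  pose a (l : nat) := oapp (fun i => dot (x : 'rV[R]_n) (r i)) 0 (insub l).
  have aE (i : 'I_e) : a i = dot (x : 'rV[R]_n) (r i) by rewrite /a valK.
  have lE s : dot (x : 'rV[R]_n) (g s) = lin e a s.
    by rewrite /g dot_sumr; apply: eq_bigr => i _; rewrite dotZr aE mulrC.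
  have hm : bn_eta ^+ 2 * e%:R * Es e (fun s => (~~ (s \in [pred s | x \in B s]))%:R) <= Es e (fun s => lin e a s ^+ 2).
    apply: Es_markov => [s _|s ss]; first exact: sqr_ge0.
    rewrite inE => hn; rewrite -(gg s ss) -exprMn -lE -[leRHS]real_normK ?num_real //.
    rewrite ler_sqr ?nnegrE ?mulr_ge0 ?(ltW et0) ?enorm_ge0 //.
    by apply: ltW; rewrite ltNge; apply/negP => h; move/negP: hn; apply; apply/mem_set.
  rewrite Es_compl Es_lin2 in hm.
  have hs : sq e a <= (bn_eta / 2) ^+ 2 * e%:R.
    by apply: le_trans hx; rewrite le_eqVlt; apply/orP; left; apply/eqP; apply: eq_bigr => i _; rewrite aE.
  have hp : 0 < bn_eta ^+ 2 * e%:R by rewrite mulr_gt0 // exprn_gt0.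
  have -> : Es e (fun s => \1_(B s) x) = Es e (fun s => (s \in [pred s | x \in B s])%:R).
    by congr Es; apply/funext => s; rewrite indicE inE.
  set E := Es e _ in hm *; rewrite mulr1.
  have : bn_eta ^+ 2 * e%:R * (1 - E) <= bn_eta ^+ 2 * e%:R * 4^-1.
    by apply: le_trans hm _; apply: le_trans hs _; rewrite le_eqVlt; apply/orP; left; apply/eqP; field.
  rewrite ler_pM2l //; lra.
lra.
Qed.

(** What exceeds level [T] is at most the sum of the tails beyond [T + j], which [18 exp (- T / 8)]
    bounds. So on a set of small mass [p] conditional means are [O(log (1 / p))] in every
    direction. *)
Lemma cond_mean (A : set V) (th : 'rV[R]_n) (T L : R) : measurable A ->
  (forall x : V, A x -> enorm (x : 'rV[R]_n) <= L) -> dot th th = 1 -> 0 <= T ->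
  18 * expR (- (T / 8)) <= pr mu A ->
  Ex mu (fun x : V => dot (x : 'rV[R]_n) th * \1_A x) <= (T + 1) * pr mu A.
Proof.
move=> mA AL th1 T0 hT.
pose J := (Num.truncn (Order.max L 0)).+1.
have LJ : L < J%:R.
  have /truncn_itv/andP[_] : 0 <= Order.max L 0 by rewrite le_max lexx orbT.
  by apply: le_lt_trans; rewrite le_max lexx.
pose D (j : nat) := [set x : V | T + j%:R <= `|dot (x : 'rV[R]_n) th|].
have mD j : measurable (D j) by exact: dge_borel.
have hb : bmf (fun x : V => dot (x : 'rV[R]_n) th * \1_A x).
  apply: (@bmfP _ _ _ _ (Order.max L 0)).
    by apply: measurable_funM; [exact: dot_borel|exact: measurable_indic].
  move=> x; rewrite normrM indicE; case: (boolP (x \in A)) => [/set_mem/AL hx|_]; last by rewrite normr0 mulr0 le_max lexx orbT.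
  rewrite normr1 mulr1; apply: le_trans (ler_dot _ _) _.
  by rewrite [enorm th]enormE th1 sqrtr1 mulr1 le_max hx.
have h : forall x : V, dot (x : 'rV[R]_n) th * \1_A x <= T * \1_A x + \sum_(j < J) \1_(D j) x.
  move=> x; have s0 : 0 <= \sum_(j < J) \1_(D j) x :> R by apply: sumr_ge0 => j _; rewrite indicE.
  rewrite [\1_A x]indicE; case: (boolP (x \in A)) => [/set_mem/AL hx|_]; last by rewrite !mulr0 add0r.
  rewrite !mulr1; set t := dot _ _.
  have [tT|Tt] := leP t T; first by lra.
  have tL : t <= L.
    apply: le_trans (ler_norm _) _; apply: le_trans (ler_dot _ _) _.
    by rewrite [enorm th]enormE th1 sqrtr1 mulr1.
  pose i := Num.truncn (t - T).
  have /truncn_itv/andP[i1 i2] : 0 <= t - T by lra.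
  rewrite -/i in i1 i2.
  have iJ : (i < J)%N by rewrite -(ltr_nat R); lra.
  suff : i.+1%:R <= \sum_(j < J) \1_(D j) x :> R by lra.
  rewrite -[X in X%:R <= _](card_ord i.+1) -sumr_const.
  rewrite (big_ord_widen J (fun=> 1)) // [leLHS]big_mkcond; apply: ler_sum => j _.
  case: ifP => [ji|_]; last by rewrite indicE.
  have jiR : (j : nat)%:R <= i%:R :> R by rewrite ler_nat -ltnS.
  have Dx : D j x by rewrite /D /= -/t ger0_norm; lra.
  by rewrite indicE mem_set.
apply: le_trans (Ex_le mu hb _ h) _.
  by apply: bmfD; [apply: bmfZ; exact: bmf_indic|apply: bmf_sum => j; exact: bmf_indic].
rewrite ExD; [|by apply: bmfZ; exact: bmf_indic|by apply: bmf_sum => j; exact: bmf_indic].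
rewrite ExZ; last exact: bmf_indic.
rewrite Ex_sum => [|j]; last exact: bmf_indic.
rewrite Ex_indic // mulrDl mul1r lerD2l.
under eq_bigr do rewrite Ex_indic //.
apply: le_trans hT.
apply: le_trans (_ : \sum_(j < J) 2 * expR (- (T / 8)) * (8 / 9) ^+ j <= _).
  apply: ler_sum => j _; apply: le_trans (tail_dot iso lc th1 _) _.
  rewrite -mulrA ler_pM2l // mulrDl opprD expRD ler_pM2l ?expR_gt0 //.
  have -> : - (j%:R / 8) = j%:R * - (1 / 8) :> R by field.
  rewrite expRM_natl; apply: lerXn2r; rewrite ?nnegrE ?expR_ge0 ?divr_ge0 //.
  have h1 := @expR_ge1Dx R (1 / 8); have h2 := expRxMexpNx_1 (1 / 8 : R); have h3 := expR_gt0 (- (1 / 8) : R).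
  nra.
rewrite -mulr_sumr.
have -> : 18 * expR (- (T / 8)) = 2 * expR (- (T / 8)) * 9 by ring.
rewrite ler_pM2l ?mulr_gt0 ?expR_gt0 //.
suff : \sum_(j < J) (8 / 9) ^+ j = 9 * (1 - (8 / 9) ^+ J) :> R.
  move=> ->; have : 0 <= (8 / 9) ^+ J :> R by rewrite exprn_ge0.
  lra.
elim: (J) => [|j ih]; first by rewrite big_ord0 expr0; ring.
by rewrite big_ord_recr /= ih exprS; field.
Qed.
End BlockNorm.

(** * Small balls for marginals *)

Section RandomProjection.
Context {R : realType} {n k e : nat} (mu : probability (borel_rV R n) R) (U : 'M[R]_(k * e, n)).
Notation V := (borel_rV R n).
Hypotheses (iso : isotropic mu) (lc : log_concave mu) (UU : U *m U^T = 1%:M).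
Hypotheses (k0 : (0 < k)%N) (e0 : (0 < e)%N).
Let d := (k * e)%N.
Let m := (k * e * k)%N.
Let kR : 0 < k%:R :> R. Proof. by rewrite ltr0n. Qed.
Let eR : 0 < e%:R :> R. Proof. by rewrite ltr0n. Qed.
Let dR : 0 < d%:R :> R. Proof. by rewrite ltr0n muln_gt0 k0. Qed.
Let sd := Num.sqrt (d%:R : R).
Let sd0 : 0 < sd. Proof. by rewrite sqrtr_gt0. Qed.
Let sd2 : sd ^+ 2 = d%:R. Proof. by rewrite sqr_sqrtr // ltW. Qed.

(* The coordinate [j] of [v], read as [0] for [j >= c]. *)
Definition fn c (v : 'rV[R]_c) (j : nat) : R := oapp (fun i : 'I_c => v ord0 i) 0 (insub j).
Lemma fnE c (v : 'rV[R]_c) (i : 'I_c) : fn v i = v ord0 i.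
Proof. by rewrite /fn valK. Qed.

(** Sign [j k + i] is entry [(i, j)]: consecutive runs of [e k] signs then correspond to runs of [e]
    rows of [U], as [lin_blocks] requires. *)
Definition Gm (s : seq R) : 'M[R]_(k, k * e) := \matrix_(i, j) (s`_(j * k + i) / sd).
Definition Wm (s : seq R) : 'M[R]_(k, n) := Gm s *m U.
Definition cf (u : 'rV[R]_k) (y : 'rV[R]_(k * e)) (l : nat) : R := fn u (l %% k) * fn y (l %/ k).

Lemma cfE u y j (i : 'I_k) : cf u y (j * k + i) = u ord0 i * fn y j.
Proof. by rewrite /cf modnMDl modn_small // divnMDl // divn_small // addn0 fnE. Qed.

Lemma sq_cf u y c j0 : sq (c * k) (fun l => cf u y (j0 * k + l)) = dot u u * \sum_(j < c) fn y (j0 + j) ^+ 2.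
Proof.
rewrite /sq (sum_mul c k (fun l => cf u y (j0 * k + l) ^+ 2)) mulr_sumr; apply: eq_bigr => j _; rewrite /dot mulr_suml; apply: eq_bigr => i _.
by rewrite addnA -mulnDl cfE; ring.
Qed.

Lemma sq_cf_all u y : sq m (cf u y) = dot u u * dot y y.
Proof.
have := sq_cf u y (k * e) 0; rewrite mul0n => ->; congr (_ * _).
by apply: eq_bigr => j _; rewrite add0n fnE expr2.
Qed.

Lemma dotGm s u y : dot (u *m Gm s) y = lin m (cf u y) s / sd.
Proof.
rewrite /lin (sum_mul (k * e) k (fun l => cf u y l * s`_l)) mulr_suml; apply: eq_bigr => j _; rewrite mxE !mulr_suml; apply: eq_bigr => i _.
by rewrite mxE cfE fnE; ring.
Qed.

Lemma dotWm s u (x : 'rV[R]_n) : dot x (u *m Wm s) = lin m (cf u (x *m U^T)) s / sd.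
Proof. by rewrite -dotGm /Wm mulmxA dotC dot_mulmx. Qed.

(** True for every sign sequence: by Cauchy-Schwarz each of the [k e] coordinates of [u *m Gm s] is
    at most [|u| sqrt (k / d)]. *)
Lemma Wm_norm s u : issign m s -> dot (u *m Wm s) (u *m Wm s) <= k%:R * dot u u.
Proof.
move=> ss; rewrite /Wm mulmxA dot_iso //.
apply: le_trans (_ : \sum_(j < k * e) (dot u u * (k%:R / d%:R)) <= _); last first.
  rewrite sumr_const card_ord -[leLHS]mulr_natr -/d le_eqVlt; apply/orP; left; apply/eqP; field.
  by rewrite gt_eqF.
apply: ler_sum => j _; rewrite -expr2.
pose g : 'rV[R]_k := \row_i Gm s i j.
have -> : (u *m Gm s) ord0 j = dot u g by rewrite mxE; apply: eq_bigr => i _; congr (_ * _); rewrite [RHS]mxE.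
apply: le_trans (dot_sqr_le _ _) _; apply: ler_wpM2l; first exact: dot_ge0.
have -> : k%:R / d%:R = \sum_(i < k) (d%:R^-1 : R) by rewrite sumr_const card_ord mulr_natl.
apply: ler_sum => i _; rewrite /g !mxE -expr2 exprMn (sign_sqr ss).
  by rewrite mul1r exprVn sd2.
by apply: leq_trans (_ : j * k + k <= m)%N; [rewrite ltn_add2l|rewrite addnC -mulSn leq_mul2r ltn_ord orbT].
Qed.

Definition rp_h : R := bn_eta / 8.
Lemma rp_h_gt0 : 0 < rp_h.
Proof. by rewrite divr_gt0 // bn_eta_gt0. Qed.
Let sk := Num.sqrt (k%:R : R).
Let sk0 : 0 < sk. Proof. by rewrite sqrtr_gt0. Qed.
Let sk2 : sk ^+ 2 = k%:R. Proof. by rewrite sqr_sqrtr // ltW. Qed.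

Lemma up_borel s u a : measurable [set x : V | a <= dot (x : 'rV[R]_n) (u *m Wm s)].
Proof. by apply: measurable_ge_set; exact: dot_borel. Qed.

(** On at least half of the mass, at least half of the [k] blocks have norm at least
    [(bn_eta / 2) sqrt e]. For such [x], [lin_blocks] makes the form exceed [rp_h sqrt k] with
    probability at least [sgp ^ k]; exchanging signs and [x] gives the statement. Concentration
    turns this rare event into a likely one in [bad_dir_prob]. *)
Lemma typical (u : 'rV[R]_k) : dot u u = 1 ->
  sgp ^+ k / 4 <= Es m (fun s => (sgp ^+ k / 4 <= pr mu [set x : V | rp_h * sk <= dot (x : 'rV[R]_n) (u *m Wm s)])%R%:R).
Proof.
move=> u1; have et0 := @bn_eta_gt0 R.
have be (b : 'I_k) (j : 'I_e) : (b * e + j < k * e)%N.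
  by apply: leq_trans (_ : b * e + e <= _)%N; [rewrite ltn_add2l|rewrite addnC -mulSn leq_mul2r ltn_ord orbT].
pose rw b j : 'rV[R]_n := row (Ordinal (be b j)) U.
have rwE (x : 'rV[R]_n) (b : 'I_k) (j : 'I_e) : fn (x *m U^T) (b * e + j) = dot x (rw b j).
  by rewrite (fnE (x *m U^T) (Ordinal (be b j))) mxE; apply: eq_bigr => l _; rewrite !mxE.
have rwo b i j : dot (rw b i) (rw b j) = (i == j)%:R.
  have -> : dot (rw b i) (rw b j) = (U *m U^T) (Ordinal (be b i)) (Ordinal (be b j)).
    by rewrite mxE; apply: eq_bigr => l _; rewrite !mxE.
  by rewrite UU mxE; congr (_%:R); rewrite -val_eqE /= eqn_add2l.
pose N b (x : 'rV[R]_n) := \sum_(j < e) dot x (rw b j) ^+ 2.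
pose c2 := (bn_eta / 2) ^+ 2 * e%:R : R.
pose Bad b := [set x : V | N b x <= c2].
have mBad b : measurable (Bad b) by apply: measurable_le_set; exact: sumsq_borel.
have pBad b : pr mu (Bad b) <= 4^-1 by exact: block_norm.
pose f (x : V) := \sum_(b < k) \1_(Bad b) x : R.
have bf : bmf f by apply: bmf_sum => b; exact: bmf_indic.
pose BadX := [set x : V | k%:R / 2 < f x].
have mBX : measurable BadX by apply: measurable_gt_set; exact: bf.1.
have pBX : pr mu BadX <= 2^-1.
  have h1 : k%:R / 2 * pr mu BadX <= Ex mu f.
    apply: markov_pr => // [x|x /ltW//]; apply: sumr_ge0 => b _; by rewrite indicE.
  have h2 : Ex mu f <= k%:R / 4.
    rewrite /f Ex_sum => [|b]; last exact: bmf_indic.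
    apply: le_trans (_ : \sum_(b < k) 4^-1 <= _); last by rewrite sumr_const card_ord mulr_natl.
    by apply: ler_sum => b _; rewrite Ex_indic.
  have h3 : k%:R / 2 * pr mu BadX <= k%:R / 2 * 2^-1 by apply: le_trans h1 _; apply: le_trans h2 _; lra.
  by move: h3; rewrite ler_pM2l // divr_gt0.
have hx (x : V) : ~ BadX x -> sgp ^+ k <= Es m (fun s => (rp_h * sk <= dot (x : 'rV[R]_n) (u *m Wm s))%R%:R).
  move=> /negP; rewrite -leNgt => hf.
  have := lin_blocks k (e * k) (cf u ((x : 'rV[R]_n) *m U^T)); rewrite mulnA -/m => /le_trans; apply.
  apply: Es_le => s _; rewrite ler_nat; case: (leP _ (lin m _ s)) => // hl.
  suff -> : rp_h * sk <= dot (x : 'rV[R]_n) (u *m Wm s) by [].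
  rewrite dotWm ler_pdivlMr //; apply: le_trans hl.
  have nb (b : 'I_k) : sq (e * k) (fun i => cf u ((x : 'rV[R]_n) *m U^T) (b * (e * k) + i)) = N b x.
    have := sq_cf u ((x : 'rV[R]_n) *m U^T) e (b * e); rewrite u1 mul1r -mulnA => ->.
    by apply: eq_bigr => j _; rewrite rwE.
  have -> : \sum_(b < k) Num.sqrt (sq (e * k) (fun i => cf u ((x : 'rV[R]_n) *m U^T) (b * (e * k) + i)%N)) / 2 = (\sum_(b < k) Num.sqrt (N b x)) / 2.
    by rewrite mulr_suml; apply: eq_bigr => b _; rewrite nb.
  have h1 : (k%:R - f x) * (bn_eta / 2 * Num.sqrt e%:R) <= \sum_(b < k) Num.sqrt (N b x).
    have -> : (k%:R - f x) * (bn_eta / 2 * Num.sqrt e%:R) = \sum_(b < k) (1 - \1_(Bad b) x) * (bn_eta / 2 * Num.sqrt e%:R).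
      by rewrite -mulr_suml sumrB sumr_const card_ord.
    apply: ler_sum => b _; rewrite indicE; case: (boolP (x \in Bad b)) => hb.
      by rewrite subrr mul0r sqrtr_ge0.
    rewrite subr0 mul1r -[X in X * _]ger0_norm; last by rewrite divr_ge0 // ltW.
    rewrite -sqrtr_sqr -sqrtrM ?sqr_ge0 // ler_wsqrtr // ltW // ltNge; apply/negP => hc.
    by move/negP: hb; apply; apply/mem_set.
  have sde : sd = sk * Num.sqrt e%:R by rewrite /sd /d natrM sqrtrM // ltW.
  have se0 : 0 < Num.sqrt (e%:R : R) by rewrite sqrtr_gt0.
  have h2 : k%:R / 2 * (bn_eta / 2 * Num.sqrt e%:R) <= (k%:R - f x) * (bn_eta / 2 * Num.sqrt e%:R).
    by rewrite ler_pM2r ?mulr_gt0 ?divr_gt0 //; lra.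
  have -> : rp_h * sk * sd = k%:R / 2 * (bn_eta / 2 * Num.sqrt e%:R) / 2.
    by rewrite /rp_h sde -sk2; field.
  by rewrite ler_pM2r // (le_trans h2).
have p0 := @sgp_gt0 R; have pk0 : 0 < sgp ^+ k :> R by rewrite exprn_gt0.
have h1 : sgp ^+ k / 2 <= Es m (fun s => pr mu [set x : V | rp_h * sk <= dot (x : 'rV[R]_n) (u *m Wm s)]).
  rewrite (Es_pr mu) => [|s]; last exact: up_borel.
  apply: le_trans (_ : sgp ^+ k * pr mu (~` BadX) <= _).
    by rewrite ler_pM2l // prC //; lra.
  rewrite -(Ex_indic mu (measurableC mBX)) -ExZ; last by apply: bmf_indic; exact: measurableC.
  apply: Ex_le => [||x].
  - by apply: bmfZ; apply: bmf_indic; exact: measurableC.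
  - by apply: Es_bmf => s; apply: bmf_indic; exact: up_borel.
  rewrite indicE; case: (boolP (x \in ~` BadX)) => [/set_mem/hx h|_]; last first.
    by rewrite mulr0; apply: Es_ge0 => s _; rewrite indicE.
  rewrite mulr1; apply: le_trans h _; rewrite le_eqVlt; apply/orP; left; apply/eqP.
  apply: Es_eq => s _; rewrite indicE; congr (nat_of_bool _)%:R.
  by apply/idP/idP => [h|/set_mem//]; apply/mem_set.
have h2 : Es m (fun s => pr mu [set x : V | rp_h * sk <= dot (x : 'rV[R]_n) (u *m Wm s)]) <=
   Es m (fun s => (sgp ^+ k / 4 <= pr mu [set x : V | rp_h * sk <= dot (x : 'rV[R]_n) (u *m Wm s)])%R%:R + sgp ^+ k / 4).
  apply: Es_le => s _; have [h|h] := leP (sgp ^+ k / 4) (pr mu [set x : V | rp_h * sk <= dot (x : 'rV[R]_n) (u *m Wm s)]); last by apply: le_trans (ltW h) _; rewrite lerDr.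
  apply: le_trans (pr_le1 mu (up_borel _ _ _)) _; rewrite lerDl; lra.
rewrite EsD Es_cst in h2; lra.
Qed.

Definition rp_tau : R := sgp ^+ k / 8.
Lemma rp_tau_gt0 : 0 < rp_tau.
Proof. by rewrite divr_gt0 // exprn_gt0 // sgp_gt0. Qed.
Definition rp_L : R := Num.sqrt (n%:R / rp_tau) + 1.
(** [rp_tau] is half of the mass found in [typical]; the ball of radius [rp_L] removes at most the
    other half and keeps the integrands bounded. *)
Definition heavy (A : set V) := [/\ measurable A, forall x : V, A x -> enorm (x : 'rV[R]_n) <= rp_L & rp_tau <= pr mu A].
Definition zm (A : set V) : 'rV[R]_n := wmean mu (fun x => (pr mu A)^-1 * \1_A x).

Lemma rp_L_gt0 : 0 < rp_L.
Proof. by rewrite /rp_L ltr_wpDl ?sqrtr_ge0. Qed.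

Lemma zm_dot A u : heavy A -> dot (zm A) u * pr mu A = Ex mu (fun x : V => dot (x : 'rV[R]_n) u * \1_A x).
Proof.
move=> [mA AL At]; have A0 : 0 < pr mu A by apply: lt_le_trans At; exact: rp_tau_gt0.
pose phi : V -> R := fun x => (pr mu A)^-1 * \1_A x.
have phi0 x : 0 <= phi x by rewrite mulr_ge0 ?invr_ge0 ?(ltW A0) // indicE.
have phib : bmf phi by apply: bmfZ; exact: bmf_indic.
have phis x : phi x != 0 -> enorm ((x : 'rV[R]_n) - 0) <= rp_L.
  rewrite /phi indicE subr0; case: (boolP (x \in A)) => [/set_mem/AL//|_]; by rewrite mulr0 eqxx.
have L0 := rp_L_gt0.
have := @wmean_dot _ _ mu phi 0 rp_L phib phis L0 u; rewrite -/(zm A) => <-.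
have hb := @wt_dot_bmf _ _ phi 0 rp_L phib phis L0 u.
rewrite mulrC -ExZ //; congr Ex; apply/funext => x; rewrite /phi; field; by rewrite gt_eqF.
Qed.

(** [cond_mean] at level [136 k], where [18 exp (- 17 k)] is below [rp_tau]. *)
Lemma zm_norm A : heavy A -> enorm (zm A) <= 137 * k%:R.
Proof.
move=> hA; have [mA AL At] := hA; have t0 := rp_tau_gt0.
have A0 : 0 < pr mu A by exact: lt_le_trans At.
have k1 : 1 <= k%:R :> R by rewrite (ler_nat _ 1).
have [z0|z0] := eqVneq (zm A) 0; first by rewrite z0 enorm0 mulr_ge0 // ltW.
have ez : 0 < enorm (zm A) by rewrite enorm_gt0.
pose th := (enorm (zm A))^-1 *: zm A.
have th1 : dot th th = 1 by rewrite /th dotZl dotZr -enorm2; field; rewrite gt_eqF.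
have ze : dot (zm A) th = enorm (zm A) by rewrite /th dotZr -enorm2; field; rewrite gt_eqF.
have h := @cond_mean _ _ _ iso lc A th (136 * k%:R) rp_L mA AL th1.
have hT : 18 * expR (- (136 * k%:R / 8)) <= pr mu A.
  apply: le_trans At; have -> : 136 * k%:R / 8 = 17 * k%:R :> R by field.
  have -> : expR (- (17 * k%:R)) = expR (- 1) ^+ (17 * k) :> R.
    by rewrite -expRM_natl natrM; congr expR; ring.
  have e1 : expR (-1) <= 2^-1 :> R.
    rewrite expRN lef_pV2 ?posrE ?expR_gt0 //; have := expR_ge1Dx (1 : R); lra.
  apply: le_trans (_ : 18 * 2^-1 ^+ (17 * k) <= _).
    by rewrite ler_pM2l //; apply: lerXn2r; rewrite ?nnegrE ?expR_ge0 // invr_ge0.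
  rewrite /rp_tau /sgp -exprVn -exprM (_ : 17 * k = 8 * k + 9 * k)%N; last by rewrite -mulnDl.
  rewrite exprD mulrA [leRHS]mulrC ler_pM2r ?exprn_gt0 ?invr_gt0 //.
  apply: le_trans (_ : 18 * 2^-1 ^+ 8 <= _); last by rewrite !exprS expr0; lra.
  rewrite ler_pM2l // exprM.
  case: (k) k0 => // k' _; rewrite exprS ler_piMr ?exprn_ge0 ?invr_ge0 //.
  by rewrite exprn_ile1 ?exprn_ge0 ?invr_ge0 // exprn_ile1 ?invr_ge0 //; lra.
have := h ltac:(by rewrite mulr_ge0 // ltW) hT; rewrite -zm_dot // ze ler_pM2r //; lra.
Qed.

(* The complement of this event is a supremum of linear forms in the signs, to which concentration applies. *)
Definition bad_dir (u : 'rV[R]_k) (s : seq R) : Prop :=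
  forall A, heavy A -> dot (zm A) (u *m Wm s) <= rp_h * sk / 2.
Definition rp_rate : R := rp_h ^+ 2 / (256 * 137 ^+ 2).

(** The supremum of [<zm A, u W>] over heavy sets is convex in the signs with Lipschitz constant
    [137 k / sqrt d], where [d = k e]. It reaches [rp_h sqrt k] with probability at least
    [sgp ^ k / 4] by [typical], so concentration makes values below half of that exponentially rare
    in [e]. *)
Lemma bad_dir_prob u : dot u u = 1 ->
  Es m (fun s => `[< bad_dir u s >]%:R) * (sgp ^+ k / 4) <= expR (- (rp_rate * e%:R)).
Proof.
(* Sets that are not heavy get the zero form, so that the supremum can run over all sets. *)
move=> u1; pose c (A : set V) (l : nat) : R := if `[< heavy A >] then cf u (zm A *m U^T) l / sd else 0.
have L0 : 0 < 137 * k%:R / sd by rewrite divr_gt0 // mulr_gt0.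
have h0 := rp_h_gt0.
have t0 : 0 <= rp_h * sk / 2 by rewrite divr_ge0 // mulr_ge0 // ltW.
have hc A : \sum_(l < m) c A l ^+ 2 <= (137 * k%:R / sd) ^+ 2.
  rewrite /c; case: asboolP => hA; last first.
    by rewrite big1 ?sqr_ge0 // => l _; rewrite expr0n.
  have -> : \sum_(l < m) (cf u (zm A *m U^T) l / sd) ^+ 2 = sq m (cf u (zm A *m U^T)) / sd ^+ 2.
    by rewrite /sq mulr_suml; apply: eq_bigr => l _; rewrite exprMn exprVn.
  rewrite sq_cf_all u1 mul1r exprMn exprVn ler_pM2r ?invr_gt0 ?exprn_gt0 //.
  rewrite -enorm2 ler_sqr ?nnegrE ?enorm_ge0 ?mulr_ge0 ?(ltW kR) //.
  by apply: le_trans (enorm_proj _ UU) _; exact: zm_norm.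
have hl A s : heavy A -> \sum_(l < m) c A l * s`_l = dot (zm A) (u *m Wm s).
  move=> hA; rewrite dotWm /lin mulr_suml; apply: eq_bigr => l _.
  by rewrite /c; case: asboolP => // _; ring.
have := @sup_lin_conc R m _ c _ (rp_h * sk / 2) (rp_h * sk / 2) L0 t0 hc.
have -> : (rp_h * sk / 2) ^+ 2 / (64 * (137 * k%:R / sd) ^+ 2) = rp_rate * e%:R.
  have -> : (rp_h * sk / 2) ^+ 2 = rp_h ^+ 2 * k%:R / 4 by rewrite -sk2; field.
  have -> : (137 * k%:R / sd) ^+ 2 = 137 ^+ 2 * k%:R / e%:R.
    by rewrite expr_div_n sd2 /d natrM; field; rewrite !gt_eqF.
  by rewrite /rp_rate; field; rewrite !gt_eqF.
apply: le_trans; apply: ler_pM.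
- by apply: Es_ge0.
- by rewrite divr_ge0 // exprn_ge0 // ltW // sgp_gt0.
- apply: Es_le => s _; rewrite ler_nat; case: asboolP => // hb; case: asboolP => // hn; case: hn => A.
  have [hA|hA] := pselect (heavy A); first by rewrite hl //; exact: hb.
  rewrite big1 // => l _; rewrite /c; case: asboolP => // _; by rewrite mul0r.
- apply: le_trans (typical u1) _; apply: Es_le => s _; rewrite ler_nat; case: leP => // hp.
  case: asboolP => // hn; case: hn.
  have t1 := rp_tau_gt0.
  pose A := [set x : V | rp_h * sk <= dot (x : 'rV[R]_n) (u *m Wm s)] `&` [set x : V | enorm (x : 'rV[R]_n) <= rp_L].
  have mA : measurable A by apply: measurableI; [exact: up_borel|exact: ball0_borel].
  have hA : heavy A.
    split => //; first by move=> x [].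
    have := pr_ballI iso (up_borel s u (rp_h * sk)) rp_L_gt0; rewrite -/A.
    have : n%:R / rp_L ^+ 2 <= rp_tau.
      rewrite ler_pdivrMr ?exprn_gt0 ?rp_L_gt0 // mulrC -ler_pdivrMr //.
      have nt : 0 <= n%:R / rp_tau by rewrite divr_ge0 // ltW.
      by rewrite -[leLHS](sqr_sqrtr nt) ler_sqr ?nnegrE ?sqrtr_ge0 ?(ltW rp_L_gt0) // /rp_L lerDl.
    have : sgp ^+ k / 4 = rp_tau + rp_tau by rewrite /rp_tau; lra.
    lra.
  exists A; rewrite hl //.
  have A0 : 0 < pr mu A by case: hA => _ _; apply: lt_le_trans.
  have -> : rp_h * sk / 2 + rp_h * sk / 2 = rp_h * sk by field.
  rewrite -(ler_pM2r A0) zm_dot // -Ex_indic // -ExZ; last exact: bmf_indic.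
  apply: Ex_le => [||x]; first by apply: bmfZ; exact: bmf_indic.
    apply: (@bmfP _ _ _ _ (rp_L * enorm (u *m Wm s))).
      by apply: measurable_funM; [exact: dot_borel|exact: measurable_indic].
    move=> x; rewrite normrM indicE; case: (boolP (x \in A)) => [/set_mem[_ hx]|_].
      rewrite normr1 mulr1; apply: le_trans (ler_dot _ _) _; rewrite ler_wpM2r ?enorm_ge0 //.
    by rewrite normr0 mulr0 mulr_ge0 ?enorm_ge0 // ltW // rp_L_gt0.
  rewrite indicE; case: (boolP (x \in A)) => [/set_mem[hx _]|_]; by rewrite ?mulr1 ?mulr0.
Qed.

Definition rp_tau3 : R := (rp_h / 4) ^+ 2 * rp_tau ^+ 2.

(** A Paley-Zygmund argument on a heavy set whose mean exceeds [rp_h sqrt k / 2]: the part above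
    half that level is controlled by Cauchy-Schwarz, and [Wm_norm] bounds the second moment by
    [k]. *)
Lemma good_dir u s : issign m s -> dot u u = 1 -> ~ bad_dir u s ->
  rp_tau3 <= pr mu [set x : V | rp_h * sk / 4 <= dot (x : 'rV[R]_n) (u *m Wm s)].
Proof.
move=> ss u1 /existsNP[A /not_implyP[hA /negP]]; rewrite -ltNge => hz.
have [mA AL At] := hA; have t0 := rp_tau_gt0; have h0 := rp_h_gt0.
have A0 : 0 < pr mu A by exact: lt_le_trans At.
set D := [set x : V | _]; have mD : measurable D by exact: up_borel.
pose X (x : V) := dot (x : 'rV[R]_n) (u *m Wm s).
have bX : bmf (fun x => X x * \1_A x).
  apply: (@bmfP _ _ _ _ (rp_L * enorm (u *m Wm s))).
    by apply: measurable_funM; [exact: dot_borel|exact: measurable_indic].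
  move=> x; rewrite normrM indicE; case: (boolP (x \in A)) => [/set_mem/AL hx|_].
    by rewrite normr1 mulr1; apply: le_trans (ler_dot _ _) _; rewrite ler_wpM2r ?enorm_ge0.
  by rewrite normr0 mulr0 mulr_ge0 ?enorm_ge0 // ltW // rp_L_gt0.
have bD : bmf (\1_D : V -> R) by exact: bmf_indic.
have bA : bmf (\1_A : V -> R) by exact: bmf_indic.
have h1 : rp_h * sk / 4 * pr mu A <= Ex mu (fun x => X x * \1_A x * \1_D x).
  have : rp_h * sk / 2 * pr mu A <= Ex mu (fun x => X x * \1_A x).
    by rewrite -zm_dot // ler_pM2r // ltW.
  have : Ex mu (fun x => X x * \1_A x) <= Ex mu (fun x => X x * \1_A x * \1_D x) + rp_h * sk / 4 * pr mu A.
    rewrite -(Ex_indic mu mA) -ExZ // -ExD; [|exact: bmfM|exact: bmfZ].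
    apply: Ex_le => // [|x]; first by apply: bmfD; [exact: bmfM|exact: bmfZ].
    rewrite [\1_D x]indicE; case: (boolP (x \in D)) => hx.
      by rewrite mulr1 lerDl; apply: mulr_ge0; [rewrite divr_ge0 // mulr_ge0 // ltW|rewrite indicE].
    rewrite mulr0 add0r; apply: ler_wpM2r; first by rewrite indicE.
    by apply: ltW; rewrite ltNge; apply/negP => h; move/negP: hx; apply; apply/mem_set.
  lra.
have h2 : Ex mu (fun x => (X x * \1_A x) ^+ 2) <= k%:R.
  apply: le_trans (_ : dot (u *m Wm s) (u *m Wm s) <= _); last by have := Wm_norm u ss; rewrite u1 mulr1.
  apply: (Ex_dot2_le iso).
    by have := bmfM bX bX; under eq_fun do rewrite -expr2.
  move=> x; rewrite exprMn indicE -/(X x) ler_piMr ?sqr_ge0 //; case: (x \in A); rewrite ?expr1n ?expr0n //.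
have h3 := Ex_CS mu bX bD.
have e1 : Ex mu (fun x => \1_D x ^+ 2) = pr mu D.
  rewrite -Ex_indic //; congr Ex; apply/funext => x; rewrite indicE; case: (x \in D); by rewrite ?expr1n ?expr0n.
rewrite e1 in h3.
have p0 := pr_ge0 mu D.
have h4 : (rp_h * sk / 4 * pr mu A) ^+ 2 <= k%:R * pr mu D.
  apply: le_trans (_ : Ex mu (fun x => X x * \1_A x * \1_D x) ^+ 2 <= _).
    have q0 : 0 < rp_h * sk / 4 * pr mu A by apply: mulr_gt0 => //; apply: divr_gt0 => //; exact: mulr_gt0.
    by rewrite ler_sqr ?nnegrE ?(ltW q0) // (le_trans (ltW q0) h1).
  by apply: le_trans h3 _; rewrite ler_wpM2r.
rewrite -(ler_pM2l kR); apply: le_trans h4.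
have -> : (rp_h * sk / 4 * pr mu A) ^+ 2 = k%:R * ((rp_h / 4) ^+ 2 * pr mu A ^+ 2) by rewrite -sk2; field.
rewrite ler_pM2l // /rp_tau3; apply: ler_wpM2l; first exact: sqr_ge0.
by rewrite ler_sqr ?nnegrE ?(ltW t0) ?(ltW A0).
Qed.

(** [rp_bb ^ k] is the box mass that [cell_bound] can guarantee; [rp_eps] lets more than [1 / rp_bb]
    boxes at spacing [7 rp_eps] fit along an edge of length [rp_h / 8]; [rp_M] bounds, through the
    tails, the centres of boxes of that mass. *)
Definition rp_bb : R := expR (-1) * sgp ^+ 4 * (Order.min 1 (rp_h ^+ 4) / 2 ^+ 22) / 36 ^+ 2.
Definition rp_eps : R := rp_h / (56 * (rp_bb^-1 + 2)).
Definition rp_M : R := 2 * rp_eps + 8 + 8 * - ln rp_bb.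
Lemma rp_bb_gt0 : 0 < rp_bb.
Proof.
have h0 := rp_h_gt0; rewrite /rp_bb divr_gt0 ?exprn_gt0 // !mulr_gt0 ?expR_gt0 ?exprn_gt0 ?sgp_gt0 //.
by rewrite lt_min ltr01 exprn_gt0.
Qed.
Lemma rp_bb_lt1 : rp_bb < 1.
Proof.
have h0 := rp_h_gt0; have p0 := @sgp_gt0 R.
have e1 : expR (-1) <= 1 :> R by rewrite -[leRHS]expR0 ler_expR.
have p1 : sgp ^+ 4 <= 1 :> R.
  by rewrite exprn_ile1 ?(ltW p0) // /sgp invf_le1 ?exprn_gt0 // exprn_ege1 //; lra.
have m1 : Order.min 1 (rp_h ^+ 4) / 2 ^+ 22 <= 1 :> R.
  by rewrite ler_pdivrMr ?exprn_gt0 // mul1r (@le_trans _ _ 1) ?ge_min ?lexx // exprn_ege1 //; lra.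
rewrite /rp_bb ltr_pdivrMr ?exprn_gt0 // mul1r; apply: le_lt_trans (_ : 1 * 1 * 1 < _); last by rewrite expr2; lra.
have m0 : 0 <= Order.min 1 (rp_h ^+ 4) / 2 ^+ 22 :> R by rewrite divr_ge0 ?exprn_ge0 // le_min ler01 exprn_ge0 // ltW.
have p00 : 0 <= sgp ^+ 4 :> R by rewrite exprn_ge0 // ltW.
apply: ler_pM => //; first by rewrite mulr_ge0 // expR_ge0.
by apply: ler_pM => //; exact: expR_ge0.
Qed.
Lemma rp_eps_gt0 : 0 < rp_eps.
Proof.
have b0 := rp_bb_gt0; rewrite /rp_eps divr_gt0 ?rp_h_gt0 // mulr_gt0 // addr_gt0 // invr_gt0 //.
Qed.
Lemma rp_M_gt0 : 0 < rp_M.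
Proof.
have b0 := rp_bb_gt0; have b1 := rp_bb_lt1; have e1 := rp_eps_gt0.
have : ln rp_bb <= 0 by apply: ln_le0; exact: ltW.
by rewrite /rp_M; lra.
Qed.

(** A fixed vector [y] is mapped by [Gm] to one of mean square norm [k |y|^2 / d]. Markov over the
    signs, then over the mass of [S0], keeps half of [S0] within [2 a sqrt k] for at least half of
    the signs. *)
Lemma ball_proj_mass (w : 'rV[R]_(k * e)) (a : R) : 0 < a ->
  let S0 := [set x : V | enorm ((x : 'rV[R]_n) *m U^T - w) <= a * sd] in
  let S s := S0 `&` [set x : V | enorm (((x : 'rV[R]_n) *m U^T - w) *m (Gm s)^T) <= 2 * a * sk] in
  (forall s, measurable (S s)) /\ (0 < pr mu S0 -> Es m (fun s => (pr mu (S s) < pr mu S0 / 2)%R%:R) <= 2^-1).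
Proof.
move=> a0 S0 S.
have mc c (M : 'M[R]_(n, c)) (v : 'rV[R]_c) (b : R) : measurable [set x : V | enorm ((x : 'rV[R]_n) *m M - v) <= b].
  apply: (measurable_le_set (f := fun x : V => enorm ((x : 'rV[R]_n) *m M - v))).
  have -> : (fun x : V => enorm ((x : 'rV[R]_n) *m M - v)) = (fun x : V => Num.sqrt (\sum_i (dot (x : 'rV[R]_n) (\row_j M j i) - v ord0 i) ^+ 2)).
    apply/funext => x; rewrite /enorm; congr Num.sqrt; apply: eq_bigr => i _; rewrite !mxE; congr ((_ - _) ^+ 2).
    by apply: eq_bigr => j _; rewrite mxE.
  apply: measurableT_comp; first by apply: continuous_measurable_fun; exact: sqrt_continuous.
  apply: measurable_sum => i; apply: measurable_funX; apply: measurable_funB => //; exact: dot_borel.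
have mS0 : measurable S0 by exact: mc.
have mS s : measurable (S s).
  apply: measurableI => //.
  by have := mc _ (U^T *m (Gm s)^T) (w *m (Gm s)^T) (2 * a * sk); under eq_set do rewrite mulmxA -mulmxBl.
split=> // p0.
have key (x : V) : S0 x -> 3 / 4 <= Es m (fun s => \1_(S s) x).
  move=> hx; set y := (x : 'rV[R]_n) *m U^T - w.
  have yG s (i : 'I_k) : (y *m (Gm s)^T) ord0 i = lin m (cf (delta_mx 0 i) y) s / sd.
    by rewrite -dotGm mxE dotC; apply: eq_bigr => j _; rewrite -rowE !mxE.
  have h1 : Es m (fun s => enorm (y *m (Gm s)^T) ^+ 2) = k%:R * (dot y y / d%:R).
    have -> : (fun s => enorm (y *m (Gm s)^T) ^+ 2) = (fun s => \sum_(i < k) (d%:R^-1 * lin m (cf (delta_mx 0 i) y) s ^+ 2)).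
      apply/funext => s; rewrite enorm2; apply: eq_bigr => i _; rewrite -expr2 yG expr_div_n sd2 mulrC //.
    rewrite Es_sum (eq_bigr (fun=> dot y y / d%:R)) => [|i _].
      by rewrite sumr_const card_ord mulr_natl.
    rewrite EsZ Es_lin2 sq_cf_all.
    have -> : dot (delta_mx 0 i) (delta_mx 0 i) = 1 :> R.
      rewrite /dot (bigD1 i) //= !mxE !eqxx mulr1 big1 ?addr0 // => j /negbTE ji.
      by rewrite !mxE ji andbF mul0r.
    by rewrite mul1r mulrC.
  have h2 : dot y y <= a ^+ 2 * d%:R.
    rewrite -enorm2 -sd2 -exprMn ler_sqr ?nnegrE ?enorm_ge0 // mulr_ge0 // ltW //.
  have h3 : (2 * a * sk) ^+ 2 * Es m (fun s => (~~ (s \in [pred s | x \in S s]))%:R) <= Es m (fun s => enorm (y *m (Gm s)^T) ^+ 2).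
    apply: Es_markov => [s _|s _]; first exact: sqr_ge0.
    rewrite inE => hn; have q0 : 0 <= 2 * a * sk by rewrite !mulr_ge0 // ltW.
    rewrite ler_sqr ?nnegrE ?enorm_ge0 //; apply: ltW; rewrite ltNge; apply/negP => h; move/negP: hn; apply; apply/mem_set.
    by split.
  have -> : Es m (fun s => \1_(S s) x) = Es m (fun s => (s \in [pred s | x \in S s])%:R).
    by congr Es; apply/funext => s; rewrite indicE inE.
  rewrite Es_compl h1 in h3; set E := Es m _ in h3 *.
  have h4 : k%:R * (dot y y / d%:R) <= k%:R * a ^+ 2.
    by rewrite ler_pM2l // ler_pdivrMr.
  have h5 : (2 * a * sk) ^+ 2 = 4 * (k%:R * a ^+ 2) by rewrite -sk2; ring.
  have kp : 0 < k%:R * a ^+ 2 by rewrite mulr_gt0 // exprn_gt0.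
  rewrite h5 in h3; have : 4 * (1 - E) <= 1.
    by rewrite -(ler_pM2r kp) mul1r; apply: le_trans h4; apply: le_trans h3; lra.
  lra.
have h1 : 3 / 4 * pr mu S0 <= Es m (fun s => pr mu (S s)).
  rewrite (Es_pr mu _ mS) -Ex_indic // -ExZ; last exact: bmf_indic.
  apply: Ex_le => [||x]; [by apply: bmfZ; exact: bmf_indic|by apply: Es_bmf => s; exact: bmf_indic|].
  rewrite indicE; case: (boolP (x \in S0)) => [/set_mem/key|_]; first by rewrite mulr1.
  by rewrite mulr0; apply: Es_ge0 => s _; rewrite indicE.
have h2 : pr mu S0 / 2 * Es m (fun s => (pr mu (S s) < pr mu S0 / 2)%R%:R) <= Es m (fun s => pr mu S0 + (- 1) * pr mu (S s)).
  apply: Es_markov => [s _|s _ h]; last by lra.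
  have : pr mu (S s) <= pr mu S0 by apply: pr_mono => // x [].
  lra.
rewrite EsD Es_cst EsZ in h2.
set E := Es m _ in h2 *; set E2 := Es m _ in h1 h2.
have : pr mu S0 / 2 * E <= pr mu S0 / 2 * 2^-1 by lra.
by rewrite ler_pM2l // divr_gt0.
Qed.

(** The centres [H] of boxes of mass at least [rp_bb ^ k] form a bounded convex set whose support
    function is at least [rp_h sqrt k / 8] in every direction. So every point of the ball of that
    radius is nearly a centre, and the ball has room for more than [rp_bb ^ (- k)] centres of
    disjoint boxes, whose total mass would exceed 1. *)
Lemma box_packing (W : 'M[R]_(k, n)) (l : seq 'rV[R]_k) :
  (forall u : 'rV[R]_k, dot (u *m W) (u *m W) <= k%:R * dot u u) ->
  (forall u : 'rV[R]_k, dot u u = 1 -> exists2 p, p \in l & enorm (u - p) <= rp_h / (8 * k%:R * rp_M)) ->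
  (forall u, u \in l -> exists2 v : 'rV[R]_k,
     rp_bb ^+ k <= pr mu [set x : V | forall i, `|dot (x : 'rV[R]_n) (row i W) - v ord0 i| <= 2 * rp_eps] &
     rp_h * sk / 4 <= dot u v) -> False.
Proof.
move=> hW hnet hH0.
have e0' := rp_eps_gt0; have h0 := rp_h_gt0; have M0 := rp_M_gt0; have b0 := rp_bb_gt0; have b1 := rp_bb_lt1.
have k1 : 1 <= k%:R :> R by rewrite (ler_nat _ 1).
set eps := rp_eps in hH0 e0' *.
pose Vi (x : 'rV[R]_n) i := dot x (row i W).
have uV (u : 'rV[R]_k) (x : 'rV[R]_n) : dot x (u *m W) = \sum_i u ord0 i * Vi x i.
  by rewrite mulmx_sum_row dot_sumr; apply: eq_bigr => i _; rewrite dotZr.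
pose b := rp_bb ^+ k : R; have bp : 0 < b by rewrite exprn_gt0.
pose box (a : R) (v : 'rV[R]_k) := [set x : V | forall i, `|Vi x i - v ord0 i| <= a].
have cbox a v : closed (box a v : set 'rV[R]_n).
  have -> : box a v = \bigcap_(i in setT) [set x : 'rV[R]_n | `|dot x (row i W) - v ord0 i| <= a].
    by apply/seteqP; split => x h i *; exact: h.
  by apply: closed_bigI => i _; exact: dle_closed.
have mbox a v : measurable (box a v) by apply: closed_borel; exact: cbox.
pose H := [set v : 'rV[R]_k | b <= pr mu (box (2 * eps) v)].
have hH u : u \in l -> exists2 v, H v & rp_h * sk / 4 <= dot u v by exact: hH0.
have bE : b = expR (- (- ln b)) by rewrite opprK lnK // posrE.
have Hb v : H v -> enorm v <= sk * (k%:R * rp_M).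
  move=> Hv; have [v0|v0] := eqVneq v 0; first by rewrite v0 enorm0 !mulr_ge0 // ltW.
  rewrite leNgt; apply/negP => hlt.
  have ev : 0 < enorm v by rewrite enorm_gt0.
  pose th := (enorm v)^-1 *: v; pose om := th *m W.
  have th1 : dot th th = 1 by rewrite /th dotZl dotZr -enorm2; field; rewrite gt_eqF.
  have tv : dot th v = enorm v by rewrite /th dotZl -enorm2; field; rewrite gt_eqF.
  have eth : enorm th = 1 by rewrite enormE th1 sqrtr1.
  have om1 : enorm om <= sk.
    by rewrite -(@ler_sqr R) ?nnegrE ?enorm_ge0 ?(ltW sk0) // enorm2 sk2; have := hW th; rewrite th1 mulr1.
  have hx x : box (2 * eps) v x -> enorm v - 2 * eps * sk <= dot x om.
    move=> bx; pose vx : 'rV[R]_k := \row_i Vi x i.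
    have -> : dot x om = dot th vx by rewrite /om uV; apply: eq_bigr => i _; rewrite [vx _ _]mxE.
    have h1 : enorm (vx - v) <= sk * (2 * eps).
      by apply: enorm_le_sup => [|i]; [rewrite mulr_ge0 // ltW|rewrite !mxE; exact: bx].
    have -> : vx = v + (vx - v) by rewrite addrC subrK.
    rewrite dotDr tv; have := ler_dot th (vx - v); rewrite eth mul1r ler_norml => /andP[h2 _]; lra.
  have sM : sk * (k%:R * rp_M) = sk * (k%:R * (2 * eps)) + sk * (k%:R * (8 + 8 * - ln rp_bb)) by rewrite /rp_M -/eps; ring.
  have lb0 : ln rp_bb < 0 by rewrite ln_lt0 // b0.
  have h2 : sk * (8 * k%:R * (1 - ln rp_bb)) < enorm v - 2 * eps * sk.
    have : sk * (2 * eps) <= sk * (k%:R * (2 * eps)).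
      by rewrite ler_pM2l // -[leLHS]mul1r ler_pM2r // mulr_gt0.
    have : sk * (8 * k%:R * (1 - ln rp_bb)) = sk * (k%:R * (8 + 8 * - ln rp_bb)) by ring.
    lra.
  have h20 : 0 < sk * (8 * k%:R * (1 - ln rp_bb)) by rewrite !mulr_gt0 //; lra.
  have [om0|om0] := eqVneq om 0.
    have : box (2 * eps) v !=set0.
      by apply/set0P/eqP => hz; move: Hv; rewrite /H /= hz pr0 leNgt bp.
    by case=> x /hx; rewrite om0 dot0r; lra.
  have eo : 0 < enorm om by rewrite enorm_gt0.
  pose ww := (enorm om)^-1 *: om.
  have w1 : dot ww ww = 1 by rewrite /ww dotZl dotZr -enorm2; field; rewrite gt_eqF.
  (* At this level the tail bound falls below [rp_bb ^ k]. *)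
  pose s := 8 * k%:R * (1 - ln rp_bb).
  have : b <= 2 * expR (- (s / 8)).
    apply: le_trans Hv _; apply: le_trans _ (tail_dot iso lc w1 s); apply: pr_mono => //; first exact: dge_borel.
    move=> x /hx h; rewrite /= /ww dotZr; apply: le_trans (ler_norm _).
    rewrite mulrC ler_pdivlMr //; apply: le_trans h; apply: le_trans (ltW h2).
    rewrite mulrC ler_pM2r // /s !mulr_gt0 //; lra.
  apply/negP; rewrite -ltNge.
  have -> : - (s / 8) = k%:R * (ln rp_bb - 1) by rewrite /s; field.
  rewrite expRM_natl expRD lnK ?posrE // exprMn -/b mulrCA -[ltRHS]mulr1 ltr_pM2l //.
  have e1 : expR (-1) < 2^-1 :> R.
    rewrite expRN ltf_pV2 ?posrE ?expR_gt0 //; have := @expR_gt1Dx R 1 (oner_neq0 _); lra.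
  apply: le_lt_trans (_ : 2 * expR (-1) < _); last by lra.
  rewrite ler_pM2l //; case: (k) k0 => // k' _; rewrite exprS ler_piMr ?expR_ge0 // exprn_ile1 ?expR_ge0 //; lra.
have Hne : H !=set0.
  pose u0 : 'rV[R]_k := delta_mx 0 (Ordinal k0).
  have [|p /hH[v Hv _] _] := hnet u0; last by exists v.
  rewrite /u0 /dot (bigD1 (Ordinal k0)) //= !mxE !eqxx mulr1 big1 ?addr0 // => j /negbTE ji.
  by rewrite !mxE ji andbF mul0r.
have Hc x y t : H x -> H y -> 0 < t < 1 -> H (t *: x + (1 - t) *: y).
  move=> Hx Hy t01; have [t0 t1] := andP t01.
  have := @lc_exp_cl R n mu iso lc (box (2 * eps) x) (box (2 * eps) y) (box (2 * eps) (t *: x + (1 - t) *: y)) t (- ln b) (- ln b) t01 (cbox _ _) (cbox _ _) (mbox _ _).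
  rewrite -mulrDl subrKC mul1r -bE; apply => // p q hp hq i.
  rewrite /Vi dotDl !dotZl !mxE -!/(Vi _ i).
  have cd (a1 a2 a3 a4 : R) : t * a1 + (1 - t) * a2 - (t * a3 + (1 - t) * a4) = t * (a1 - a3) + (1 - t) * (a2 - a4) by ring.
  rewrite cd.
  apply: le_trans (ler_normD _ _) _; rewrite !normrM (gtr0_norm t0) (@gtr0_norm _ (1 - t)) ?subr_gt0 //.
  have := hp i; have := hq i => h1 h2.
  have : t * `|Vi p i - x ord0 i| <= t * (2 * eps) by rewrite ler_pM2l.
  have : (1 - t) * `|Vi q i - y ord0 i| <= (1 - t) * (2 * eps) by rewrite ler_pM2l // subr_gt0.
  lra.
have Hs p : enorm p <= rp_h * sk / 8 -> b <= pr mu (box (3 * eps) p).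
  move=> hp.
  have [|v Hv vp] := @conv_approx R k H (sk * (k%:R * rp_M)) p Hne Hb Hc _ eps e0'.
    move=> g; have [g0|g0] := eqVneq g 0.
      by case: Hne => v Hv; exists v => //; rewrite g0 !dot0l.
    have eg : 0 < enorm g by rewrite enorm_gt0.
    pose th := (enorm g)^-1 *: g.
    have th1 : dot th th = 1 by rewrite /th dotZl dotZr -enorm2; field; rewrite gt_eqF.
    have gE : g = enorm g *: th by rewrite /th scalerA divff ?gt_eqF // scale1r.
    have eth : enorm th = 1 by rewrite enormE th1 sqrtr1.
    have [u ul hu] := hnet _ th1; have [v Hv huv] := hH _ ul; exists v => //.
    rewrite gE dotZl [leRHS]dotZl ler_pM2l //.
    apply: le_trans (dot_le _ _) _; rewrite eth mul1r; apply: le_trans hp _.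
    have -> : th = u + (th - u) by rewrite addrC subrK.
    rewrite dotDl; have := ler_dot (th - u) v; rewrite ler_norml => /andP[h2 _].
    have : enorm (th - u) * enorm v <= rp_h / (8 * k%:R * rp_M) * (sk * (k%:R * rp_M)).
      by apply: ler_pM; rewrite ?enorm_ge0 // Hb.
    have -> : rp_h / (8 * k%:R * rp_M) * (sk * (k%:R * rp_M)) = rp_h * sk / 8 by field; rewrite !gt_eqF.
    lra.
  apply: le_trans Hv _; apply: pr_mono => // x hx i.
  have := hx i; have := ler_coord (p - v) i; rewrite !mxE => h1 h2.
  have -> : Vi x i - p ord0 i = (Vi x i - v ord0 i) - (p ord0 i - v ord0 i) by ring.
  apply: le_trans (ler_normB _ _) _; lra.
(* The cube of [J ^ k] centres with spacing [7 eps] lies in the ball, its edge being at most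
   [rp_h / 8]; boxes of half-width [3 eps] about them are disjoint. *)
pose J := (Num.truncn (rp_bb^-1)).+1.
have bi : 0 < rp_bb^-1 by rewrite invr_gt0.
have J1 : rp_bb^-1 < J%:R by exact: truncnS_gt.
have J2 : J%:R <= rp_bb^-1 + 1 :> R.
  by rewrite /J -natr1 lerD2r; have /truncn_itv/andP[] := ltW bi.
have eJ : 7 * eps * J%:R <= rp_h / 8.
  have -> : rp_h / 8 = 7 * eps * (rp_bb^-1 + 2) by rewrite /eps /rp_eps; field; rewrite !gt_eqF //; lra.
  have e7 : 0 < 7 * eps by rewrite mulr_gt0.
  rewrite (ler_pM2l e7); apply: le_trans J2 _; by rewrite lerD2l (ler_nat _ 1 2).
pose pz (z : {ffun 'I_k -> 'I_J}) : 'rV[R]_k := \row_i (7 * eps * (z i)%:R).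
have hz z : b <= pr mu (box (3 * eps) (pz z)).
  apply: Hs; apply: le_trans (_ : sk * (rp_h / 8) <= _); last by rewrite le_eqVlt; apply/orP; left; apply/eqP; ring.
  apply: enorm_le_sup => [|i]; first by rewrite divr_ge0 // ltW.
  have e7 : 0 < 7 * eps by rewrite mulr_gt0.
  rewrite mxE ger0_norm; last by apply: mulr_ge0 => //; exact: ltW.
  by apply: le_trans eJ; rewrite ler_pM2l // ler_nat ltnW.
have hs : \sum_(z : {ffun 'I_k -> 'I_J}) 1 * pr mu (box (3 * eps) (pz z)) <= 1.
  apply: sum_pr_le => [z|x]; first exact: mbox.
  apply: le_trans (_ : \sum_(z : {ffun 'I_k -> 'I_J}) ((x \in box (3 * eps) (pz z))%:R : R) <= _).
    by apply: ler_sum => z _; rewrite mul1r indicE.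
  apply: sum_disj_le1; first exact: index_enum_uniq.
  move=> z z' _ _ /set_mem h1 /set_mem h2; apply/ffunP => i; apply/val_inj => /=.
  have := h1 i; have := h2 i; rewrite !mxE => a1 a2.
  have : 7 * eps * `|(z i)%:R - (z' i)%:R : R| <= 6 * eps.
    have e7 : 0 < 7 * eps by rewrite mulr_gt0.
    rewrite -[X in X * _](gtr0_norm e7) -normrM.
    have -> : 7 * eps * ((z i)%:R - (z' i)%:R) = (Vi x i - 7 * eps * (z' i)%:R) - (Vi x i - 7 * eps * (z i)%:R) by ring.
    apply: le_trans (ler_normB _ _) _; lra.
  have e7 : 0 < 7 * eps by rewrite mulr_gt0.
  rewrite -ler_pdivlMl //.
  have -> : (7 * eps)^-1 * (6 * eps) = 6 / 7 by field; rewrite gt_eqF.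
  move=> h; apply/eqP; case: ltngtP => // hlt; exfalso; move: h; apply/negP; rewrite -ltNge.
    apply: lt_le_trans (_ : 1 <= _); first by lra.
    rewrite distrC; apply: le_trans (ler_norm _).
    by rewrite lerBrDr -(natrD _ 1) ler_nat.
  apply: lt_le_trans (_ : 1 <= _); first by lra.
  by apply: le_trans (ler_norm _); rewrite lerBrDr -(natrD _ 1) ler_nat.
have : J%:R ^+ k * b <= 1.
  apply: le_trans hs.
  have -> : J%:R ^+ k * b = \sum_(z : {ffun 'I_k -> 'I_J}) b.
    by rewrite sumr_const card_ffun !card_ord -[RHS]mulr_natl natrX.
  by apply: ler_sum => z _; rewrite mul1r.
apply/negP; rewrite -ltNge /b -exprMn exprn_egt1 ?gtn_eqF //.
by rewrite -ltr_pdivrMr // div1r.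
Qed.

(** Suppose the ball has larger mass. For some signs, half of that mass is mapped within
    [2 rp_eps sqrt k] of one point and no direction of a net is bad. Then [cell_bound], with the
    mapped half as tame set, finds for each net direction [u] a box of mass at least [rp_bb ^ k]
    with centre [v] and [<u, v> >= rp_h sqrt k / 4], which [box_packing] excludes. *)
Theorem small_proj (w : 'rV[R]_(k * e)) :
  (24 * (8 * k%:R * rp_M / rp_h + 1)) ^+ k * 16 <= sgp ^+ k * expR (rp_rate * e%:R) ->
  pr mu [set x : V | enorm ((x : 'rV[R]_n) *m U^T - w) <= rp_eps * sd] <= expR (- k%:R).
Proof.
move=> hcond; rewrite leNgt; apply/negP => hS.
have e0' := rp_eps_gt0; have h0 := rp_h_gt0; have M0 := rp_M_gt0; have b0 := rp_bb_gt0; have b1 := rp_bb_lt1.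
have p0 := @sgp_gt0 R; have pk0 : 0 < sgp ^+ k :> R by rewrite exprn_gt0.
have k1 : 1 <= k%:R :> R by rewrite (ler_nat _ 1).
set eps := rp_eps in hS e0' *.
pose S0 := [set x : V | enorm ((x : 'rV[R]_n) *m U^T - w) <= eps * sd].
pose S s := S0 `&` [set x : V | enorm (((x : 'rV[R]_n) *m U^T - w) *m (Gm s)^T) <= 2 * eps * sk].
have [mS hT] := ball_proj_mass w e0'; rewrite -/S0 in hT.
have {hT} := hT (lt_trans (expR_gt0 _) hS) => hT.
pose dl := rp_h / (8 * k%:R * rp_M); have dl0 : 0 < dl by rewrite divr_gt0 // !mulr_gt0.
pose sph := [set u : 'rV[R]_k | dot u u = 1].
have [||l [_ hl1 hl2 hl3]] := @sep_cover R k dl sph ((24 * (8 * k%:R * rp_M / rp_h + 1)) ^+ k).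
  exact: ltW.
  move=> l hl ll; have := @pack_size R k dl 1 0 l dl0 ler01 hl.
  have -> : 1 / dl = 8 * k%:R * rp_M / rp_h by rewrite /dl; field; rewrite !gt_eqF.
  by apply => p pl; rewrite subr0 enormE (ll p pl) sqrtr1.
(* One minus a count of failures: its mean is at least [1/4], and since the count is an integer a
   value at least [1/4] means no failure. *)
pose f s : R := 1 - ((pr mu (S s) < pr mu S0 / 2)%R%:R + \sum_(u <- l) `[< bad_dir u s >]%:R).
have [s ss hs] : exists2 s, issign m s & 4^-1 <= f s.
  apply: Es_exists; rewrite /f.
  have -> : (fun s => 1 - ((pr mu (S s) < pr mu S0 / 2)%R%:R + \sum_(u <- l) `[< bad_dir u s >]%:R : R)) =
     (fun s => 1 + (-1) * ((pr mu (S s) < pr mu S0 / 2)%R%:R + \sum_(u <- l) `[< bad_dir u s >]%:R)).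
    by apply/funext => s; rewrite mulN1r.
  rewrite EsD Es_cst EsZ EsD Es_sum.
  suff : \sum_(u <- l) Es m (fun s => `[< bad_dir u s >]%:R) <= 4^-1 by move: hT; rewrite -/(S _); lra.
  pose q := expR (- (rp_rate * e%:R)) * 4 / sgp ^+ k.
  apply: le_trans (_ : \sum_(u <- l) q <= _).
    rewrite !big_seq; apply: ler_sum => u ul; have := bad_dir_prob (hl1 u ul).
    by rewrite /q ler_pdivlMr // => h; lra.
  rewrite big_const_seq count_predT iter_addr_0 -[leLHS]mulr_natl.
  have q0 : 0 < q by rewrite /q divr_gt0 // mulr_gt0 // expR_gt0.
  apply: le_trans (ler_wpM2r (ltW q0) hl2) _.
  rewrite /q expRN -[leRHS]mul1r ler_pdivlMr //.
  have E0 := expR_gt0 (rp_rate * e%:R).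
  have -> : (24 * (8 * k%:R * rp_M / rp_h + 1)) ^+ k * ((expR (rp_rate * e%:R))^-1 * 4 / sgp ^+ k) * 4 =
     (24 * (8 * k%:R * rp_M / rp_h + 1)) ^+ k * 16 / (sgp ^+ k * expR (rp_rate * e%:R)).
    by field; rewrite !gt_eqF.
  by rewrite ler_pdivrMr ?mul1r // mulr_gt0.
have t1 : true%:R = 1 :> R by [].
have sb0 : 0 <= \sum_(u <- l) `[< bad_dir u s >]%:R :> R by apply: sumr_ge0.
have hSs : pr mu S0 / 2 <= pr mu (S s).
  by rewrite leNgt; apply/negP => h; move: hs; rewrite /f h t1; lra.
have hgood u : u \in l -> ~ bad_dir u s.
  move=> ul hb; move: hs; rewrite /f (big_rem u ul) /=; case: asboolP => // _.
  have : 0 <= \sum_(y <- rem u l) `[< bad_dir y s >]%:R :> R by apply: sumr_ge0.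
  have : 0 <= (pr mu (S s) < pr mu S0 / 2)%R%:R :> R by [].
  rewrite t1; lra.
pose W := Wm s; pose Vi (x : 'rV[R]_n) i := dot x (row i W).
have uV (u : 'rV[R]_k) (x : 'rV[R]_n) : dot x (u *m W) = \sum_i u ord0 i * Vi x i.
  by rewrite mulmx_sum_row dot_sumr; apply: eq_bigr => i _; rewrite dotZr.
pose b := rp_bb ^+ k : R; have bp : 0 < b by rewrite exprn_gt0.
pose box (a : R) (v : 'rV[R]_k) := [set x : V | forall i, `|Vi x i - v ord0 i| <= a].
have cbox a v : closed (box a v : set 'rV[R]_n).
  have -> : box a v = \bigcap_(i in setT) [set x : 'rV[R]_n | `|dot x (row i W) - v ord0 i| <= a].
    by apply/seteqP; split => x h i *; exact: h.
  by apply: closed_bigI => i _; exact: dle_closed.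
have mbox a v : measurable (box a v) by apply: closed_borel; exact: cbox.
pose H := [set v : 'rV[R]_k | b <= pr mu (box (2 * eps) v)].
have hH u : u \in l -> exists2 v, H v & rp_h * sk / 4 <= dot u v.
  move=> ul; have ht3 := good_dir ss (hl1 u ul) (hgood u ul).
  set B := [set x : V | _] in ht3; have mB : measurable B by exact: up_borel.
  pose u' i := (2 * eps)^-1 *: row i W.
  pose t0 i := (2 * eps)^-1 * (w *m (Gm s)^T) ord0 i.
  have tau0 : 0 < expR (- k%:R) / 2 :> R by rewrite divr_gt0 // expR_gt0.
  have ei : 0 < (2 * eps)^-1 by rewrite invr_gt0 mulr_gt0.
  have u'E i x : dot x (u' i) = (2 * eps)^-1 * Vi x i by rewrite /u' dotZr.
  have hTm : expR (- k%:R) / 2 <= pr mu [set x : V | \sum_i `|dot (x : 'rV[R]_n) (u' i) - t0 i| <= 1 * k%:R].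
    apply: le_trans (_ : pr mu (S s) <= _); first by apply: le_trans hSs; rewrite ler_pM2r //; exact: ltW.
    apply: pr_mono => //; first exact: mS.
      apply: (measurable_le_set (f := fun x : V => \sum_i `|dot (x : 'rV[R]_n) (u' i) - t0 i|)).
      by apply: continuous_borel; exact: sumdot_continuous.
    move=> x [_ /= hx].
    have -> : \sum_i `|dot x (u' i) - t0 i| = (2 * eps)^-1 * \sum_i `|((x *m U^T - w) *m (Gm s)^T) ord0 i|.
      rewrite mulr_sumr; apply: eq_bigr => i _; rewrite u'E /t0 -mulrBr normrM gtr0_norm //; congr (_ * `|_|).
      rewrite mulmxBl [RHS]mxE [X in _ = _ + X]mxE; congr (_ - _).
      rewrite -mulmxA -trmx_mul -/(Wm s) -/W mxE; apply: eq_bigr => j _; by rewrite !mxE.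
    have e2 : 0 < 2 * eps by rewrite mulr_gt0.
    rewrite mul1r (ler_pdivrMl _ _ e2).
    apply: le_trans (sum_abs_le _) _; apply: le_trans (_ : sk * (2 * eps * sk) <= _); first by rewrite ler_pM2l.
    by rewrite -sk2; lra.
  have [hex|hnex] := pselect (exists t : 'I_k -> R, b < pr mu (B `&` [set x : V | forall i, `|dot (x : 'rV[R]_n) (u' i) - t i| <= 2^-1])).
    have [t ht] := hex; set C := [set x : V | _] in ht.
    have [x [Bx Cx]] : B `&` C !=set0.
      by apply/set0P/eqP => h0'; move: ht; rewrite h0' pr0 ltNge (ltW bp).
    exists (\row_i Vi x i); last first.
      have -> : dot u (\row_i Vi x i) = dot x (u *m W) by rewrite uV; apply: eq_bigr => i _; rewrite mxE.
      exact: Bx.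
    apply: le_trans (ltW ht) _; apply: pr_mono => //.
      apply: measurableI => //; apply: closed_borel.
      have -> : C = \bigcap_(i in setT) [set x : 'rV[R]_n | `|dot x (u' i) - t i| <= 2^-1].
        by apply/seteqP; split => y h i *; exact: h.
      by apply: closed_bigI => i _; exact: dle_closed.
    move=> y [_ Cy] i; rewrite mxE.
    have h1 := Cx i; have h2 := Cy i; rewrite !u'E in h1 h2.
    have : `|(2 * eps)^-1 * (Vi y i - Vi x i)| <= 1.
      have -> : (2 * eps)^-1 * (Vi y i - Vi x i) = ((2 * eps)^-1 * Vi y i - t i) - ((2 * eps)^-1 * Vi x i - t i) by ring.
      by apply: le_trans (ler_normB _ _) _; lra.
    have e2 : 0 < 2 * eps by rewrite mulr_gt0.
    by rewrite normrM gtr0_norm // (ler_pdivrMl _ _ e2) mulr1.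
  exfalso; have := @cell_bound R n mu iso lc k u' t0 B b _ 1 (ltW bp) tau0 (lexx _) hTm mB.
  move=> /(_ ltac:(by move=> t; rewrite leNgt; apply/negP => h; apply: hnex; exists t)).
  apply/negP; rewrite -ltNge; apply: lt_le_trans ht3.
  have t30 : 0 < rp_tau3.
    have t1' := rp_tau_gt0; have h4 : 0 < rp_h / 4 by rewrite divr_gt0.
    by rewrite /rp_tau3 mulr_gt0 // exprn_gt0.
  rewrite mulr1 -[X in _ * X]ger0_norm ?exprn_ge0 // -[ltRHS]ger0_norm ?(ltW t30) // -!sqrtr_sqr -sqrtrM; last by rewrite divr_ge0 ?(ltW bp) // ltW.
  rewrite ltr_sqrt; last by rewrite exprn_gt0.
  (* [rp_bb] contains [exp (-1)], [36 ^ (-2)] and [sgp ^ 4] to match the tame mass, the overlap and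
     [rp_tau3 ^ 2]; what remains is [2 c ^ k < rp_h ^ 4 / 2 ^ 20]. *)
  have -> : b / (expR (- k%:R) / 2) = 2 * ((sgp ^+ 4) ^+ k * (Order.min 1 (rp_h ^+ 4) / 2 ^+ 22) ^+ k * ((36 ^+ 2)^-1) ^+ k).
    rewrite /b /rp_bb !exprMn; have -> : expR (- k%:R) = expR (-1) ^+ k :> R by rewrite -expRM_natl mulrN1.
    by field; rewrite gt_eqF // exprn_gt0 // expR_gt0.
  have -> : (36 ^+ k) ^+ 2 = (36 ^+ 2) ^+ k :> R by rewrite -!exprM mulnC.
  rewrite -!mulrA -exprMn mulVf ?expr1n ?mulr1; last by rewrite gt_eqF // exprn_gt0.
  have -> : rp_tau3 ^+ 2 = (sgp ^+ 4) ^+ k * (rp_h ^+ 4 / (4 ^+ 4 * 8 ^+ 4)).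
    rewrite /rp_tau3 /rp_tau -[(sgp ^+ 4) ^+ k]exprM mulnC exprM; move: (sgp ^+ k) => q; by field.
  rewrite mulrCA ltr_pM2l ?exprn_gt0 //.
  set c := Order.min 1 _ / _.
  have c1 : c <= rp_h ^+ 4 / 2 ^+ 22 by rewrite /c ler_pM2r ?invr_gt0 ?exprn_gt0 // ge_min lexx orbT.
  have c2 : c <= 1.
    by rewrite /c ler_pdivrMr ?exprn_gt0 // mul1r (@le_trans _ _ 1) ?ge_min ?lexx // exprn_ege1 //; lra.
  have c0 : 0 <= c by rewrite /c divr_ge0 ?exprn_ge0 // le_min ler01 exprn_ge0 // ltW.
  have c3 : c ^+ k <= c by case: (k) k0 => // k' _; rewrite exprS ler_piMr // exprn_ile1.
  apply: le_lt_trans (_ : 2 * (rp_h ^+ 4 / 2 ^+ 22) < _); first by rewrite ler_pM2l // (le_trans c3).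
  have -> : 4 ^+ 4 * 8 ^+ 4 = 2 ^+ 20 :> R by ring.
  have hp : 0 < rp_h ^+ 4 by rewrite exprn_gt0.
  have -> : 2 * (rp_h ^+ 4 / 2 ^+ 22) = rp_h ^+ 4 / 2 ^+ 20 / 2 by field.
  have : 0 < rp_h ^+ 4 / 2 ^+ 20 by rewrite divr_gt0 // exprn_gt0.
  lra.
apply: (@box_packing W l) hl3 _ => //.
  by move=> u; exact: Wm_norm.
Qed.
End RandomProjection.

(** * Tilted measures *)

Section Tilt.
Context {R : realType} {n : nat} (mu : probability (borel_rV R n) R).
Notation V := (borel_rV R n).
Hypotheses (iso : isotropic mu) (lc : log_concave mu) (n0 : (0 < n)%N).
Let nR : 0 < n%:R :> R. Proof. by rewrite ltr0n. Qed.
Let sn0 : 0 < Num.sqrt (n%:R : R). Proof. by rewrite sqrtr_gt0. Qed.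
Let sn2 : Num.sqrt (n%:R : R) ^+ 2 = n%:R. Proof. by rewrite sqr_sqrtr // ltW. Qed.

Definition tR0 : R := 2 * Num.sqrt n%:R.
Lemma tR0_gt0 : 0 < tR0. Proof. by rewrite mulr_gt0. Qed.
(** For [|w| <= tzeta] the exponent [tdev xi w] is at most [1/2] in absolute value on the truncation
    ball. *)
Definition tzeta : R := (4 * tR0)^-1.
Lemma tzeta_gt0 : 0 < tzeta. Proof. by rewrite invr_gt0 mulr_gt0 // tR0_gt0. Qed.
Let r0 := tR0_gt0.
Definition tD : set V := [set x : V | enorm (x : 'rV[R]_n) <= tR0].
Lemma tD_meas : measurable tD. Proof. exact: ball0_borel. Qed.
Definition twt (xi : 'rV[R]_n) (x : V) : R := expR (dot (x : 'rV[R]_n) xi) * \1_tD x.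

Lemma twt_ge0 xi x : 0 <= twt xi x.
Proof. by rewrite mulr_ge0 ?expR_ge0 // indicE. Qed.

Lemma expdot_borel (xi : 'rV[R]_n) : measurable_fun setT (fun x : V => expR (dot (x : 'rV[R]_n) xi)).
Proof. by apply: measurableT_comp => //; exact: dot_borel. Qed.

Lemma twt_bmf xi : bmf (twt xi).
Proof.
apply: (@bmfP _ _ _ _ (expR (tR0 * enorm xi))).
  by apply: measurable_funM; [exact: expdot_borel|apply: measurable_indic; exact: tD_meas].
move=> x; rewrite ger0_norm ?twt_ge0 // /twt indicE; case: (boolP (x \in tD)) => [/set_mem hx|_].
  rewrite mulr1 ler_expR; apply: le_trans (dot_le _ _) _; by rewrite ler_wpM2r ?enorm_ge0.
by rewrite mulr0 expR_ge0.
Qed.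

Definition tZ xi : R := Ex mu (twt xi).

Lemma tD_mass : 3 / 4 <= pr mu tD.
Proof.
have h := cheb_norm iso r0.
have mC : measurable [set x : V | tR0 < enorm (x : 'rV[R]_n)] by apply: measurable_gt_set; exact: enorm_borel.
have -> : tD = ~` [set x : V | tR0 < enorm (x : 'rV[R]_n)].
  by apply/seteqP; split => x /=; rewrite /tD /= leNgt; [move/negP|move/negP].
have e : n%:R / tR0 ^+ 2 = 4^-1 by rewrite /tR0 exprMn sn2; field; rewrite gt_eqF.
rewrite e in h; rewrite prC //; lra.
Qed.

Lemma tZ_ge xi : expR (- (2 * enorm xi)) / 2 <= tZ xi.
Proof.
pose B := [set x : V | `|dot (x : 'rV[R]_n) xi| <= 2 * enorm xi].
have mB : measurable B.
  by apply: measurable_le_set; apply: measurableT_comp => //; exact: dot_borel.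
have hB : 3 / 4 <= pr mu B.
  have [x0|x0] := eqVneq xi 0.
    have -> : B = setT.
      by apply/seteqP; split => // x _; rewrite /B /= x0 dot0r normr0 enorm0 mulr0.
    rewrite prT; lra.
  have ex : 0 < enorm xi by rewrite enorm_gt0.
  have h := cheb_dot iso xi (mulr_gt0 (ltr0n R 2) ex).
  have -> : B = ~` [set x : V | 2 * enorm xi < `|dot (x : 'rV[R]_n) xi|].
    by apply/seteqP; split => x /=; rewrite /B /= leNgt; [move/negP|move/negP].
  rewrite prC; last by apply: measurable_gt_set; apply: measurableT_comp => //; exact: dot_borel.
  have e : dot xi xi / (2 * enorm xi) ^+ 2 = 4^-1 by rewrite -enorm2; field; rewrite gt_eqF.
  rewrite e in h; lra.
have hI := prI_ge mu tD_meas mB.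
have mI : measurable (tD `&` B) by apply: measurableI => //; exact: tD_meas.
have := @markov_pr _ _ _ mu (twt xi) (tD `&` B) (expR (- (2 * enorm xi))) (twt_bmf xi) mI (twt_ge0 xi).
move=> h; apply: le_trans (h _); last first.
  move=> x [Dx Bx]; rewrite /twt indicE mem_set // mulr1 ler_expR.
  by move: Bx; rewrite /B /= ler_norml => /andP[].
by rewrite ler_pM2l ?expR_gt0 //; have := tD_mass; lra.
Qed.

Lemma tZ_gt0 xi : 0 < tZ xi.
Proof. by apply: lt_le_trans (tZ_ge xi); rewrite divr_gt0 // expR_gt0. Qed.

Definition phi xi (x : V) : R := (tZ xi)^-1 * twt xi x.
Lemma phi_ge0 xi x : 0 <= phi xi x.
Proof. by rewrite mulr_ge0 ?twt_ge0 // invr_ge0 ltW // tZ_gt0. Qed.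
Lemma phi_bmf xi : bmf (phi xi).
Proof. by apply: bmfZ; exact: twt_bmf. Qed.
Lemma phi_one xi : Ex mu (phi xi) = 1.
Proof. by rewrite ExZ ?mulVf ?gt_eqF ?tZ_gt0 //; exact: twt_bmf. Qed.
Lemma phi_supp xi (x : V) : phi xi x != 0 -> enorm ((x : 'rV[R]_n) - 0) <= tR0.
Proof.
rewrite /phi /twt subr0 indicE; case: (boolP (x \in tD)) => [/set_mem //|_]; by rewrite !mulr0 eqxx.
Qed.
Definition tz xi : 'rV[R]_n := wmean mu (phi xi).
Lemma tz_norm xi : enorm (tz xi) <= tR0.
Proof. by have := wmean_dist (phi_ge0 xi) (phi_bmf xi) (phi_one xi) (phi_supp (xi := xi)) r0; rewrite subr0. Qed.

Lemma phi_wt xi (g : V -> R) (K : R) : measurable_fun setT g ->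
  (forall x : V, enorm (x : 'rV[R]_n) <= tR0 -> `|g x| <= K) -> bmf (fun x => g x * phi xi x).
Proof.
move=> mg hg; apply: (wt_bmf (phi_bmf xi) (phi_supp (xi := xi)) r0 mg (K := K)) => x.
by rewrite subr0; exact: hg.
Qed.

Lemma phi_le xi (f g : V -> R) : bmf (fun x => f x * phi xi x) -> bmf (fun x => g x * phi xi x) ->
  (forall x : V, enorm (x : 'rV[R]_n) <= tR0 -> f x <= g x) ->
  Ex mu (fun x => f x * phi xi x) <= Ex mu (fun x => g x * phi xi x).
Proof.
move=> bf bg h; apply: Ex_le => // x; have [->|px] := eqVneq (phi xi x) 0; first by rewrite !mulr0.
by rewrite ler_wpM2r ?phi_ge0 // h //; have := phi_supp px; rewrite subr0.
Qed.

(** Cauchy-Schwarz against the tilted density, whose second moment is [tZ (2 xi) / tZ xi ^ 2]; this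
    is why good tilts are selected by [tZ (xi + xi)]. *)
Lemma phi_CS xi (A : R) (C : set V) (t : R) : tZ (xi + xi) <= A -> measurable C -> 0 <= t ->
  t <= Ex mu (fun x => \1_C x * phi xi x) -> t ^+ 2 <= 4 * A * expR (4 * enorm xi) * pr mu C.
Proof.
move=> hA mC t0 ht.
have bC : bmf (\1_C : V -> R) by exact: bmf_indic.
have h := Ex_CS mu bC (phi_bmf xi).
have e1 : Ex mu (fun x => \1_C x ^+ 2) = pr mu C.
  rewrite -(Ex_indic mu mC); congr Ex; apply/funext => x; rewrite indicE; case: (x \in C); by rewrite ?expr1n ?expr0n.
have e2 : Ex mu (fun x => phi xi x ^+ 2) = (tZ xi) ^- 2 * tZ (xi + xi).
  rewrite -ExZ; last exact: twt_bmf.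
  congr Ex; apply/funext => x; rewrite /phi exprMn exprVn; congr (_ * _).
  rewrite /twt exprMn -expRM_natl dotDr indicE; congr (expR _ * _); first by ring.
  by case: (x \in tD); rewrite ?expr1n ?expr0n.
rewrite e1 e2 in h.
have Z0 := tZ_gt0 xi; have p0 := pr_ge0 mu C.
apply: le_trans (_ : Ex mu (fun x => \1_C x * phi xi x) ^+ 2 <= _).
  by rewrite ler_sqr ?nnegrE // (le_trans t0).
apply: le_trans h _; rewrite mulrC ler_wpM2r //.
have hZ : (tZ xi) ^- 2 <= 4 * expR (4 * enorm xi).
  have h2 : 0 < expR (- (2 * enorm xi)) / 2 :> R by rewrite divr_gt0 // expR_gt0.
  have -> : 4 * expR (4 * enorm xi) = (expR (- (2 * enorm xi)) / 2) ^- 2 :> R.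
    rewrite expr_div_n -expRM_natl invf_div -expRN; congr (_ * _); last by congr expR; ring.
    by rewrite expr2; ring.
  rewrite lef_pV2 ?posrE ?exprn_gt0 //; apply: lerXn2r; rewrite ?nnegrE ?(ltW Z0) ?(ltW h2) //; exact: tZ_ge.
have -> : 4 * A * expR (4 * enorm xi) = 4 * expR (4 * enorm xi) * A by ring.
apply: ler_pM; [by rewrite invr_ge0 exprn_ge0 // ltW|exact: ltW (tZ_gt0 _)|exact: hZ|exact: hA].
Qed.

Definition tdev xi (w : 'rV[R]_n) (x : V) : R := dot (x : 'rV[R]_n) w - dot (tz xi) w.
Lemma tdev_borel xi w : measurable_fun setT (tdev xi w).
Proof. by apply: measurable_funB => //; exact: dot_borel. Qed.
Lemma tdev_le xi w (x : V) : enorm (x : 'rV[R]_n) <= tR0 -> `|tdev xi w x| <= 2 * tR0 * enorm w.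
Proof.
move=> hx; rewrite /tdev -dotBl; apply: le_trans (ler_dot _ _) _; rewrite ler_wpM2r ?enorm_ge0 //.
by apply: le_trans (enormB _ _) _; have := tz_norm xi; lra.
Qed.
Lemma tdev_bmf xi w : bmf (fun x => tdev xi w x * phi xi x).
Proof. by apply: phi_wt; [exact: tdev_borel|exact: tdev_le]. Qed.

Lemma tdev_mean xi : forall w xi', Ex mu (fun x => tdev xi' w x * phi xi x) = dot (tz xi - tz xi') w.
Proof.
move=> w xi'.
have hb := wt_dot_bmf (phi_bmf xi) (phi_supp (xi := xi)) r0 w.
have -> : (fun x => tdev xi' w x * phi xi x) = (fun x : V => dot (x : 'rV[R]_n) w * phi xi x - dot (tz xi') w * phi xi x).
  by apply/funext => x; rewrite /tdev mulrBl.
rewrite ExB //; last by apply: bmfZ; exact: phi_bmf.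
rewrite ExZ; last exact: phi_bmf.
rewrite phi_one mulr1 dotBl; congr (_ - _).
exact: (wmean_dot mu (phi_bmf xi) (phi_supp (xi := xi)) r0 w).
Qed.

Definition tvar xi (w : 'rV[R]_n) : R := Ex mu (fun x => tdev xi w x ^+ 2 * phi xi x).
Lemma tdev2_bmf xi w : bmf (fun x => tdev xi w x ^+ 2 * phi xi x).
Proof.
apply: (@phi_wt _ _ ((2 * tR0 * enorm w) ^+ 2)).
  by apply: measurable_funX; exact: tdev_borel.
move=> x hx; rewrite normrX; apply: lerXn2r; rewrite ?nnegrE // ?tdev_le //.
by rewrite !mulr_ge0 ?enorm_ge0 // ltW.
Qed.

Let tshift_K xi w := expR (dot (tz xi) w) * tZ xi / tZ (xi + w).
Let tshiftE xi w : (fun x => expR (tdev xi w x) * phi xi x) = (fun x => (tshift_K xi w)^-1 * phi (xi + w) x).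
Proof.
apply/funext => x; rewrite /tshift_K /phi /twt /tdev dotDr.
rewrite [expR (_ - _)]expRD [expR (dot x xi + _)]expRD expRN.
move: (tZ_gt0 xi) (tZ_gt0 (xi + w)) (expR_gt0 (dot (tz xi) w)).
move: (tZ xi) (tZ (xi + w)) (expR (dot (tz xi) w)) (expR (dot x w)) (expR (dot x xi)) (\1_tD x) => z1 z2 e1 e2 e3 i z10 z20 e0.
by field; rewrite !gt_eqF.
Qed.

(** The density at [xi + w] is [K exp (tdev xi w)] times that at [xi], and [tdev xi w] has mean 0 at
    [xi]; so the shift of the mean along [w] is a mean of [y (exp y - 1)], which is nonnegative. *)
Lemma tshift_id xi w : exists2 K : R, 0 < K &
  dot (tz (xi + w) - tz xi) w = K * Ex mu (fun x => tdev xi w x * (expR (tdev xi w x) - 1) * phi xi x) /\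
  K * Ex mu (fun x => expR (tdev xi w x) * phi xi x) = 1.
Proof.
have K0 : 0 < tshift_K xi w by rewrite divr_gt0 ?tZ_gt0 // mulr_gt0 ?tZ_gt0 // expR_gt0.
exists (tshift_K xi w) => //; split; last first.
  rewrite tshiftE ExZ ?phi_one ?mulr1 ?divff ?gt_eqF //; exact: phi_bmf.
have b1 : bmf (fun x => tdev xi w x * phi (xi + w) x) by apply: phi_wt; [exact: tdev_borel|exact: tdev_le].
have -> : (fun x => tdev xi w x * (expR (tdev xi w x) - 1) * phi xi x) =
   (fun x => (tshift_K xi w)^-1 * (tdev xi w x * phi (xi + w) x) - tdev xi w x * phi xi x).
  apply/funext => x; have := congr1 (fun f => f x) (tshiftE xi w); rewrite /= => e.
  rewrite mulrBr mulrBl -mulrA e mulr1; congr (_ - _); ring.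
rewrite ExB; [|exact: bmfZ|exact: tdev_bmf].
rewrite (ExZ mu _ b1) (tdev_mean (xi + w) w xi).
have -> : Ex mu (fun x => tdev xi w x * phi xi x) = 0 by rewrite tdev_mean subrr dot0l.
move: (dot _ w) (tshift_K xi w) K0 => a K K0.
by field; rewrite gt_eqF.
Qed.

Lemma mul_expB1_ge0 (y : R) : 0 <= y * (expR y - 1).
Proof.
have [y0|y0] := leP 0 y; first by rewrite mulr_ge0 // subr_ge0 -[leLHS]expR0 ler_expR.
by rewrite mulr_le0 ?(ltW y0) // subr_le0 -[leRHS]expR0 ler_expR ltW.
Qed.

Lemma mul_expB1_ge (y : R) : `|y| <= 2^-1 -> y ^+ 2 / 2 <= y * (expR y - 1).
Proof.
rewrite ler_norml => /andP[h1 h2]; have h3 := expR_ge1Dx y.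
have [y0|y0] := leP 0 y.
  apply: le_trans (_ : y * y <= _); first by nra.
  by rewrite ler_wpM2l //; lra.
have h4 := expR_ge1Dx (- y); have h5 := expRN y; have h6 := expR_gt0 y.
have h7 : expR y * expR (- y) = 1 by rewrite -expRD subrr expR0.
have h8 : expR y * (1 - y) <= 1 by rewrite -h7 ler_pM2l // addrC; lra.
have : expR y <= 1 + y / 2.
  have p : 0 < 1 - y by lra.
  rewrite -(ler_pM2r p); apply: le_trans h8 _; nra.
nra.
Qed.

Lemma tshift_bmf xi w : bmf (fun x => tdev xi w x * (expR (tdev xi w x) - 1) * phi xi x).
Proof.
apply: (@phi_wt _ _ (2 * tR0 * enorm w * (expR (2 * tR0 * enorm w) + 1))).
  apply: measurable_funM; first exact: tdev_borel.
  by apply: measurable_funB => //; apply: measurableT_comp => //; exact: tdev_borel.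
move=> x hx; rewrite normrM; apply: ler_pM => //; first exact: tdev_le.
apply: le_trans (ler_normB _ _) _; rewrite normr1 lerD2r ger0_norm ?expR_ge0 // ler_expR.
by apply: le_trans (ler_norm _) _; exact: tdev_le.
Qed.

(** Means are monotone in the tilt, being gradients of a convex log-Laplace transform. *)
Lemma tshift_ge0 xi w : 0 <= dot (tz (xi + w) - tz xi) w.
Proof.
have [K K0 [-> _]] := tshift_id xi w; rewrite mulr_ge0 ?(ltW K0) //; apply: Ex_ge0 => x.
by rewrite mulr_ge0 ?phi_ge0 // mul_expB1_ge0.
Qed.

Lemma tshift_ge xi w : enorm w <= tzeta -> tvar xi w / 4 <= dot (tz (xi + w) - tz xi) w.
Proof.
move=> hw; have [K K0 [-> hK]] := tshift_id xi w.
have hd (x : V) : enorm (x : 'rV[R]_n) <= tR0 -> `|tdev xi w x| <= 2^-1.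
  move=> /(tdev_le xi w) h; apply: le_trans h _.
  have -> : 2^-1 = 2 * tR0 * tzeta by rewrite /tzeta; field; rewrite gt_eqF.
  by rewrite ler_pM2l // mulr_gt0.
have h1 : 2^-1 * tvar xi w <= Ex mu (fun x => tdev xi w x * (expR (tdev xi w x) - 1) * phi xi x).
  rewrite /tvar -ExZ; last exact: tdev2_bmf.
  have -> : (fun x => 2^-1 * (tdev xi w x ^+ 2 * phi xi x)) = (fun x => (tdev xi w x ^+ 2 / 2) * phi xi x).
    by apply/funext => x; ring.
  apply: phi_le; last by move=> x /hd; exact: mul_expB1_ge.
    have := bmfZ 2^-1 (tdev2_bmf xi w); congr bmf; apply/funext => x; ring.
  exact: tshift_bmf.
have h2 : Ex mu (fun x => expR (tdev xi w x) * phi xi x) <= 2.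
  apply: le_trans (_ : Ex mu (fun x => 2 * phi xi x) <= _); last first.
    by rewrite ExZ ?phi_one ?mulr1 //; exact: phi_bmf.
  apply: phi_le; last first.
  - move=> x /hd; rewrite ler_norml => /andP[_ h].
    have h4 := expR_ge1Dx (- (2^-1 : R)); have h6 := expR_gt0 (2^-1 : R).
    have h7 : expR (2^-1) * expR (- 2^-1) = 1 :> R by rewrite -expRD subrr expR0.
    apply: le_trans (_ : expR 2^-1 <= _); first by rewrite ler_expR.
    have : expR (2^-1) * (1 + - 2^-1) <= expR (2^-1) * expR (- 2^-1) :> R by rewrite ler_pM2l.
    rewrite h7; lra.
  - by apply: bmfZ; exact: phi_bmf.
  apply: (@phi_wt _ _ (expR (2 * tR0 * enorm w))).
    by apply: measurableT_comp => //; exact: tdev_borel.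
  move=> x hx; rewrite ger0_norm ?expR_ge0 // ler_expR.
  by apply: le_trans (ler_norm _) _; exact: tdev_le.
have v0 : 0 <= tvar xi w by apply: Ex_ge0 => x; rewrite mulr_ge0 ?sqr_ge0 // phi_ge0.
have K1 : 2^-1 <= K.
  have : K * Ex mu (fun x => expR (tdev xi w x) * phi xi x) <= K * 2 by rewrite ler_pM2l.
  rewrite hK; lra.
apply: le_trans (_ : K * (2^-1 * tvar xi w) <= _); last by rewrite ler_pM2l.
have -> : tvar xi w / 4 = 2^-1 * (2^-1 * tvar xi w) by field.
by apply: ler_wpM2r => //; rewrite mulr_ge0.
Qed.

Definition tcov xi : 'M[R]_n := \matrix_(i, j) Ex mu (fun x => tdev xi (delta_mx 0 i) x * tdev xi (delta_mx 0 j) x * phi xi x).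

Lemma tcov_sym xi : (tcov xi)^T = tcov xi.
Proof. by apply/matrixP => i j; rewrite !mxE; congr Ex; apply/funext => x; rewrite [X in X * _]mulrC. Qed.

Lemma tdev_sum xi (v : 'rV[R]_n) x : tdev xi v x = \sum_i v ord0 i * tdev xi (delta_mx 0 i) x.
Proof.
rewrite /tdev -dotBl {1}(row_sum_delta v) dot_sumr; apply: eq_bigr => i _.
by rewrite dotZr dotBl.
Qed.

Lemma tcovE xi (v : 'rV[R]_n) : dot (v *m tcov xi) v = tvar xi v.
Proof.
have bij i j : bmf (fun x => tdev xi (delta_mx 0 i) x * tdev xi (delta_mx 0 j) x * phi xi x).
  pose e k : 'rV[R]_n := delta_mx 0 k.
  apply: (@phi_wt _ _ ((2 * tR0 * enorm (e i)) * (2 * tR0 * enorm (e j)))).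
    by apply: measurable_funM; exact: tdev_borel.
  by move=> x hx; rewrite normrM; apply: ler_pM => //; exact: tdev_le.
have -> : tvar xi v = Ex mu (fun x => \sum_j \sum_i (v ord0 i * v ord0 j) * (tdev xi (delta_mx 0 i) x * tdev xi (delta_mx 0 j) x * phi xi x)).
  congr Ex; apply/funext => x; rewrite tdev_sum expr2 mulr_sumr mulr_suml; apply: eq_bigr => j _.
  rewrite mulr_suml mulr_suml; apply: eq_bigr => i _; ring.
rewrite Ex_sum => [|j]; last by apply: bmf_sum => i; exact: bmfZ.
apply: eq_bigr => j _; rewrite mxE mulr_suml Ex_sum => [|i]; last exact: bmfZ.
apply: eq_bigr => i _; rewrite mxE ExZ //; ring.
Qed.

Lemma tvar_ge0 xi v : 0 <= tvar xi v.
Proof. by apply: Ex_ge0 => x; rewrite mulr_ge0 ?sqr_ge0 // phi_ge0. Qed.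

(** On the truncation ball the functional is at most [tR0], so a mean at least [m] forces tilted
    mass at least [m / (2 tR0)] above level [m / 2]; [phi_CS] converts it to [mu]. *)
Lemma hit_mass xi (A m : R) (th : 'rV[R]_n) : tZ (xi + xi) <= A -> dot th th = 1 -> 0 <= m -> m <= dot (tz xi) th ->
  (m / (2 * tR0)) ^+ 2 <= 4 * A * expR (4 * enorm xi) * pr mu (tD `&` [set x : V | m / 2 <= dot (x : 'rV[R]_n) th]).
Proof.
move=> hA th1 m0 hm; set C := tD `&` _.
have mC : measurable C.
  by apply: measurableI; [exact: tD_meas|apply: measurable_ge_set; exact: dot_borel].
apply: phi_CS => //; first by rewrite divr_ge0 // mulr_ge0 // ltW.
have eth : enorm th = 1 by rewrite enormE th1 sqrtr1.
rewrite ler_pdivrMr ?mulr_gt0 //.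
have bC : bmf (fun x => \1_C x * phi xi x) by apply: bmfM; [exact: bmf_indic|exact: phi_bmf].
have h : dot (tz xi) th <= Ex mu (fun x => (m / 2 + tR0 * \1_C x) * phi xi x).
  rewrite /tz -(wmean_dot mu (phi_bmf xi) (phi_supp (xi := xi)) r0 th).
  apply: phi_le.
  - exact: (wt_dot_bmf (phi_bmf xi) (phi_supp (xi := xi)) r0).
  - by apply: bmfM; [apply: bmfD; [exact: bmf_cst|apply: bmfZ; exact: bmf_indic]|exact: phi_bmf].
  move=> x hx; rewrite indicE; case: (boolP (x \in C)) => hC.
    apply: le_trans (dot_le _ _) _; rewrite eth !mulr1; apply: le_trans hx _; rewrite lerDr; lra.
  rewrite mulr0 addr0 leNgt; apply/negP => h; move/negP: hC; apply; apply/mem_set; split => //=.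
  exact: ltW.
have e : Ex mu (fun x => (m / 2 + tR0 * \1_C x) * phi xi x) = m / 2 + tR0 * Ex mu (fun x => \1_C x * phi xi x).
  have -> : (fun x => (m / 2 + tR0 * \1_C x) * phi xi x) = (fun x => m / 2 * phi xi x + tR0 * (\1_C x * phi xi x)).
    by apply/funext => x; ring.
  have bp := phi_bmf xi; rewrite ExD; [|exact: bmfZ|exact: bmfZ].
  by rewrite (ExZ mu _ bp) (ExZ mu _ bC) phi_one mulr1.
rewrite e in h; lra.
Qed.

End Tilt.

(** * A grid of tilts *)

Lemma cosh_le {R : realType} (y : R) : expR y + expR (- y) <= 2 * expR (2 * y ^+ 2).
Proof.
have [h|h] := leP (2^-1) `|y|.
  have h1 : `|y| <= 2 * y ^+ 2.
    rewrite -(real_normK (num_real y)); move: h; move: `|y| => t h; nra.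
  have h2 : expR y <= expR (2 * y ^+ 2) by rewrite ler_expR (le_trans (ler_norm _)).
  have h3 : expR (- y) <= expR (2 * y ^+ 2) by rewrite ler_expR (le_trans (ler_norm _)) // normrN.
  lra.
move: h; rewrite ltr_norml => /andP[h1 h2].
have e1 := expR_ge1Dx (- y); have e2 := expR_ge1Dx y; have e3 := expR_ge1Dx (2 * y ^+ 2).
have p1 := expR_gt0 y; have p2 := expR_gt0 (- y).
have pp : expR y * expR (- y) = 1 by rewrite -expRD subrr expR0.
move: (expR y) (expR (- y)) (expR (2 * y ^+ 2)) e1 e2 e3 p1 p2 pp => a b c e1 e2 e3 p1 p2 pp.
have a1 : a * (1 - y) <= 1 by rewrite -[leRHS]pp ler_pM2l.
have b1 : b * (1 + y) <= 1 by rewrite mulrC -[leRHS]pp ler_pM2r.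
have y1 : 0 < 1 - y by lra.
have y2 : 0 < 1 + y by lra.
have a2 : a <= (1 - y)^-1 by rewrite -[leRHS]div1r ler_pdivlMr.
have b2 : b <= (1 + y)^-1 by rewrite -[leRHS]div1r ler_pdivlMr.
have : (1 - y)^-1 + (1 + y)^-1 <= 2 * (1 + 2 * y ^+ 2).
  have -> : (1 - y)^-1 + (1 + y)^-1 = 2 / ((1 - y) * (1 + y)) by field; rewrite !gt_eqF.
  rewrite ler_pdivrMr ?mulr_gt0 //.
  have : y ^+ 2 <= 4^-1 by nra.
  have -> : (1 - y) * (1 + y) = 1 - y ^+ 2 by ring.
  move: (y ^+ 2) (sqr_ge0 y) => w w0 w1; nra.
lra.
Qed.

Section Grid.
Context {R : realType} {n : nat} (mu : probability (borel_rV R n) R) (q : R).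
Notation V := (borel_rV R n).
Hypotheses (iso : isotropic mu) (n0 : (0 < n)%N) (q1 : 1 <= q).
Let nR : 0 < n%:R :> R. Proof. by rewrite ltr0n. Qed.
Let sn := Num.sqrt (n%:R : R).
Let sn0 : 0 < sn. Proof. by rewrite sqrtr_gt0. Qed.
Let sn2 : sn ^+ 2 = n%:R. Proof. by rewrite sqr_sqrtr // ltW. Qed.
Let sq := Num.sqrt q.
Let sq0 : 0 < sq. Proof. by rewrite sqrtr_gt0 (lt_le_trans ltr01). Qed.
Let sq2 : sq ^+ 2 = q. Proof. by rewrite sqr_sqrtr // (le_trans ler01). Qed.
Let ze : R := @tzeta R n.
Let ze0 : 0 < ze. Proof. exact: tzeta_gt0. Qed.

Definition gm : nat := (Num.truncn (2 * sq / ze)).+1.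
(** Coordinates of step [ze / sn] centred at 0; reversal of the index changes the sign, so
    exponentials can be paired into hyperbolic cosines. *)
Definition ga (j : nat) : R := ze / sn * (j%:R - gm.-1%:R / 2).
Definition gpt (z : {ffun 'I_n -> 'I_gm}) : 'rV[R]_n := \row_i ga (z i).

Lemma ga_le (j : 'I_gm) : `|ga j| <= sq / sn.
Proof.
have j1 : j%:R <= gm.-1%:R :> R by rewrite ler_nat -ltnS prednK.
have h : gm.-1%:R <= 2 * sq / ze by have /truncn_itv/andP[] : 0 <= 2 * sq / ze by rewrite divr_ge0 ?mulr_ge0 // ltW.
have j0 : 0 <= j%:R :> R by [].
rewrite /ga normrM gtr0_norm ?divr_gt0 //.
apply: le_trans (_ : ze / sn * (sq / ze) <= _).
  rewrite ler_pM2l ?divr_gt0 // ler_norml; apply/andP; split; lra.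
by rewrite le_eqVlt; apply/orP; left; apply/eqP; field; rewrite !gt_eqF.
Qed.

Lemma ga_rev (j : 'I_gm) : ga (rev_ord j) = - ga j.
Proof.
rewrite /ga /= natrB //.
have -> : gm%:R = gm.-1%:R + 1 :> R by rewrite natr1 prednK.
by rewrite -natr1; field; rewrite gt_eqF.
Qed.

Lemma grid_sum1 (x : R) : \sum_(j < gm) expR (2 * ga j * x) <= gm%:R * expR (8 * (q / n%:R) * x ^+ 2).
Proof.
have h : \sum_(j < gm) (expR (2 * ga j * x) + expR (- (2 * ga j * x))) <= \sum_(j < gm) 2 * expR (8 * (q / n%:R) * x ^+ 2).
  apply: ler_sum => j _; apply: le_trans (cosh_le _) _; rewrite ler_pM2l // ler_expR.
  have -> : 2 * (2 * ga j * x) ^+ 2 = 8 * ga j ^+ 2 * x ^+ 2 by ring.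
  apply: ler_wpM2r; first exact: sqr_ge0.
  rewrite ler_pM2l // -(real_normK (num_real (ga j))) -sq2 -sn2 -expr_div_n.
  have s0 : 0 < sq / sn by rewrite divr_gt0.
  by apply: lerXn2r; rewrite ?nnegrE ?(ltW s0) //; exact: ga_le.
rewrite big_split /= in h.
have e : \sum_(j < gm) expR (- (2 * ga j * x)) = \sum_(j < gm) expR (2 * ga j * x).
  rewrite (reindex_inj rev_ord_inj); apply: eq_bigr => j _; rewrite ga_rev; congr expR; ring.
rewrite e sumr_const card_ord -[leRHS]mulr_natl in h; lra.
Qed.

Lemma gpt_norm z : enorm (gpt z) <= sq.
Proof.
apply: le_trans (_ : sn * (sq / sn) <= _).
  by apply: enorm_le_sup => [|i]; [rewrite divr_ge0 // ltW|rewrite mxE; exact: ga_le].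
by rewrite mulrCA divff ?mulr1 // gt_eqF.
Qed.

(** The sum factors over the coordinates, each average being subgaussian, and
    [8 (q / n) |x|^2 <= 32 q] on the truncation ball. *)
Lemma grid_sum (x : V) : \sum_(z : {ffun 'I_n -> 'I_gm}) twt (gpt z + gpt z) x <= gm%:R ^+ n * expR (32 * q).
Proof.
rewrite /twt -mulr_suml indicE; case: (boolP (x \in @tD R n)) => [/set_mem hx|_]; last first.
  by rewrite mulr0 mulr_ge0 ?exprn_ge0 ?expR_ge0.
rewrite mulr1.
have -> : \sum_(z : {ffun 'I_n -> 'I_gm}) expR (dot (x : 'rV[R]_n) (gpt z + gpt z)) =
   \sum_(z : {ffun 'I_n -> 'I_gm}) \prod_i expR (2 * ga (z i) * (x : 'rV[R]_n) ord0 i).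
  apply: eq_bigr => z _; rewrite -expR_sum; congr expR; rewrite /dot; apply: eq_bigr => i _; rewrite !mxE; ring.
rewrite -(bigA_distr_bigA (fun i j => expR (2 * ga (j : 'I_gm) * (x : 'rV[R]_n) ord0 i))).
apply: le_trans (_ : \prod_(i < n) (gm%:R * expR (8 * (q / n%:R) * (x : 'rV[R]_n) ord0 i ^+ 2)) <= _).
  by apply: ler_prod => i _; rewrite grid_sum1 andbT; apply: sumr_ge0 => j _; exact: expR_ge0.
rewrite big_split /= prodr_const card_ord ler_wpM2l ?exprn_ge0 // -expR_sum ler_expR -mulr_sumr.
have -> : \sum_(i < n) (x : 'rV[R]_n) ord0 i ^+ 2 = enorm (x : 'rV[R]_n) ^+ 2.
  by rewrite enorm2; apply: eq_bigr => i _; rewrite expr2.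
have : enorm (x : 'rV[R]_n) ^+ 2 <= tR0 (R := R) (n := n) ^+ 2.
  by apply: lerXn2r; rewrite ?nnegrE ?enorm_ge0 ?(ltW (tR0_gt0 n0)).
have -> : tR0 (R := R) (n := n) ^+ 2 = 4 * n%:R by rewrite /tR0 exprMn -/sn sn2; ring.
move=> h; have q0 : 0 < 8 * (q / n%:R) by rewrite mulr_gt0 // divr_gt0 // (lt_le_trans ltr01).
apply: le_trans (_ : 8 * (q / n%:R) * (4 * n%:R) <= _); first by rewrite ler_pM2l.
by rewrite le_eqVlt; apply/orP; left; apply/eqP; field; rewrite gt_eqF.
Qed.

(** By Markov over the grid at least half of its points satisfy this. *)
Definition tgood (xi : 'rV[R]_n) := enorm xi <= sq /\ tZ mu (xi + xi) <= 2 * expR (32 * q).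

(** [39 = 3 + 32 + 4]: the factor 8, the bound on [tZ (xi + xi)], and
    [4 |xi| <= 4 sqrt q <= 4 q]. *)
Lemma tgood_cst xi : tgood xi -> 4 * (2 * expR (32 * q)) * expR (4 * enorm xi) <= expR (39 * q).
Proof.
move=> [h1 h2].
have sqq : sq <= q by rewrite -sq2 expr2 ler_peMl ?(ltW sq0) // -(@ler_sqr R) ?nnegrE ?(ltW sq0) // expr1n sq2.
have -> : 39 * q = 3 * q + (32 * q + 4 * q) by ring.
rewrite 2!expRD [leRHS]mulrA.
have e3 : 8 <= expR (3 * q).
  apply: le_trans (_ : expR 3%:R <= _); last by rewrite ler_expR -[leLHS]mulr1 ler_pM2l.
  by have := @expR_ge2n R 3; rewrite !exprS expr0; lra.
have -> : 4 * (2 * expR (32 * q)) * expR (4 * enorm xi) = 8 * expR (32 * q) * expR (4 * enorm xi) by ring.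
apply: ler_pM => //; rewrite ?mulr_ge0 ?expR_ge0 //.
  by rewrite ler_wpM2r ?expR_ge0.
by rewrite ler_expR; lra.
Qed.

Lemma tgood_phi xi (C : set V) (t : R) : tgood xi -> measurable C -> 0 <= t ->
  t <= Ex mu (fun x => \1_C x * phi mu xi x) -> expR (- (39 * q)) * t ^+ 2 <= pr mu C.
Proof.
move=> hg mC t0 ht; have := phi_CS iso n0 hg.2 mC t0 ht => h.
rewrite expRN ler_pdivrMl ?expR_gt0 //; apply: le_trans h _.
by apply: ler_wpM2r; [exact: pr_ge0|exact: tgood_cst].
Qed.

Lemma tgood_hit xi (m : R) (th : 'rV[R]_n) : tgood xi -> dot th th = 1 -> 0 <= m -> m <= dot (tz mu xi) th ->
  expR (- (39 * q)) * (m / (4 * sn)) ^+ 2 <= pr mu (tD `&` [set x : V | m / 2 <= dot (x : 'rV[R]_n) th]).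
Proof.
move=> hg th1 m0 hm; have := hit_mass iso n0 hg.2 th1 m0 hm => h.
rewrite expRN ler_pdivrMl ?expR_gt0 //; apply: le_trans (_ : (m / (2 * (2 * sn))) ^+ 2 <= _); first by rewrite mulrA -natrM.
by apply: le_trans h _; apply: ler_wpM2r; [exact: pr_ge0|exact: tgood_cst].
Qed.

(** At least half of the grid is good, and a ball of radius [ze] contains at most [24 ^ n] grid
    points, so a maximal [ze]-separated list of good points keeps a fraction at least
    [24 ^ (- n) / 2] of the grid. *)
Lemma tgood_many : exists l, [/\ sep ze l, forall xi, xi \in l -> tgood xi & (sq / (24 * ze)) ^+ n <= (size l)%:R].
Proof.
pose good z := `[< tgood (gpt z) >].
pose G := [set z | good z]%SET.
have E0 := expR_gt0 (32 * q).
have g0 : 0 < gm%:R :> R by rewrite ltr0n.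
have gn0 : 0 < gm%:R ^+ n :> R by rewrite exprn_gt0.
have hb : \sum_(z : {ffun 'I_n -> 'I_gm}) tZ mu (gpt z + gpt z) <= gm%:R ^+ n * expR (32 * q).
  have h := @Ex_sum _ _ _ mu _ (index_enum {ffun 'I_n -> 'I_gm}) (fun z => twt (gpt z + gpt z)) (fun z => twt_bmf (gpt z + gpt z)).
  rewrite /tZ -h -[leRHS](Ex_cst mu); apply: Ex_le; [|exact: bmf_cst|exact: grid_sum].
  by apply: bmf_sum => z; exact: twt_bmf.
have hG : gm%:R ^+ n / 2 <= #|G|%:R :> R.
  have cG : #|G|%:R = gm%:R ^+ n - \sum_(z : {ffun 'I_n -> 'I_gm} | ~~ good z) 1 :> R.
    have : \sum_(z : {ffun 'I_n -> 'I_gm}) 1 = gm%:R ^+ n :> R by rewrite sumr_const card_ffun !card_ord natrX.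
    rewrite (bigID good) /= => <-; rewrite addrK -sum1_card natr_sum; apply: eq_bigl => z; by rewrite inE.
  have : 2 * expR (32 * q) * \sum_(z : {ffun 'I_n -> 'I_gm} | ~~ good z) 1 <= gm%:R ^+ n * expR (32 * q).
    apply: le_trans hb; rewrite [leRHS](bigID good) /= mulr_sumr -[leLHS]add0r; apply: lerD.
      by apply: sumr_ge0 => z _; exact: ltW (tZ_gt0 iso n0 _).
    apply: ler_sum => z /asboolP hz; rewrite mulr1 leNgt; apply/negP => hlt; apply: hz; split; first exact: gpt_norm.
    exact: ltW.
  set B := \sum_(_ | _) _ in cG *.
  have -> : 2 * expR (32 * q) * B = 2 * B * expR (32 * q) by ring.
  rewrite ler_pM2r // cG; lra.
pose A := [set xi : 'rV[R]_n | exists2 z, good z & xi = gpt z].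
have [||l [sl lA _ cov]] := @sep_cover R n ze A (gm%:R ^+ n) _ _.
- exact: ltW.
- move=> l [ul _] hl; rewrite -natrX ler_nat -[X in (_ <= X ^ _)%N]card_ord -[X in (_ <= _ ^ X)%N]card_ord -card_ffun.
  have -> : #|{ffun 'I_n -> 'I_gm}| = size [seq gpt z | z <- enum {ffun 'I_n -> 'I_gm}].
    by rewrite size_map cardE.
  apply: uniq_leq_size => // p /hl[z _ ->]; apply: map_f; exact: mem_enum.
exists l; split => // [xi /lA[z /asboolP hz ->]//|].
have cnt : #|G|%:R <= \sum_(p <- l) (24 ^+ n : R).
  apply: le_trans (_ : \sum_(p <- l) #|[set z : {ffun 'I_n -> 'I_gm} | enorm (gpt z - p) <= ze]%SET|%:R <= _).
    rewrite -natr_sum ler_nat -sum1_card.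
    apply: (@leq_trans (\sum_(z in G) \sum_(p <- l) (enorm (gpt z - p) <= ze)%R)).
      apply: leq_sum => z; rewrite inE => hz.
      have [p pl hp] := cov (gpt z) (ex_intro2 _ _ z hz erefl).
      by rewrite (big_rem p pl) /= hp.
    rewrite exchange_big /=; apply: leq_sum => p _.
    rewrite -sum1_card big_mkcond [leqRHS]big_mkcond /=; apply: leq_sum => z _; rewrite [in leqRHS]inE.
    by case: (z \in G); case: (_ <= _)%R.
  rewrite !big_seq; apply: ler_sum => p pl.
  have := @lattice_count R n gm 1 (fun i => p ord0 i * sn / ze + gm.-1%:R / 2) [set z : {ffun 'I_n -> 'I_gm} | enorm (gpt z - p) <= ze]%SET (lexx _).
  rewrite mulr1; apply => z; rewrite inE => hz; rewrite mul1r.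
  have -> : \sum_i `|p ord0 i * sn / ze + gm.-1%:R / 2 - (z i)%:R| = sn / ze * \sum_i `|(gpt z - p) ord0 i|.
    rewrite mulr_sumr; apply: eq_bigr => i _; rewrite !mxE -[X in _ = X * _]gtr0_norm ?divr_gt0 // -normrM -normrN.
    by congr (`|_|); rewrite /ga; field; rewrite !gt_eqF.
  rewrite -ler_pdivlMl ?divr_gt0 // ; apply: le_trans (sum_abs_le _) _; rewrite -/sn.
  apply: le_trans (_ : sn * ze <= _); first by rewrite ler_pM2l.
  by rewrite le_eqVlt; apply/orP; left; apply/eqP; rewrite -sn2; field; rewrite !gt_eqF.
rewrite big_const_seq count_predT iter_addr_0 -[leRHS]mulr_natl in cnt.
have hgm : 2 * sq / ze <= gm%:R by apply: ltW; exact: truncnS_gt.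
have p24 : 0 < 24 ^+ n :> R by rewrite exprn_gt0.
rewrite -(ler_pM2r p24); apply: le_trans cnt; apply: le_trans hG.
rewrite ler_pdivlMr // -exprMn.
have -> : sq / (24 * ze) * 24 = sq / ze by field; rewrite gt_eqF.
apply: le_trans (_ : (sq / ze) ^+ n * 2 ^+ n <= _).
  rewrite ler_pM2l ?exprn_gt0 ?divr_gt0 // -[leLHS]expr1; apply: ler_weXn2l => //; lra.
rewrite -exprMn; apply: lerXn2r; rewrite ?nnegrE ?(ltW g0) //.
  by rewrite mulr_ge0 // divr_ge0 // ltW.
by apply: le_trans hgm; lra.
Qed.
End Grid.

(** * Clusters of tilted means *)

(* Points of a ball around [p] differ from [p] nearly by elements of a [D]-dimensional space, so
   halving the radius of the ball costs a factor [216 ^ D] only. *)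
Lemma octave_count {R : realType} {n : nat} (D : nat) (z : R) (S : seq 'rV[R]_n) : 0 < z -> sep z S ->
  (forall p, p \in S -> exists d (U : 'M[R]_(d, n)), [/\ U *m U^T = 1%:M, (d <= D)%N &
     forall x, x \in S -> enorm ((x - p) - (x - p) *m U^T *m U) <= enorm (x - p) / 16]) ->
  forall J S' p, uniq S' -> {subset S' <= S} -> p \in S' ->
    (forall x, x \in S' -> enorm (x - p) <= 2 ^+ J * z) -> (size S')%:R <= (216 ^+ D) ^+ J :> R.
Proof.
move=> z0 [uS sepS] hU; elim=> [|J ih] S' p uS' sub pS' hS'.
  rewrite expr0 (ler_nat _ _ 1); apply: (@uniq_leq_size _ S' [:: p]) => // x xS'.
  rewrite inE; apply/negP => /negP xp.
  have := sepS x p (sub _ xS') (sub _ pS') xp; rewrite ltNge; have := hS' x xS'; rewrite expr0 mul1r => ->.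
  by [].
have [d [U [UU dD hp]]] := hU p (sub _ pS').
pose rho := 2 ^+ J.+1 * z; have r0 : 0 < rho by rewrite mulr_gt0 // exprn_gt0.
(* The net has mesh [rho / 8]; points of one class differ by at most [rho / 8 + rho / 8] along [U]
   and [rho / 16 + rho / 16] across it, which is less than [rho / 2]. *)
have [||l [_ _ hl hcov]] := @sep_cover R d (rho / 8) [set c | enorm c <= rho] (216 ^+ d).
- by rewrite divr_ge0 // ltW.
- move=> l sl ll.
  have r8 : 0 < rho / 8 by rewrite divr_gt0.
  have := @pack_size R d (rho / 8) rho 0 l r8 (ltW r0) sl; have -> : 24 * (rho / (rho / 8) + 1) = 216 by field; rewrite gt_eqF.
  by apply => q /ll; rewrite subr0.
pose Sc c := [seq x <- S' | enorm ((x - p) *m U^T - c) <= rho / 8].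
have h1 : (size S' <= \sum_(c <- l) size (Sc c))%N.
  rewrite -[size S']sum1_size big_seq.
  apply: (@leq_trans (\sum_(x <- S') \sum_(c <- l) (enorm ((x - p) *m U^T - c) <= rho / 8)%R)).
    rewrite [leqRHS]big_seq; apply: leq_sum => x xS'.
    have [|c cl hc] := hcov ((x - p) *m U^T); first by apply: le_trans (enorm_proj _ UU) _; exact: hS'.
    by rewrite (big_rem c cl) /= hc.
  rewrite exchange_big /=; apply: leq_sum => c _; rewrite size_filter -sum1_count [leqRHS]big_mkcond /=.
  by apply: leq_sum => x _; case: (_ <= _)%R.
apply: le_trans (_ : \sum_(c <- l) (216 ^+ D) ^+ J <= _).
  apply: le_trans (_ : (\sum_(c <- l) size (Sc c))%:R <= _); first by rewrite ler_nat.
  rewrite natr_sum; apply: ler_sum => c _.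
  have [->|] := eqVneq (Sc c) [::]; first by rewrite exprn_ge0 // exprn_ge0.
  case E : (Sc c) => [//|y r] _; rewrite -E.
  have yS : y \in Sc c by rewrite E mem_head.
  apply: (ih _ y) => //; first by rewrite filter_uniq.
    by move=> x; rewrite mem_filter => /andP[_ /sub].
  move=> x; move: yS; rewrite !mem_filter => /andP[hy yS'] /andP[hx xS'].
  set a := x - p in hx; set b := y - p in hy.
  have -> : x - y = (a - a *m U^T *m U) - (b - b *m U^T *m U) + ((a *m U^T - c) - (b *m U^T - c)) *m U.
    have -> : x - y = a - b by rewrite /a /b opprB addrA subrK.
    clearbody a b; have -> : a *m U^T - c - (b *m U^T - c) = a *m U^T - b *m U^T by rewrite opprB addrA subrK.
    rewrite mulmxBl; move: (a *m U^T *m U) (b *m U^T *m U) => v1 v2.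
    by apply/matrixP => i j; rewrite !mxE; ring.
  apply: le_trans (enormD _ _) _; rewrite enorm_iso //.
  have e1 : enorm (a - a *m U^T *m U) <= rho / 16.
    by apply: le_trans (hp x (sub _ xS')) _; rewrite ler_pM2r ?invr_gt0 //; exact: hS'.
  have e2 : enorm (b - b *m U^T *m U) <= rho / 16.
    by apply: le_trans (hp y (sub _ yS')) _; rewrite ler_pM2r ?invr_gt0 //; exact: hS'.
  have e3 := enormB (a - a *m U^T *m U) (b - b *m U^T *m U).
  have e4 := enormB (a *m U^T - c) (b *m U^T - c).
  have -> : 2 ^+ J * z = rho / 2 by rewrite /rho exprS; field.
  lra.
rewrite big_const_seq count_predT iter_addr_0 -[leLHS]mulr_natl exprS ler_wpM2r ?exprn_ge0 //.
apply: le_trans hl _; apply: ler_weXn2l => //; lra.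
Qed.

Lemma shift_arith {R : realType} (A B T s z : R) : 0 <= A -> T / 4 <= B -> A + B <= 2 * s * z -> T <= 8 * s * z.
Proof. lra. Qed.

Section Local.
Context {R : realType} {n k e : nat} (mu : probability (borel_rV R n) R) (q : R).
Notation V := (borel_rV R n).
Hypotheses (iso : isotropic mu) (lc : log_concave mu) (n0 : (0 < n)%N) (q1 : 1 <= q).
Hypotheses (k0 : (0 < k)%N) (e0 : (0 < e)%N).
Hypothesis cond : (24 * (8 * k%:R * rp_M / rp_h + 1)) ^+ k * 16 <= sgp ^+ k * expR (rp_rate * e%:R) :> R.
Hypothesis hk : 4 * expR (39 * q) < expR k%:R.
Let ze : R := @tzeta R n.
Let ze0 : 0 < ze. Proof. exact: tzeta_gt0. Qed.
Definition lkap : R := rp_eps ^+ 2 / 2.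
Lemma lkap_gt0 : 0 < lkap.
Proof. by rewrite divr_gt0 // exprn_gt0 // rp_eps_gt0. Qed.

(** With [k e] orthonormal directions of variance at most [lkap], Markov would put tilted mass at
    least [1/2], hence [mu]-mass at least [exp (- 39 q) / 4], in a ball of the marginal whose mass
    [small_proj] bounds by [exp (- k)]. *)
Lemma local_dim xi : tgood mu q xi -> exists d (U : 'M[R]_(d, n)), [/\ U *m U^T = 1%:M, (d <= k * e)%N &
  forall v : 'rV[R]_n, lkap * dot (v - v *m U^T *m U) (v - v *m U^T *m U) <= tvar mu xi v].
Proof.
move=> hg; have kp0 := lkap_gt0; have ep0 := @rp_eps_gt0 R.
have [|d [U [UU hr hv]]] := @spectral R n (tcov mu xi) (tcov_sym mu xi) _ lkap.
  by move=> v; rewrite tcovE //; exact: tvar_ge0.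
exists d, U; split => // [|v]; last by rewrite -(tcovE iso n0).
rewrite leqNgt; apply/negP => hd.
pose f (i : 'I_(k * e)) : 'I_d := widen_ord (ltnW hd) i.
pose W : 'M[R]_(k * e, n) := \matrix_(i, j) U (f i) j.
have WW : W *m W^T = 1%:M.
  apply/matrixP => i j; have := congr1 (fun A : 'M[R]_d => A (f i) (f j)) UU; rewrite !mxE -[f i == f j]val_eqE /= => <-.
  by apply: eq_bigr => l _; rewrite !mxE.
pose w := tz mu xi *m W^T.
pose g (x : V) : R := \sum_i tdev mu xi (row (f i) U) x ^+ 2.
have gE (x : V) : enorm ((x : 'rV[R]_n) *m W^T - w) ^+ 2 = g x.
  rewrite enorm2 /w -mulmxBl; apply: eq_bigr => i _; rewrite -expr2; congr (_ ^+ 2).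
  rewrite /tdev -dotBl mxE; apply: eq_bigr => j _; by rewrite !mxE.
have bg : bmf (fun x => g x * phi mu xi x).
  have -> : (fun x => g x * phi mu xi x) = (fun x => \sum_i tdev mu xi (row (f i) U) x ^+ 2 * phi mu xi x).
    by apply/funext => x; rewrite /g mulr_suml.
  by apply: bmf_sum => i; exact: tdev2_bmf.
have ke0 : 0 < (k * e)%:R :> R by rewrite ltr0n muln_gt0 k0.
have Eg : Ex mu (fun x => g x * phi mu xi x) <= (k * e)%:R * lkap.
  have -> : (fun x => g x * phi mu xi x) = (fun x => \sum_i tdev mu xi (row (f i) U) x ^+ 2 * phi mu xi x).
    by apply/funext => x; rewrite /g mulr_suml.
  rewrite Ex_sum => [|i]; last exact: tdev2_bmf.
  apply: le_trans (_ : \sum_(i < k * e) lkap <= _); last by rewrite sumr_const card_ord mulr_natl.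
  by apply: ler_sum => i _; rewrite -/(tvar mu xi (row (f i) U)) -(tcovE iso n0); exact: hr.
pose C := [set x : V | enorm ((x : 'rV[R]_n) *m W^T - w) <= rp_eps * Num.sqrt ((k * e)%:R : R)].
pose T : R := rp_eps ^+ 2 * (k * e)%:R.
have T0 : 0 < T by rewrite mulr_gt0 // exprn_gt0.
have s0 : 0 < rp_eps * Num.sqrt ((k * e)%:R : R) by rewrite mulr_gt0 // sqrtr_gt0.
have TE : (rp_eps * Num.sqrt ((k * e)%:R : R)) ^+ 2 = T by rewrite exprMn sqr_sqrtr // ltW.
have CE : C = [set x : V | g x <= T].
  by apply/seteqP; split => x /=; rewrite /C /= -gE -TE ler_sqr ?nnegrE ?enorm_ge0 // ltW.
have mC : measurable C.
  rewrite CE; apply: measurable_le_set; apply: measurable_sum => i; apply: measurable_funX; exact: tdev_borel.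
have bp := phi_bmf mu xi.
have bC : bmf (fun x => \1_C x * phi mu xi x) by apply: bmfM => //; exact: bmf_indic.
have hC : 2^-1 <= Ex mu (fun x => \1_C x * phi mu xi x).
  apply: le_trans (_ : Ex mu (fun x => phi mu xi x - T^-1 * (g x * phi mu xi x)) <= _).
    rewrite ExB //; last exact: bmfZ.
    rewrite (ExZ mu _ bg) (phi_one iso n0).
    have : T^-1 * Ex mu (fun x => g x * phi mu xi x) <= T^-1 * ((k * e)%:R * lkap) by rewrite ler_pM2l // invr_gt0.
    have -> : T^-1 * ((k * e)%:R * lkap) = 2^-1 by rewrite /T /lkap; move: (_%:R) ke0 => K K0; field; rewrite !gt_eqF.
    lra.
  apply: Ex_le => // [|x]; first by apply: bmfB => //; exact: bmfZ.
  have p0 := phi_ge0 iso n0 xi x.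
  have -> : phi mu xi x - T^-1 * (g x * phi mu xi x) = (1 - T^-1 * g x) * phi mu xi x by ring.
  apply: ler_wpM2r => //; rewrite indicE; case: (boolP (x \in C)) => hx.
    by rewrite gerBl mulr_ge0 ?invr_ge0 ?(ltW T0) // -gE sqr_ge0.
  rewrite subr_le0 ler_pdivlMl // mulr1; apply: ltW; rewrite ltNge; apply/negP => h; move/negP: hx; apply; apply/mem_set.
  by rewrite CE.
have h2 : 0 <= 2^-1 :> R by [].
have h1 := tgood_phi iso n0 q1 hg mC h2 hC.
have h3 := small_proj iso lc WW k0 e0 w cond; rewrite -/C in h3.
have := le_trans h1 h3; apply/negP; rewrite -ltNge expRN [ltRHS]mulrC expr2.
have E1 := expR_gt0 (39 * q); have E2 := expR_gt0 (k%:R : R).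
rewrite expRN ltr_pdivlMr // -invfM ltr_pdivrMl //.
rewrite ltr_pdivlMr ?mulr_gt0 //; apply: le_lt_trans hk.
by rewrite le_eqVlt; apply/orP; left; apply/eqP; ring.
Qed.

(** Chosen so that [8 tsep ze = lkap (ze / 16) ^ 2]. *)
Definition tsep : R := ze * lkap / 2 ^+ 11.

(** For [p], [x] in [S] let [w] have length [ze] and point from [p] towards [x]. Monotonicity along
    the segment bounds [tvar mu p w / 4] by [<tz x - tz p, w>], at most [2 tsep ze]. By [local_dim]
    the vector [w], and by scaling [x - p], is within a sixteenth of its length of a space of
    dimension at most [k e], so [octave_count] applies. *)
Theorem cluster_count (S : seq 'rV[R]_n) (J : nat) : sep ze S -> (forall p, p \in S -> tgood mu q p) ->
  (forall p x, p \in S -> x \in S -> enorm (tz mu p - tz mu x) <= 2 * tsep) ->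
  2 * Num.sqrt q <= 2 ^+ J * ze -> (size S)%:R <= (216 ^+ (k * e)) ^+ J :> R.
Proof.
move=> sS hg hz hJ; have kp0 := lkap_gt0.
case E : S => [|p0 r]; first by rewrite /= exprn_ge0 // exprn_ge0.
rewrite -E; have pS : p0 \in S by rewrite E mem_head.
apply: (@octave_count R n (k * e) ze S ze0 sS _ J S p0) => //; last first.
- move=> x xS; apply: le_trans hJ; apply: le_trans (enormB _ _) _.
  by have [h1 _] := hg _ xS; have [h2 _] := hg _ pS; lra.
- by case: sS.
move=> p pS'; have [d [U [UU dk hU]]] := local_dim (hg _ pS'); exists d, U; split => // x xS.
set v := x - p.
have [v0|v0] := eqVneq v 0; first by rewrite v0 !mul0mx subr0 enorm0 mul0r.
have xp : x != p by rewrite -subr_eq0.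
have ev : ze < enorm v by case: sS => _; apply.
have ev0 : 0 < enorm v by exact: lt_trans ev.
pose a := ze / enorm v; have a0 : 0 < a by rewrite divr_gt0.
pose w := a *: v.
have ew : enorm w = ze by rewrite enormZ gtr0_norm // /a mulfVK // gt_eqF.
pose t := enorm v / ze - 1.
have t0 : 0 < t by rewrite subr_gt0 ltr_pdivlMr // mul1r.
have xE : x = p + w + t *: w.
  rewrite -addrA -[X in X + t *: w]scale1r -scalerDl /w scalerA.
  have -> : (1 + t) * a = 1 by rewrite /t /a; field; rewrite !gt_eqF.
  by rewrite scale1r addrC subrK.
have h1 : 0 <= dot (tz mu x - tz mu (p + w)) w.
  by have := tshift_ge0 iso n0 (p + w) (t *: w); rewrite -xE dotZr pmulr_rge0.
have h2 := tshift_ge iso n0 p (w := w) ltac:(by rewrite ew).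
have h3 : tvar mu p w <= 8 * tsep * ze.
  have : dot (tz mu x - tz mu p) w <= 2 * tsep * ze.
    by apply: le_trans (dot_le _ _) _; rewrite ew ler_pM2r // hz.
  have -> : tz mu x - tz mu p = (tz mu x - tz mu (p + w)) + (tz mu (p + w) - tz mu p) by rewrite addrA subrK.
  by rewrite dotDl; exact: shift_arith h1 h2.
have h4 := le_trans (hU w) h3.
have e4 : w - w *m U^T *m U = a *: (v - v *m U^T *m U) by rewrite /w -!scalemxAl -scalerBr.
rewrite e4 dotZl dotZr in h4.
have : (enorm (v - v *m U^T *m U)) ^+ 2 <= (enorm v / 16) ^+ 2.
  rewrite enorm2; move: (dot _ _) h4 => y h4.
  have ka : 0 < lkap * (a * a) by apply: mulr_gt0 => //; exact: mulr_gt0.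
  rewrite -(ler_pM2l ka); have -> : lkap * (a * a) * y = lkap * (a * (a * y)) by ring.
  apply: le_trans h4 _.
  by rewrite le_eqVlt; apply/orP; left; apply/eqP; rewrite /tsep /a; field; rewrite !gt_eqF.
by rewrite ler_sqr ?nnegrE ?enorm_ge0 // divr_ge0 // enorm_ge0.
Qed.
End Local.

(** * Two means with close projections *)

Lemma fiber_count {R : realType} (T T' : eqType) (S : seq T) (L : seq T') (r : T -> T' -> bool) (B : R) :
  (forall x, x \in S -> exists2 p, p \in L & r x p) ->
  (forall p, p \in L -> (size [seq x <- S | r x p])%:R <= B) -> (size S)%:R <= (size L)%:R * B.
Proof.
move=> hS hL.
have h1 : (size S <= \sum_(c <- L) size [seq x <- S | r x c])%N.
  rewrite -[size S]sum1_size big_seq.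
  apply: (@leq_trans (\sum_(x <- S) \sum_(c <- L) r x c)).
    rewrite [leqRHS]big_seq; apply: leq_sum => x /hS[c cl hc].
    by rewrite (big_rem c cl) /= hc.
  rewrite exchange_big /=; apply: leq_sum => c _; rewrite size_filter -sum1_count [leqRHS]big_mkcond /=.
  by apply: leq_sum => x _; case: (r x c).
apply: le_trans (_ : (\sum_(c <- L) size [seq x <- S | r x c])%:R <= _); first by rewrite ler_nat.
apply: le_trans (_ : \sum_(c <- L) B <= _).
  by rewrite natr_sum !big_seq; apply: ler_sum.
by rewrite big_const_seq count_predT iter_addr_0 mulr_natl.
Qed.

Lemma orth_compl {R : realType} {n d : nat} (U : 'M[R]_(d, n)) : U *m U^T = 1%:M ->
  exists W : 'M[R]_(n - d, n), W *m W^T = 1%:M /\ forall v : 'rV[R]_n, v = v *m U^T *m U + v *m W^T *m W.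
Proof.
move=> UU.
pose f : {linear 'rV[R]_n -> 'rV[R]_d} := mulmxr U^T.
pose K := lker (linfun f).
have Kin (v : 'rV[R]_n) : (v \in K) = (v *m U^T == 0) by rewrite memv_ker lfunE.
have dimK : \dim K = (n - d)%N.
  have := limg_ker_dim (linfun f) fullv; rewrite capfv -/K.
  have -> : (linfun f @: fullv)%VS = fullv.
    apply/vspaceP => c; rewrite memvf; apply/memv_imgP; exists (c *m U); first exact: memvf.
    by rewrite lfunE /= -mulmxA UU mulmx1.
  rewrite !dimvf /dim /= !mul1n => h; by move: (\dim K) h => dK; lia.
have [W [WW hW]] := onb K; rewrite dimK in W WW hW.
exists W; split => // v.
have WK (c : 'rV[R]_(n - d)) : c *m W *m U^T = 0.
  by apply/eqP; rewrite -Kin; apply/hW; rewrite -[c *m W *m W^T]mulmxA WW mulmx1.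
have WU : W *m U^T = 0.
  by apply/row_matrixP => i; rewrite row_mul row0 -[row i W]mul1mx; have := WK (delta_mx 0 i); rewrite -rowE mul1mx.
have UW : U *m W^T = 0 by apply: trmx_inj; rewrite trmx_mul trmxK WU trmx0.
have : v - v *m U^T *m U \in K by rewrite Kin mulmxBl -[v *m U^T *m U *m U^T]mulmxA UU mulmx1 subrr.
move=> /hW; rewrite mulmxBl -[v *m U^T *m U *m W^T]mulmxA UW mulmx0 subr0 => h.
by rewrite h addrC subrK.
Qed.

(** Three successive nets: for the means, for their projections to the complement inside one ball of
    the first, and for their components along [U] inside a class of the second, which has diameter
    at most [r] if the claim fails. Final classes have diameter at most [4 s], hence at most [A4]
    elements, and the product contradicts the size of [S]. *)
Lemma pigeon {R : realType} {n d : nat} (U : 'M[R]_(d, n)) (W : 'M[R]_(n - d, n)) (S : seq 'rV[R]_n)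
  (f : 'rV[R]_n -> 'rV[R]_n) (A1 A4 sc s r : R) :
  U *m U^T = 1%:M -> W *m W^T = 1%:M -> (forall v : 'rV[R]_n, v = v *m U^T *m U + v *m W^T *m W) ->
  uniq S -> 0 < s -> 0 <= sc -> 0 <= r -> 0 <= A1 -> 0 <= A4 ->
  covers [set f x | x in [set` S]] A1 sc ->
  (forall S', uniq S' -> {subset S' <= S} -> (forall x y, x \in S' -> y \in S' -> enorm (f x - f y) <= 4 * s) -> (size S')%:R <= A4) ->
  A1 * (24 * (sc / s + 1)) ^+ (n - d) * (24 * (r / s + 1)) ^+ d * A4 < (size S)%:R ->
  exists x y, [/\ x \in S, y \in S, enorm ((f x - f y) *m W^T) <= 2 * s & r < enorm (f x - f y)].
Proof.
move=> UU WW dec uS s0 sc0 r0 A10 A40 [L1 [sL1 hL1]] h4 hS; apply: contrapT => hn.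
have hn' x y : x \in S -> y \in S -> enorm ((f x - f y) *m W^T) <= 2 * s -> enorm (f x - f y) <= r.
  by move=> xS yS hw; rewrite leNgt; apply/negP => hr; apply: hn; exists x, y.
have net c (t : R) : 0 <= t -> exists2 L : seq 'rV[R]_c, (size L)%:R <= (24 * (t / s + 1)) ^+ c &
    forall v, enorm v <= t -> exists2 p, p \in L & enorm (v - p) <= s.
  move=> t0; have [||L [_ _ h1 h2]] := @sep_cover R c s [set v | enorm v <= t] ((24 * (t / s + 1)) ^+ c).
  - exact: ltW.
  - by move=> l sl ll; apply: (@pack_size R c s t 0 l s0 t0 sl) => p /ll; rewrite subr0.
  by exists L.
have [L2 sL2 hL2] := net (n - d)%N sc sc0; have [L3 sL3 hL3] := net d r r0.
move: hS; apply/negP; rewrite -leNgt.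
set B2 := _ ^+ (n - d) in sL2 *; set B3 := _ ^+ d in sL3 *.
have B20 : 0 <= B2 by apply: le_trans sL2.
have B30 : 0 <= B3 by apply: le_trans sL3.
apply: le_trans (_ : (size L1)%:R * (B2 * (B3 * A4)) <= _); last first.
  by rewrite -!mulrA ler_wpM2r // mulr_ge0 // mulr_ge0.
apply: (@fiber_count R _ _ S L1 (fun x p => enorm (f x - p) <= sc)).
  by move=> x xS; apply: hL1; exists x.
move=> p _; set S1 := [seq x <- S | _].
apply: le_trans (_ : (size L2)%:R * (B3 * A4) <= _); last by rewrite ler_wpM2r // mulr_ge0.
apply: (@fiber_count R _ _ S1 L2 (fun x c => enorm ((f x - p) *m W^T - c) <= s)).
  move=> x; rewrite mem_filter => /andP[hx _]; apply: hL2.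
  exact: le_trans (enorm_proj _ WW) hx.
move=> c _; set S2 := [seq x <- S1 | _].
have sub2 : {subset S2 <= S} by move=> x; rewrite !mem_filter => /andP[_ /andP[]].
have d2 x y : x \in S2 -> y \in S2 -> enorm ((f x - f y) *m W^T) <= 2 * s.
  rewrite !mem_filter => /andP[hx _] /andP[hy _].
  have -> : (f x - f y) *m W^T = ((f x - p) *m W^T - c) - ((f y - p) *m W^T - c).
    rewrite !mulmxBl; move: (f x *m _) (f y *m _) (p *m _) => a b g.
    by apply/matrixP => i j; rewrite !mxE; ring.
  by apply: le_trans (enormB _ _) _; lra.
have [->|] := eqVneq S2 [::]; first by rewrite mulr_ge0.
case E : S2 => [//|x0 rr] _; rewrite -E.
have x0S : x0 \in S2 by rewrite E mem_head.
apply: le_trans (_ : (size L3)%:R * A4 <= _); last by rewrite ler_wpM2r.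
apply: (@fiber_count R _ _ S2 L3 (fun x c => enorm ((f x - f x0) *m U^T - c) <= s)).
  move=> x xS; apply: hL3; apply: le_trans (enorm_proj _ UU) _.
  by apply: hn'; [exact: sub2|exact: sub2|exact: d2].
move=> g _; apply: h4 => [||x y].
- by rewrite !filter_uniq.
- by move=> x; rewrite mem_filter => /andP[_ /sub2].
rewrite mem_filter => /andP[hx xS]; rewrite mem_filter => /andP[hy yS].
rewrite [f x - f y]dec; apply: le_trans (enormD _ _) _; rewrite (enorm_iso _ UU) (enorm_iso _ WW).
have h1 : enorm ((f x - f y) *m W^T) <= 2 * s by exact: d2.
have -> : (f x - f y) *m U^T = ((f x - f x0) *m U^T - g) - ((f y - f x0) *m U^T - g).
  rewrite !mulmxBl; move: (f x *m _) (f y *m _) (f x0 *m _) => a b g'.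
  by apply/matrixP => i j; rewrite !mxE; ring.
have := enormB ((f x - f x0) *m U^T - g) ((f y - f x0) *m U^T - g); lra.
Qed.

Section Spread.
Context {R : realType}.
(** Product of the bases of the exponential factors in [pigeon]: the covering of the means, the
    complement net, the clusters, and the density [24 ^ (- n)] of the good tilts. *)
Definition spG : R := 24 * 24 * 2 * expR 83 * (24 * (3 * 2 ^+ 12 / lkap + 1)).
(* Chosen so that [spG ^ n * spb a ^ d <= exp (- n)] whenever [a n <= d]. *)
Definition spb (a : R) : R := expR (- ((ln spG + 1) / a)).
(** Scaled so that, given [hX], [24 (spt a sq / s + 1) <= spb a (sq / ze)] for [s = tsep / 2]. *)
Definition spt (a : R) : R := spb a * lkap / (48 * 2 ^+ 12).
Lemma spG_ge1 : 1 <= spG.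
Proof.
have l0 := @lkap_gt0 R; have e1 : 1 <= expR 83 :> R by rewrite -expR0 ler_expR.
have h : 0 < 3 * 2 ^+ 12 / lkap :> R by rewrite divr_gt0 // mulr_gt0 // exprn_gt0.
rewrite /spG; move: (expR 83) (3 * 2 ^+ 12 / lkap) e1 h => u v h1 h2.
have : 1 * 1 <= u * (24 * (v + 1)) by apply: ler_pM => //; lra.
lra.
Qed.
Lemma spb_gt0 a : 0 < spb a. Proof. exact: expR_gt0. Qed.
Lemma spt_gt0 a : 0 < spt a.
Proof.
have l0 := @lkap_gt0 R; have b0 := spb_gt0 a; apply: divr_gt0; apply: mulr_gt0 => //; exact: exprn_gt0.
Qed.

Context {n : nat} (mu : probability (borel_rV R n) R) (q : R).
Notation V := (borel_rV R n).
Hypotheses (iso : isotropic mu) (lc : log_concave mu) (n0 : (0 < n)%N) (q1 : 1 <= q) (qn : q <= n%:R) (qln : ln (6 * n%:R) <= q).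
Let nR : 0 < n%:R :> R. Proof. by rewrite ltr0n. Qed.
Let n1 : 1 <= n%:R :> R. Proof. by rewrite (ler_nat _ 1). Qed.
Let q0 : 0 < q. Proof. exact: lt_le_trans q1. Qed.
Let sq := Num.sqrt q.
Let sq0 : 0 < sq. Proof. by rewrite sqrtr_gt0. Qed.
Let sq2 : sq ^+ 2 = q. Proof. by rewrite sqr_sqrtr // ltW. Qed.
Let ze : R := @tzeta R n.
Let ze0 : 0 < ze. Proof. exact: tzeta_gt0. Qed.

(** The sum argument for tilted densities, of cost [39 q]: with [n <= m q <= 2 n] the steps cost at
    most [82 n], since [2 ln (2 m + 2) <= 2 q], and the final remainder costs at most [n]. *)
Lemma tz_cover (S : seq 'rV[R]_n) : (forall xi, xi \in S -> tgood mu q xi) ->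
  covers [set tz mu x | x in [set` S]] (24 ^+ n * expR (83 * n%:R)) (3 * sq).
Proof.
move=> hS; pose z (i : 'I_(size S)) := tz mu S`_i.
pose m := (Num.truncn (n%:R / q)).+1.
have nq0 : 0 <= n%:R / q by rewrite divr_ge0 // ltW.
have m1 : n%:R <= m%:R * q by rewrite -ler_pdivrMr //; apply: ltW; exact: truncnS_gt.
have m2 : m%:R * q <= 2 * n%:R.
  have : m%:R <= n%:R / q + 1 by rewrite /m -natr1 lerD2r; have /truncn_itv/andP[] := nq0.
  rewrite -(ler_pM2r q0) mulrDl mul1r divfK ?gt_eqF // => h; apply: le_trans h _.
  have -> : 2 * n%:R = n%:R + n%:R :> R by ring.
  by rewrite lerD2l.
have mR : 0 < m%:R :> R by rewrite ltr0n.
have s0 : 0 < 3 * sq by rewrite mulr_gt0.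
have rho0 : 0 < m%:R * (3 * sq) / n%:R by rewrite divr_gt0 // mulr_gt0.
have Wm i : Wset mu (m%:R * (3 * sq) / n%:R) m (83 * n%:R) (m%:R *: z i).
  have hg : tgood mu q S`_i by apply: hS; exact: mem_nth.
  have v0 : dot (0 : 'rV[R]_n) 0 <= 2 * (m - m)%:R * @tR0 R n ^+ 2 by rewrite dot0l subnn mulr0 mul0r.
  have := Wmember (phi_ge0 iso n0 S`_i) (phi_bmf mu S`_i) (phi_one iso n0 S`_i) (phi_supp (xi := S`_i)) (tR0_gt0 n0)
    (fun C t mC t0 => tgood_phi iso n0 q1 hg mC t0) rho0 (leqnn m) v0.
  rewrite addr0; apply: Wmono => //.
  rewrite dot0l add0r.
  have h1 : m%:R * (39 * q + 2 * ln (2 * m%:R + 2)) <= 82 * n%:R.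
    have hl : ln (2 * m%:R + 2) <= q.
      apply: le_trans qln; rewrite ler_ln ?posrE ?addr_gt0 ?mulr_gt0 //.
      have n1' := n1; have : m%:R <= m%:R * q by rewrite ler_peMr // ltW.
      lra.
    apply: le_trans (_ : m%:R * (41 * q) <= _); first by rewrite ler_pM2l //; lra.
    lra.
  have h2 : Num.sqrt (2 * m%:R * @tR0 R n ^+ 2) / (m%:R * (3 * sq) / n%:R) <= n%:R.
    rewrite ler_pdivrMr //; have -> : n%:R * (m%:R * (3 * sq) / n%:R) = m%:R * (3 * sq) by field; rewrite gt_eqF.
    rewrite -[leRHS]ger0_norm; last by rewrite mulr_ge0 // ltW.
    rewrite -sqrtr_sqr ler_wsqrtr // /tR0 !exprMn sqr_sqrtr ?(ltW nR) // sq2.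
    have : m%:R * n%:R <= m%:R * (m%:R * q) by rewrite ler_pM2l.
    have : 0 <= m%:R * n%:R :> R by rewrite mulr_ge0.
    rewrite !expr2; lra.
  lra.
have := Whull_cover lc n0 (isT : (0 < m)%N) s0 Wm; apply: covers_sub => _ [x /= xS <-].
have xi : (index x S < size S)%N by rewrite index_mem.
exists (fun i => (i == Ordinal xi)%:R); split=> //.
  by rewrite (bigD1 (Ordinal xi)) //= eqxx big1 ?addr0 // => i /negbTE ->.
rewrite (bigD1 (Ordinal xi)) //= eqxx scale1r big1 ?addr0; last by move=> i /negbTE ->; rewrite scale0r.
by rewrite /z /= nth_index.
Qed.

Context {k e J : nat} (a : R).
Hypotheses (k0 : (0 < k)%N) (e0 : (0 < e)%N).
Hypothesis cond : (24 * (8 * k%:R * rp_M / rp_h + 1)) ^+ k * 16 <= sgp ^+ k * expR (rp_rate * e%:R) :> R.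
Hypothesis hk : 4 * expR (39 * q) < expR k%:R.
Hypotheses (hJ : 2 * sq <= 2 ^+ J * ze) (hC : (216 ^+ (k * e)) ^+ J <= 2 ^+ n :> R).
Hypotheses (a0 : 0 < a) (hX : 48 <= spb a * (sq / ze)).

Theorem spread (S : seq 'rV[R]_n) d (U : 'M[R]_(d, n)) (W : 'M[R]_(n - d, n)) :
  sep ze S -> (forall xi, xi \in S -> tgood mu q xi) -> (sq / (24 * ze)) ^+ n <= (size S)%:R -> (d <= n)%N -> a * n%:R <= d%:R ->
  U *m U^T = 1%:M -> W *m W^T = 1%:M -> (forall v : 'rV[R]_n, v = v *m U^T *m U + v *m W^T *m W) ->
  exists x y, [/\ x \in S, y \in S, enorm ((tz mu x - tz mu y) *m W^T) <= @tsep R n &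
    spt a * sq < enorm (tz mu x - tz mu y)].
Proof.
move=> sS gS cS dn ad UU WW dec; have l0 := @lkap_gt0 R.
pose s := @tsep R n / 2.
have ts0 : 0 < @tsep R n by rewrite divr_gt0 ?exprn_gt0 // mulr_gt0.
have s0 : 0 < s by rewrite divr_gt0.
have sE : s = ze * lkap / 2 ^+ 12 by rewrite /s /tsep -/ze; field.
have [|||||||||x [y [xS yS h1 h2]]] := @pigeon R n d U W S (tz mu) (24 ^+ n * expR (83 * n%:R)) (2 ^+ n) (3 * sq) s (spt a * sq) UU WW dec; last first.
- exists x, y; split => //.
  by apply: le_trans h1 _; rewrite /s le_eqVlt; apply/orP; left; apply/eqP; field.
- apply: lt_le_trans cS.
  (* With [X] the ratio of the two scales, the complement net contributes at most [(c X) ^ (n - d)]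
     and the net along [U] only [(spb a * X) ^ d], while there are at least [(X / 24) ^ n] tilts. *)
  pose X := sq / ze; have X0 : 0 < X by rewrite divr_gt0.
  have b0 := spb_gt0 a.
  have b1 : spb a <= 1.
    rewrite /spb -[leRHS]expR0 ler_expR oppr_le0 divr_ge0 ?(ltW a0) // addr_ge0 // ln_ge0 //; exact: spG_ge1.
  have X1 : 1 <= X.
    have : spb a * X <= X by rewrite ler_piMl // ltW.
    move: hX; rewrite -/X; lra.
  have c1 : 24 * (3 * sq / s + 1) <= 24 * (3 * 2 ^+ 12 / lkap + 1) * X.
    have -> : 3 * sq / s = 3 * 2 ^+ 12 / lkap * X by rewrite sE /X; field; rewrite !gt_eqF.
    rewrite -[leRHS]mulrA ler_pM2l // mulrDl mul1r; lra.
  have c2 : 24 * (spt a * sq / s + 1) <= spb a * X.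
    have -> : spt a * sq / s = spb a * X / 48 by rewrite sE /X /spt; field; rewrite !gt_eqF.
    move: hX; rewrite -/X; lra.
  have -> : sq / (24 * ze) = X / 24 by rewrite /X; field; rewrite gt_eqF.
  set c := 24 * (3 * 2 ^+ 12 / lkap + 1) in c1.
  have cc : 0 < 3 * 2 ^+ 12 / lkap :> R by rewrite divr_gt0 // mulr_gt0 // exprn_gt0.
  have c0 : 1 <= c by rewrite /c; lra.
  have p1 : 0 <= 24 * (3 * sq / s + 1) by rewrite mulr_ge0 // addr_ge0 // divr_ge0 ?(ltW s0) // mulr_ge0 // ltW.
  have p2 : 0 <= 24 * (spt a * sq / s + 1) by rewrite mulr_ge0 // addr_ge0 // divr_ge0 ?(ltW s0) // mulr_ge0 // ltW // spt_gt0.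
  move: c1 c2 p1 p2; move: (24 * (3 * sq / s + 1)) (24 * (spt a * sq / s + 1)) => P1 P2 c1 c2 p1 p2.
  apply: le_lt_trans (_ : 24 ^+ n * expR (83 * n%:R) * (c * X) ^+ (n - d) * (spb a * X) ^+ d * 2 ^+ n < _).
    apply: ler_wpM2r; first exact: exprn_ge0.
    have pA : 0 <= 24 ^+ n * expR (83 * n%:R) :> R by rewrite mulr_ge0 ?expR_ge0 // exprn_ge0.
    apply: ler_pM.
    - by apply: mulr_ge0 => //; exact: exprn_ge0.
    - exact: exprn_ge0.
    - by apply: ler_wpM2l => //; apply: lerXn2r; rewrite ?nnegrE // (le_trans p1).
    - by apply: lerXn2r; rewrite ?nnegrE // (le_trans p2).
  have cn : c ^+ (n - d) <= c ^+ n by apply: ler_weXn2l => //; exact: leq_subr.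
  have Xn : X ^+ n = X ^+ (n - d) * X ^+ d by rewrite -exprD subnK.
  have Xn0 : 0 < X ^+ n by rewrite exprn_gt0.
  have G0 : 0 < spG :> R by exact: lt_le_trans spG_ge1.
  have bd : spb a ^+ d * spG ^+ n < 1.
    rewrite /spb -expRM_natl -[spG]lnK ?posrE // -expRM_natl -expRD -[ltRHS]expR0 ltr_expR.
    rewrite expRK.
    have lG : 0 <= ln spG :> R by rewrite ln_ge0 // spG_ge1.
    have : a * n%:R * ((ln spG + 1) / a) <= d%:R * ((ln spG + 1) / a).
      by apply: ler_wpM2r => //; rewrite divr_ge0 ?(ltW a0) // addr_ge0.
    have -> : a * n%:R * ((ln spG + 1) / a) = n%:R * ln spG + n%:R by field; rewrite gt_eqF.
    have nR' := nR; rewrite mulrN; lra.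
  apply: le_lt_trans (_ : (24 ^+ n * expR 83 ^+ n * c ^+ n * 2 ^+ n) * spb a ^+ d * X ^+ n < _).
    rewrite -expRM_natr Xn [(c * X) ^+ _]exprMn [(spb a * X) ^+ _]exprMn.
    have -> : (24 ^+ n * expR (83 * n%:R) * c ^+ n * 2 ^+ n) * spb a ^+ d * (X ^+ (n - d) * X ^+ d) =
      (24 ^+ n * expR (83 * n%:R) * (X ^+ (n - d)) * (spb a ^+ d * X ^+ d) * 2 ^+ n) * c ^+ n by ring.
    have -> : 24 ^+ n * expR (83 * n%:R) * (c ^+ (n - d) * X ^+ (n - d)) * (spb a ^+ d * X ^+ d) * 2 ^+ n =
      (24 ^+ n * expR (83 * n%:R) * (X ^+ (n - d)) * (spb a ^+ d * X ^+ d) * 2 ^+ n) * c ^+ (n - d) by ring.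
    apply: ler_wpM2l => //; have xx := ltW X0; have bb := ltW b0.
    by rewrite !mulr_ge0 ?expR_ge0 ?exprn_ge0.
  rewrite [(X / 24) ^+ n]expr_div_n ltr_pdivlMr ?exprn_gt0 //.
  have -> : (24 ^+ n * expR 83 ^+ n * c ^+ n * 2 ^+ n) * spb a ^+ d * X ^+ n * 24 ^+ n = (spb a ^+ d * spG ^+ n) * X ^+ n.
    have -> : spG ^+ n = 24 ^+ n * expR 83 ^+ n * c ^+ n * 2 ^+ n * 24 ^+ n :> R.
      by rewrite -!exprMn; congr (_ ^+ n); rewrite /spG -/c; ring.
    by ring.
  by rewrite -[ltRHS]mul1r ltr_pM2r.
- move=> S' uS' sub hS'; apply: le_trans hC.
  apply: (@cluster_count R n k e mu q iso lc n0 q1 k0 e0 cond hk S' J) => //.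
  + by split => // x y /sub xS /sub yS; case: sS => _; apply.
  + by move=> p /sub /gS.
  + move=> p x pS xS; apply: le_trans (hS' _ _ pS xS) _.
    by rewrite /s le_eqVlt; apply/orP; left; apply/eqP; field.
- exact: tz_cover.
- exact: exprn_ge0.
- by rewrite mulr_ge0 ?expR_ge0 // exprn_ge0.
- by rewrite mulr_ge0 ?(ltW sq0) // ltW // spt_gt0.
- by rewrite mulr_ge0 // ltW.
- exact: s0.
- by case: sS.
Qed.
End Spread.

(** * Support function of the symmetric hull *)

Section SupportFunction.
Context {R : realType} {n N : nat} (x : 'I_N -> 'rV[R]_n).

Lemma convex_setP (C : set 'rV[R]_n) : @convex_set R 'rV[R]_n C ->
  forall a b l, 0 < l < 1 -> C a -> C b -> C (l *: a + (1 - l) *: b).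
Proof.
move=> hC a b l /andP[l0 l1] Ca Cb.
by have := hC a b (Itv01 (ltW l0) (ltW l1)) (mem_set Ca) (mem_set Cb) => /set_mem.
Qed.

Lemma crosshull_sub (i0 : 'I_N) : crosshull x `<=` sym_hull x.
Proof.
move=> _ [c hc ->] C [hC sub]; have cv := convex_setP hC.
have Cp i : C (x i) by apply: sub; left; exists i.
have Cm i : C (- x i) by apply: sub; right; exists i.
have C0 : C 0.
  have := cv (x i0) (- x i0) 2^-1 ltac:(by apply/andP; split; lra) (Cp i0) (Cm i0).
  by have -> : 1 - 2^-1 = 2^-1 :> R by [lra]; rewrite scalerN subrr.
pose w i := if 0 <= c i then x i else - x i.
have wE i : c i *: x i = `|c i| *: w i.
  rewrite /w; case: (leP 0 (c i)) => ci; first by rewrite ger0_norm.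
  by rewrite ltr0_norm // scalerN scaleNr opprK.
under eq_bigr do rewrite wE.
set s := \sum_i _ in hc; have s0 : 0 <= s by apply: sumr_ge0.
have [sz|sn] := eqVneq s 0.
  rewrite big1 // => i _; have -> : `|c i| = 0; last by rewrite scale0r.
  have /eqP := sz; rewrite psumr_eq0 // => /allP /(_ i (mem_index_enum i)) /eqP //.
have sp : 0 < s by rewrite lt_def sn.
have hm : C (s^-1 *: \sum_i `|c i| *: w i).
  apply: conv_mean => // i; rewrite /w; by case: ifP.
have [s1|s1] := eqVneq s 1; first by move: hm; rewrite s1 invr1 scale1r.
have := cv _ 0 s ltac:(by rewrite sp lt_def eq_sym s1 hc) hm C0.
by rewrite scaler0 addr0 scalerA divff // scale1r.
Qed.

(** The coefficient vectors form a compact set, on which the squared distance to [p] attains its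
    minimum. *)
Lemma crosshull_closed (p : 'rV[R]_n) :
  (forall e, 0 < e -> exists2 h, crosshull x h & enorm (p - h) <= e) -> crosshull x p.
Proof.
move=> hp.
pose S := [set c : 'rV[R]_N | \sum_i `|c ord0 i| <= 1].
pose f (c : 'rV[R]_N) := \sum_j (p ord0 j - \sum_i c ord0 i * x i ord0 j) ^+ 2.
have fE c : f c = enorm (p - \sum_i c ord0 i *: x i) ^+ 2.
  rewrite enorm2; apply: eq_bigr => j _; rewrite -expr2 !mxE; congr ((_ - _) ^+ 2).
  by rewrite summxE; apply: eq_bigr => i _; rewrite !mxE.
have cf : continuous f.
  apply: continuous_sumr => j.
  have c1 : continuous (fun c : 'rV[R]_N => p ord0 j - dot c (\row_i x i ord0 j)).
    move=> c; exact: (@continuousB _ _ _ (cst (p ord0 j)) (fun c : 'rV[R]_N => dot c (\row_i x i ord0 j)) c (@cst_continuous _ _ _ c) (@dot_continuous R N _ c)).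
  have -> : (fun c : 'rV[R]_N => (p ord0 j - \sum_i c ord0 i * x i ord0 j) ^+ 2) =
     (fun c => (p ord0 j - dot c (\row_i x i ord0 j)) * (p ord0 j - dot c (\row_i x i ord0 j))).
    by apply/funext => c; rewrite expr2 /dot; congr ((_ - _) * (_ - _)); apply: eq_bigr => i _; rewrite mxE.
  move=> c; exact: (@continuousM _ _ (fun c : 'rV[R]_N => p ord0 j - dot c (\row_i x i ord0 j)) (fun c : 'rV[R]_N => p ord0 j - dot c (\row_i x i ord0 j)) c (c1 c) (c1 c)).
have cS : compact S.
  apply: (@compact_ball _ _ _ 0 1) => [|c hc].
    apply: closed_le; apply: continuous_sumr => i c.
    exact: (continuous_comp (@coord_continuous R 1 N ord0 i c) (@norm_continuous _ _ _)).
  rewrite subr0 /enorm -[leRHS]sqrtr1 ler_wsqrtr //; apply: le_trans (hc); apply: ler_sum => i _.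
  have h1 : `|c ord0 i| <= 1.
    apply: le_trans hc; rewrite (bigD1 i) //= lerDl; exact: sumr_ge0.
  by rewrite -(real_normK (num_real _)) expr2 ler_piMl.
have S0 : S 0 by rewrite /S /= big1 // => i _; rewrite mxE normr0.
have [c /set_mem Sc hmin] := @compact_EVT_min _ R f S (ex_intro _ _ S0) cS (continuous_subspaceT cf).
have f0 : f c <= 0.
  apply/ler_addgt0Pr => e e0; rewrite add0r; have se : 0 < Num.sqrt e by rewrite sqrtr_gt0.
  have [h [a ha hE] he] := hp _ se.
  have Sa : S (\row_i a i) by rewrite /S /=; under eq_bigr do rewrite mxE.
  apply: le_trans (hmin _ (mem_set Sa)) _; rewrite fE.
  have -> : \sum_i (\row_i a i : 'rV[R]_N) ord0 i *: x i = h by rewrite hE; apply: eq_bigr => i _; rewrite mxE.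
  by rewrite -[leRHS](sqr_sqrtr (ltW e0)) ler_sqr ?nnegrE ?enorm_ge0 // ltW.
exists (fun i => c ord0 i) => //; apply/eqP; rewrite -subr_eq0 -enorm_eq0 -[_ == 0](@expf_eq0 _ _ 2).
by rewrite -fE eq_le f0 fE sqr_ge0.
Qed.

(** Separation in the form of [conv_approx], followed by closedness; the points [x i] and [- x i]
    realise the support function. *)
Lemma sym_hull_support (y : 'rV[R]_n) : (0 < N)%N ->
  (forall u : 'rV[R]_n, exists i, dot u y <= `|dot u (x i)|) -> sym_hull x y.
Proof.
move=> N0 hy; pose i0 := Ordinal N0.
apply: (crosshull_sub i0); apply: crosshull_closed.
have ch : crosshull x 0 by apply: sym_hull_sub; exact: sym_hull0 i0.
pose t := \sum_i enorm (x i).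
have t0 : 0 <= t by apply: sumr_ge0 => i _; exact: enorm_ge0.
apply: (@conv_approx R n (crosshull x) t).
- by exists 0.
- move=> z; apply: crosshull_norm => // i; rewrite /t (bigD1 i) //= lerDl; apply: sumr_ge0 => j _; exact: enorm_ge0.
- move=> a b l ha hb l01; have [l0 l1] := andP l01.
  apply: sym_hull_sub => C [hC sub]; have cv := convex_setP hC.
  apply: cv => //; [have := crosshull_sub i0 ha|have := crosshull_sub i0 hb]; by apply.
- move=> u; have [i hi] := hy u; pose e : R := if 0 <= dot u (x i) then 1 else -1.
  exists (e *: x i).
    exists (fun j => (j == i)%:R * e).
      rewrite (bigD1 i) //= eqxx mul1r big1 ?addr0 => [|j /negbTE ->]; last by rewrite mul0r normr0.
      by rewrite /e; case: ifP => _; rewrite ?normrN normr1.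
    rewrite (bigD1 i) //= eqxx mul1r big1 ?addr0 // => j /negbTE ->; by rewrite mul0r scale0r.
  apply: le_trans hi _; rewrite dotZr /e; case: (leP 0 (dot u (x i))) => h; first by rewrite mul1r ger0_norm.
  by rewrite mulN1r ltr0_norm.
Qed.
End SupportFunction.

(** * Samples that hit prescribed sets *)

Section Hitting.
Context {R : realType} {d d' : measure_display} {T : measurableType d} {T' : measurableType d'}.
Variables (P : probability T R) (mu : probability T' R) (N : nat) (x : 'I_N -> {mfun T >-> T'}).
Hypotheses (ind : independent_rvs P x) (hx : forall i, has_law P (x i) mu).

Lemma no_hit (J : {set 'I_N}) (A : set T') : measurable A ->
  measurable [set w | forall i, i \in J -> ~ A (x i w)] /\
  pr P [set w | forall i, i \in J -> ~ A (x i w)] = (1 - pr mu A) ^+ #|J|.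
Proof.
move=> mA; have mC : measurable (~` A) by exact: measurableC.
have e : [set w | forall i, i \in J -> ~ A (x i w)] = \bigcap_(i in [set i | i \in J]) (x i @^-1` (~` A)).
  by apply/seteqP; split => w h i; exact: h.
have mI : measurable [set w | forall i, i \in J -> ~ A (x i w)].
  rewrite e; apply: fin_bigcap_measurable => [|i _]; first exact: finite_finset.
  exact: preim_meas.
split => //.
have h := ind J (fun=> mC); rewrite -e in h.
rewrite /pr h.
have -> : (\prod_(i in J) P (x i @^-1` (~` A)) = \prod_(i in J) (1 - pr mu A)%:E)%E.
  apply: eq_bigr => i _; rewrite -(prC mu mA) -(law_pr hx i mC) prE //; exact: preim_meas.
by rewrite prodEFin /= prodr_const.
Qed.
End Hitting.

Lemma sq_ge3 (n : nat) : (3 <= n)%N -> (6 * n <= 3 * n ^ 2)%N /\ (n ^ 2 <= 3 * n ^ 2 - 6 * n)%N.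
Proof.
move=> n3; rewrite -mulnn; have : (3 * n <= n * n)%N by rewrite leq_mul2r n3 orbT.
lia.
Qed.

Lemma sphere_net {R : realType} (n : nat) (e : R) : 0 < e ->
  exists L : seq 'rV[R]_n, [/\ forall p, p \in L -> dot p p = 1, (size L)%:R <= (24 * (1 / e + 1)) ^+ n &
    forall u : 'rV[R]_n, dot u u = 1 -> exists2 p, p \in L & enorm (u - p) <= e].
Proof.
move=> e0; have [||L [_ h1 h2 h3]] := @sep_cover R n e [set u | dot u u = 1] ((24 * (1 / e + 1)) ^+ n).
- exact: ltW.
- move=> l sl ll; apply: (@pack_size R n e 1 0 l e0 ler01 sl) => p /ll /= h.
  by rewrite subr0 enormE h sqrtr1.
by exists L.
Qed.

(** * A fixed ball inside the random hull *)

Section InBall.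
Context {R : realType}.
(** The net has at most [(ib_K n / ib_g ^ 6) ^ n] points, and a net direction fails with probability
    at most [(sb_C ib_g ^ 3) ^ (n ^ 2)]. For [n >= 3] a factor [ib_g ^ (n ^ 2)] survives, and [ib_g]
    is small enough for it to beat the rest. *)
Definition ib_K : R := 24 * 161.
Definition ib_g : R := (ib_K * expR 3 * (sb_C + 1))^-1.
Definition ib_d : R := ib_g ^+ 6.
Definition ib_c : R := ib_d / 2.
Let K1 : 1 <= ib_K. Proof. by rewrite /ib_K; lra. Qed.
Lemma ib_g_gt0 : 0 < ib_g.
Proof.
have s0 := @sb_C_gt0 R; have k1 := K1; rewrite invr_gt0; apply: mulr_gt0; last by lra.
by apply: mulr_gt0; [lra|exact: expR_gt0].
Qed.
Lemma ib_g_le1 : ib_g <= 1.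
Proof.
have s0 := @sb_C_gt0 R; have k1 := K1.
have e1 : 1 <= expR 3 :> R by rewrite -expR0 ler_expR.
have h : 1 <= ib_K * expR 3 * (sb_C + 1).
  move: k1 e1; move: ib_K (expR 3) => u v u1 v1.
  have h : 1 * 1 <= u * v by apply: ler_pM.
  rewrite mulr1 in h; rewrite -[leLHS]mulr1; apply: ler_pM => //; lra.
by rewrite /ib_g invf_le1 // (lt_le_trans ltr01).
Qed.
Lemma ib_d_gt0 : 0 < ib_d. Proof. by rewrite exprn_gt0 // ib_g_gt0. Qed.
Lemma ib_d_le1 : ib_d <= 1. Proof. by rewrite exprn_ile1 ?ib_g_le1 // ltW // ib_g_gt0. Qed.
Lemma ib_c_gt0 : 0 < ib_c. Proof. by rewrite divr_gt0 // ib_d_gt0. Qed.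

Context {n : nat} (mu : probability (borel_rV R n) R).
Notation V := (borel_rV R n).
Hypotheses (iso : isotropic mu) (lc : log_concave mu) (n3 : (3 <= n)%N).
Let nR : 3 <= n%:R :> R. Proof. by rewrite (ler_nat _ 3). Qed.
Let sn := Num.sqrt (n%:R : R).
Let sn0 : 0 < sn. Proof. by rewrite sqrtr_gt0 (lt_le_trans _ nR). Qed.
Let sn2 : sn ^+ 2 = n%:R. Proof. by rewrite sqr_sqrtr. Qed.

(** Union bound over the coordinates, one of which is at least [t / sqrt n] in absolute value. *)
Lemma norm_tail (t : R) : pr mu [set x : V | t < enorm (x : 'rV[R]_n)] <= 2 * n%:R * expR (- (t / (8 * sn))).
Proof.
have [t0|t0] := leP 0 t; last first.
  apply: le_trans (pr_le1 mu _) _; first by apply: measurable_gt_set; exact: enorm_borel.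
  have nR' := nR; have : 1 <= expR (- (t / (8 * sn))).
    rewrite -[leLHS]expR0 ler_expR oppr_ge0 ler_pdivrMr ?mulr_gt0 // mul0r; exact: ltW.
  move: (expR _) => u; nra.
pose B (i : 'I_n) := [set x : V | t / sn <= `|dot (x : 'rV[R]_n) (delta_mx 0 i)|].
have di (x : 'rV[R]_n) i : dot x (delta_mx 0 i) = x ord0 i.
  rewrite /dot (bigD1 i) //= mxE !eqxx mulr1 big1 ?addr0 // => j /negbTE ji.
  by rewrite mxE ji andbF mulr0.
have mB i : measurable (B i) by exact: dge_borel.
apply: le_trans (_ : pr mu (\big[setU/set0]_(i <- index_enum 'I_n) B i) <= _).
  apply: pr_mono; [by apply: measurable_gt_set; exact: enorm_borel|by apply: measurable_bigsetU => i _|].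
  move=> x /= hx; apply: contrapT => hn; move: hx; apply/negP; rewrite -leNgt.
  apply: le_trans (_ : sn * (t / sn) <= _).
    apply: enorm_le_sup => [|i]; first by rewrite divr_ge0 // ltW.
    apply: ltW; rewrite ltNge; apply/negP => h; apply: hn; rewrite -bigcup_seq; exists i; first exact: mem_index_enum.
    by rewrite /B /= di.
  by rewrite mulrCA divff ?mulr1 // gt_eqF.
apply: le_trans (pr_bigU_le mu (fun i _ => mB i)) _.
apply: le_trans (_ : \sum_(i < n) 2 * expR (- (t / (8 * sn))) <= _); last first.
  by rewrite sumr_const card_ord -mulr_natl; lra.
apply: ler_sum => i _.
have -> : t / (8 * sn) = t / sn / 8 by field; rewrite gt_eqF.
apply: (tail_dot iso lc); rewrite di mxE !eqxx //.
Qed.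

Context {d : measure_display} {T : measurableType d} (P : probability T R) (N : nat) (x : 'I_N -> {mfun T >-> V}).
Hypotheses (ind : independent_rvs P x) (hx : forall i, has_law P (x i) mu).

Lemma inball_num : (24 * (1 / (ib_d / (160 * n%:R)) + 1)) ^+ n * (sb_C * Num.sqrt ib_d) ^+ (n ^ 2) <= expR (- sn) / 4.
Proof.
have g0 := ib_g_gt0; have g1 := ib_g_le1; have d0 := ib_d_gt0; have d1 := ib_d_le1; have s0 := @sb_C_gt0 R; have nR' := nR; have K1' := K1.
have n0 : 0 < n%:R :> R by lra.
have -> : Num.sqrt ib_d = ib_g ^+ 3.
  have -> : ib_d = (ib_g ^+ 3) ^+ 2 by rewrite /ib_d -exprM.
  by rewrite sqrtr_sqr ger0_norm // exprn_ge0 // ltW.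
have h1 : 24 * (1 / (ib_d / (160 * n%:R)) + 1) <= ib_K * n%:R / ib_g ^+ 6.
  have -> : 1 / (ib_d / (160 * n%:R)) = 160 * n%:R / ib_d by field; rewrite !gt_eqF.
  have : 1 <= n%:R / ib_d by rewrite ler_pdivlMr // mul1r; lra.
  rewrite -/ib_d /ib_K -[160 * _ / _]mulrA -[24 * 161 * _ / _]mulrA; lra.
have h2 : n%:R <= expR 1 ^+ n :> R by rewrite -expRM_natl mulr1; have := expR_ge1Dx (n%:R : R); lra.
have h3 : ib_K * n%:R <= (ib_K * expR 1) ^+ n.
  rewrite exprMn; apply: ler_pM => //; first by lra.
  by rewrite -[leLHS]expr1; apply: ler_weXn2l => //; apply: leq_trans n3.
have e1 : 0 <= 24 * (1 / (ib_d / (160 * n%:R)) + 1).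
  by rewrite mulr_ge0 // addr_ge0 // divr_ge0 // divr_ge0 ?(ltW d0) // mulr_ge0 // ltW.
apply: le_trans (_ : (((ib_K * expR 1) ^+ n) / ib_g ^+ 6) ^+ n * (sb_C * ib_g ^+ 3) ^+ (n ^ 2) <= _).
  apply: ler_wpM2r; first by rewrite exprn_ge0 // mulr_ge0 ?(ltW s0) // exprn_ge0 // ltW.
  apply: lerXn2r; rewrite ?nnegrE //; first by rewrite (le_trans e1) // (le_trans h1) // ler_pM2r // invr_gt0 exprn_gt0.
  by apply: le_trans h1 _; rewrite ler_pM2r // invr_gt0 exprn_gt0.
have -> : (((ib_K * expR 1) ^+ n) / ib_g ^+ 6) ^+ n * (sb_C * ib_g ^+ 3) ^+ (n ^ 2) =
   (ib_K * expR 1 * sb_C) ^+ (n ^ 2) * (ib_g ^+ (3 * n ^ 2 - 6 * n)).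
  rewrite expr_div_n -[((_ * _) ^+ n) ^+ n]exprM -[(ib_g ^+ 6) ^+ n]exprM [(sb_C * _) ^+ _]exprMn -[(ib_g ^+ 3) ^+ _]exprM mulnn.
  rewrite -{1}(@subnK (6 * n) (3 * n ^ 2)); last exact: (sq_ge3 n3).1.
  rewrite [ib_g ^+ (_ + _)]exprD [(ib_K * expR 1 * sb_C) ^+ _]exprMn.
  by field; rewrite gt_eqF // exprn_gt0.
apply: le_trans (_ : (ib_K * expR 1 * sb_C) ^+ (n ^ 2) * ib_g ^+ (n ^ 2) <= _).
  apply: ler_wpM2l; first by rewrite exprn_ge0 // mulr_ge0 ?(ltW s0) // mulr_ge0 ?expR_ge0 //; lra.
  by apply: ler_wiXn2l => //; [exact: ltW|exact: (sq_ge3 n3).2].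
rewrite -exprMn; have h4 : ib_K * expR 1 * sb_C * ib_g <= expR (-2).
  have Kp : 0 < ib_K by lra.
  have E1 := expR_gt0 (1 : R); have E2 := expR_gt0 (2 : R).
  have -> : ib_K * expR 1 * sb_C * ib_g = sb_C / (expR 2 * (sb_C + 1)).
    rewrite /ib_g; have -> : expR 3 = expR 1 * expR 2 :> R by rewrite -expRD; congr expR; lra.
    by field; rewrite !gt_eqF //; lra.
  rewrite expRN ler_pdivrMr; last by rewrite mulr_gt0 //; lra.
  rewrite mulrA mulVf ?mul1r ?gt_eqF //; lra.
apply: le_trans (_ : expR (-2) ^+ (n ^ 2) <= _).
  apply: lerXn2r; rewrite ?nnegrE ?expR_ge0 //; apply: mulr_ge0; last exact: ltW.
  by apply: mulr_ge0; [rewrite mulr_ge0 ?expR_ge0 //; lra|exact: ltW].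
rewrite ler_pdivlMr // -expRM_natl natrX.
have e4 : 4 <= expR 2 :> R.
  by have := @expR_ge2n R 2; rewrite !exprS expr0; lra.
apply: le_trans (_ : expR (n%:R ^+ 2 * -2) * expR 2 <= _); first by rewrite ler_pM2l // expR_gt0.
rewrite -expRD ler_expR; have : sn <= n%:R by rewrite -sn2 expr2 ler_peMl ?(ltW sn0) // -(@ler_sqr R) ?nnegrE ?(ltW sn0) // expr1n sn2; lra.
by move: nR; move: n%:R sn => v s h1' h2'; nra.
Qed.

Lemma inball_tail : n%:R ^+ 2 * (2 * n%:R * expR (- (80 * n%:R / (8 * sn)))) <= expR (- sn) / 4.
Proof.
have nR' := nR; have n0 : 0 < n%:R :> R by lra.
have -> : 80 * n%:R / (8 * sn) = 10 * sn by rewrite -sn2; field; rewrite gt_eqF.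
rewrite ler_pdivlMr //.
have h1 : n%:R <= expR (2 * sn) by rewrite -[leLHS]lnK ?posrE // ler_expR ln_le_sqrt.
have s1 : 1 <= sn by rewrite -(@ler_sqr R) ?nnegrE ?(ltW sn0) // expr1n sn2; lra.
have h8 : 8 <= expR (3 * sn).
  apply: le_trans (_ : expR 3%:R <= _); last by rewrite ler_expR -[leLHS]mulr1 ler_pM2l.
  by have := @expR_ge2n R 3; rewrite !exprS expr0; lra.
have h3 : n%:R ^+ 3 <= expR (2 * sn) ^+ 3 by apply: lerXn2r; rewrite ?nnegrE ?expR_ge0.
have -> : n%:R ^+ 2 * (2 * n%:R * expR (- (10 * sn))) * 4 = 8 * n%:R ^+ 3 * expR (- (10 * sn)) by ring.
apply: le_trans (_ : expR (3 * sn) * expR (2 * sn) ^+ 3 * expR (- (10 * sn)) <= _).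
  by rewrite ler_wpM2r ?expR_ge0 //; apply: ler_pM => //; rewrite exprn_ge0.
by rewrite -expRM_natl -!expRD ler_expR; lra.
Qed.

(* Only the first [n ^ 2] points of the sample are used: their norms are bounded independently of [N], and
   [n ^ 2 > 2 n] makes the small-ball gain beat the size of the net even for [n = 3]. *)
Theorem inball : (n ^ 2 <= N)%N -> exists E : set T, [/\ measurable E, 1 - expR (- sn) / 2 <= pr P E &
  forall w, E w -> forall th : 'rV[R]_n, dot th th = 1 -> exists i, ib_c <= `|dot (x i w : 'rV[R]_n) th|].
Proof.
move=> nN; have nR' := nR; have n0 : 0 < n%:R :> R by lra.
have d0 := ib_d_gt0; have s0 := @sb_C_gt0 R.
pose J := [set i : 'I_N | (i < n ^ 2)%N]%SET.
have cJ : #|J| = (n ^ 2)%N.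
  rewrite -sum1_card (eq_bigl (fun i : 'I_N => (i < n ^ 2)%N)) => [|i]; last by rewrite inE.
  by rewrite (big_ord_narrow nN) sum1_card card_ord.
have e0 : 0 < ib_d / (160 * n%:R) by rewrite divr_gt0 // mulr_gt0.
have [L [L1 L2 L3]] := sphere_net n e0.
pose B1 i := x i @^-1` [set y : V | 80 * n%:R < enorm (y : 'rV[R]_n)].
pose A (p : 'rV[R]_n) := [set y : V | ib_d < `|dot (y : 'rV[R]_n) p|].
have mA p : measurable (A p) by apply: measurable_gt_set; apply: measurableT_comp => //; exact: dot_borel.
pose B2 p := [set w | forall i, i \in J -> ~ A p (x i w)].
have mN : measurable [set y : V | 80 * n%:R < enorm (y : 'rV[R]_n)] by apply: measurable_gt_set; exact: enorm_borel.
have mB1 i : measurable (B1 i) by exact: preim_meas.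
have mB2 p : measurable (B2 p) by have [] := no_hit ind hx J (mA p).
pose U1 := \big[setU/set0]_(i <- enum J) B1 i; pose U2 := \big[setU/set0]_(p <- L) B2 p.
have mU1 : measurable U1 by apply: measurable_bigsetU => i _.
have mU2 : measurable U2 by apply: measurable_bigsetU => i _.
exists (~` (U1 `|` U2)); split; first by apply: measurableC; exact: measurableU.
- rewrite prC; last exact: measurableU.
  rewrite lerD2l lerN2; apply: le_trans (prU_le P mU1 mU2) _.
  have p1 : pr P U1 <= expR (- sn) / 4.
    apply: le_trans (pr_bigU_le P (fun i _ => mB1 i)) _; apply: le_trans inball_tail.
    apply: le_trans (_ : \sum_(i <- enum J) (2 * n%:R * expR (- (80 * n%:R / (8 * sn)))) <= _).
      by apply: ler_sum => i _; rewrite /B1 (law_pr hx) //; exact: norm_tail.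
    by rewrite big_const_seq count_predT iter_addr_0 -cardE cJ -[leLHS]mulr_natl natrX.
  have p2 : pr P U2 <= expR (- sn) / 4.
    apply: le_trans (pr_bigU_le P (fun i _ => mB2 i)) _; apply: le_trans inball_num.
    have c0 : 0 <= (sb_C * Num.sqrt ib_d) ^+ (n ^ 2) :> R by rewrite exprn_ge0 // mulr_ge0 ?sqrtr_ge0 // ltW.
    apply: le_trans (_ : \sum_(p <- L) ((sb_C * Num.sqrt ib_d) ^+ (n ^ 2)) <= _); last first.
      by rewrite big_const_seq count_predT iter_addr_0 -[leLHS]mulr_natl ler_wpM2r.
    rewrite !big_seq; apply: ler_sum => p pL; have [_ ->] := no_hit ind hx J (mA p).
    rewrite cJ; apply: lerXn2r; rewrite ?nnegrE ?subr_ge0 ?pr_le1 //; first by rewrite mulr_ge0 ?sqrtr_ge0 // ltW.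
    rewrite -prC //; have -> : ~` A p = [set y : V | `|dot (y : 'rV[R]_n) p| <= ib_d].
      by apply/seteqP; split => y /=; rewrite /A /= leNgt => /negP.
    exact: (small_ball1 iso lc (L1 _ pL)).
  lra.
move=> w hw th th1.
have [p pL hp] := L3 _ th1.
have hp2 : ~ B2 p w by move=> h; apply: hw; right; rewrite /U2 -bigcup_seq; exists p.
have [i /not_implyP[iJ /contrapT hA]] : exists i, ~ (i \in J -> ~ A p (x i w)) by apply/existsNP.
exists i.
have hn : enorm (x i w : 'rV[R]_n) <= 80 * n%:R.
  rewrite leNgt; apply/negP => h; apply: hw; left; rewrite /U1 -bigcup_seq; exists i => //=; by rewrite mem_enum.
have -> : th = p + (th - p) by rewrite addrC subrK.
rewrite dotDr; have h1 := ler_dot (x i w : 'rV[R]_n) (th - p).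
have h2 : enorm (x i w : 'rV[R]_n) * enorm (th - p) <= 80 * n%:R * (ib_d / (160 * n%:R)).
  by apply: ler_pM; rewrite ?enorm_ge0.
have h3 : 80 * n%:R * (ib_d / (160 * n%:R)) = ib_d / 2 by field; rewrite gt_eqF.
rewrite h3 in h2.
have := lerB_dist (dot (x i w : 'rV[R]_n) p) (- dot (x i w : 'rV[R]_n) (th - p)).
rewrite opprK normrN => h4; move: hA; rewrite /A /= => hA.
apply: le_trans h4; rewrite /ib_c; lra.
Qed.
End InBall.

(** * Tilted means below the support function *)

Section Hits.
Context {R : realType} {n : nat} (mu : probability (borel_rV R n) R) (q : R).
Notation V := (borel_rV R n).
Hypotheses (iso : isotropic mu) (n0 : (0 < n)%N) (q1 : 1 <= q) (qn : q <= n%:R).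
Let n1 : 1 <= n%:R :> R. Proof. by rewrite (ler_nat _ 1). Qed.
Let sn := Num.sqrt (n%:R : R).
Let sn0 : 0 < sn. Proof. by rewrite sqrtr_gt0 (lt_le_trans ltr01). Qed.
Let sn2 : sn ^+ 2 = n%:R. Proof. by rewrite sqr_sqrtr. Qed.
Let snn : sn <= n%:R.
Proof. by rewrite -sn2 expr2 ler_peMl ?(ltW sn0) // -(@ler_sqr R) ?nnegrE ?(ltW sn0) // expr1n sn2. Qed.

Context {d : measure_display} {T : measurableType d} (P : probability T R) (N : nat) (x : 'I_N -> {mfun T >-> V}).
Hypotheses (ind : independent_rvs P x) (hx : forall i, has_law P (x i) mu).

(** A direction in which the mean is at most [ib_c] is served by the fixed ball. Otherwise some
    sample point exceeds half the mean in the nearest net direction, except with probability at most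
    [exp (- N p0)]; passing to the net and back costs at most [ib_c / 8] each time, so that at least
    [5/16] of the mean is reached, more than a quarter. *)
Theorem hits (S : seq 'rV[R]_n) : sep (@tzeta R n) S -> (forall xi, xi \in S -> tgood mu q xi) ->
  (216 * n%:R) ^+ n * (24 * (16 * n%:R / ib_c + 1)) ^+ n *
    expR (- (N%:R * (expR (- (39 * q)) * (ib_c ^+ 2 / (64 * n%:R))))) <= expR (- sn) / 2 ->
  exists E : set T, [/\ measurable E, 1 - expR (- sn) / 2 <= pr P E &
  forall w, E w -> (forall th : 'rV[R]_n, dot th th = 1 -> exists i, ib_c <= `|dot (x i w : 'rV[R]_n) th|) ->
    forall xi th, xi \in S -> dot th th = 1 -> exists i, dot (tz mu xi) th <= 4 * `|dot (x i w : 'rV[R]_n) th|].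
Proof.
move=> sS gS hnum; have c0 := @ib_c_gt0 R; have n1' := n1; have z0 := @tzeta_gt0 R n n0; have r0 := @tR0_gt0 R n n0.
have nR : 0 < n%:R :> R by exact: lt_le_trans n1.
have e0 : 0 < ib_c / (8 * @tR0 R n) by rewrite divr_gt0 // mulr_gt0.
have [L [L1 L2 L3]] := sphere_net n e0.
(* Thin directions get the full space, which every sample point hits. *)
pose A (p : 'rV[R]_n * 'rV[R]_n) : set V := if 7 / 8 * ib_c <= dot (tz mu p.1) p.2 then
  tD `&` [set y : V | dot (tz mu p.1) p.2 / 2 <= dot (y : 'rV[R]_n) p.2] else setT.
have mA p : measurable (A p).
  rewrite /A; case: ifP => // _; apply: measurableI; [exact: tD_meas|apply: measurable_ge_set; exact: dot_borel].
pose B p := [set w | forall i, i \in [set: 'I_N]%SET -> ~ A p (x i w)].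
have mB p : measurable (B p) by have [] := no_hit ind hx [set: 'I_N]%SET (mA p).
pose LL := [seq (xi, th) | xi <- S, th <- L].
pose p0 := expR (- (39 * q)) * (ib_c ^+ 2 / (64 * n%:R)).
pose U := \big[setU/set0]_(p <- LL) B p.
have mU : measurable U by apply: measurable_bigsetU => i _.
exists (~` U); split; first exact: measurableC.
- rewrite prC // lerD2l lerN2; apply: le_trans (pr_bigU_le P (fun i _ => mB i)) _; apply: le_trans hnum.
  apply: le_trans (_ : \sum_(p <- LL) expR (- (N%:R * p0)) <= _).
    rewrite !big_seq; apply: ler_sum => _ /allpairsP[[xi th] /= [xS tL ->]].
    have [_ ->] := no_hit ind hx [set: 'I_N]%SET (mA (xi, th)).
    rewrite cardsT card_ord -mulrN expRM_natl; apply: lerXn2r; rewrite ?nnegrE ?expR_ge0 ?subr_ge0 ?pr_le1 //.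
    apply: le_trans (_ : 1 - p0 <= _); last by have := expR_ge1Dx (- p0).
    rewrite lerD2l lerN2 /A /=; case: ifP => hm; last first.
      rewrite prT /p0 mulr_ile1 ?expR_ge0 //.
      - by rewrite divr_ge0 ?sqr_ge0 // mulr_ge0.
      - by rewrite -expR0 ler_expR oppr_le0 mulr_ge0 // (le_trans ler01).
      rewrite ler_pdivrMr ?mulr_gt0 // mul1r; apply: le_trans (_ : 1 <= _); last by move: n1; lra.
      by rewrite exprn_ile1 ?(ltW c0) // /ib_c; have := @ib_d_le1 R; lra.
    have m0 : 0 <= dot (tz mu xi) th by move: hm c0; lra.
    apply: le_trans (tgood_hit iso n0 q1 (gS _ xS) (L1 _ tL) m0 (lexx _)).
    rewrite /p0 ler_pM2l ?expR_gt0 //.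
    have -> : ib_c ^+ 2 / (64 * n%:R) = (ib_c / (8 * sn)) ^+ 2 by rewrite -sn2; field; rewrite gt_eqF.
    have s4 : 0 < 4 * sn by rewrite mulr_gt0.
    apply: lerXn2r; rewrite ?nnegrE.
    - by rewrite divr_ge0 ?(ltW c0) // mulr_ge0 // ltW.
    - by rewrite divr_ge0 // ltW.
    have -> : ib_c / (8 * sn) = ib_c / 2 / (4 * sn) by field; rewrite gt_eqF.
    by rewrite ler_pM2r ?invr_gt0 //; move: hm; lra.
  rewrite big_const_seq count_predT iter_addr_0 size_allpairs -[leLHS]mulr_natl natrM.
  apply: ler_wpM2r; first exact: expR_ge0.
  apply: ler_pM => //.
    have sq0 : 0 <= Num.sqrt q by exact: sqrtr_ge0.
    have := @pack_size R n (@tzeta R n) (Num.sqrt q) 0 S z0 sq0 sS.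
    move=> /(_ ltac:(by move=> p /gS[h _]; rewrite subr0)) h; apply: le_trans h _.
    apply: lerXn2r; rewrite ?nnegrE.
    + by rewrite mulr_ge0 // addr_ge0 // divr_ge0 // ltW.
    + by rewrite mulr_ge0.
    have -> : Num.sqrt q / @tzeta R n = 8 * (Num.sqrt q * sn) by rewrite /tzeta /tR0 invrK -/sn; ring.
    have : Num.sqrt q * sn <= sn * sn by rewrite ler_pM2r // ler_wsqrtr.
    rewrite -expr2 sn2; move: n1; lra.
  apply: le_trans L2 _; apply: lerXn2r; rewrite ?nnegrE.
  + by rewrite mulr_ge0 // addr_ge0 // divr_ge0 // ?(ltW e0).
  + rewrite mulr_ge0 // addr_ge0 //; apply: divr_ge0; [exact: mulr_ge0|exact: ltW].
  rewrite ler_pM2l // lerD2r.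
  have -> : 1 / (ib_c / (8 * @tR0 R n)) = 16 * sn / ib_c by rewrite /tR0 -/sn; field; rewrite !gt_eqF.
  by rewrite ler_pM2r ?invr_gt0 // ler_pM2l.
move=> w hw hball xi th xS th1.
have [hm|hm] := leP (dot (tz mu xi) th) ib_c.
  by have [i hi] := hball th th1; exists i; have := normr_ge0 (dot (x i w : 'rV[R]_n) th); lra.
have [p pL hp] := L3 _ th1.
have hd (y : 'rV[R]_n) : enorm y <= @tR0 R n -> `|dot y th - dot y p| <= ib_c / 8.
  move=> hy; rewrite -dotBr; apply: le_trans (ler_dot _ _) _.
  apply: le_trans (_ : @tR0 R n * (ib_c / (8 * @tR0 R n)) <= _); first by apply: ler_pM; rewrite ?enorm_ge0.
  by rewrite le_eqVlt; apply/orP; left; apply/eqP; field; rewrite gt_eqF.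
have h1 := hd _ (tz_norm iso n0 xi).
have hB : ~ B (xi, p) w.
  move=> h; apply: hw; rewrite /U -bigcup_seq; exists (xi, p) => //=.
  by apply/allpairsP; exists (xi, p).
have [i /not_implyP[_ /contrapT hA]] : exists i, ~ (i \in [set: 'I_N]%SET -> ~ A (xi, p) (x i w)) by apply/existsNP.
exists i; move: hA; rewrite /A /=; move: h1; rewrite ler_norml => /andP[h1 h2].
have -> : 7 / 8 * ib_c <= dot (tz mu xi) p by lra.
move=> [/= hD hA]; have := hd _ hD; rewrite ler_norml => /andP[h3 h4].
have := ler_norm (dot (x i w : 'rV[R]_n) th); lra.
Qed.
End Hits.

(** * Points of a section of the random hull *)

Section SectionRadius.
Context {R : realType} {n N : nat} (x : 'I_N -> 'rV[R]_n) (c : R).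
Hypotheses (N0 : (0 < N)%N) (c0 : 0 < c).
Hypothesis hc : forall th : 'rV[R]_n, dot th th = 1 -> exists i, c <= `|dot (x i) th|.

Let maxi u : exists i, forall j, `|dot u (x j)| <= `|dot u (x i)|.
Proof.
pose i0 := Ordinal N0; exists [arg max_(i > i0) `|dot u (x i)|]%O.
by case: arg_maxP => // i _ hi j; exact: hi.
Qed.

Lemma ball_sym_hull (v : 'rV[R]_n) : enorm v <= c -> sym_hull x v.
Proof.
move=> hv; apply: sym_hull_support => // u; have [u0|u0] := eqVneq u 0.
  by exists (Ordinal N0); rewrite u0 dot0l.
have eu : 0 < enorm u by rewrite enorm_gt0.
have th1 : dot ((enorm u)^-1 *: u) ((enorm u)^-1 *: u) = 1 by rewrite dotZl dotZr -enorm2; field; rewrite gt_eqF.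
have [i hi] := hc th1; exists i; apply: le_trans (dot_le _ _) _.
move: hi; rewrite dotZr normrM ger0_norm ?invr_ge0 ?(ltW eu) // ler_pdivlMl // dotC => hi.
by apply: le_trans hi; rewrite ler_pM2l.
Qed.

(** In direction [th] each of [z] and [- z'] contributes at most 4 times, and [- p] at most once,
    the largest [|<x i, th>|]; 12 exceeds the total 9. *)
Lemma section_point (z z' p : 'rV[R]_n) : 
  (forall th : 'rV[R]_n, dot th th = 1 -> exists i, dot z th <= 4 * `|dot (x i) th|) ->
  (forall th : 'rV[R]_n, dot th th = 1 -> exists i, dot z' th <= 4 * `|dot (x i) th|) ->
  enorm p <= c -> sym_hull x (12^-1 *: (z - z' - p)).
Proof.
move=> hz hz' hp; apply: sym_hull_support => // u; have [u0|u0] := eqVneq u 0.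
  by exists (Ordinal N0); rewrite u0 dot0l.
have [i hi] := maxi u; exists i.
have eu : 0 < enorm u by rewrite enorm_gt0.
pose th := (enorm u)^-1 *: u.
have th1 : dot th th = 1 by rewrite dotZl dotZr -enorm2; field; rewrite gt_eqF.
have thN : dot (- th) (- th) = 1 by rewrite dotNl dotNr opprK.
have uE : u = enorm u *: th by rewrite /th scalerA divff ?scale1r // gt_eqF.
have hj j : `|dot (x j) th| <= `|dot u (x i)| / enorm u.
  by rewrite ler_pdivlMr // -[X in _ * X](ger0_norm (ltW eu)) -normrM mulrC -dotZr -uE dotC.
clearbody th; have [j1 h1] := hz _ th1; have [j2 h2] := hz' _ thN; have [j3 h3] := hc th1.
rewrite dotNr dotNr normrN in h2.
have g1 := hj j1; have g2 := hj j2; have g3 := hj j3.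
rewrite dotZr !dotBr (dotC u z) (dotC u z') (dotC u p) [in dot z u]uE [in dot z' u]uE [in dot p u]uE !dotZr.
have : - dot p th <= c.
  have := ler_dot p th; rewrite [enorm th]enormE th1 sqrtr1 mulr1 ler_norml => /andP[h4 _]; lra.
move: g1 g2 g3 h1 h2 h3; set M := _ / enorm u => g1 g2 g3 h1 h2 h3 h4.
have -> : `|dot u (x i)| = enorm u * M by rewrite /M mulrC divfK // gt_eqF.
have -> : 12^-1 * (enorm u * dot z th - enorm u * dot z' th - enorm u * dot p th) = enorm u * (12^-1 * (dot z th - dot z' th - dot p th)) by ring.
have M0 : 0 <= M by apply: le_trans g3.
rewrite ler_pM2l //; lra.
Qed.
End SectionRadius.

Section DtildeLower.
Context {R : realType} {n k : nat} (nu : probability (borel_subspace R n) R).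
Hypothesis hnu : grassmannian_haar k nu.

Lemma Dtilde_ge (K : set 'rV[R]_n) (r : R) : 0 <= r ->
  (forall F : {vspace 'rV[R]_n}, \dim F = k -> exists y, [/\ K y, y \in F & r <= enorm y]) ->
  (r%:E <= Dtilde k nu K)%E.
Proof.
move=> r0 h; rewrite /Dtilde.
have mG := @grassmannian_meas R n k.
have -> : r%:E = (\int[nu]_(F in @grassmannian R n k) r%:E)%E.
  rewrite integral_cst //; transitivity (r%:E * 1)%E; first by rewrite mule1.
  by congr (_ * _)%E; exact/esym/hnu.1.
apply: ge0_le_integral_any => F hF; first by rewrite lee_fin.
have [y [Ky yF ry]] := h F hF; apply: le_trans (_ : (enorm y)%:E <= _)%E; first by rewrite lee_fin.
by apply: ereal_sup_ubound; exists y.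
Qed.
End DtildeLower.

(** * The lower bound *)

Section Constants.
Context {R : realType}.

Lemma expR_half_le2 : expR 2^-1 <= 2 :> R.
Proof.
have h : expR 2^-1 * expR 2^-1 <= 4 :> R.
  by rewrite -expRD; have -> : 2^-1 + 2^-1 = 1 :> R by [lra]; exact: expR1_le4.
have := expR_gt0 (2^-1 : R); nra.
Qed.

Lemma expR_ge_pow15 (L : R) : 0 <= L -> L ^+ 15 <= 15 ^+ 15 * expR L.
Proof.
move=> L0; have -> : expR L = expR (L / 15) ^+ 15.
  by rewrite -expRM_natl; congr expR; field.
rewrite -exprMn; apply: lerXn2r; rewrite ?nnegrE ?mulr_ge0 ?expR_ge0 //.
have := expR_ge1Dx (L / 15); lra.
Qed.

(** The net of directions has [(C k) ^ k] points, so [e] must exceed a multiple of [k (1 + log k)];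
    [v] stands for a bound on [log k]. *)
Lemma small_cond (k e : nat) (v : R) : (0 < k)%N -> k%:R <= expR v -> 0 <= v ->
  (24 * (8 * rp_M / rp_h + 1) * 16 / sgp + v) * k%:R <= rp_rate * e%:R ->
  (24 * (8 * k%:R * rp_M / rp_h + 1)) ^+ k * 16 <= sgp ^+ k * expR (rp_rate * e%:R) :> R.
Proof.
move=> k0 kv v0 he; have p0 := @sgp_gt0 R; have h0 := @rp_h_gt0 R; have M0 := @rp_M_gt0 R.
have k1 : 1 <= k%:R :> R by rewrite (ler_nat _ 1).
have m0 : 0 < 8 * rp_M / rp_h :> R by rewrite divr_gt0 // mulr_gt0.
set C := 24 * (8 * rp_M / rp_h + 1) * 16 / sgp in he.
have C0 : 0 < C by rewrite divr_gt0 // mulr_gt0 // mulr_gt0 // addr_gt0.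
have h1 : 24 * (8 * k%:R * rp_M / rp_h + 1) <= 24 * (8 * rp_M / rp_h + 1) * k%:R :> R.
  have -> : 8 * k%:R * rp_M / rp_h = 8 * rp_M / rp_h * k%:R :> R by ring.
  by rewrite -[leRHS]mulrA ler_pM2l // mulrDl mul1r; lra.
have m1 : 0 <= 24 * (8 * k%:R * rp_M / rp_h + 1) :> R.
  rewrite mulr_ge0 // addr_ge0 //; apply: divr_ge0; last exact: ltW.
  by rewrite mulr_ge0 ?(ltW M0) // mulr_ge0.
apply: le_trans (_ : (24 * (8 * rp_M / rp_h + 1) * k%:R) ^+ k * 16 ^+ k <= _).
  apply: ler_pM => //; first exact: exprn_ge0.
    by apply: lerXn2r; rewrite ?nnegrE // (le_trans m1).
  by rewrite -[leLHS]expr1; apply: ler_weXn2l => //; lra.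
have -> : (24 * (8 * rp_M / rp_h + 1) * k%:R) ^+ k * 16 ^+ k = sgp ^+ k * (C * k%:R) ^+ k :> R.
  by rewrite -!exprMn; congr (_ ^+ k); rewrite /C; field; rewrite !gt_eqF.
rewrite ler_pM2l ?exprn_gt0 //; apply: le_trans (_ : expR ((C + v) * k%:R) <= _); last by rewrite ler_expR.
have Ck : 0 <= C * k%:R by apply: mulr_ge0 => //; exact: ltW.
rewrite [X in _ <= expR X]mulrC expRM_natl; apply: lerXn2r; rewrite ?nnegrE ?expR_ge0 ?Ck //.
rewrite expRD; apply: ler_pM => //; first exact: ltW.
by have := expR_ge1Dx C; lra.
Qed.

Definition pa_C : R := 24 * (8 * rp_M / rp_h + 1) * 16 / sgp.
Definition pa_K : R := (pa_C + 1) / rp_rate + 1.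
Lemma rp_rate_gt0 : 0 < rp_rate :> R.
Proof.
apply: divr_gt0; first by rewrite exprn_gt0 // rp_h_gt0.
by apply: mulr_gt0; [|apply: exprn_gt0]; rewrite ltr0n.
Qed.
Lemma pa_C_gt0 : 0 < pa_C.
Proof.
have p0 := @sgp_gt0 R; have h0 := @rp_h_gt0 R; have M0 := @rp_M_gt0 R.
have m0 : 0 < 8 * rp_M / rp_h :> R by rewrite divr_gt0 // mulr_gt0.
by rewrite divr_gt0 // mulr_gt0 // mulr_gt0 // addr_gt0.
Qed.
Lemma pa_K_ge1 : 1 <= pa_K.
Proof.
have r0 := rp_rate_gt0; have c0 := pa_C_gt0.
by rewrite /pa_K lerDr divr_ge0 ?(ltW r0) // addr_ge0 // ltW.
Qed.

(** [k] is just above [39 q], [e] is of order [L k], and [J], of order [L], counts the octaves from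
    [tzeta] to [2 sqrt q]. As [216 <= 2 ^ 8], what is required is [8 k e J <= n], whose left side is
    at most [88 pa_K L ^ 2 Q ^ 2]. Taking fifth powers, [Q ^ 5 <= (n L) ^ 2] and
    [L ^ 15 <= 15 ^ 15 n] reduce this to the lower bound on [L]. *)
Lemma dim_params (n : nat) (L Q : R) : (0 < n)%N -> n%:R = expR L -> (88 * pa_K) ^+ 5 * 15 ^+ 15 <= L -> 78 <= L ->
  L ^+ 6 <= Q -> Q ^+ 5 <= (n%:R * L) ^+ 2 -> Q <= n%:R ->
  exists k e J, [/\ (0 < k)%N, (0 < e)%N,
    (24 * (8 * k%:R * rp_M / rp_h + 1)) ^+ k * 16 <= sgp ^+ k * expR (rp_rate * e%:R) :> R,
    4 * expR (39 * (Q / 78)) < expR k%:R &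
    2 * Num.sqrt (Q / 78) <= 2 ^+ J * @tzeta R n /\ (216 ^+ (k * e)) ^+ J <= 2 ^+ n :> R].
Proof.
move=> n0 nE hK L78 LQ Q5 Qn; set q := Q / 78.
have L0 : 0 < L by lra.
have K1 := pa_K_ge1; have r0 := rp_rate_gt0; have C0 := pa_C_gt0.
have L6 : L <= L ^+ 6 by rewrite -[leLHS]expr1; apply: ler_weXn2l => //; lra.
have QL : L <= Q by exact: le_trans LQ.
have q1 : 1 <= q by rewrite /q ler_pdivlMr //; lra.
have qE : Q = 78 * q by rewrite /q; field.
clearbody q.
pose k := (Num.truncn (39 * q + 2)).+1.
have kl : 39 * q + 2 < k%:R by exact: truncnS_gt.
have ku : k%:R <= 39 * q + 3.
  have /truncn_itv/andP[h _] : 0 <= 39 * q + 2 by lra.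
  by rewrite /k -natr1; lra.
have k1 : 1 <= k%:R :> R by rewrite (ler_nat _ 1).
pose e := (Num.truncn ((pa_C + L) * k%:R / rp_rate)).+1.
have eb0 : 0 <= (pa_C + L) * k%:R / rp_rate by rewrite divr_ge0 ?(ltW r0) // mulr_ge0 // addr_ge0 // ltW.
have el : (pa_C + L) * k%:R / rp_rate < e%:R by exact: truncnS_gt.
have eu : e%:R <= (pa_C + L) * k%:R / rp_rate + 1.
  have /truncn_itv/andP[h _] := eb0.
  by rewrite /e -natr1 lerD2r.
pose J := (Num.truncn (2 * L + 8)).+1.
have Jl : 2 * L + 8 < J%:R by exact: truncnS_gt.
have Ju : J%:R <= 11 * L.
  have /truncn_itv/andP[h _] : 0 <= 2 * L + 8 by lra.
  by rewrite /J -natr1; lra.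
exists k, e, J; split => //.
- apply: (@small_cond k e L) => //; [by rewrite -nE; lra|exact: ltW|].
  by rewrite -/pa_C -ler_pdivrMl // mulrC; exact: ltW.
- apply: lt_le_trans (_ : expR (39 * q + 2) <= _); last by rewrite ler_expR ltW.
  rewrite expRD mulrC ltr_pM2l ?expR_gt0 //.
  have -> : expR 2 = expR (2 / 3) ^+ 3 :> R by rewrite -expRM_natl; congr expR; field.
  have h := expR_ge1Dx (2 / 3 : R).
  apply: lt_le_trans (_ : (1 + 2 / 3) ^+ 3 <= _); first by rewrite !exprS expr0; lra.
  by apply: lerXn2r; rewrite ?nnegrE ?expR_ge0 //; lra.
split.
  have h2J : 16 * n%:R <= 2 ^+ J :> R.
    apply: le_trans (_ : expR 2^-1 ^+ J <= _); last by apply: lerXn2r; rewrite ?nnegrE ?expR_ge0 // expR_half_le2.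
    rewrite -expRM_natl; apply: le_trans (_ : expR (4%:R + L) <= _); last by rewrite ler_expR; lra.
    rewrite expRD -nE ler_wpM2r //; have := @expR_ge2n R 4; rewrite !exprS expr0; lra.
  rewrite /tzeta /tR0; set sn := Num.sqrt n%:R.
  have s0 : 0 < sn by rewrite sqrtr_gt0 ltr0n.
  rewrite ler_pdivlMr ?mulr_gt0 //; apply: le_trans h2J.
  have -> : n%:R = sn * sn :> R by rewrite -expr2 sqr_sqrtr.
  have : Num.sqrt q <= sn by rewrite ler_wsqrtr //; lra.
  move=> h; have : Num.sqrt q * sn <= sn * sn by rewrite ler_pM2r.
  lra.
rewrite -exprM; apply: le_trans (_ : (2 ^+ 8) ^+ (k * e * J) <= _).
  by apply: lerXn2r; rewrite ?nnegrE // ?exprn_ge0 // !exprS expr0; lra.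
rewrite -exprM; apply: ler_weXn2l; first lra.
rewrite -(ler_nat R) !natrM.
have ek : e%:R <= L * k%:R * pa_K.
  apply: le_trans eu _; rewrite /pa_K mulrDr mulr1.
  have lk : 1 <= L * k%:R by rewrite -[leLHS]mulr1; apply: ler_pM => //; lra.
  have : (pa_C + L) * k%:R / rp_rate <= L * k%:R * ((pa_C + 1) / rp_rate).
    rewrite [leRHS]mulrA ler_pM2r ?invr_gt0 //.
    have -> : L * k%:R * (pa_C + 1) = (pa_C * L + L) * k%:R by ring.
    rewrite ler_pM2r ?(lt_le_trans ltr01 k1) // lerD2r ler_peMr ?(ltW C0) //; lra.
  lra.
have kQ : k%:R <= Q by lra.
apply: le_trans (_ : 88 * pa_K * L ^+ 2 * Q ^+ 2 <= _).
  have -> : 88 * pa_K * L ^+ 2 * Q ^+ 2 = 8 * (Q * (L * Q * pa_K) * (11 * L)) by ring.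
  rewrite ler_pM2l //; have Q0 : 0 <= Q by lra.
  have K0 : 0 <= pa_K by lra.
  apply: ler_pM => //.
  apply: ler_pM => //; apply: le_trans ek _; apply: ler_wpM2r => //.
  by rewrite ler_pM2l.
have nR : 0 < n%:R :> R by rewrite ltr0n.
have Q0 : 0 <= Q by lra.
have K0 : 0 <= pa_K by lra.
have X0 : 0 <= 88 * pa_K * L ^+ 2 * Q ^+ 2 by rewrite mulr_ge0 ?sqr_ge0 // mulr_ge0 ?sqr_ge0 // mulr_ge0.
rewrite -(@ler_pXn2r _ 5) ?nnegrE //.
have -> : (88 * pa_K * L ^+ 2 * Q ^+ 2) ^+ 5 = (88 * pa_K) ^+ 5 * L ^+ 10 * (Q ^+ 5) ^+ 2.
  move: (88 * pa_K) => c; ring.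
apply: le_trans (_ : (88 * pa_K) ^+ 5 * L ^+ 10 * ((n%:R * L) ^+ 2) ^+ 2 <= _).
  apply: ler_wpM2l; first by rewrite mulr_ge0 // exprn_ge0 // ?mulr_ge0 // ltW.
  by apply: lerXn2r; rewrite ?nnegrE ?exprn_ge0 // mulr_ge0 // ltW.
have c0 : 0 <= (88 * pa_K) ^+ 5 by rewrite exprn_ge0 // mulr_ge0.
move: ((88 * pa_K) ^+ 5) c0 hK => c c0 hK.
have -> : c * L ^+ 10 * ((n%:R * L) ^+ 2) ^+ 2 = n%:R ^+ 4 * (c * L ^+ 14) by ring.
rewrite [leRHS]exprS [leRHS]mulrC ler_pM2l ?exprn_gt0 //.
have h15 := expR_ge_pow15 (ltW L0); rewrite -nE in h15.
have t0 : 0 < 15 ^+ 15 :> R by rewrite exprn_gt0.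
rewrite -(ler_pM2l t0); apply: le_trans h15.
have -> : 15 ^+ 15 * (c * L ^+ 14) = c * 15 ^+ 15 * L ^+ 14 by ring.
by rewrite [leRHS]exprS ler_wpM2r // exprn_ge0 // ltW.
Qed.

(** [39 (Q / 78) = Q / 2], so the tilting cost leaves [exp (Q / 2) >= n ^ 5] of the sample size and
    a positive multiple of [n ^ 4] in the exponent, while the nets contribute [O(n ^ 2)]. *)
Lemma hits_params (n : nat) (L Q : R) : (0 < n)%N -> n%:R = expR L -> 64 * ((216 * 24 * 17) / ib_c + 6) / ib_c ^+ 2 <= L -> 78 <= L ->
  L ^+ 6 <= Q ->
  (216 * n%:R) ^+ n * (24 * (16 * n%:R / ib_c + 1)) ^+ n *
    expR (- (expR Q * (expR (- (39 * (Q / 78))) * (ib_c ^+ 2 / (64 * n%:R))))) <= expR (- Num.sqrt n%:R) / 2.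
Proof.
move=> n0 nE hL L78 LQ; have c0 := @ib_c_gt0 R.
have c1 : ib_c <= 1 :> R by rewrite /ib_c; have := @ib_d_le1 R; lra.
have nR : 0 < n%:R :> R by rewrite ltr0n.
have n1 : 1 <= n%:R :> R by rewrite (ler_nat _ 1).
set v := n%:R in nE nR n1 *.
set K : R := 216 * 24 * 17 / ib_c in hL.
have K0 : 0 < K by rewrite divr_gt0 // mulr_gt0 // mulr_gt0.
have Lv : L <= v by rewrite nE; have := expR_ge1Dx L; lra.
have hA : (216 * v) * (24 * (16 * v / ib_c + 1)) <= K * v ^+ 2.
  have h : 1 <= v / ib_c by rewrite ler_pdivlMr // mul1r; lra.
  have -> : K * v ^+ 2 = (216 * v) * (24 * (17 * (v / ib_c))) by rewrite /K; field; rewrite gt_eqF.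
  rewrite ler_pM2l ?mulr_gt0 // ler_pM2l // -mulrA; lra.
have hB : K * v ^+ 2 <= expR (K + 2 * v).
  rewrite expRD; apply: ler_pM; rewrite ?(ltW K0) ?sqr_ge0 //; first by have := expR_ge1Dx K; lra.
  rewrite nE -expRM_natl -nE ler_expR; lra.
have p1 : 0 <= (216 * v) * (24 * (16 * v / ib_c + 1)).
  apply: mulr_ge0; first by rewrite mulr_ge0 // ltW.
  rewrite mulr_ge0 // addr_ge0 //; apply: divr_ge0; last exact: ltW.
  by rewrite mulr_ge0 // ltW.
rewrite -exprMn; apply: le_trans (_ : expR (K + 2 * v) ^+ n * expR (- (v ^+ 4 * (ib_c ^+ 2 / 64))) <= _).
  apply: ler_pM; rewrite ?expR_ge0 ?exprn_ge0 //.
    by apply: lerXn2r; rewrite ?nnegrE ?expR_ge0 // (le_trans hA).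
  rewrite ler_expR lerN2.
  have hE : v ^+ 5 <= expR Q * expR (- (39 * (Q / 78))).
    rewrite -expRD nE -expRM_natl ler_expR.
    have L2 : 10 * L <= L ^+ 6.
      have -> : L ^+ 6 = L ^+ 5 * L by rewrite -exprSr.
      rewrite ler_pM2r; last by lra.
      apply: le_trans (_ : L <= _); first by lra.
      by rewrite -[leLHS]expr1; apply: ler_weXn2l => //; lra.
    lra.
  have c2 : 0 <= ib_c ^+ 2 / (64 * v) by rewrite divr_ge0 ?sqr_ge0 // mulr_ge0 // ltW.
  have -> : v ^+ 4 * (ib_c ^+ 2 / 64) = v ^+ 5 * (ib_c ^+ 2 / (64 * v)) by field; rewrite gt_eqF.
  by rewrite [leRHS]mulrA ler_wpM2r.
rewrite ler_pdivlMr //.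
have e2 : 2 <= expR 1 :> R by have := expR_ge1Dx (1 : R); lra.
apply: le_trans (_ : expR (K + 2 * v) ^+ n * expR (- (v ^+ 4 * (ib_c ^+ 2 / 64))) * expR 1 <= _).
  by rewrite ler_wpM2l // mulr_ge0 ?expR_ge0 // exprn_ge0 // expR_ge0.
rewrite -expRM_natl -!expRD ler_expR -/v.
have sv : Num.sqrt v <= v.
  have s0 : 0 < Num.sqrt v by rewrite sqrtr_gt0.
  have s1 : 1 <= Num.sqrt v by rewrite -[leLHS]sqrtr1 ler_wsqrtr.
  by rewrite -[leRHS](sqr_sqrtr (ltW nR)) expr2 ler_peMl // ltW.
have hv : 64 * (K + 6) / ib_c ^+ 2 <= v ^+ 2.
  by apply: le_trans hL _; apply: le_trans Lv _; rewrite expr2 ler_peMl // ltW.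
have : (K + 6) * v ^+ 2 <= v ^+ 4 * (ib_c ^+ 2 / 64).
  have -> : v ^+ 4 * (ib_c ^+ 2 / 64) = (v ^+ 2 * (ib_c ^+ 2 / 64)) * v ^+ 2 by ring.
  rewrite ler_wpM2r ?sqr_ge0 //.
  have cc : 0 < ib_c ^+ 2 / 64 :> R by rewrite divr_gt0 // exprn_gt0.
  rewrite -ler_pdivrMr //; apply: le_trans hv; rewrite le_eqVlt; apply/orP; left; apply/eqP; field.
  by rewrite gt_eqF.
have v2 : v <= v ^+ 2 by rewrite expr2 ler_peMl // ltW.
have Kv : K * v <= K * v ^+ 2 by rewrite ler_pM2l.
rewrite mulrDr -[v * (2 * v)]mulrCA -expr2; lra.
Qed.
End Constants.

Section PartTwo.
Context {R : realType}.

Lemma expR1_lt4 : expR 1 < 4 :> R.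
Proof.
have h := expR_ge1Dx (- (4^-1 : R)); have p := expR_gt0 (4^-1 : R).
have e : expR 4^-1 * expR (- 4^-1) = 1 :> R by rewrite -expRD subrr expR0.
have h1 : expR 4^-1 <= 4 / 3 :> R.
  have : expR 4^-1 * (1 + - 4^-1) <= 1 :> R by rewrite -[leRHS]e ler_pM2l.
  lra.
have -> : expR 1 = expR 4^-1 ^+ 4 :> R by rewrite -expRM_natl; congr expR; field.
apply: le_lt_trans (_ : (4 / 3) ^+ 4 < _); last by rewrite !exprS expr0; lra.
by apply: lerXn2r; rewrite ?nnegrE ?expR_ge0 // divr_ge0.
Qed.

Lemma ln2_gt : 2^-1 < ln 2 :> R.
Proof.
rewrite -ltr_expR lnK ?posrE //.
have h : expR 2^-1 * expR 2^-1 < 4 :> R.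
  by rewrite -expRD; have -> : 2^-1 + 2^-1 = 1 :> R by [lra]; exact: expR1_lt4.
have := expR_gt0 (2^-1 : R); nra.
Qed.

Lemma pr_leP {d : measure_display} {T : measurableType d} (P : probability T R) (E : set T) (c : R) :
  measurable E -> c <= pr P E -> (c%:E <= P E)%E.
Proof. by move=> mE h; rewrite prE // lee_fin. Qed.

Context {n k N : nat} (mu : probability (borel_rV R n) R) (nu : probability (borel_subspace R n) R)
  {d : measure_display} {T : measurableType d} (P : probability T R) (x : 'I_N -> {mfun T >-> borel_rV R n}).
Hypotheses (n3 : (3 <= n)%N) (k1 : (1 <= k)%N) (kn : (k <= n)%N) (iso : isotropic mu) (lc : log_concave mu).
Hypotheses (ind : independent_rvs P x) (hx : forall i, has_law P (x i) mu) (hnu : grassmannian_haar k nu) (nN : (n ^ 2 <= N)%N).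
Let N0 : (0 < N)%N.
Proof. by apply: leq_trans nN; rewrite expn_gt0 (leq_trans _ n3). Qed.
Let n0 : (0 < n)%N. Proof. exact: leq_trans n3. Qed.

Lemma lower_ball (r : R) : r <= ib_c -> with_prob_ge P (1 - expR (- Num.sqrt n%:R))
  [set w | (r%:E <= Dtilde k nu (sym_hull (fun i => x i w)))%E].
Proof.
move=> hr; have c0 := @ib_c_gt0 R.
have [E [mE pE hE]] := inball iso lc n3 ind hx nN; exists E; split => // [w Ew|]; last first.
  by apply: pr_leP => //; apply: le_trans pE; have := expR_gt0 (- Num.sqrt (n%:R : R)); lra.
apply: le_trans (_ : (@ib_c R)%:E <= _)%E; first by rewrite lee_fin.
apply: (Dtilde_ge hnu (ltW c0)) => F dF.
have v0 : vpick F != 0 by rewrite vpick0 -dimv_eq0 dF -lt0n.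
have ev : 0 < enorm (vpick F) by rewrite enorm_gt0.
pose y := (ib_c / enorm (vpick F)) *: vpick F.
have ey : enorm y = ib_c by rewrite /y enormZ (gtr0_norm (divr_gt0 c0 ev)) divfK // gt_eqF.
exists y; split; [|by rewrite memvZ // memv_pick|by rewrite ey].
by apply: (ball_sym_hull N0 (hE w Ew)); rewrite ey.
Qed.

(** Only the component in [F] of the difference [v] of two means is kept. The component [p] across
    [F] has length at most [tsep <= ib_c], so [section_point] applies and yields a point of norm at
    least [(spt a sqrt q - tsep) / 12]. *)
Lemma lower_spread (a Q : R) (k' e' J : nat) : let q := Q / 78 in let sn := Num.sqrt (n%:R : R) in
  Q = ln N%:R -> 0 < a -> a * n%:R <= k%:R -> 1 <= q -> q <= n%:R -> ln (6 * n%:R) <= q -> (0 < k')%N -> (0 < e')%N ->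
  (24 * (8 * k'%:R * rp_M / rp_h + 1)) ^+ k' * 16 <= sgp ^+ k' * expR (rp_rate * e'%:R) :> R ->
  4 * expR (39 * q) < expR k'%:R -> 2 * Num.sqrt q <= 2 ^+ J * @tzeta R n -> (216 ^+ (k' * e')) ^+ J <= 2 ^+ n :> R ->
  48 <= spb a * (Num.sqrt q / @tzeta R n) -> @tsep R n <= ib_c -> @tsep R n <= spt a * Num.sqrt q / 2 ->
  (216 * n%:R) ^+ n * (24 * (16 * n%:R / ib_c + 1)) ^+ n *
    expR (- (N%:R * (expR (- (39 * q)) * (ib_c ^+ 2 / (64 * n%:R))))) <= expR (- sn) / 2 ->
  with_prob_ge P (1 - expR (- sn)) [set w | ((spt a * Num.sqrt q / 24)%:E <= Dtilde k nu (sym_hull (fun i => x i w)))%E].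
Proof.
move=> q sn QE a0 ak q1 qn qln k0 e0 cond hk hJ hC hX ts1 ts2 hnum.
have c0 := @ib_c_gt0 R; have st0 := @spt_gt0 R a.
have [S [sS gS cS]] := tgood_many iso n0 q1.
have [E1 [mE1 pE1 hE1]] := inball iso lc n3 ind hx nN.
have [E2 [mE2 pE2 hE2]] := hits iso n0 q1 qn ind hx sS gS hnum.
have r0 : 0 <= spt a * Num.sqrt q / 24 by rewrite divr_ge0 // mulr_ge0 ?sqrtr_ge0 // ltW.
exists (E1 `&` E2); split; first exact: measurableI.
  move=> w [Ew1 Ew2]; apply: (Dtilde_ge hnu r0) => F dF.
  have hb := hE1 w Ew1; have hs := hE2 w Ew2 hb.
  have [U [UU hU]] := onb F; have [W [WW dec]] := orth_compl UU.
  have dn : (\dim F <= n)%N by rewrite dF.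
  have ad : a * n%:R <= (\dim F)%:R by rewrite dF.
  have [z [z' [zS zS' h1 h2]]] := spread iso lc n0 q1 qn qln k0 e0 cond hk hJ hC a0 hX sS gS cS dn ad UU WW dec.
  set v := tz mu z - tz mu z' in h1 h2; pose p := v *m W^T *m W.
  have ep : enorm p <= @tsep R n by rewrite /p enorm_iso.
  have vp : v - p = v *m U^T *m U by rewrite {1}(dec v) addrK.
  exists (12^-1 *: (v - p)); split.
  - apply: (section_point N0 hb (z := tz mu z) (z' := tz mu z')); last exact: le_trans ts1.
      by move=> th th1; exact: hs.
    by move=> th th1; exact: hs.
  - by rewrite memvZ // vp; apply/hU; rewrite -[_ *m U *m U^T]mulmxA UU mulmx1.
  rewrite enormZ gtr0_norm //.
  have : enorm v <= enorm (v - p) + enorm p by rewrite -{1}[v](subrK p); exact: enormD.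
  move: h2 ts2 ep; lra.
apply: pr_leP; first exact: measurableI.
have := prI_ge P mE1 mE2; move: pE1 pE2; rewrite -/sn; lra.
Qed.
End PartTwo.

Lemma part_two {R : realType} (a : R) : 0 < a < 1 -> exists2 ca : R, 0 < ca &
    forall (n k N : nat) (mu : probability (borel_rV R n) R)
      (nu : probability (borel_subspace R n) R)
      (d : measure_display) (T : measurableType d) (P : probability T R)
      (x : 'I_N -> {mfun T >-> borel_rV R n}),
    (2 <= n)%N -> (1 <= k <= n)%N ->
    isotropic mu -> log_concave mu ->
    independent_rvs P x -> (forall i, has_law P (x i) mu) ->
    grassmannian_haar k nu ->
    a * n%:R <= k%:R ->
    (n ^ 2 <= N)%N ->
    N%:R <= expR ((n%:R * ln n%:R) `^ (2 / 5) : R) ->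
    with_prob_ge P (1 - expR (- Num.sqrt n%:R))
      [set w | ((ca * (Num.sqrt (ln N%:R) / ln n%:R ^+ 3))%:E <=
                Dtilde k nu (sym_hull (fun i => x i w)))%E].
Proof.
move=> /andP[a0 a1].
have c0 := @ib_c_gt0 R; have st0 := @spt_gt0 R a; have sb0 := @spb_gt0 R a; have l0 := @lkap_gt0 R; have K1 := @pa_K_ge1 R.
pose B : R := 48 / spb a + (lkap / ib_c + 2 * lkap / spt a).
have b1 : 0 < 48 / spb a by rewrite divr_gt0.
have b2 : 0 < lkap / ib_c :> R by exact: divr_gt0.
have b3 : 0 < 2 * lkap / spt a by rewrite divr_gt0 // mulr_gt0.
pose L1 : R := (88 * pa_K) ^+ 5 * 15 ^+ 15.
pose L2 : R := 64 * ((216 * 24 * 17) / ib_c + 6) / ib_c ^+ 2.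
have L10 : 0 <= L1 by rewrite mulr_ge0 // exprn_ge0 // mulr_ge0 // (le_trans ler01).
have L20 : 0 <= L2.
  apply: divr_ge0; last exact: sqr_ge0.
  have : 0 <= (216 * 24 * 17) / ib_c :> R by apply: divr_ge0; [lra|exact: ltW].
  lra.
(* Beyond [L0] all largeness conditions on [ln n] hold; below it [n] is bounded. *)
pose L0 : R := L1 + L2 + 78 + B ^+ 2.
have B0 : 0 < B by rewrite /B; lra.
have [hB1 hB2 hB3] : [/\ 48 / spb a <= B, lkap / ib_c <= B & 2 * lkap / spt a <= B] by rewrite /B; split; lra.
have hL0 L : L0 <= L -> [/\ L1 <= L, L2 <= L, 78 <= L & B ^+ 2 <= L].
  by have := sqr_ge0 B; rewrite /L0 => h1 h2; split; lra.
have L00 : 0 <= L0 by have := sqr_ge0 B; rewrite /L0; lra.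
clear L10 L20 b1 b2 b3; clearbody L0 B.
(* The first term serves bounded [n], where [8] bounds [1 / L ^ 3] as [L > 1/2], and the case
   [ln N < L ^ 6]; the second serves the main case, with [9 >= sqrt 78]. *)
pose ca : R := Order.min (ib_c / (8 * expR L0)) (spt a / (24 * 9)).
have e0 := expR_gt0 L0.
have ca0 : 0 < ca by rewrite lt_min; apply/andP; split; apply: divr_gt0 => //; exact: mulr_gt0.
have ca1 : ca * (8 * expR L0) <= ib_c.
  by rewrite -ler_pdivlMr ?mulr_gt0 // /ca ge_min lexx.
have ca2 : ca <= spt a / (24 * 9) by rewrite /ca ge_min lexx orbT.
clearbody ca; exists ca => // n k N mu nu d T P x n2 /andP[k1 kn] iso lc ind hx hnu ak nN hN.
have nR : 0 < n%:R :> R by rewrite ltr0n (leq_trans _ n2).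
have NR : 0 < N%:R :> R by rewrite ltr0n (leq_trans _ nN) // expn_gt0 (leq_trans _ n2).
set L := ln (n%:R : R) in hN *; set Q := ln (N%:R : R); have QE : Q = ln N%:R by [].
have nE : n%:R = expR L by rewrite lnK // posrE.
have NE : N%:R = expR Q by rewrite lnK // posrE.
clearbody Q; have ln2 := @ln2_gt R.
have Lh : 2^-1 < L by apply: lt_le_trans ln2 _; rewrite ler_ln ?posrE // (ler_nat _ 2).
have Lp : 0 < L by lra.
have Q2 : 2 * L <= Q.
  have -> : 2 * L = ln (n%:R ^+ 2 : R) by rewrite lnXn // mulr_natl.
  by rewrite QE ler_ln ?posrE ?exprn_gt0 // -natrX ler_nat.
have Q5 : Q ^+ 5 <= (n%:R * L) ^+ 2.
  have nL0 : 0 <= n%:R * L by rewrite mulr_ge0 // ltW.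
  have hQ : Q <= (n%:R * L) `^ (2 / 5) by rewrite -ler_expR -NE.
  apply: le_trans (_ : ((n%:R * L) `^ (2 / 5)) ^+ 5 <= _).
    by apply: lerXn2r; rewrite ?nnegrE ?powR_ge0 //; lra.
  rewrite -powR_mulrn ?powR_ge0 // -powRrM.
  have -> : 2 / 5 * 5%:R = 2%:R :> R by field.
  by rewrite powR_mulrn.
have Ln : L <= n%:R by rewrite nE; have := expR_ge1Dx L; lra.
(* [n = 2] is vacuous, [N] being at least [4] and at most [exp ((2 ln 2) ^ (2 / 5)) < 4]. *)
have [n3|n3] := leqP 3 n; last first.
  exfalso; have nn : n = 2 by apply/eqP; rewrite eqn_leq n2 -ltnS n3.
  have L2E : L = ln 2 by rewrite /L nn.
  have nL : n%:R * L = 2 * L by rewrite nn.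
  rewrite nL in Q5; have t1 : 1 < 2 * L by lra.
  have : (2 * L) ^+ 5 <= (2 * L) ^+ 2.
    by apply: le_trans Q5; apply: lerXn2r; rewrite ?nnegrE //; lra.
  by apply/negP; rewrite -ltNge ltr_eXn2l.
have Q0 : 0 < Q by lra.
have Qn : Q <= n%:R.
  have n1 : 1 <= n%:R :> R by rewrite (ler_nat _ 1) (leq_trans _ n3).
  rewrite -(@ler_pXn2r _ 5) ?nnegrE ?(ltW Q0) ?(ltW nR) //.
  apply: le_trans Q5 _; apply: le_trans (_ : (n%:R * n%:R) ^+ 2 <= _).
    by apply: lerXn2r; rewrite ?nnegrE ?mulr_ge0 // ?(ltW Lp) // ler_pM2l.
  by rewrite -expr2 -exprM; apply: ler_weXn2l.
have L30 : 0 < L ^+ 3 by rewrite exprn_gt0.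
have [Ls|Ll] := ltP L L0.
  apply: (lower_ball n3 k1 iso lc ind hx hnu nN); apply: le_trans ca1; apply: ler_wpM2l; first exact: ltW.
  rewrite ler_pdivrMr //; apply: le_trans (_ : expR L0 <= _).
    apply: le_trans (_ : n%:R <= _); last by rewrite nE ler_expR ltW.
    have n1 : 1 <= n%:R :> R by rewrite (ler_nat _ 1) (leq_trans _ n3).
    apply: le_trans (_ : Num.sqrt (n%:R ^+ 2) <= _); last by rewrite sqrtr_sqr ger0_norm.
    by rewrite ler_wsqrtr // (le_trans Qn) // expr2 ler_peMl.
  have : (2^-1) ^+ 3 <= L ^+ 3 by apply: lerXn2r; rewrite ?nnegrE ?(ltW Lp) // ltW.
  have -> : 2^-1 ^+ 3 = 8^-1 :> R by rewrite !exprS expr0; field.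
  have -> : 8 * expR L0 * L ^+ 3 = expR L0 * (8 * L ^+ 3) by ring.
  by move=> h; rewrite ler_peMr ?(ltW e0) //; lra.
have [_ _ L78 LB] := hL0 _ Ll.
have [Qs|Ql] := ltP Q (L ^+ 6).
  apply: (lower_ball n3 k1 iso lc ind hx hnu nN); apply: le_trans (_ : ca * 1 <= _).
    apply: ler_wpM2l; first exact: ltW.
    rewrite ler_pdivrMr // mul1r; apply: le_trans (_ : Num.sqrt ((L ^+ 3) ^+ 2) <= _); last first.
      by rewrite sqrtr_sqr ger0_norm // ltW.
    by rewrite ler_wsqrtr // -exprM ltW.
  rewrite mulr1; apply: le_trans ca1; rewrite ler_peMr ?(ltW ca0) //.
  have : 1 <= expR L0 by rewrite -[leLHS]expR0 ler_expR.
  lra.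
have n0 : (0 < n)%N by exact: leq_trans n3.
have q1 : 1 <= Q / 78 by rewrite ler_pdivlMr //; have : L <= L ^+ 6 by [rewrite -[leLHS]expr1; apply: ler_weXn2l => //; lra]; lra.
pose sn := Num.sqrt (n%:R : R); have sn0 : 0 < sn by rewrite sqrtr_gt0.
have Bn : B <= sn.
  rewrite -(@ler_sqr R) ?nnegrE ?(ltW B0) ?(ltW sn0) // sqr_sqrtr ?(ltW nR) //; exact: le_trans Ln.
have sq1 : 1 <= Num.sqrt (Q / 78) by rewrite -[leLHS]sqrtr1 ler_wsqrtr.
have tsE : @tsep R n = lkap / sn / 2 ^+ 14.
  by rewrite /tsep /tzeta /tR0 -/sn; field; rewrite gt_eqF.
have lks : 0 < lkap / sn by exact: divr_gt0.
have ts0 : @tsep R n <= lkap / sn / 2.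
  rewrite tsE; apply: ler_wpM2l; first exact: ltW.
  rewrite lef_pV2 ?posrE ?exprn_gt0 //.
  by rewrite -[leLHS]expr1; apply: ler_weXn2l => //; lra.
have qln : ln (6 * n%:R) <= Q / 78.
  rewrite lnM ?posrE // -/L ler_pdivlMr //.
  have l6 : ln 6 <= 5 :> R.
    have -> : (6 : R) = 1 + 5 by lra.
    by apply: le_ln1Dx; lra.
  apply: le_trans Ql; have -> : L ^+ 6 = L ^+ 4 * L * L by rewrite -!exprSr.
  have L4 : 2 <= L ^+ 4.
    by apply: le_trans (_ : L <= _); [lra|rewrite -[leLHS]expr1; apply: ler_weXn2l => //; lra].
  apply: le_trans (_ : 2 * L * L <= _); last by rewrite ler_pM2r // ler_pM2r.
  have l60 : 0 <= ln 6 :> R by rewrite ln_ge0 // (ler_nat _ 1).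
  by apply: ler_pM => //; [rewrite addr_ge0 // ltW|lra].
have qn : Q / 78 <= n%:R by rewrite ler_pdivrMr //; lra.
have hX : 48 <= spb a * (Num.sqrt (Q / 78) / @tzeta R n).
  have -> : Num.sqrt (Q / 78) / @tzeta R n = 8 * (Num.sqrt (Q / 78) * sn) by rewrite /tzeta /tR0 invrK -/sn; ring.
  rewrite mulrC -ler_pdivrMr //; apply: le_trans (_ : sn <= _); first exact: le_trans Bn.
  have : sn <= Num.sqrt (Q / 78) * sn by rewrite ler_peMl // ltW.
  lra.
have ts1 : @tsep R n <= ib_c.
  have : lkap / sn <= ib_c.
    by rewrite ler_pdivrMr // mulrC -ler_pdivrMr // (le_trans hB2).
  lra.
have ts2 : @tsep R n <= spt a * Num.sqrt (Q / 78) / 2.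
  have h : lkap / sn <= spt a.
    rewrite ler_pdivrMr // mulrC -ler_pdivrMr //; apply: le_trans Bn; apply: le_trans hB3.
    by rewrite ler_pM2r ?invr_gt0 // ler_peMl ?(ltW l0) //; lra.
  have : spt a <= spt a * Num.sqrt (Q / 78) by rewrite ler_peMr // ltW.
  lra.
have [LL1 LL2 _ _] := hL0 _ Ll.
have [k' [e' [J [k0 e0' cond hk [hJ hC]]]]] := dim_params n0 nE LL1 L78 Ql Q5 Qn.
have hnum := hits_params n0 nE LL2 L78 Ql; rewrite -NE in hnum.
have [E [mE sE pE]] := lower_spread n3 kn iso lc ind hx hnu nN QE a0 ak q1 qn qln k0 e0' cond hk hJ hC hX ts1 ts2 hnum.
exists E; split => // w /sE /=; apply: le_trans; rewrite lee_fin.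
have L1' : 1 <= L ^+ 3 by rewrite exprn_ege1 // (le_trans _ L78) // (ler_nat _ 1).
apply: le_trans (_ : spt a / (24 * 9) * (9 * Num.sqrt (Q / 78)) <= _); last first.
  by rewrite le_eqVlt; apply/orP; left; apply/eqP; field.
apply: ler_pM => //; first exact: ltW.
  by rewrite divr_ge0 ?sqrtr_ge0 // ltW.
rewrite ler_pdivrMr //; apply: le_trans (_ : 9 * Num.sqrt (Q / 78) <= _); last first.
  by rewrite ler_peMr // mulr_ge0 // sqrtr_ge0.
have q0 : 0 <= Q / 78 by exact: le_trans q1.
have s9 : 0 <= 9 * Num.sqrt (Q / 78) by rewrite mulr_ge0 // sqrtr_ge0.
rewrite -(@ler_sqr R) ?nnegrE ?sqrtr_ge0 //.
rewrite [leRHS]exprMn !sqr_sqrtr ?(ltW Q0) // -{1}(@divfK _ 78 _ Q) //.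
by rewrite mulrC ler_wpM2r // expr2 -(natrM _ 9 9) ler_nat.
Qed.

Theorem theorem1p8 (R : realType) :
  (forall b : R, 0 < b < 1 -> exists2 cb : R, 0 < cb &
    forall (n k N : nat) (mu : probability (borel_rV R n) R)
      (nu : probability (borel_subspace R n) R)
      (d : measure_display) (T : measurableType d) (P : probability T R)
      (x : 'I_N -> {mfun T >-> borel_rV R n}),
    (2 <= n)%N -> (1 <= k <= n)%N ->
    isotropic mu -> log_concave mu ->
    independent_rvs P x -> (forall i, has_law P (x i) mu) ->
    grassmannian_haar k nu ->
    k%:R <= b * n%:R ->
    ((n ^ 2 <= N)%N -> N%:R <= expR (Num.sqrt n%:R : R) ->
      with_prob_ge P (1 - N%:R^-1)
        [set w | (Dtilde k nu (sym_hull (fun i => x i w)) <=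
                  (cb * Num.sqrt (ln N%:R))%:E)%E]) /\
    (expR (Num.sqrt n%:R : R) <= N%:R -> N%:R <= expR (n%:R : R) ->
      with_prob_ge P (1 - N%:R^-1)
        [set w | (Dtilde k nu (sym_hull (fun i => x i w)) <=
                  (cb * Num.sqrt (ln N%:R) * ln (ln N%:R) ^+ 2)%:E)%E])) /\
  (forall a : R, 0 < a < 1 -> exists2 ca : R, 0 < ca &
    forall (n k N : nat) (mu : probability (borel_rV R n) R)
      (nu : probability (borel_subspace R n) R)
      (d : measure_display) (T : measurableType d) (P : probability T R)
      (x : 'I_N -> {mfun T >-> borel_rV R n}),
    (2 <= n)%N -> (1 <= k <= n)%N ->
    isotropic mu -> log_concave mu ->
    independent_rvs P x -> (forall i, has_law P (x i) mu) ->
    grassmannian_haar k nu ->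
    a * n%:R <= k%:R ->
    (n ^ 2 <= N)%N ->
    N%:R <= expR ((n%:R * ln n%:R) `^ (2 / 5) : R) ->
    with_prob_ge P (1 - expR (- Num.sqrt n%:R))
      [set w | ((ca * (Num.sqrt (ln N%:R) / ln n%:R ^+ 3))%:E <=
                Dtilde k nu (sym_hull (fun i => x i w)))%E]).
Proof. by split=> [b|a]; [exact: part_one|exact: part_two]. Qed.
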